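(* Let $\epsilon_k\to0$ be a sequence of horizons, let $u_0,v_0$ be LEFM initial data (the same for every $k$), let $b\in C^1([0,T];L^2_0(D;\mathbb{R}^d))$, and let $u^{\epsilon_k}$ be the cohesive evolution with horizon $\epsilon_k$, initial data $u^{\epsilon_k}(0)=u_0$, $u^{\epsilon_k}_t(0)=v_0$ and body force $b$. Suppose that $$\sup_{\epsilon_k}\sup_{0\le t\le T}\Vert u^{\epsilon_k}(t)\Vert_{L^\infty(D;\mathbb{R}^d)}<\infty .$$ Then, on passing to a subsequence if necessary, the cohesive evolutions $u^{\epsilon_k}$ converge in mean square uniformly in time to a limit evolution $u^0$ with the same LEFM initial data, i.e. $$\lim_{\epsilon_k\to0}\max_{0\le t\le T}\left\{\Vert u^{\epsilon_k}(t)-u^0(t)\Vert_{L^2(D;\mathbb{R}^d)}\right\}=0,$$ and $u^0(x,0)=u_0(x)$ and $\partial_tu^0(x,0)=v_0(x)$.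
   Context: Domain and spaces. $d\in\{2,3\}$; $D\subset\mathbb{R}^d$ is a bounded domain, split as $D=D_c\cup D_s$, where $D_c$ is a boundary layer of $D$ of thickness $a$ and $D_s$ is the interior. $L^2_0(D;\mathbb{R}^d)$ is the space of $u\in L^2(D;\mathbb{R}^d)$ that vanish on $D_c$; such $u$ are extended by $0$ outside $D$. Horizons $\epsilon>0$ satisfy $2\epsilon<a$; $\mathcal{H}_\epsilon(x)=\{y\in\mathbb{R}^d:|y-x|<\epsilon\}$; $\omega_n$ is the volume of the unit ball of $\mathbb{R}^n$; $V_d=\epsilon^d\omega_d$. Potential. $f:[0,\infty)\to\mathbb{R}$ is smooth, positive on $(0,\infty)$, concave, with $f(0)=0$, $\lim_{r\to0^+}f(r)/r=f'(0)>0$, $\lim_{r\to\infty}f(r)=f_\infty<\infty$, and $r\mapsto f(r^2)$ on $[0,\infty)$ is convex-concave with inflection point $\overline r>0$. $J$ is a nonnegative bounded function on $[0,\infty)$, vanishing on $[1,\infty)$ and not a.e. zero; $J^\epsilon(r)=J(r/\epsilon)$. For a displacement $u$ the strain is $\mathcal{S}=\mathcal{S}(y,x)=\frac{u(y)-u(x)}{|y-x|}\cdot\frac{y-x}{|y-x|}$, and $$\mathcal{W}^\epsilon(\mathcal{S},y-x)=\frac1\epsilon J^\epsilon(|y-x|)\frac{1}{|y-x|}f(|y-x|\mathcal{S}^2),\qquad PD^\epsilon(u)=\int_D\frac{1}{V_d}\int_{\mathcal{H}_\epsilon(x)}|y-x|\,\mathcal{W}^\epsilon(\mathcal{S},y-x)\,dy\,dx.$$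 Cohesive evolution. $\rho>0$ and $T>0$ are constants. The cohesive evolution $u^\epsilon\in C^2([0,T];L^2_0(D;\mathbb{R}^d))$ is the unique solution of $\rho u^\epsilon_{tt}=-\nabla PD^\epsilon(u^\epsilon)+b$ on $D_s$, $u^\epsilon=0$ on $D_c$, with $u^\epsilon(0)=u_0$, $u^\epsilon_t(0)=v_0$, where for $x\in D_s$ $$\nabla PD^\epsilon(u)(x)=-\frac{2}{V_d}\int_{\mathcal{H}_\epsilon(x)}\partial_{\mathcal{S}}\mathcal{W}^\epsilon(\mathcal{S},y-x)\frac{y-x}{|y-x|}\,dy .$$ LEFM initial data. For $u$ in $SBD(D)$ (special functions of bounded deformation) with jump set $J_u$ and absolutely continuous part of the strain $\mathcal{E}u$, put $LEFM(u,D)=\int_D(2\mu|\mathcal{E}u|^2+\lambda|\mathrm{div}\,u|^2)dx+\mathcal{G}_c\mathcal{H}^{d-1}(J_u)$, where $\mu=\lambda=\frac14f'(0)\int_0^1r^2J(r)dr$ if $d=2$, $\mu=\lambda=\frac15f'(0)\int_0^1r^3J(r)dr$ if $d=3$, and $\mathcal{G}_c=\frac{2\omega_{d-1}}{\omega_d}f_\infty\int_0^1r^dJ(r)dr$. LEFM initial data are bounded $u_0,v_0\in L^2_0(D;\mathbb{R}^d)$ with $u_0\in SBD(D)$ and $LEFM(u_0,D)<\infty$. *)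

(* Defs.v *)
From HB Require Import structures.
From mathcomp Require Import all_boot all_order all_algebra.
From mathcomp Require Import all_classical all_reals all_analysis.

Set Implicit Arguments.
Unset Strict Implicit.
Unset Printing Implicit Defensive.
Import Order.TTheory GRing.Theory Num.Theory.
Import numFieldNormedType.Exports.

Local Open Scope classical_set_scope.
Local Open Scope ring_scope.

(* 'rV[R]_n carries the sigma-algebra generated by the coordinates, i.e. the
   Borel sigma-algebra of R^n. *)
Definition rV_display : measure_display. Proof. exact. Qed.

Section rV_measurable.
Context (R : realType) (n : nat).

Definition rV_coord (i : 'I_n) (v : 'rV[R]_n) : R := v ord0 i.

Let rV_set0 : g_sigma_preimage rV_coord set0.
Proof. exact: sigma_algebra0. Qed.

Let rV_setC A : g_sigma_preimage rV_coord A -> g_sigma_preimage rV_coord (~` A).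
Proof. exact: sigma_algebraC. Qed.

Let rV_bigcup (F : (set 'rV[R]_n)^nat) :
  (forall i, g_sigma_preimage rV_coord (F i)) ->
  g_sigma_preimage rV_coord (\bigcup_i (F i)).
Proof. exact: sigma_algebra_bigcup. Qed.

HB.instance Definition _ := @isMeasurable.Build rV_display 'rV[R]_n
  (g_sigma_preimage rV_coord) rV_set0 rV_setC rV_bigcup.

Lemma measurable_rV_coord (i : 'I_n) :
  measurable_fun [set: 'rV[R]_n] (fun v : 'rV[R]_n => v ord0 i).
Proof.
move=> _ Y mY; rewrite setTI; apply: sub_sigma_algebra => /=.
rewrite -bigcup_seq/=; exists i => /=; first by rewrite mem_index_enum.
by exists Y => //; rewrite setTI.
Qed.

Lemma measurable_fun_rVP d (T : measurableType d) (f : T -> 'rV[R]_n) :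
  measurable_fun [set: T] f <->
  forall i, measurable_fun [set: T] (fun x => f x ord0 i).
Proof.
split=> [mf i|mf].
  exact: measurableT_comp (measurable_rV_coord i) mf.
move=> _ A mA.
have : preimage_set_system [set: T] f (g_sigma_preimage rV_coord)
    `<=` (measurable : set (set T)).
  rewrite -g_sigma_preimage_comp.
  apply: smallest_sub; first exact: sigma_algebra_measurable.
  rewrite -bigcup_seq; apply: bigcup_sub => i _ B [C mC <-].
  exact: mf.
by apply; exists A.
Qed.

End rV_measurable.

Section lebesgue_rV.
Context (R : realType).

Definition rV_cons n (p : measurableTypeR R * 'rV[R]_n) : 'rV[R]_n.+1 :=
  row_mx (p.1 : R)%:M p.2.

Lemma measurable_rV_cons n : measurable_fun setT (@rV_cons n).
Proof.
apply/measurable_fun_rVP => i; rewrite /rV_cons.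
have [j ->|j ->] := @split_ordP 1 n i.
  rewrite (_ : (fun x => _) = fun x => x.1).
    exact: measurable_fst.
  by apply/funext => x; rewrite (@row_mxEl _ 1 1 n) (ord1 j) mxE eqxx.
rewrite (_ : (fun x => _) =
  (fun v : 'rV[R]_n => v ord0 j) \o (snd : measurableTypeR R * _ -> _)).
  exact: measurableT_comp (measurable_rV_coord j) measurable_snd.
by apply/funext => x; rewrite (@row_mxEr _ 1 1 n).
Qed.

Section lebesgue_rV_step.
Context (n : nat) (m : {sigma_finite_measure set 'rV[R]_n -> \bar R}).

Definition lebesgue_rV_step : set 'rV[R]_n.+1 -> \bar R :=
  pushforward (@lebesgue_measure R \x m)%E (@rV_cons n).

Let p : {measure set 'rV[R]_n.+1 -> \bar R} :=
  measure_function_pushforward__canonical__measure_function_Measure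
    (@lebesgue_measure R \x m)%E (@measurable_rV_cons n).

HB.instance Definition _ := isMeasure.Build _ _ _ lebesgue_rV_step
  (measure0 p) (measure_ge0 p) (@measure_semi_sigma_additive _ _ _ p).

Let lebesgue_rV_step_sigma_finite : sigma_finite setT lebesgue_rV_step.
Proof.
pose q (v : 'rV[R]_n.+1) : measurableTypeR R * 'rV[R]_n :=
  (v ord0 ord0, rsubmx (v : 'rV_(1 + n))).
have mq : measurable_fun setT q.
  apply: measurable_fun_pair; first exact: measurable_rV_coord.
  apply/measurable_fun_rVP => i.
  rewrite (_ : (fun x => _) = fun x : 'rV_n.+1 => x ord0 (rshift 1 i)).
    exact: measurable_rV_coord.
  by apply/funext => x; rewrite mxE.
have qK : cancel (@rV_cons n) q.
  move=> [x v]; rewrite /q /rV_cons row_mxKr; congr pair.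
  rewrite (_ : ord0 = lshift n (ord0 : 'I_1)); last exact/val_inj.
  by rewrite (@row_mxEl _ 1 1 n) mxE eqxx.
have /sigma_finiteP[F [TF ndF Foo]] := sigma_finiteT (@lebesgue_measure R).
have /sigma_finiteP[G [TG ndG Goo]] := sigma_finiteT m.
exists (fun k => q @^-1` (F k `*` G k)).
  rewrite -preimage_bigcup (_ : \bigcup_k _ = setT) ?preimage_setT//.
  rewrite -subTset => -[x y] _.
  have [i _ Fix] : (\bigcup_k F k) x by rewrite -TF.
  have [j _ Gjy] : (\bigcup_k G k) y by rewrite -TG.
  exists (maxn i j) => //; split => /=.
    by move: x Fix; exact/subsetPset/ndF/leq_maxl.
  by move: y Gjy; exact/subsetPset/ndG/leq_maxr.
move=> k; have [mF Fk] := Foo k; have [mG Gk] := Goo k; split.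
  by rewrite -[X in measurable X]setTI; apply: mq => //; exact: measurableX.
rewrite /lebesgue_rV_step /pushforward -comp_preimage.
rewrite (_ : q \o _ = id); last by apply/funext => x /=; exact: qK.
by rewrite preimage_id product_measure1E// lte_mul_pinfty// ge0_fin_numE.
Qed.

HB.instance Definition _ := Measure_isSigmaFinite.Build _ _ _ lebesgue_rV_step
  lebesgue_rV_step_sigma_finite.

End lebesgue_rV_step.

Fixpoint lebesgue_rV n : {sigma_finite_measure set 'rV[R]_n -> \bar R} :=
  if n is n'.+1 then lebesgue_rV_step (lebesgue_rV n') else \d_(0 : 'rV[R]_0).

End lebesgue_rV.

(* The library's norm on 'rV[R]_n is the sup norm, so the Euclidean structure
   is introduced separately. *)
Section euclidean.
Context (R : realType) (n : nat).
Implicit Types (x y : 'rV[R]_n).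

Definition dot x y : R := \sum_(i < n) x ord0 i * y ord0 i.

Definition enorm x : R := Num.sqrt (dot x x).

Definition eball x (r : R) : set 'rV[R]_n := [set y | enorm (y - x) < r].

Definition ediam (A : set 'rV[R]_n) : \bar R :=
  ereal_sup (0%E |` [set (enorm (p.1 - p.2))%:E | p in A `*` A]).

End euclidean.

Definition unit_ball_volume (R : realType) (n : nat) : R :=
  fine (lebesgue_rV R n (eball 0 1)).

(* The s-dimensional Hausdorff measure, s >= 1, with the normalization that
   makes it agree with Lebesgue measure when s = n. *)
Section hausdorff.
Context (R : realType) (n s : nat).
Local Open Scope ereal_scope.

Definition hausdorff_content (delta : R) (A : set 'rV[R]_n) : \bar R :=
  ereal_inf
    [set \sum_(0 <= i <oo)
        (unit_ball_volume R s)%:E * ((2^-1)%:E * ediam (U i)) ^+ s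
    | U in [set U : (set 'rV[R]_n)^nat |
        A `<=` \bigcup_i U i /\ forall i, ediam (U i) <= delta%:E]].

Definition hausdorff_measure (A : set 'rV[R]_n) : \bar R :=
  ereal_sup [set hausdorff_content delta A | delta in [set x : R | (0 < x)%R]].

End hausdorff.

Section domain_and_spaces.
Context (R : realType) (d : nat).
Local Notation V := 'rV[R]_d.
Local Notation leb := (lebesgue_rV R d).

Definition bounded_domain (D : set V) :=
  [/\ D !=set0, open D, connected D & bounded_set D].

(* The boundary of the open set D is closure D `\` D. The layer D_c is closed in
   D, so that its complement D_s is open. *)
Definition boundary_layer (D : set V) (a : R) : set V :=
  [set x | D x /\ exists y, (closure D `\` D) y /\ enorm (y - x) <= a].

Definition interior_part (D : set V) (a : R) : set V :=
  D `\` boundary_layer D a.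

Definition L2norm (D : set V) (w : V -> V) : \bar R :=
  ('N[leb]_2%:E[(fun x => (enorm (w x))%:E) \_ D])%E.

Definition Linfnorm (D : set V) (w : V -> V) : \bar R :=
  ('N[leb]_+oo[(fun x => (enorm (w x))%:E) \_ D])%E.

(* L^2_0(D;R^d). Elements are represented by functions on the whole of R^d:
   the last clause expresses both the vanishing on D_c and the extension by 0
   outside D. *)
Definition L20 (D : set V) (a : R) (w : V -> V) :=
  [/\ measurable_fun [set: V] w,
      (L2norm D w < +oo)%E &
      {ae leb, forall x, ~ interior_part D a x -> w x = 0}].

Definition L2_continuous (D : set V) (T : R) (w : R -> V -> V) :=
  forall t, t \in `[0, T] ->
    L2norm D (w s \- w t) @[s --> within `[0, T] (nbhs t)] --> 0%E.

(* v is the derivative at t, in L^2(D;R^d), of w : [0,T] -> L^2(D;R^d);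
   it is one-sided when t = 0 or t = T. *)
Definition L2_derivative_at (D : set V) (T : R) (w : R -> V -> V) (t : R)
    (v : V -> V) :=
  L2norm D (fun x => (s - t)^-1 *: (w s x - w t x) - v x)
    @[s --> within `[0, T] t^'] --> 0%E.

(* w is in C^1([0,T];L^2_0(D;R^d)), with time derivative w1 *)
Definition C1_L20 (D : set V) (a T : R) (w w1 : R -> V -> V) :=
  (forall t, t \in `[0, T] ->
     [/\ L20 D a (w t), L20 D a (w1 t) & L2_derivative_at D T w t (w1 t)]) /\
  L2_continuous D T w1.

End domain_and_spaces.

Section potential.
Context (R : realType).

(* All derivatives are taken within [0,+oo[, hence one-sided at 0. *)
Definition smooth_halfline (f : R -> R) :=
  exists F : nat -> R -> R,
    (forall x, 0 <= x -> F 0%N x = f x) /\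
    (forall n x, 0 <= x ->
      (F n y - F n x) / (y - x) @[y --> within `[0, +oo[ x^'] --> F n.+1 x).

(* fp0 and finf are f'(0) and f_oo; rbar is the inflection point of f(r^2). *)
Definition cohesive_potential (f : R -> R) (fp0 finf rbar : R) :=
  [/\ smooth_halfline f,
      f 0 = 0 /\ (forall r, 0 < r -> 0 < f r),
      convex_function (`[0, +oo[%classic : set R^o) (fun r : R^o => - f r),
      [/\ f r / r @[r --> 0^'+] --> fp0, 0 < fp0 &
          f r @[r --> +oo] --> finf] &
      [/\ 0 < rbar,
        convex_function (`[0, rbar]%classic : set R^o)
          (fun r : R^o => f (r ^+ 2)) &
        convex_function (`[rbar, +oo[%classic : set R^o)
          (fun r : R^o => - f (r ^+ 2))]].

Definition influence_function (J : R -> R) :=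
  [/\ measurable_fun (`[0, +oo[%classic : set R) J,
      (forall r, 0 <= r -> 0 <= J r),
      (exists M, forall r, 0 <= r -> J r <= M),
      (forall r, 1 <= r -> J r = 0) &
      ~ {ae @lebesgue_measure R, forall r, 0 <= r -> J r = 0}].

End potential.

Section cohesive_dynamics.
Context (R : realType) (d : nat).
Local Notation V := 'rV[R]_d.
Local Notation leb := (lebesgue_rV R d).
Variables (f J : R -> R).

Definition strain (u : V -> V) (y x : V) : R :=
  dot ((enorm (y - x))^-1 *: (u y - u x)) ((enorm (y - x))^-1 *: (y - x)).

Definition cohesive_energy (eps S : R) (xi : V) : R :=
  eps^-1 * J (enorm xi / eps) * (enorm xi)^-1 * f (enorm xi * S ^+ 2).

Definition dS_cohesive_energy (eps S : R) (xi : V) : R :=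
  derive1 (fun s : R => cohesive_energy eps s xi) S.

Definition gradPD (eps : R) (u : V -> V) (x : V) : V :=
  \row_i (- (2 / (eps ^+ d * unit_ball_volume R d)) *
    \int[leb]_(y in eball x eps)
      (dS_cohesive_energy eps (strain u y x) (y - x) *
       ((enorm (y - x))^-1 *: (y - x)) ord0 i)).

Definition cohesive_evolution (D : set V) (a T rho eps : R)
    (u0 v0 : V -> V) (b : R -> V -> V) (u : R -> V -> V) :=
  exists ut utt : R -> V -> V,
    [/\ C1_L20 D a T u ut, C1_L20 D a T ut utt,
        (forall t, t \in `[0, T] ->
          {ae leb, forall x, interior_part D a x ->
            rho *: utt t x = - gradPD eps (u t) x + b t x}),
        {ae leb, forall x, u 0 x = u0 x} &
        {ae leb, forall x, ut 0 x = v0 x}].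

End cohesive_dynamics.

Section SBD.
Context (R : realType) (d : nat).
Local Notation V := 'rV[R]_d.
Local Notation leb := (lebesgue_rV R d).
Variables (D : set V) (u : V -> V).

(* c is the one-sided Lebesgue limit of u at x from the side nu points to *)
Definition one_sided_limit (x nu c : V) :=
  ((r ^- d)%:E *
    \int[leb]_(y in eball x r `&` [set y | (0 < dot (y - x) nu)%R])
      (enorm (u y - c))%:E)%E @[r --> 0^'+] --> 0%E.

Definition jump_set : set V :=
  [set x | D x /\ exists nu cp cm : V,
     [/\ enorm nu = 1, cp != cm, one_sided_limit x nu cp &
         one_sided_limit x (- nu) cm]].

Definition C1c (phi : V -> R) :=
  [/\ forall x i, derivable phi x (delta_mx ord0 i),
      forall i, continuous (fun x => 'D_(delta_mx ord0 i) phi x),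
      continuous phi &
      exists K, [/\ compact K, K `<=` D & forall x, ~ K x -> phi x = 0]].

(* The distributional strain E u = (Du + Du^T)/2 is the matrix of finite signed
   measures Ep i j - Em i j on D. *)
Definition distributional_strain
    (Ep Em : 'I_d -> 'I_d -> {finite_measure set V -> \bar R}) :=
  forall i j phi, C1c phi ->
    \int[Ep i j]_(x in D) phi x - \int[Em i j]_(x in D) phi x =
    - 2^-1 * \int[leb]_(x in D)
      (u x ord0 i * 'D_(delta_mx ord0 j) phi x +
       u x ord0 j * 'D_(delta_mx ord0 i) phi x).

Definition singular_strain
    (Ep Em : 'I_d -> 'I_d -> {finite_measure set V -> \bar R})
    (e : V -> 'M[R]_d) (i j : 'I_d) (A : set V) : R :=
  fine (Ep i j A) - fine (Em i j A) - \int[leb]_(x in A) e x i j.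

(* u is in SBD(D) and e is the density of the absolutely continuous part of its
   strain: e leb + singular_strain is the Lebesgue decomposition of E u, and the
   singular part is concentrated on the jump set (no Cantor part). *)
Definition SBD_with_density (e : V -> 'M[R]_d) :=
  [/\ measurable D,
      (forall i, leb.-integrable D (fun x => (u x ord0 i)%:E)),
      (forall i j, leb.-integrable D (fun x => (e x i j)%:E)) &
      exists Ep Em, [/\ distributional_strain Ep Em,
        (exists Z, [/\ measurable Z, leb Z = 0%E &
          forall i j A, measurable A -> A `<=` D `\` Z ->
            singular_strain Ep Em e i j A = 0]) &
        (forall i j A, measurable A -> A `<=` D `\` jump_set ->
            singular_strain Ep Em e i j A = 0)]].

End SBD.

Section LEFM.
Context (R : realType) (d : nat).
Local Notation V := 'rV[R]_d.
Local Notation leb := (lebesgue_rV R d).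
Variables (J : R -> R) (fp0 finf : R).

(* mu = lambda: the factor 1/(d+2) is 1/4 for d = 2 and 1/5 for d = 3. *)
Definition lame_constant : R :=
  d.+2%:R^-1 * fp0 * \int[lebesgue_measure]_(r in `[0, 1]) (r ^+ d * J r).

Definition fracture_toughness : R :=
  2 * unit_ball_volume R d.-1 / unit_ball_volume R d * finf *
  \int[lebesgue_measure]_(r in `[0, 1]) (r ^+ d * J r).

(* e stands for the absolutely continuous part of the strain of u. *)
Definition LEFM_energy (D : set V) (u : V -> V) (e : V -> 'M[R]_d) : \bar R :=
  (\int[leb]_(x in D)
      (2 * lame_constant * (\sum_i \sum_j (e x i j) ^+ 2) +
       lame_constant * (\tr (e x)) ^+ 2)%:E +
   (fracture_toughness)%:E * hausdorff_measure d.-1 (jump_set D u))%E.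

Definition LEFM_initial_data (D : set V) (a : R) (u0 v0 : V -> V) :=
  [/\ L20 D a u0, L20 D a v0,
      (Linfnorm D u0 < +oo)%E, (Linfnorm D v0 < +oo)%E &
      exists e, SBD_with_density D u0 e /\ (LEFM_energy D u0 e < +oo)%E].

End LEFM.

(* Main.v *)
Require Import Defs.
From HB Require Import structures.
From mathcomp Require Import all_boot all_order all_algebra.
From mathcomp Require Import all_classical all_reals all_analysis.
From mathcomp Require Import measurable_realfun ess_sup_inf.
From mathcomp Require Import ring lra.

(* The total energy is the kinetic energy plus PD^eps. For LEFM initial data PD^eps(u_0) is bounded
   uniformly in eps: off a set of measure O(|h|), swept by a neighbourhood of the jump set,
   the increment (u_0(x+h) - u_0(x)).h is an average of the absolutely continuous strain along the
   segment [x, x+h], and on that set the potential is at most f_oo. Energy balance then bounds PD^eps_k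
   and the velocities uniformly in k and t.
   Since PD^(m eps) <= PD^eps, the energies at scale eps_k control nonlocal
   averages at a fixed scale; the averaged fields are equicontinuous, so a diagonal
   argument yields L^2 convergence uniform in time. The initial velocity of the limit is
   found from |u_k(s) - u_0 - s v_0|^2 = o(s^2) uniformly in k: the norm of u_k(s) - u_0 is bounded by the
   energy balance and the lower semicontinuity of PD, and its product with v_0 by
   testing the equation against Lipschitz fields. *)

Set Implicit Arguments.
Unset Strict Implicit.
Unset Printing Implicit Defensive.
Import Order.TTheory GRing.Theory Num.Theory.
Import numFieldNormedType.Exports.
Local Open Scope classical_set_scope.
Local Open Scope ring_scope.

(** The potential is bounded, so the energy alone controls no power of the strain. The sup bound on
    the fields keeps the argument of f in a range where f dominates a linear function, and this
    makes the energy coercive. Even so it controls only the component along z of the increment over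
    a bond z. The nonlocal average is therefore the projected one, of J(z) (z . u(x + e z)) z /
    |z|^2: for small e it is close to a fixed positive definite matrix applied to u(x), so
    convergence of averages gives convergence of fields without a Korn inequality. The multiples of
    eps_k near a fixed scale depend on k, hence the averages must be continuous in the scale as well
    as in x. Accelerations are controlled uniformly in the horizon only against Lipschitz fields, so
    strong differentiability of the limit at 0 has to be recovered from weak information together
    with an upper bound on norms. The concavity of f makes PD^eps semiconcave at each fixed horizon;
    this yields the energy balance as an inequality, in the direction that the estimates use. *)

Notation mfunT := (measurable_fun setT).

Lemma le_of_eq (d : Order.disp_t) (T : porderType d) (x y : T) : x = y -> (x <= y)%O.
Proof. by move=> ->. Qed.

(** * Affine changes of variables for Lebesgue measure *)

Section affine1.
Context (R : realType).
Local Notation mu := (@lebesgue_measure R).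

Let aff1 (l h : R) (x : R) : R := l * x + h.

Let measurable_aff1 l h :
  measurable_fun [set: measurableTypeR R] (aff1 l h : measurableTypeR R -> measurableTypeR R).
Proof. by apply: measurable_funD => //; exact: mulrl_measurable. Qed.

(** Uniqueness of Lebesgue measure: the pushforward under the affine map, multiplied by |l|, gives
    every half-open interval its length. *)
Lemma ge0_integral_affine1 (l h : R) (F : R -> \bar R) : l != 0 ->
  measurable_fun [set: R] F -> (forall x, 0 <= F x)%E ->
  (\int[mu]_x F (l * x + h)%R = `|l|^-1%:E * \int[mu]_x F x)%E.
Proof.
move=> l0 mF F0.
have al0 : 0 < `|l| by rewrite normr_gt0.
pose p : {measure set (measurableTypeR R) -> \bar R} :=
  measure_function_pushforward__canonical__measure_function_Measure
    mu (@measurable_aff1 l h).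
pose q : {measure set (measurableTypeR R) -> \bar R} := mscale (NngNum (ltW al0)) p.
have qE A : measurable A -> mu A = q A.
  apply: lebesgue_measure_unique => _ [[a b]] _ <-.
  transitivity (`|l|%:E * mu (aff1 l h @^-1` `]a, b]))%E; last by [].
  have [l_gt0|l_le0] := ltP 0 l.
    rewrite (_ : aff1 l h @^-1` _ = `](a - h) / l, (b - h) / l]%classic); last first.
      apply/seteqP; split => x /=; rewrite !in_itv/= /aff1;
      by rewrite ltr_pdivrMr// ler_pdivlMr// mulrC ltrBlDr lerBrDr.
    rewrite !lebesgue_measure_itv/= !lte_fin gtr0_norm//.
    rewrite ltr_pM2r ?invr_gt0// ltrD2r; case: ifPn => // _; last by rewrite mule0.
    by rewrite -!EFinB -EFinM; congr EFin; field.
  have l_lt0 : l < 0 by rewrite lt_neqAle l0.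
  rewrite (_ : aff1 l h @^-1` _ = `[(b - h) / l, (a - h) / l[%classic); last first.
    apply/seteqP; split => x /=; rewrite !in_itv/= /aff1;
    by rewrite ltr_ndivlMr// ler_ndivrMr// mulrC ltrBlDr lerBrDr andbC.
  rewrite !lebesgue_measure_itv/= !lte_fin ltr0_norm//.
  rewrite ltr_nM2r ?invr_lt0// ltrD2r; case: ifPn => // _; last by rewrite mule0.
  by rewrite -!EFinB -EFinM; congr EFin; field.
have -> : (\int[mu]_x F x = \int[q]_x F x)%E.
  by apply: eq_measure_integral => A mA _; exact: qE.
rewrite /q ge0_integral_mscale//= ge0_integral_pushforward//=.
rewrite preimage_setT muleA -EFinM mulVf ?mul1e// gt_eqF//.
Qed.
End affine1.

Section affine.
Context (R : realType).
Local Notation leb := (lebesgue_rV R).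

Lemma rV_cons_ord0 n (p : measurableTypeR R * 'rV[R]_n) i :
  rV_cons p i ord0 = p.1.
Proof.
rewrite /rV_cons (_ : ord0 = lshift n (ord0 : 'I_1)); last exact/val_inj.
by rewrite (ord1 i) (@row_mxEl _ 1 1 n) mxE eqxx mulr1n.
Qed.

Lemma rV_cons_lift n (p : measurableTypeR R * 'rV[R]_n) i j :
  rV_cons p i (lift ord0 j) = p.2 ord0 j.
Proof.
rewrite /rV_cons (_ : lift ord0 j = rshift 1 j); last exact/val_inj.
by rewrite (ord1 i) (@row_mxEr _ 1 1 n).
Qed.

Definition rV_affine n (l h v : 'rV[R]_n) : 'rV[R]_n :=
  \row_i (l ord0 i * v ord0 i + h ord0 i).

Lemma measurable_rV_affine n (l h : 'rV[R]_n) :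
  measurable_fun [set: 'rV[R]_n] (rV_affine l h).
Proof.
apply/measurable_fun_rVP => i; under eq_fun do rewrite mxE.
apply: measurable_funD => //; apply: measurable_funM => //.
exact: measurable_rV_coord.
Qed.

Lemma ge0_integral_lebesgue_rVS n (F : 'rV[R]_n.+1 -> \bar R) :
  mfunT F -> (forall v, 0 <= F v)%E ->
  (\int[leb n.+1]_v F v =
   \int[@lebesgue_measure R]_x \int[leb n]_v F (rV_cons (x, v)))%E.
Proof.
move=> mF F0.
have mc := @measurable_rV_cons R n.
transitivity (\int[pushforward (@lebesgue_measure R \x leb n)%E (@rV_cons R n)]_v F v)%E.
  by [].
rewrite (@ge0_integral_pushforward _ _ _ _ _ _ mc _ _ _)//.
rewrite preimage_setT (fubini_tonelli1 (F \o @rV_cons R n))//.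
- exact: measurableT_comp mF mc.
- by move=> x; exact: F0.
Qed.

(** Induction on the dimension by Tonelli. Each coordinate has its own factor because the reflection
    and the doubling of a single coordinate are used later, besides translations and homotheties. *)
Lemma ge0_integral_affine n (l h : 'rV[R]_n) (F : 'rV[R]_n -> \bar R) :
  (forall i, l ord0 i != 0) ->
  mfunT F -> (forall v, 0 <= F v)%E ->
  (\int[leb n]_v F (rV_affine l h v) =
   (\prod_i `|l ord0 i|)^-1%:E * \int[leb n]_v F v)%E.
Proof.
elim: n l h F => [|n IH] l h F l0 mF F0.
  rewrite big_ord0 invr1 mul1e; apply: eq_integral => v _; congr F.
  by apply/rowP => -[].
have mA := @measurable_rV_affine n.+1 l h.
have mc := @measurable_rV_cons R n.
rewrite !ge0_integral_lebesgue_rVS//; last exact: measurableT_comp.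
have E x v : rV_affine l h (rV_cons (x, v)) =
   rV_cons (l ord0 ord0 * x + h ord0 ord0,
     rV_affine (rsubmx (l : 'rV_(1 + n))) (rsubmx (h : 'rV_(1 + n))) v).
  apply/rowP => i; rewrite mxE.
  have [j ->|->] := unliftP ord0 i; last by rewrite !rV_cons_ord0.
  rewrite !rV_cons_lift /= !mxE.
  by rewrite (_ : rshift 1 j = lift ord0 j)//; exact/val_inj.
under eq_integral => x _.
  under eq_integral => v _ do rewrite E.
  rewrite (IH _ _ (fun w => F (rV_cons (l ord0 ord0 * x + h ord0 ord0, w)))); last 3 first.
  - by move=> i; rewrite mxE; exact: l0.
  - by apply: (measurableT_comp mF); apply: (measurableT_comp mc); exact: pair1_measurable.
  - by move=> v; exact: F0.
  over.
have mG : measurable_fun [set: R] (fun x => \int[leb n]_v F (rV_cons (x, v)))%E.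
  apply: (measurable_fun_fubini_tonelli_F (m2 := leb n) (F \o @rV_cons R n)).
    exact: measurableT_comp.
  by move=> x; exact: F0.
rewrite (@ge0_integral_affine1 _ _ _ (fun y => ((\prod_(i < n) `|rsubmx (l : 'rV_(1 + n)) ord0 i|)^-1%:E *
   \int[leb n]_v F (rV_cons (y, v)))%E)) //; last 2 first.
- by apply: emeasurable_funM => //.
- move=> x; apply: mule_ge0; last exact: integral_ge0.
  by rewrite lee_fin invr_ge0 prodr_ge0.
rewrite ge0_integralZl//; last 2 first.
- by move=> x _; exact: integral_ge0.
- by rewrite lee_fin invr_ge0 prodr_ge0.
rewrite muleA -EFinM; congr (_ * _)%E; congr EFin.
rewrite big_ord_recl invfM; congr (_ * _^-1).
by apply: eq_bigr => i _; rewrite mxE; congr (`|l _ _|); apply/val_inj.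
Qed.

Definition rV_box n (c : 'rV[R]_n) (r : R) : set 'rV[R]_n :=
  [set v | forall i, `|v ord0 i - c ord0 i| <= r].

Lemma measurable_rV_box n (c : 'rV[R]_n) r : measurable (rV_box c r).
Proof.
rewrite (_ : rV_box c r = \bigcap_(i in [set: 'I_n]) [set v | `|v ord0 i - c ord0 i| <= r]).
  apply: fin_bigcap_measurable => // i _.
  have mg : measurable_fun [set: 'rV[R]_n] (fun v => `|v ord0 i - c ord0 i|).
    apply: measurableT_comp => //; apply: measurable_funB => //.
    exact: measurable_rV_coord.
  have := mg measurableT _ (measurable_itv `]-oo, r]).
  by rewrite setTI; congr measurable; apply/seteqP; split => v /=; rewrite in_itv.
by apply/seteqP; split => v h i; [move=> _; exact: h | exact: h].
Qed.

Lemma lebesgue_rV_box n (c : 'rV[R]_n) r : 0 <= r ->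
  leb n (rV_box c r) = ((2 * r) ^+ n)%:E.
Proof.
move=> r0; elim: n c => [|n IH] c.
  rewrite expr0 /= diracE mem_set//; by case.
rewrite -[rV_box c r]setIT -integral_indic//; last exact: measurable_rV_box.
rewrite ge0_integral_lebesgue_rVS//; last first.
  by apply/measurable_EFinP; apply: measurable_indic; exact: measurable_rV_box.
have E x (v : 'rV[R]_n) : \1_(rV_box c r) (rV_cons (x, v)) =
   \1_(`[c ord0 ord0 - r, c ord0 ord0 + r]%classic) x * \1_(rV_box (rsubmx (c : 'rV_(1 + n))) r) v :> R.
  rewrite !indicE -natrM mulnb; congr (_%:R : R); congr nat_of_bool; apply/idP/andP.
    move=> /set_mem H; split; apply/mem_set.
      by have := H ord0; rewrite rV_cons_ord0 /= in_itv/= ler_distl.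
    move=> i; have := H (lift ord0 i); rewrite rV_cons_lift mxE.
    by rewrite (_ : rshift 1 i = lift ord0 i)//; exact/val_inj.
  move=> [/set_mem H1 /set_mem H2]; apply/mem_set => i.
  have [j ->|->] := unliftP ord0 i.
    rewrite rV_cons_lift; have := H2 j; rewrite mxE.
    by rewrite (_ : rshift 1 j = lift ord0 j)//; exact/val_inj.
  by rewrite rV_cons_ord0; move: H1; rewrite /= in_itv/= -ler_distl.
transitivity (\int[@lebesgue_measure R]_x
    (((2 * r) ^+ n)%:E * (\1_(`[c ord0 ord0 - r, c ord0 ord0 + r]%classic) x)%:E))%E.
  apply: eq_integral => x _.
  under eq_integral => v _ do rewrite E EFinM.
  rewrite ge0_integralZl//; last first.
    by apply/measurable_EFinP; apply: measurable_indic; exact: measurable_rV_box.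
  rewrite integral_indic//; last exact: measurable_rV_box.
  rewrite muleC; congr (_ * _)%E.
  by rewrite (setIT (rV_box _ _)); exact: IH.
have I1 : (\int[@lebesgue_measure R]_x
    (\1_(`[c ord0 ord0 - r, c ord0 ord0 + r]%classic) x)%:E = (2 * r)%:E)%E.
  rewrite integral_indic// setIT.
  transitivity (@lebesgue_measure R `[c ord0 ord0 - r, c ord0 ord0 + r]%classic) => //.
  rewrite lebesgue_measure_itv/= lte_fin; case: ltP => h.
    by rewrite -EFinB; congr (_%:E)%E; ring.
  have -> : r = 0 by apply/eqP; rewrite eq_le r0 andbT; lra.
  by rewrite mulr0.
rewrite ge0_integralZl//.
- by rewrite I1 exprSr EFinM.
- by apply/measurable_EFinP; apply: measurable_indic.
- by rewrite lee_fin exprn_ge0// mulr_ge0.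
Qed.

End affine.

(** * Euclidean norm and Borel measurability *)

Section dot_enorm.
Context (R : realType) (n : nat).
Implicit Types (x y z : 'rV[R]_n) (a : R).

Lemma dotC x y : dot x y = dot y x.
Proof. by apply: eq_bigr => i _; rewrite mulrC. Qed.

Lemma dotDl x y z : dot (x + y) z = dot x z + dot y z.
Proof. by rewrite /dot -big_split/=; apply: eq_bigr => i _; rewrite mxE mulrDl. Qed.

Lemma dotZl a x y : dot (a *: x) y = a * dot x y.
Proof. by rewrite /dot mulr_sumr; apply: eq_bigr => i _; rewrite mxE mulrA. Qed.

Lemma dotNl x y : dot (- x) y = - dot x y.
Proof. by rewrite -scaleN1r dotZl mulN1r. Qed.

Lemma dotBl x y z : dot (x - y) z = dot x z - dot y z.
Proof. by rewrite dotDl dotNl. Qed.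

Lemma dotDr x y z : dot z (x + y) = dot z x + dot z y.
Proof. by rewrite dotC dotDl !(dotC z). Qed.

Lemma dotZr a x y : dot y (a *: x) = a * dot y x.
Proof. by rewrite dotC dotZl dotC. Qed.

Lemma dotNr x y : dot y (- x) = - dot y x.
Proof. by rewrite dotC dotNl dotC. Qed.

Lemma dotBr x y z : dot z (x - y) = dot z x - dot z y.
Proof. by rewrite dotDr dotNr. Qed.

Lemma dot0l x : dot 0 x = 0.
Proof. by rewrite -(scale0r 0) dotZl mul0r. Qed.

Lemma dot0r x : dot x 0 = 0.
Proof. by rewrite dotC dot0l. Qed.

Lemma dot_ge0 x : 0 <= dot x x.
Proof. by apply: sumr_ge0 => i _; rewrite -expr2 sqr_ge0. Qed.

Lemma enorm_ge0 x : 0 <= enorm x.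
Proof. exact: sqrtr_ge0. Qed.
Hint Resolve enorm_ge0 : core.

Lemma sqr_enorm x : enorm x ^+ 2 = dot x x.
Proof. by rewrite sqr_sqrtr// dot_ge0. Qed.

Lemma enorm0 : enorm (0 : 'rV[R]_n) = 0.
Proof. by rewrite /enorm dot0l sqrtr0. Qed.

Lemma enormZ a x : enorm (a *: x) = `|a| * enorm x.
Proof. by rewrite /enorm dotZl dotZr mulrA -expr2 sqrtrM ?sqr_ge0// sqrtr_sqr. Qed.

Lemma enormN x : enorm (- x) = enorm x.
Proof. by rewrite -scaleN1r enormZ normrN1 mul1r. Qed.

Lemma enormB x y : enorm (x - y) = enorm (y - x).
Proof. by rewrite -enormN opprB. Qed.

Lemma ler_coord_enorm x i : `|x ord0 i| <= enorm x.
Proof.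
rewrite -sqrtr_sqr ler_wsqrtr// /dot (bigD1 i)//= -expr2 lerDl.
by apply: sumr_ge0 => j _; rewrite -expr2 sqr_ge0.
Qed.

Lemma enorm_eq0 x : (enorm x == 0) = (x == 0).
Proof.
apply/eqP/eqP => [h|->]; last exact: enorm0.
apply/rowP => i; rewrite mxE; apply/eqP; rewrite -normr_eq0 eq_le normr_ge0 andbT.
by rewrite -h ler_coord_enorm.
Qed.

Lemma enorm_gt0 x : (0 < enorm x) = (x != 0).
Proof. by rewrite lt_neqAle enorm_ge0 andbT eq_sym enorm_eq0. Qed.

Lemma ler_dot_enorm x y : `|dot x y| <= enorm x * enorm y.
Proof.
have [->|y0] := eqVneq y 0; first by rewrite dot0r normr0 enorm0 mulr0.
have y2 : 0 < dot y y by rewrite -sqr_enorm exprn_gt0// enorm_gt0.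
rewrite -(@ler_pXn2r _ 2)// ?nnegrE// ?mulr_ge0//.
rewrite exprMn !sqr_enorm real_normK ?num_real//.
have : 0 <= dot (dot y y *: x - dot x y *: y) (dot y y *: x - dot x y *: y).
  exact: dot_ge0.
rewrite !(dotBl, dotBr, dotZl, dotZr) (dotC y x) => h.
rewrite -subr_ge0 -(pmulr_rge0 _ y2).
by apply: le_trans h _; apply: le_of_eq; ring.
Qed.

Lemma ler_enormD x y : enorm (x + y) <= enorm x + enorm y.
Proof.
rewrite -(@ler_pXn2r _ 2)// ?nnegrE// ?addr_ge0//.
rewrite sqr_enorm sqrrD !sqr_enorm dotDl !dotDr (dotC y x).
have := le_trans (ler_norm _) (ler_dot_enorm x y).
by move=> h; rewrite mulr2n; lra.
Qed.

Lemma ler_enorm_sum x : enorm x <= \sum_i `|x ord0 i|.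
Proof.
have S0 : 0 <= \sum_i `|x ord0 i| by apply: sumr_ge0.
rewrite -(@ler_pXn2r _ 2)// ?nnegrE// sqr_enorm expr2 mulr_suml.
apply: ler_sum => i _; rewrite -expr2 -real_normK ?num_real// expr2.
by apply: ler_wpM2l => //; rewrite (bigD1 i)//= lerDl sumr_ge0.
Qed.

Lemma ler_enorm_box x r : (forall i, `|x ord0 i| <= r) -> enorm x <= n%:R * r.
Proof.
move=> h; apply: le_trans (ler_enorm_sum x) _.
by apply: le_trans (ler_sum _ (fun i _ => h i)) _; rewrite sumr_const card_ord mulr_natl.
Qed.

Lemma ler_norm_enorm x : `|x| <= enorm x.
Proof.
rewrite [leLHS]/Num.norm/= mx_normrE; apply: bigmax_le => // -[i j] _ /=.
by rewrite (ord1 i) ler_coord_enorm.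
Qed.

Lemma ler_coord_norm x i : `|x ord0 i| <= `|x|.
Proof.
rewrite [leRHS]/Num.norm/= mx_normrE.
by rewrite (le_trans _ (le_bigmax _ _ (ord0, i))).
Qed.

Lemma ler_enorm_norm x : enorm x <= n%:R * `|x|.
Proof. exact/ler_enorm_box/ler_coord_norm. Qed.

End dot_enorm.
#[export] Hint Resolve enorm_ge0 : core.

Section measurable_rV.
Context d (T : measurableType d) (R : realType) (n : nat).
Implicit Types f g : T -> 'rV[R]_n.

Lemma measurable_coord f i :
  mfunT f -> mfunT (fun x => f x ord0 i).
Proof. by move/measurable_fun_rVP. Qed.

Lemma measurable_rVD f g : mfunT f -> mfunT g ->
  mfunT (fun x => f x + g x).
Proof.
move=> mf mg; apply/measurable_fun_rVP => i; under eq_fun do rewrite mxE.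
by apply: measurable_funD; exact: measurable_coord.
Qed.

Lemma measurable_rVZ (h : T -> R) f : mfunT h -> mfunT f ->
  mfunT (fun x => h x *: f x).
Proof.
move=> mh mf; apply/measurable_fun_rVP => i; under eq_fun do rewrite mxE.
by apply: measurable_funM => //; exact: measurable_coord.
Qed.

Lemma measurable_rVN f : mfunT f ->
  mfunT (fun x => - f x).
Proof.
move=> mf; under eq_fun do rewrite -scaleN1r.
exact: measurable_rVZ.
Qed.

Lemma measurable_rVB f g : mfunT f -> mfunT g ->
  mfunT (fun x => f x - g x).
Proof. by move=> mf mg; apply: measurable_rVD => //; exact: measurable_rVN. Qed.

Lemma measurable_dot f g : mfunT f -> mfunT g ->
  mfunT (fun x => dot (f x) (g x)).
Proof.
move=> mf mg; apply: measurable_sum => i.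
by apply: measurable_funM; exact: measurable_coord.
Qed.

Lemma measurable_enorm f : mfunT f ->
  mfunT (fun x => enorm (f x)).
Proof.
move=> mf; apply: (measurableT_comp (f := @Num.sqrt R)); last exact: measurable_dot.
by apply: continuous_measurable_fun => x; exact: sqrt_continuous.
Qed.

Lemma measurable_invr (h : T -> R) : mfunT h ->
  mfunT (fun x => (h x)^-1).
Proof.
move=> mh; apply: (measurableT_comp (f := @GRing.inv R)) => //.
have -> : [set: R] = [set 0] `|` ~` [set 0] by rewrite setUv.
have oD : open (~` [set (0 : R)]) by apply: closed_openC; exact: closed_eq.
have mD : measurable (~` [set (0 : R)]) by exact: measurableC.
apply/measurable_funU => //; split; first exact: measurable_fun_set1.
apply: open_continuous_measurable_fun => // x; rewrite inE/= => /eqP x0.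
exact: inv_continuous.
Qed.

End measurable_rV.

Section borel_rV.
Context (R : realType) (n : nat).
Local Notation V := 'rV[R]_n.

(** The sigma-algebra comes from the coordinates and the topology from the sup norm. They meet
    because an open set is the countable union of the boxes with rational centre and radius 1/(m+1)
    that it contains. *)
Lemma open_measurable_rV (A : set V) : open A -> measurable A.
Proof.
move=> oA.
pose B (p : 'rV[rat]_n * nat) : set V := rV_box (map_mx ratr p.1) p.2.+1%:R^-1.
pose F k : set V := if @unpickle ('rV[rat]_n * nat)%type k is Some p then
   (if `[< B p `<=` A >] then B p else set0) else set0.
have -> : A = \bigcup_k F k.
  apply/seteqP; split => [x Ax|x [k _]]; last first.
    rewrite /F; case: unpickle => [p|//]; by case: asboolP => // BA; exact: BA.
  have /nbhs_ballP[r /= r0 xrA] : nbhs x A by exact: open_nbhs_nbhs.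
  have [m mr] : exists m : nat, 2 * m.+1%:R^-1 < r.
    have r2 : 0 < r / 2 by lra.
    have [m hm] := ltr_add_invr r2.
    by exists m; move: hm; rewrite add0r; set t := _^-1 => hm; lra.
  have m0 : 0 < m.+1%:R^-1 :> R by rewrite invr_gt0.
  have hq i : exists q : rat, `|x ord0 i - ratr q| <= m.+1%:R^-1.
    move: m0; set t := _^-1 => t0.
    have h : x ord0 i - t < x ord0 i + t by lra.
    have [q] := rat_in_itvoo h.
    rewrite in_itv/= => /andP[q1 q2]; exists q; rewrite ler_norml; lra.
  have [q hqE] := choice hq.
  pose p : 'rV[rat]_n * nat := (\row_i q i, m).
  exists (pickle p) => //; rewrite /F pickleK.
  have -> : `[< B p `<=` A >]; last by move=> i; rewrite /= !mxE; exact: hqE.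
  apply/asboolP => y By; apply: xrA.
  rewrite /ball /= /mx_ball; split => // i j; rewrite (ord1 i) /ball/=.
  have h1 := hqE j; have := By j; rewrite /= !mxE => h2.
  rewrite (_ : x ord0 j - y ord0 j = (x ord0 j - ratr (q j)) - (y ord0 j - ratr (q j))); last by ring.
  by apply: le_lt_trans (ler_normB _ _) _; move: h1 h2 mr; set t := _^-1 => *; lra.
apply: bigcupT_measurable => k; rewrite /F; case: unpickle => [p|//].
by case: asboolP => // _; exact: measurable_rV_box.
Qed.

Lemma continuous_measurable_rV (f : V -> R) : continuous f -> mfunT f.
Proof.
move=> cf; apply: (measurability _ (RGenOInfty.measurableE R)) => //.
move=> /= _ [_ [a ->] <-]; rewrite setTI; apply: open_measurable_rV.
by apply: open_comp => //; exact: interval_open.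
Qed.

Lemma lipschitz_continuous_rV (f : V -> R) L :
  (forall x y, `|f x - f y| <= L * enorm (x - y)) -> continuous f.
Proof.
move=> fL x; have fx : Filter (nbhs x) by exact: nbhs_filter.
apply/cvgrPdist_lt => e e0.
have L0 : 0 < n%:R * `|L| + 1 by rewrite ltr_wpDl.
suff : nbhs x [set t | `|f x - f t| < e] by [].
apply/nbhs_ballP; exists (e / (n%:R * `|L| + 1)); first by rewrite /= divr_gt0.
move=> y [_ xy]; apply: le_lt_trans (fL _ _) _.
apply: le_lt_trans (ler_wpM2r (enorm_ge0 _) (ler_norm L)) _.
apply: (@le_lt_trans _ _ (`|L| * (n%:R * (e / (n%:R * `|L| + 1))))).
  apply: ler_wpM2l => //; apply: ler_enorm_box => i; rewrite !mxE.
  by apply: ltW; exact: xy.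
rewrite [ltLHS](_ : _ = e * (n%:R * `|L|) / (n%:R * `|L| + 1)); last first.
  by field; rewrite gt_eqF.
by rewrite ltr_pdivrMr// ltr_pM2l// ltrDl.
Qed.

Lemma enorm_lipschitz (x y : V) : `|enorm x - enorm y| <= enorm (x - y).
Proof.
have := ler_enormD (x - y) y; have := ler_enormD (y - x) x.
by rewrite !subrK (enormB y x) ler_norml; lra.
Qed.

Lemma measurable_eball (x : V) r : measurable (eball x r).
Proof.
have := measurable_enorm (measurable_rVB (@measurable_id _ V setT) (measurable_cst x)).
move=> /(_ measurableT _ (measurable_itv `]-oo, r[)).
by rewrite setTI; congr measurable; apply/seteqP; split => y /=; rewrite in_itv.
Qed.

End borel_rV.

(** * Integrals of nonnegative real functions *)

Section rint.
Context d (T : measurableType d) (R : realType) (mu : {measure set T -> \bar R}).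

(** Read off the definition of the integral as a supremum over simple functions below the integrand,
    so that it also applies where measurability is inconvenient to establish. *)
Lemma ge0_le_integralT (f g : T -> \bar R) : (forall x, 0 <= f x)%E ->
  (forall x, f x <= g x)%E -> (\int[mu]_x f x <= \int[mu]_x g x)%E.
Proof.
move=> f0 fg; rewrite !ge0_integralTE//; last first.
  by move=> x; exact: le_trans (fg x).
apply: ge_ereal_sup => _ [h hf <-]; apply: ereal_sup_ubound; exists h => //= x.
exact: le_trans (fg x).
Qed.

Lemma rint_ge0 (f : T -> R) : (forall x, 0 <= f x) -> (0 <= \int[mu]_x (f x)%:E)%E.
Proof. by move=> f0; apply: integral_ge0 => x _; rewrite lee_fin. Qed.

Lemma le_rint (f g : T -> R) : (forall x, 0 <= f x) ->
  (forall x, f x <= g x) -> (\int[mu]_x (f x)%:E <= \int[mu]_x (g x)%:E)%E.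
Proof. by move=> f0 fg; apply: ge0_le_integralT => x; rewrite lee_fin. Qed.

Lemma rintZl c (f : T -> R) : 0 <= c -> mfunT f -> (forall x, 0 <= f x) ->
  (\int[mu]_x (c * f x)%:E = c%:E * \int[mu]_x (f x)%:E)%E.
Proof.
move=> c0 mf f0; under eq_integral do rewrite EFinM.
by rewrite ge0_integralZl// ?lee_fin//; [exact/measurable_EFinP|move=> x _; rewrite lee_fin].
Qed.

Lemma rintD (f g : T -> R) : mfunT f -> (forall x, 0 <= f x) ->
  mfunT g -> (forall x, 0 <= g x) ->
  (\int[mu]_x (f x + g x)%:E = \int[mu]_x (f x)%:E + \int[mu]_x (g x)%:E)%E.
Proof.
move=> mf f0 mg g0; under eq_integral do rewrite EFinD.
rewrite ge0_integralD// ?lee_fin//; [by move=> x _; rewrite lee_fin|exact/measurable_EFinP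
  |by move=> x _; rewrite lee_fin|exact/measurable_EFinP].
Qed.

Lemma rint_sum (I : Type) (s : seq I) (f : I -> T -> R) :
  (forall i, mfunT (f i)) -> (forall i x, 0 <= f i x) ->
  (\int[mu]_x (\sum_(i <- s) f i x)%:E = \sum_(i <- s) \int[mu]_x (f i x)%:E)%E.
Proof.
move=> mf f0; under eq_integral do rewrite -sumEFin.
rewrite ge0_integral_sum//; first by move=> i; exact/measurable_EFinP.
by move=> i x _; rewrite lee_fin.
Qed.

Lemma rint_indic (A : set T) : measurable A -> (\int[mu]_x (\1_A x : R)%:E = mu A)%E.
Proof. by move=> mA; rewrite integral_indic// setIT. Qed.

Lemma rint_ae (f g : T -> R) : mfunT f -> (forall x, 0 <= f x) ->
  mfunT g -> (forall x, 0 <= g x) ->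
  {ae mu, forall x, f x <= g x} -> (\int[mu]_x (f x)%:E <= \int[mu]_x (g x)%:E)%E.
Proof.
move=> mf f0 mg g0 fg; apply: ae_ge0_le_integral => //.
- by move=> x _; rewrite lee_fin.
- exact/measurable_EFinP.
- by move=> x _; rewrite lee_fin.
- exact/measurable_EFinP.
- by apply: filterS fg => x h _; rewrite lee_fin.
Qed.

Lemma rint_ae_eq (f g : T -> R) : mfunT f -> (forall x, 0 <= f x) ->
  mfunT g -> (forall x, 0 <= g x) ->
  {ae mu, forall x, f x = g x} -> (\int[mu]_x (f x)%:E = \int[mu]_x (g x)%:E)%E.
Proof.
move=> mf f0 mg g0 fg; apply/eqP; rewrite eq_le; apply/andP; split;
apply: rint_ae => //; by apply: filterS fg => x ->.
Qed.

End rint.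

Lemma indic_ge0 T (R : realType) (A : set T) x : 0 <= \1_A x :> R.
Proof. by rewrite indicE. Qed.

Ltac pos := repeat first [ done | exact: enorm_ge0 | exact: dot_ge0 | exact: indic_ge0
  | exact: ltW | apply: sqr_ge0 | apply: mulr_ge0 | apply: addr_ge0 | apply: exprn_ge0 | rewrite invr_ge0 ].

Ltac mfun := repeat first
  [ assumption
  | done
  | exact: measurable_cst
  | exact: measurable_id
  | exact: measurable_fst
  | exact: measurable_snd
  | match goal with |- measurable_fun _ (fun x => EFin (@?f x)) => apply/measurable_EFinP end
  | match goal with H : measurable_fun _ ?f |- measurable_fun _ (fun x => ?f (@?g x)) =>
      apply: (measurableT_comp H) end
  | match goal with |- measurable_fun _ (fun x => Num.norm (@?g x)) =>
      apply: (measurableT_comp (@normr_measurable _ setT)) end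
  | apply: measurable_indic
  | apply: measurable_eball
  | apply: measurable_rV_box
  | apply: measurable_dot
  | apply: measurable_enorm
  | apply: measurable_rVD
  | apply: measurable_rVN
  | apply: measurable_rVZ
  | apply: measurable_invr
  | apply: measurable_funX
  | apply: measurable_funM
  | apply: measurable_funD
  | apply: measurable_funN
  | match goal with |- measurable_fun _ (fun x => ?f (?g x)) =>
      apply: (measurableT_comp (f := f)) end ].

Ltac sidec := first [ done | by pos | by mfun | by (move=> *; pos) | by (move=> *; mfun)
  | by (apply: measurable_sum => *; mfun) ].

(** * Volumes, null sets and a singular integral without polar coordinates *)

Section volume.
Context (R : realType).
Local Notation leb := (lebesgue_rV R).

Lemma ge0_integral_translate n (h : 'rV[R]_n) (F : 'rV[R]_n -> \bar R) :
  mfunT F -> (forall v, 0 <= F v)%E ->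
  (\int[leb n]_v F (v + h)%R = \int[leb n]_v F v)%E.
Proof.
move=> mF F0.
have := @ge0_integral_affine R n (const_mx 1) h F.
rewrite (_ : \prod_i _ = 1); last by rewrite big1// => i _; rewrite mxE normr1.
rewrite invr1 mul1e => <-//; last by move=> i; rewrite mxE oner_neq0.
by apply: eq_integral => v _; congr F; apply/rowP => i; rewrite !mxE mul1r.
Qed.

Lemma ge0_integral_dilate n (l : R) (h : 'rV[R]_n) (F : 'rV[R]_n -> \bar R) : l != 0 ->
  mfunT F -> (forall v, 0 <= F v)%E ->
  (\int[leb n]_v F (l *: v + h)%R = (`|l| ^+ n)^-1%:E * \int[leb n]_v F v)%E.
Proof.
move=> l0 mF F0.
have := @ge0_integral_affine R n (const_mx l) h F.
rewrite (_ : \prod_i _ = `|l| ^+ n); last first.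
  by rewrite (eq_bigr (fun=> `|l|)) ?prodr_const ?card_ord// => i _; rewrite mxE.
move=> <-//; last by move=> i; rewrite mxE.
by apply: eq_integral => v _; congr F; apply/rowP => i; rewrite !mxE.
Qed.

Lemma rint_translate n (h : 'rV[R]_n) (f : 'rV[R]_n -> R) :
  mfunT f -> (forall v, 0 <= f v) ->
  (\int[leb n]_v (f (v + h)%R)%:E = \int[leb n]_v (f v)%:E)%E.
Proof.
move=> mf f0; rewrite (@ge0_integral_translate n h (fun v => (f v)%:E))//.
by mfun.
Qed.

Lemma rint_dilate n (l : R) (h : 'rV[R]_n) (f : 'rV[R]_n -> R) : l != 0 ->
  mfunT f -> (forall v, 0 <= f v) ->
  (\int[leb n]_v (f (l *: v + h)%R)%:E = (`|l| ^+ n)^-1%:E * \int[leb n]_v (f v)%:E)%E.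
Proof.
move=> l0 mf f0; rewrite (@ge0_integral_dilate n l h (fun v => (f v)%:E))//.
by mfun.
Qed.

Lemma eball_sub_box n (x : 'rV[R]_n) r : eball x r `<=` rV_box x r.
Proof.
move=> y h i; apply: (@le_trans _ _ (enorm (y - x))); last exact: ltW.
by have := ler_coord_enorm (y - x) i; rewrite !mxE.
Qed.

Lemma lebesgue_eball_fin n (x : 'rV[R]_n) r : (leb n (eball x r) < +oo)%E.
Proof.
have [r0|r0] := leP 0 r.
  apply: (@le_lt_trans _ _ (leb n (rV_box x r))); last by rewrite lebesgue_rV_box ?ltry.
  by apply: le_measure; rewrite ?inE; [exact: measurable_eball|exact: measurable_rV_box|exact: eball_sub_box].
rewrite (_ : eball x r = set0) ?measure0//; apply/seteqP; split => // y.
by rewrite /eball/= => h; have := enorm_ge0 (y - x); lra.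
Qed.

Lemma unit_ball_volume_gt0 n : 0 < unit_ball_volume R n.
Proof.
have r0 : 0 < (2 * n.+1%:R)^-1 :> R by rewrite invr_gt0 mulr_gt0.
apply: fine_gt0; rewrite lebesgue_eball_fin andbT.
apply: (@lt_le_trans _ _ (leb n (rV_box 0 (2 * n.+1%:R)^-1))).
  by rewrite lebesgue_rV_box ?ltW// lte_fin exprn_gt0// mulr_gt0.
apply: le_measure; rewrite ?inE; [exact: measurable_rV_box|exact: measurable_eball|].
move=> y h; rewrite /eball/= subr0.
have h' i : `|y ord0 i| <= (2 * n.+1%:R)^-1 by have := h i; rewrite mxE subr0.
apply: le_lt_trans (ler_enorm_box h') _.
rewrite ltr_pdivrMr ?mulr_gt0// mul1r -natrM ltr_nat mul2n -addnn.
by rewrite addSn ltnS leq_addr.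
Qed.

Lemma unit_ball_volumeE n : leb n (eball 0 1) = (unit_ball_volume R n)%:E.
Proof. by rewrite fineK// ge0_fin_numE// lebesgue_eball_fin. Qed.

(** Doubling coordinate i leaves the part of the hyperplane in a box invariant, so its finite
    measure m satisfies m = m/2. *)
Lemma hyperplane_null n (i : 'I_n) : leb n [set v : 'rV[R]_n | v ord0 i = 0] = 0%E.
Proof.
have mH : measurable [set v : 'rV[R]_n | v ord0 i = 0].
  have := @measurable_rV_coord R n i measurableT _ (measurable_set1 0).
  by rewrite setTI.
pose B k : set 'rV[R]_n := [set v : 'rV[R]_n | v ord0 i = 0] `&` rV_box 0 k%:R.
have mB k : measurable (B k) by apply: measurableI => //; exact: measurable_rV_box.
have B0 k : leb n (B k) = 0%E.
  pose l : 'rV[R]_n := \row_j (if j == i then 2 else 1).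
  have mI : mfunT (fun v => (\1_(B k) v : R)%:E).
    by apply/measurable_EFinP; exact: measurable_indic.
  have F0 (v : 'rV[R]_n) : (0 <= (\1_(B k) v : R)%:E)%E by rewrite lee_fin.
  have Bfin : leb n (B k) \is a fin_num.
    rewrite ge0_fin_numE//; apply: (@le_lt_trans _ _ (leb n (rV_box 0 k%:R))).
      by apply: le_measure; rewrite ?inE; [exact: mB|exact: measurable_rV_box|move=> v []].
    by rewrite lebesgue_rV_box// ltry.
  have l0 j : l ord0 j != 0.
    by rewrite mxE; case: ifP => _; rewrite ?oner_neq0// pnatr_eq0.
  have := ge0_integral_affine 0 l0 mI (fun v => F0 v).
  have E0 v : \1_(B k) (rV_affine l 0 v) = \1_(B k) v :> R.
    rewrite !indicE; congr (_%:R : R); congr nat_of_bool.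
    have E j : rV_affine l 0 v ord0 j = if j == i then 2 * v ord0 j else v ord0 j.
      by rewrite !mxE addr0; case: ifP => // _; rewrite mul1r.
    apply/idP/idP => /set_mem[/= h1 h2]; apply/mem_set; split => /=.
    - by move: h1; rewrite E eqxx; lra.
    - move=> j; have := h2 j; rewrite E; case: ifP => // /eqP ->.
      have -> : v ord0 i = 0 by move: h1; rewrite E eqxx; lra.
      by rewrite mulr0.
    - by rewrite E eqxx h1 mulr0.
    - by move=> j; have := h2 j; rewrite E; case: ifP => // /eqP ->; rewrite h1 mulr0.
  under eq_integral do rewrite E0.
  rewrite integral_indic// setIT => h.
  move: h; rewrite (bigD1 i)//= mxE eqxx big1 ?mulr1; last first.
    by move=> j /negbTE ji; rewrite mxE ji normr1.
  rewrite -(fineK Bfin) -EFinM => -[] h; congr EFin.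
  by move: h; rewrite ger0_norm//; set t := fine _ => h; lra.
apply/eqP; rewrite eq_le measure_ge0 andbT.
have -> : [set v : 'rV[R]_n | v ord0 i = 0] = \bigcup_k B k.
  apply/seteqP; split => [v vi|v [k _ []]//].
  have [k hk] : exists k : nat, `|v| <= k%:R.
    by exists (Num.bound `|v|); apply/ltW/archi_boundP.
  exists k => //; split => // j; rewrite mxE subr0; exact: le_trans (ler_coord_norm _ _) hk.
apply: le_trans (measure_sigma_subadditive _ _ _ _) _ => //.
  exact: bigcupT_measurable.
by rewrite eseries0// => k _ _; exact: B0.
Qed.

Lemma hyperplane_ae n (i : 'I_n) : {ae leb n, forall v : 'rV[R]_n, v ord0 i != 0}.
Proof.
exists [set v : 'rV[R]_n | v ord0 i = 0]; split; [|exact: hyperplane_null|].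
  have := @measurable_rV_coord R n i measurableT _ (measurable_set1 0).
  by rewrite setTI.
by move=> v /= /negP; rewrite negbK => /eqP.
Qed.

Lemma mem_eball0 n (z : 'rV[R]_n) r : (z \in eball 0 r) = (enorm z < r).
Proof. by apply/idP/idP => [/set_mem|h]; [|apply/mem_set]; rewrite /eball/= subr0. Qed.

Lemma lebesgue_eball_le n (x : 'rV[R]_n) r : 0 <= r ->
  (leb n (eball x r) <= ((2 * r) ^+ n)%:E)%E.
Proof.
move=> r0; rewrite -(lebesgue_rV_box x r0).
by apply: le_measure; rewrite ?inE; [exact: measurable_eball|exact: measurable_rV_box|exact: eball_sub_box].
Qed.

(** Dyadic self-similarity. On the annulus 2^-(k+1) <= |z| < 1 either |z| >= 1/2, where the
    integrand is at most 2, or 2z lies in the annulus of index k. Substituting 2z costs the factor 2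
    * 2^-n, at most 1/2 because n >= 2, hence I(k+1) <= 2^(n+1) + I(k)/2. The fixed point of this
    recursion is 2^(n+2), and monotone convergence concludes. *)
Lemma invnorm_integral n : (2 <= n)%N ->
  (\int[leb n]_z ((enorm z)^-1 * \1_(eball 0 1) z)%:E <= (2 ^+ n.+2)%:E)%E.
Proof.
move=> n2.
pose W (B : set 'rV[R]_n) z := (enorm z)^-1 * \1_B z.
pose A k : set 'rV[R]_n := eball 0 1 `\` eball 0 (2^-1 ^+ k).
have mA k : measurable (A k) by apply: measurableD; exact: measurable_eball.
have mW B : measurable B -> mfunT (W B) by move=> mB; mfun.
have W0 B z : 0 <= W B z by rewrite /W; pos.
have memA k z : (z \in A k) = (enorm z < 1) && (2^-1 ^+ k <= enorm z).
  by rewrite in_setD !mem_eball0 -leNgt.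
pose I k := (\int[leb n]_z (W (A k) z)%:E)%E.
have IS k : (I k.+1 <= (2 ^+ n.+1)%:E + 2^-1%:E * I k)%E.
  apply: (@le_trans _ _ (\int[leb n]_z (2 * \1_(eball 0 1) z + 2 * W (A k) (2 *: z + 0))%:E)%E).
    apply: le_rint => // z; rewrite addr0 /W !indicE !memA mem_eball0 enormZ ger0_norm//.
    have [z1 /=|z1 /=] := ltP (enorm z) 1; last by rewrite mulr0 mulr0 add0r; pos.
    rewrite mulr1; case: (leP (2^-1 ^+ k.+1) (enorm z)) => /= hk; last by rewrite mulr0; pos.
    rewrite mulr1; have z0 : 0 < enorm z by apply: lt_le_trans hk; rewrite exprn_gt0.
    have -> : 2^-1 ^+ k <= 2 * enorm z.
      by rewrite -ler_pdivrMl// -exprS.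
    rewrite andbT; case: (ltP (2 * enorm z) 1) => hz /=.
      by rewrite mulr1 invfM mulrA mulfV// mul1r lerDr.
    rewrite !mulr0 addr0 -[leRHS]invrK lef_pV2 ?posrE ?invr_gt0//.
    by rewrite -(ler_pM2l (_ : 0 < 2 :> R))// mulfV.
  have m1 : measurable (eball (0 : 'rV[R]_n) 1) by exact: measurable_eball.
  have m2 := mW _ (mA k).
  rewrite rintD; [|by mfun|by move=> z; pos|by mfun|by move=> z; pos].
  rewrite rintZl//; apply: leeD.
    rewrite rint_indic// exprS EFinM lee_pmul2l//.
    by apply: le_trans (lebesgue_eball_le _ _) _; rewrite ?mulr1.
  rewrite rintZl//; [|by mfun].
  rewrite (@rint_dilate n 2 0 (W (A k)))//.
  rewrite muleA -EFinM; apply: lee_wpmul2r; first exact: rint_ge0.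
  rewrite lee_fin ger0_norm//.
  case: n n2 {mA W mW W0 I memA A m1 m2} => [//|[//|m]] _.
  have m0 : 0 < 2 ^+ m :> R by rewrite exprn_gt0.
  rewrite exprS invfM mulrA mulfV// mul1r lef_pV2 ?posrE ?exprn_gt0//.
  by rewrite exprS ler_peMr// exprn_ege1// ler1n.
have I0 k : (I k <= (2 ^+ n.+2)%:E)%E.
  elim: k => [|k IH].
    rewrite /I (eq_integral (fun=> 0%E)) ?integral0 ?lee_fin ?exprn_ge0//.
    move=> z _; rewrite /W indicE memA expr0.
    by case: ltP => //= z1; rewrite ?leNgt ?z1 ?mulr0.
  apply: le_trans (IS k) _.
  apply: (@le_trans _ _ ((2 ^+ n.+1)%:E + 2^-1%:E * (2 ^+ n.+2)%:E)%E).
    by apply: leeD => //; apply: lee_wpmul2l.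
  rewrite -EFinM -EFinD lee_fin [2 ^+ n.+2]exprS mulrA mulVf// mul1r.
  by rewrite mulr_natl mulr2n.
have cI : I k @[k --> \oo] --> (\int[leb n]_z (W (eball 0 1) z)%:E)%E.
  rewrite (_ : (\int[leb n]_z _)%E =
    (\int[leb n]_z (limn (fun k => (W (A k) z)%:E)))%E); last first.
    apply: eq_integral => z _; apply/esym/cvg_lim => //.
    apply: cvg_near_cst.
    have [->|z0] := eqVneq z 0; first by near=> k; rewrite /W enorm0 invr0 !mul0r.
    have z1 : 0 < enorm z by rewrite enorm_gt0.
    near=> k; congr (_ * _)%:E; rewrite !indicE; congr (_%:R).
    rewrite memA mem_eball0 (_ : 2^-1 ^+ k <= enorm z) ?andbT//.
    apply: ltW; near: k.
    have h : (2^-1 ^+ k : R) @[k --> \oo] --> 0 by apply: cvg_expr; rewrite ger0_norm ?invf_lt1 ?ltr1n.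
    have := cvgr_lt _ h _ z1; exact.
  apply: cvg_monotone_convergence => //.
  - by move=> k; apply/measurable_EFinP; apply: mW; exact: mA.
  - by move=> k z _; rewrite lee_fin.
  - move=> z _ j k jk; rewrite lee_fin ler_wpM2l ?invr_ge0 ?enorm_ge0// !indicE !memA ler_nat.
    case: ltP => //= _; case: (leP _ (enorm z)) => //= h.
    rewrite (le_trans _ h)//; apply: ler_wiXn2l => //; rewrite invf_le1 ?ler1n//.
rewrite -(cvg_lim _ cI)//; apply: lime_le; first exact: cvgP cI.
exact: nearW.
Unshelve. all: by end_near. Qed.

Lemma ae_ex n (P : 'rV[R]_n -> Prop) : {ae leb n, forall z, P z} -> exists z, P z.
Proof.
move=> [N [mN N0 PN]]; apply: contrapT => nP.
have NT : N = setT by apply/seteqP; split => // z _; apply: PN => /= Pz; apply: nP; exists z.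
have : (leb n (rV_box 0 1) <= leb n N)%E.
  by apply: le_measure; rewrite ?inE//; [exact: measurable_rV_box|rewrite NT].
by rewrite N0 lebesgue_rV_box// mulr1 lee_fin leNgt exprn_gt0.
Qed.

(* Averages over all dilations of the sphere-like level sets replace polar
   coordinates. *)
Lemma radial_null n (g : R -> R) : (0 < n)%N -> mfunT g ->
  (forall r, 0 <= g r) -> (\int[leb n]_z (g (enorm z))%:E = 0)%E ->
  (\int[@lebesgue_measure R]_r (\1_(`]0, +oo[%classic) r * g r)%:E = 0)%E.
Proof.
move=> n0 mg g0 Ig.
pose i0 : 'I_n := Ordinal n0.
pose H (p : 'rV[R]_n * measurableTypeR R) : R := \1_(`]0, +oo[%classic) p.2 * g (p.2 * enorm p.1).
have mI : mfunT (\1_(`]0, +oo[%classic) : R -> R) by exact: measurable_indic.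
have mH : mfunT (fun p => (H p)%:E).
  by apply/measurable_EFinP; apply: measurable_funM; mfun.
have H0 p : (0 <= (H p)%:E)%E by rewrite lee_fin /H; pos.
have := fubini_tonelli (m1 := leb n) (m2 := @lebesgue_measure R) _ mH H0.
rewrite [X in _ = X -> _](_ : _ = 0%E); last first.
  rewrite -[RHS](integral0 (@lebesgue_measure R) setT); apply: eq_integral => s _.
  rewrite /H /= indicE; case: (boolP (s \in _)) => [/set_mem|_]; last first.
    by under eq_integral do rewrite mul0r; rewrite integral0.
  rewrite /= in_itv/= andbT => s0.
  under eq_integral => z _ do rewrite mul1r.
  transitivity (\int[leb n]_z (g (enorm (s *: z + 0)))%:E)%E.
    by apply: eq_integral => z _; rewrite addr0 enormZ gtr0_norm.
  rewrite (@rint_dilate n s 0 (fun z => g (enorm z))) ?gt_eqF//; first by rewrite Ig mule0.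
  by mfun.
have mF : mfunT (fun z => \int[@lebesgue_measure R]_s (H (z, s))%:E)%E.
  exact: (measurable_fun_fubini_tonelli_F (m2 := @lebesgue_measure R) (fun p => (H p)%:E)).
have F0 z : (0 <= \int[@lebesgue_measure R]_s (H (z, s))%:E)%E by apply: integral_ge0.
move=> h; have hae : ae_eq (leb n) setT (fun z => \int[@lebesgue_measure R]_s (H (z, s))%:E)%E (cst 0)%E.
  by apply/ae_eq_integral_abs => //; under eq_integral => z _ do rewrite gee0_abs//.
have [z [zi]] : exists z : 'rV[R]_n, z ord0 i0 != 0 /\
   (setT z -> (\int[@lebesgue_measure R]_s (H (z, s))%:E = 0)%E).
  by apply: ae_ex; apply: filterS2 (hyperplane_ae i0) hae => z h1 h2; split.
move=> /(_ I) hz.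
have z0 : 0 < enorm z.
  by rewrite enorm_gt0; apply: contraNneq zi => ->; rewrite mxE.
have := @ge0_integral_affine1 R (enorm z) 0 (fun r => (\1_(`]0, +oo[%classic) r * g r)%:E).
rewrite gt_eqF// => /(_ isT).
have mIg : measurable_fun [set: R] (fun r : R => (\1_`]0, +oo[ r * g r)%:E).
  by apply/measurable_EFinP; apply: measurable_funM; mfun.
move=> /(_ mIg) h1; have {}h1 := h1 (fun r => mulr_ge0 (indic_ge0 _ _ _) (g0 r)).
move: h1; rewrite [X in X = _ -> _](_ : _ = 0%E); last first.
  rewrite -[RHS]hz; apply: eq_integral => s _; rewrite /H /= addr0 [s * _]mulrC.
  congr (_ * _)%:E; rewrite !indicE; congr (_%:R); congr nat_of_bool.
  apply/idP/idP => /set_mem hs; apply/mem_set; move: hs; rewrite /= !in_itv/= !andbT;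
  by rewrite pmulr_rgt0.
move/esym/eqP; rewrite mule_eq0 => /orP[|/eqP //].
by rewrite gtr0_norm// eqe invr_eq0 gt_eqF.
Qed.

End volume.

(** * Density of Lipschitz functions and continuity in L^1 under affine maps *)

Lemma cvge0_lt (R : realType) T (F : set_system T) {FF : Filter F} (u : T -> \bar R) e :
  u x @[x --> F] --> 0%E -> 0 < e -> \forall x \near F, (u x < e%:E)%E.
Proof.
move=> /fine_cvgP[f1 f2] e0; have f3 : \forall x \near F, fine (u x) < e by exact: (cvgr_lt _ f2).
by apply: filterS2 f1 f3 => k kf kl; rewrite -(fineK kf) lte_fin.
Qed.

Lemma measure_shrink d (T : measurableType d) (R : realType) (mu : {measure set T -> \bar R})
    (Q : set T) (E : nat -> set T) (e : R) :
  measurable Q -> (mu Q < +oo)%E -> (forall k, measurable (E k)) ->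
  (forall k, E k.+1 `<=` E k) -> \bigcap_k E k = set0 -> 0 < e ->
  exists k, (mu (Q `&` E k) <= e%:E)%E.
Proof.
move=> mQ Qfin mE Edec E0 e0.
have nE : nonincreasing_seq (fun k => Q `&` E k).
  by apply/nonincreasing_seqP => k; apply/subsetPset; exact: setIS (Edec k).
have capE : \bigcap_k (Q `&` E k) = set0.
  apply/seteqP; split => // x h; rewrite -E0 => k _.
  by have [] := h k I.
have mQE k : measurable (Q `&` E k) by exact: measurableI.
have := nonincreasing_cvg_mu (mu := mu) _ mQE _ nE.
rewrite capE measure0 => h.
have {}h : (mu (Q `&` E k)) @[k --> \oo] --> 0%E.
  apply: h => //; apply: le_lt_trans Qfin.
  by apply: le_measure; rewrite ?inE// => x [].
have : \forall k \near \oo, (mu (Q `&` E k) < e%:E)%E.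
  exact: cvge0_lt.
move=> [N _ hN]; exists N; apply: ltW; exact: (hN N (leqnn N)).
Qed.

Section density.
Context (R : realType) (n : nat).
Local Notation V := 'rV[R]_n.
Local Notation leb := (lebesgue_rV R n).

Definition elipschitz (f : V -> R) :=
  exists L, 0 <= L /\ forall x y, `|f x - f y| <= L * enorm (x - y).

Lemma elipschitz_measurable f : elipschitz f -> mfunT f.
Proof.
by move=> [L [_ fL]]; apply: continuous_measurable_rV; exact: lipschitz_continuous_rV fL.
Qed.

Lemma elipschitz_cst c : elipschitz (fun=> c).
Proof. by exists 0; split => // x y; rewrite subrr normr0 mul0r. Qed.

Lemma elipschitzD f g : elipschitz f -> elipschitz g -> elipschitz (fun x => f x + g x).
Proof.
move=> [L [L0 fL]] [K [K0 gK]]; exists (L + K); split; first exact: addr_ge0.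
move=> x y; rewrite mulrDl; have := fL x y; have := gK x y.
rewrite (_ : f x + g x - _ = (f x - f y) + (g x - g y)); last by ring.
move=> h1 h2; apply: le_trans (ler_normD _ _) _; lra.
Qed.

Lemma elipschitzZ c f : elipschitz f -> elipschitz (fun x => c * f x).
Proof.
move=> [L [L0 fL]]; exists (`|c| * L); split; first exact: mulr_ge0.
by move=> x y; rewrite -mulrBr normrM -mulrA ler_wpM2l.
Qed.

Lemma elipschitzM f g : (exists M, forall x, `|f x| <= M) -> (exists M, forall x, `|g x| <= M) ->
  elipschitz f -> elipschitz g -> elipschitz (fun x => f x * g x).
Proof.
move=> [M fM] [N gN] [L [L0 fL]] [K [K0 gK]].
have M0 : 0 <= M := le_trans (normr_ge0 _) (fM 0).
have N0 : 0 <= N := le_trans (normr_ge0 _) (gN 0).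
exists (L * N + M * K); split; first by rewrite addr_ge0// mulr_ge0.
move=> x y; rewrite (_ : f x * g x - _ = (f x - f y) * g x + f y * (g x - g y)); last by ring.
apply: le_trans (ler_normD _ _) _; rewrite !normrM mulrDl; apply: lerD.
  by rewrite mulrAC; apply: ler_pM.
by rewrite -mulrA; apply: ler_pM.
Qed.

Lemma elipschitz_sum (I : Type) (s : seq I) (f : I -> V -> R) : (forall i, elipschitz (f i)) ->
  elipschitz (fun x => \sum_(i <- s) f i x).
Proof.
move=> hf; elim: s => [|i s IH].
  by under eq_fun do rewrite big_nil; exact: elipschitz_cst.
by under eq_fun do rewrite big_cons; exact: elipschitzD.
Qed.

Definition clamp (t : R) : R := Num.min 1 (Num.max 0 t).

Lemma clamp_itv t : 0 <= clamp t <= 1.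
Proof. by rewrite /clamp le_min ler01 le_max lexx ge_min lexx. Qed.

Lemma clamp_lipschitz s t : `|clamp s - clamp t| <= `|s - t|.
Proof.
rewrite /clamp; have [s0|s0] := leP 0 s; have [t0|t0] := leP 0 t;
  repeat (case: (ltP 1 _) => ?); rewrite ?subrr ?normr0 ?normr_ge0// ler_norml;
  have := ler_norm (s - t); have := ler_norm (- (s - t)); rewrite normrN; lra.
Qed.

Lemma elipschitz_clamp f : elipschitz f -> elipschitz (fun x => clamp (f x)).
Proof.
by move=> [L [L0 fL]]; exists L; split => // x y; exact: le_trans (clamp_lipschitz _ _) (fL x y).
Qed.

Variables (Q : set V) (mQ : measurable Q) (Qfin : (leb Q < +oo)%E).

(** Sets whose indicator is an L^1(Q) limit of Lipschitz functions with values in [0, 1]. They form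
    a sigma-algebra that contains the coordinate half-spaces, hence all measurable sets. *)
Definition lip_approx (A : set V) := measurable A /\ forall e, 0 < e ->
  exists p, [/\ elipschitz p, forall x, 0 <= p x <= 1 &
    (\int[leb]_x (\1_Q x * `|\1_A x - p x|)%:E <= e%:E)%E].

Lemma lip_approxC A : lip_approx A -> lip_approx (~` A).
Proof.
move=> [mA hA]; split; first exact: measurableC.
move=> e /hA[p [lp p01 pe]]; exists (fun x => 1 + (-1) * p x); split.
- by apply: elipschitzD; [exact: elipschitz_cst|exact: elipschitzZ].
- by move=> x; have := p01 x; lra.
- apply: le_trans pe; apply: le_rint => x; first by pos.
  apply: ler_wpM2l; first by pos.
  have -> : \1_(~` A) x = 1 - \1_A x :> R.
    by rewrite !indicE in_setC; case: (_ \in _); rewrite /= ?subr0 ?subrr.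
  rewrite (_ : 1 - \1_A x - _ = - (\1_A x - p x)) ?normrN//; by ring.
Qed.

Lemma lip_approxU A B : lip_approx A -> lip_approx B -> lip_approx (A `|` B).
Proof.
move=> [mA hA] [mB hB]; split; first exact: measurableU.
move=> e e0; have e2 : 0 < e / 2 by rewrite divr_gt0.
have [p [lp p01 pe]] := hA _ e2; have [q [lq q01 qe]] := hB _ e2.
have mp := elipschitz_measurable lp; have mq := elipschitz_measurable lq.
have bd r : (forall x : V, 0 <= r x <= 1) -> exists M : R, forall x, `|r x| <= M.
  by move=> h; exists 1 => x; have := h x; rewrite ler_norml; lra.
(* This is 1 - (1 - p)(1 - q), the analogue for functions of the indicator of a union. *)
exists (fun x => (p x + q x) + (-1) * (p x * q x)); split.
- apply: elipschitzD; first exact: elipschitzD.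
  by apply: elipschitzZ; apply: elipschitzM => //; exact: bd.
- by move=> x; have := p01 x; have := q01 x; nra.
- apply: (@le_trans _ _ (\int[leb]_x (\1_Q x * `|\1_A x - p x| + \1_Q x * `|\1_B x - q x|)%:E)%E).
    apply: le_rint => x; first by pos.
    rewrite -mulrDr; apply: ler_wpM2l; first by pos.
    have -> : \1_(A `|` B) x = \1_A x + \1_B x - \1_A x * \1_B x :> R.
      by rewrite !indicE in_setU; case: (_ \in A); case: (_ \in B) => /=; ring.
    have := p01 x; have := q01 x; rewrite !indicE; set a := p x; set b := q x.
    case: (_ \in A); case: (_ \in B) => /= ? ?;
    rewrite ler_norml; apply/andP; split;
    have := ler_norm (1 - a); have := ler_norm (- (1 - a)); have := ler_norm (0 - a);
    have := ler_norm (-(0 - a)); have := ler_norm (1 - b); have := ler_norm (- (1 - b));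
    have := ler_norm (0 - b); have := ler_norm (-(0 - b)); rewrite !normrN; nra.
  rewrite rintD.
  + by rewrite (_ : e%:E = (e / 2)%:E + (e / 2)%:E)%E ?leeD// -EFinD -splitr.
  + by mfun.
  + by move=> x; pos.
  + by mfun.
  + by move=> x; pos.
Qed.

Lemma lip_approx0 : lip_approx set0.
Proof.
split => // e e0; exists (fun=> 0); split => //; first exact: elipschitz_cst.
  by move=> x; rewrite lexx ler01.
under eq_integral => x _ do rewrite indic0 subrr normr0 mulr0.
by rewrite integral0 lee_fin ltW.
Qed.

Lemma lip_approx_shrink A B (e : R) : measurable A -> lip_approx B -> B `<=` A -> 0 < e ->
  (leb (Q `&` (A `\` B)) <= e%:E)%E -> exists p, [/\ elipschitz p, forall x, 0 <= p x <= 1 &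
    (\int[leb]_x (\1_Q x * `|\1_A x - p x|)%:E <= (2 * e)%:E)%E].
Proof.
move=> mA [mB hB] BA e0 he; have [p [lp p01 pe]] := hB _ e0.
have mp := elipschitz_measurable lp.
have mAB : measurable (A `\` B) by exact: measurableD.
exists p; split => //.
apply: (@le_trans _ _ (\int[leb]_x (\1_(Q `&` (A `\` B)) x + \1_Q x * `|\1_B x - p x|)%:E)%E).
  apply: le_rint => x; first by pos.
  have -> : \1_(Q `&` (A `\` B)) x = \1_Q x * (\1_A x - \1_B x) :> R.
    rewrite !indicE in_setI in_setD; have : x \in B -> x \in A by rewrite !inE; exact: BA.
    by case: (x \in A); case: (x \in B); case: (x \in Q) => //= h; rewrite ?mul0r ?mul1r ?subr0 ?subrr//; have := h isT.
  rewrite -mulrDr; apply: ler_wpM2l; first by pos.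
  have AB : \1_B x <= \1_A x :> R.
    rewrite !indicE ler_nat; have : x \in B -> x \in A by rewrite !inE; exact: BA.
    by case: (x \in B); case: (x \in A) => //= h; have := h isT.
  rewrite (_ : \1_A x - p x = (\1_A x - \1_B x) + (\1_B x - p x)); last by ring.
  by apply: le_trans (ler_normD _ _) _; rewrite lerD2r ger0_norm// subr_ge0.
have mQAB : measurable (Q `&` (A `\` B)) by exact: measurableI.
rewrite rintD; [|by mfun|by move=> x; pos|by mfun|by move=> x; pos].
rewrite rint_indic// mulrDl mul1r EFinD; exact: leeD.
Qed.

Lemma lip_approx_bigcup (A : nat -> set V) :
  (forall k, lip_approx (A k)) -> lip_approx (\bigcup_k A k).
Proof.
move=> hA; have mA : measurable (\bigcup_k A k).
  by apply: bigcupT_measurable => k; have [] := hA k.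
split => // e e0.
pose B k := \big[setU/set0]_(i < k) A i.
have hB k : lip_approx (B k).
  rewrite /B; elim: k => [|k IH]; first by rewrite big_ord0; exact: lip_approx0.
  by rewrite big_ord_recr/=; exact: lip_approxU.
have BA k : B k `<=` \bigcup_k A k by rewrite /B -bigcup_mkord => x [i _ Ai]; exists i.
have [k hk] : exists k, (leb (Q `&` (\bigcup_k A k `\` B k)) <= (e / 2)%:E)%E.
  apply: measure_shrink => //.
  - by move=> k; apply: measurableD => //; have [] := hB k.
  - by move=> k x [Ax nB]; split => // Bk; apply: nB; rewrite /B big_ord_recr/=; left.
  - apply/seteqP; split => // x h; have [[k _ Ak] _] := h 0%N I.
    by have [_ +] := h k.+1 I; apply; rewrite /B big_ord_recr/=; right.
  - by rewrite divr_gt0.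
have e2 : 0 < e / 2 by rewrite divr_gt0.
have [p [h1 h2 h3]] := lip_approx_shrink mA (hB k) (BA k) e2 hk.
by exists p; split => //; apply: le_trans h3 _; rewrite mulrC divfK.
Qed.

Lemma lip_approx_ray (i : 'I_n) a : lip_approx [set v : V | a < v ord0 i].
Proof.
have mS (S : set R) : measurable S -> measurable [set v : V | S (v ord0 i)].
  by move=> mS; have := @measurable_rV_coord R n i measurableT _ mS; rewrite setTI.
have mA : measurable [set v : V | a < v ord0 i].
  by have := mS _ (measurable_itv `]a, +oo[); congr measurable; apply/seteqP;
     split => v /=; rewrite in_itv/= andbT.
split => // e e0.
(* The strip on which a ramp of slope k + 1 differs from the indicator of the half-space. The strips
   decrease to the empty set. *)
pose E k := [set v : V | `]a, (a + k.+1%:R^-1)[%classic (v ord0 i)].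
have [k hk] : exists k, (leb (Q `&` E k) <= e%:E)%E.
  apply: measure_shrink => //.
  - by move=> k; exact: mS.
  - move=> k v; rewrite /E/= !in_itv/= => /andP[-> h] /=; apply: lt_le_trans h _.
    by rewrite lerD2l lef_pV2 ?posrE// ler_nat.
  - apply/seteqP; split => // v h.
    have := h 0%N I; rewrite /E/= in_itv/= => /andP[av _].
    have [m hm] := ltr_add_invr av.
    have := h m I; rewrite /E/= in_itv/= av/= => h'.
    by have := lt_trans h' hm; rewrite ltxx.
exists (fun v => clamp (k.+1%:R * (v ord0 i + (- a)))); split.
- apply: elipschitz_clamp; apply: elipschitzZ; apply: elipschitzD; last exact: elipschitz_cst.
  exists 1; split => // x y; rewrite mul1r; have := ler_coord_enorm (x - y) i.
  by rewrite !mxE.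
- by move=> x; exact: clamp_itv.
- apply: (@le_trans _ _ (\int[leb]_x (\1_(Q `&` E k) x)%:E)%E); last first.
    by rewrite rint_indic//; apply: measurableI => //; exact: mS.
  apply: le_rint => x; first by pos.
  rewrite !indicE in_setI; case: (x \in Q); last by rewrite mul0r.
  rewrite mul1r /=.
  have -> : (x \in [set v : V | a < v ord0 i]) = (a < x ord0 i).
    by apply/idP/idP => [/set_mem|h]; last exact/mem_set.
  have -> : (x \in E k) = (a < x ord0 i < a + k.+1%:R^-1).
    by apply/idP/idP => [/set_mem|h]; [|apply/mem_set]; rewrite /E/= in_itv.
  set t := _ * _; have := clamp_itv t; have [ax|ax] := ltP a (x ord0 i) => /=; last first.
    suff -> : clamp t = 0 by rewrite subrr normr0.
    rewrite /clamp; have t0 : t <= 0 by rewrite /t pmulr_rle0//; lra.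
    by rewrite (max_idPl t0) (min_idPr ler01).
  case: (ltP (x ord0 i) _) => h; first by rewrite ler_norml /=; lra.
  suff -> : clamp t = 1 by rewrite subrr normr0.
  have t1 : 1 <= t.
    by rewrite /t mulrC -ler_pdivrMr// mul1r lerBrDl.
  by rewrite /clamp (max_idPr (le_trans ler01 t1)) (min_idPl t1).
Qed.

Lemma measurable_lip_approx A : measurable A -> lip_approx A.
Proof.
move: A; apply: smallest_sub.
  split; first exact: lip_approx0.
    by move=> A hA; rewrite setTD; exact: lip_approxC.
  exact: lip_approx_bigcup.
rewrite -bigcup_seq; apply: bigcup_sub => i _ B [C mC <-]; rewrite setTI.
pose G (C : set R) := lip_approx ((@rV_coord R n i) @^-1` C).
suff : (measurable : set (set (measurableTypeR R))) `<=` G by apply.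
rewrite [X in X `<=` _](RGenOInfty.measurableE R); apply: smallest_sub.
  split; rewrite /G.
  - by rewrite preimage_set0; exact: lip_approx0.
  - by move=> D hD; rewrite setTD preimage_setC; exact: lip_approxC.
  - by move=> D hD; rewrite preimage_bigcup; exact: lip_approx_bigcup.
move=> _ [a ->]; rewrite /G (_ : _ @^-1` _ = [set v : V | a < v ord0 i]).
  exact: lip_approx_ray.
by apply/seteqP; split => v /=; rewrite in_itv/= andbT.
Qed.

End density.

(** The sum is the smaller of N and the integer part of y. It serves to replace a function by a
    combination of indicators of its superlevel sets, with error at most one step. *)
Lemma staircase (R : realType) (N : nat) (y : R) : 0 <= y ->
  \sum_(j < N) ((j.+1%:R <= y)%R)%:R <= y /\
  (y <= N%:R -> y <= \sum_(j < N) ((j.+1%:R <= y)%R)%:R + 1).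
Proof.
elim: N y => [|N IH] y y0.
  by rewrite big_ord0 add0r; split => // yN; apply: le_trans yN _.
rewrite big_ord_recl /=; have [y1|y1] := leP 1 y.
  have y10 : 0 <= y - 1 by rewrite subr_ge0.
  have [h1 h2] := IH _ y10.
  have -> : \sum_(i < N) (((bump 0 i).+1%:R <= y)%R)%:R = \sum_(j < N) ((j.+1%:R <= y - 1)%R)%:R :> R.
    by apply: eq_bigr => j _; rewrite lerBrDr natr1.
  have -> : (true : nat)%:R = 1 :> R by [].
  move: h1 h2; set S := \sum_(j < N) _ => h1 h2; split; first by lra.
  rewrite -natr1 => yN; have : y - 1 <= N%:R by lra.
  by move/h2; lra.
rewrite big1 => [|j _]; last first.
  rewrite (_ : _ <= y = false)//; apply/negbTE; rewrite -ltNge; apply: lt_le_trans y1 _.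
  by rewrite ler1n.
by rewrite !add0r; split => // _; exact: ltW.
Qed.

Section dense_continuity.
Context (R : realType) (n : nat).
Local Notation V := 'rV[R]_n.
Local Notation leb := (lebesgue_rV R n).

Lemma rint_box (c : V) (r : R) : 0 <= r ->
  (\int[leb]_x (\1_(rV_box c r) x : R)%:E = ((2 * r) ^+ n)%:E)%E.
Proof.
move=> r0; rewrite rint_indic; first exact: lebesgue_rV_box.
exact: measurable_rV_box.
Qed.

(** After rescaling to values in [0, 1], w is up to 1/N the mean of the indicators of N superlevel
    sets. Each indicator is replaced by a Lipschitz function between 0 and 1, and scaling back
    preserves the bound M. *)
Lemma lip_dense (Q : set V) (w : V -> R) (M e : R) : measurable Q -> (leb Q < +oo)%E ->
  mfunT w -> 0 < M -> (forall x, `|w x| <= M) -> 0 < e ->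
  exists p, [/\ elipschitz p, forall x, `|p x| <= M &
    (\int[leb]_x (\1_Q x * `|w x - p x|)%:E <= e%:E)%E].
Proof.
move=> mQ Qfin mw M0 wM e0.
pose q := fine (leb Q).
have qE : leb Q = q%:E by rewrite fineK// ge0_fin_numE.
have q0 : 0 <= q by rewrite -lee_fin -qE.
(* The staircase error is 2 M / N on a set of measure q, so this N makes it at most e/2. The other
   half of e pays for the N Lipschitz approximations, each within e / (4 M). *)
have [m hm] : exists m : nat, 4 * M * q / e < m.+1%:R.
  exists (Num.bound (4 * M * q / e)); apply: lt_trans (archi_boundP _) _; last by rewrite ltr_nat.
  by pos.
set N := m.+1 in hm; have N0 : 0 < N%:R :> R by [].
pose v x := (w x + M) / (2 * M).
have v01 x : 0 <= v x <= 1.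
  have := wM x; rewrite ler_norml => /andP[h1 h2].
  by rewrite /v divr_ge0 ?ler_pdivrMr ?mulr_gt0//=; lra.
pose A (j : nat) : set V := [set x | j.+1%:R <= N%:R * v x].
have mA j : measurable (A j).
  have mv : mfunT (fun x => N%:R * v x) by rewrite /v; mfun.
  have := mv measurableT _ (measurable_itv `[j.+1%:R, +oo[).
  by rewrite setTI; congr measurable; apply/seteqP; split => y /=; rewrite in_itv/= andbT.
have e1 : 0 < e / (4 * M) by rewrite divr_gt0// mulr_gt0.
have /choice[p hp] (j : nat) : exists p, [/\ elipschitz p, forall x, 0 <= p x <= 1 &
    (\int[leb]_x (\1_Q x * `|\1_(A j) x - p x|)%:E <= (e / (4 * M))%:E)%E].
  exact: (measurable_lip_approx mQ Qfin (mA j)).2.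
have mp j : mfunT (p j) by apply: elipschitz_measurable; have [] := hp j.
pose P x := N%:R^-1 * \sum_(j < N) p j x.
have P01 x : 0 <= P x <= 1.
  have S0 : 0 <= \sum_(j < N) p j x by apply: sumr_ge0 => j _; have [_ + _] := hp j => /(_ x)/andP[].
  have S1 : \sum_(j < N) p j x <= N%:R.
    apply: (@le_trans _ _ (\sum_(j < N) 1)); last by rewrite sumr_const card_ord.
    by apply: ler_sum => j _; have [_ + _] := hp j => /(_ x)/andP[].
  by rewrite /P mulr_ge0 ?invr_ge0//= mulrC ler_pdivrMr// mul1r.
exists (fun x => - M + 2 * M * P x); split.
- apply: elipschitzD; first exact: elipschitz_cst.
  apply: elipschitzZ; apply: elipschitzZ; apply: elipschitz_sum => j.
  by have [] := hp j.
- by move=> x; have := P01 x; rewrite ler_norml; nra.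
have key x : `|w x - (- M + 2 * M * P x)| <=
    2 * M * N%:R^-1 * (1 + \sum_(j < N) `|\1_(A j) x - p j x|).
  have -> : w x - (- M + 2 * M * P x) = 2 * M * N%:R^-1 * (N%:R * v x - \sum_(j < N) p j x).
    by rewrite /P /v; field; rewrite gt_eqF//= gt_eqF.
  rewrite normrM ger0_norm; last by pos.
  apply: ler_wpM2l; first by pos.
  have Nv0 : 0 <= N%:R * v x by rewrite mulr_ge0//; have := v01 x; lra.
  have [h1 h2] := staircase N Nv0.
  have {}h2 : N%:R * v x <= \sum_(j < N) ((j.+1%:R <= N%:R * v x)%R)%:R + 1.
    by apply: h2; rewrite ler_piMr//; have := v01 x; lra.
  have E : \sum_(j < N) ((j.+1%:R <= N%:R * v x)%R)%:R = \sum_(j < N) \1_(A j) x :> R.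
    apply: eq_bigr => j _; rewrite indicE; congr (_%:R); congr nat_of_bool.
    by apply/idP/idP => [h|/set_mem//]; exact/mem_set.
  rewrite E in h1 h2.
  rewrite (_ : _ - _ = (N%:R * v x - \sum_(j < N) \1_(A j) x) +
     \sum_(j < N) (\1_(A j) x - p j x)); last by rewrite sumrB; ring.
  apply: le_trans (ler_normD _ _) _; apply: lerD; last exact: ler_norm_sum.
  by rewrite ger0_norm; lra.
apply: (@le_trans _ _ (\int[leb]_x ((2 * M * N%:R^-1) *
   (\1_Q x + \sum_(j < N) (\1_Q x * `|\1_(A j) x - p j x|)))%:E)%E).
  apply: le_rint => x; first by pos.
  rewrite -mulr_sumr -[X in _ * (X + _)]mulr1 -mulrDr [leRHS]mulrCA.
  by apply: ler_wpM2l; [pos|exact: key].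
have mj (j : 'I_N) : mfunT (fun x => \1_Q x * `|\1_(A j) x - p j x|).
  by have := mA j; have := mp j => ? ?; mfun.
have Sj0 x : 0 <= \sum_(j < N) (\1_Q x * `|\1_(A j) x - p j x|) by apply: sumr_ge0 => j _; pos.
have mS : mfunT (fun x => \sum_(j < N) (\1_Q x * `|\1_(A j) x - p j x|)).
  exact: measurable_sum.
have c0 : 0 <= 2 * M * N%:R^-1 by pos.
rewrite rintZl; [|sidec..|by move=> x; have := Sj0 x; move=> ?; pos].
rewrite rintD; [|sidec..].
rewrite rint_indic// rint_sum; [|sidec..].
apply: (@le_trans _ _ ((2 * M * N%:R^-1)%:E * (q%:E + \sum_(j < N) (e / (4 * M))%:E))%E).
  apply: lee_wpmul2l => //; apply: leeD; first by rewrite -qE.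
  by apply: lee_sum => j _; have [] := hp j.
rewrite sumEFin -EFinD -EFinM lee_fin sumr_const card_ord.
have -> : e / (4 * M) *+ N = e / (4 * M) * N%:R by rewrite mulr_natr.
have -> : 2 * M / N%:R * (q + e / (4 * M) * N%:R) = (2 * M * q) / N%:R + e / 2.
  by field; rewrite gt_eqF//= gt_eqF.
have : (2 * M * q) / N%:R <= e / 2.
  rewrite ler_pdivrMr//; move: hm; rewrite ltr_pdivrMr// => hm.
  lra.
lra.
Qed.

(** Approximation by a Lipschitz function, for which the claim is a direct estimate on a box.
    Dilations are included since kernels will be compared at different scales. *)
Lemma affine_continuity (w : V -> R) (M r e : R) : mfunT w ->
  (forall x, `|w x| <= M) -> (forall x, ~ rV_box 0 r x -> w x = 0) -> 0 <= r -> 0 < e ->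
  exists2 dl : R, 0 < dl & forall (l : R) (h : V), `|l - 1| <= dl -> (forall i, `|h ord0 i| <= dl) ->
    (\int[leb]_x (`|w (l *: x + h) - w x|)%:E <= e%:E)%E.
Proof.
move=> mw wM wr r0 e0.
pose M' := `|M| + 1; have M'0 : 0 < M' by rewrite /M' ltr_wpDl.
have wM' x : `|w x| <= M'.
  by apply: le_trans (wM x) _; rewrite /M'; have := ler_norm M; lra.
pose Q1 : set V := rV_box 0 (2 * (r + 1)); pose Q2 : set V := rV_box 0 (4 * (r + 1)).
have mQ1 : measurable Q1 by exact: measurable_rV_box.
have mQ2 : measurable Q2 by exact: measurable_rV_box.
have Q2fin : (leb Q2 < +oo)%E by rewrite lebesgue_rV_box ?ltry// mulr_ge0// addr_ge0.
(* The error of the Lipschitz approximation occurs twice: at l x + h, where the Jacobian is at most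
   2^n because l >= 1/2, and at x. *)
pose c := 2 ^+ n + 1 : R; have c0 : 0 < c by rewrite /c ltr_wpDl// exprn_ge0.
have e1 : 0 < e / 2 / c by rewrite !divr_gt0.
have [p [[L [L0 pL]] pM pe]] := lip_dense mQ2 Q2fin mw M'0 wM' e1.
have mp : mfunT p by apply: elipschitz_measurable; exists L.
pose K := L * (n%:R * (2 * (r + 1)) + n%:R) * (2 * (2 * (r + 1))) ^+ n.
have K0 : 0 <= K.
  by rewrite /K !mulr_ge0// ?addr_ge0// ?mulr_ge0// ?addr_ge0// exprn_ge0// !mulr_ge0// addr_ge0.
pose dl := Num.min (2^-1) (e / 2 / (K + 1)).
have K1 : 0 < K + 1 by rewrite ltr_wpDl.
have dl0 : 0 < dl by rewrite /dl lt_min invr_gt0 ltr0n/= !divr_gt0.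
exists dl => // l h ll hh.
have dl2 : dl <= 2^-1 by rewrite /dl ge_min lexx.
have dlK : dl * K <= e / 2.
  apply: (@le_trans _ _ (e / 2 / (K + 1) * K)).
    by apply: ler_wpM2r => //; rewrite /dl ge_min lexx orbT.
  rewrite -[leLHS]mulrA ler_piMr// ?divr_ge0// ?ltW//.
  by rewrite mulrC ltr_pdivrMr// mul1r ltrDl.
have l2 : 2^-1 <= l <= 3 / 2 by move: ll; rewrite ler_norml; lra.
have lp : 0 < l by lra.
have nQ1 x : ~ Q1 x -> w (l *: x + h) - w x = 0.
  move=> nx.
  have [i hi] : exists i, 2 * (r + 1) < `|x ord0 i|.
    apply: contrapT => hx; apply: nx => i; rewrite mxE subr0 leNgt; apply/negP => h1.
    by apply: hx; exists i.
  rewrite !wr ?subrr// => hx; have := hx i; rewrite !mxE subr0; first by lra.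
  have := hh i; have h1 : l * `|x ord0 i| <= `|l * x ord0 i + h ord0 i| + `|h ord0 i|.
    rewrite -{1}(gtr0_norm lp) -normrM -{1}(addrK (h ord0 i) (l * x ord0 i)).
    exact: ler_normB.
  have : 0 <= (l - 2^-1) * `|x ord0 i| by rewrite mulr_ge0//; lra.
  by rewrite mulrBl; lra.
have Q12 x : Q1 x -> Q2 (l *: x + h).
  move=> hx i; have := hx i; rewrite !mxE !subr0 => h1.
  apply: le_trans (ler_normD _ _) _; rewrite normrM gtr0_norm//.
  have := hh i; have : l * `|x ord0 i| <= 3 / 2 * (2 * (r + 1)) by apply: ler_pM => //; lra.
  by lra.
have Q1Q2 x : Q1 x -> Q2 x.
  by move=> hx i; apply: le_trans (hx i) _; lra.
pose T1 x := \1_Q2 x * `|w x - p x|.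
have mT1 : mfunT T1 by rewrite /T1; mfun.
have T10 x : 0 <= T1 x by rewrite /T1; pos.
apply: (@le_trans _ _ (\int[leb]_x (T1 (l *: x + h) + (T1 x +
   L * (dl * (n%:R * (2 * (r + 1)) + n%:R)) * \1_Q1 x))%:E)%E).
  apply: le_rint => x; first by pos.
  have [x1|x1] := pselect (Q1 x); last first.
    rewrite nQ1// normr0 addr_ge0// addr_ge0// mulr_ge0 ?indic_ge0// mulr_ge0//.
    by pos.
  rewrite /T1 !indicE !mem_set ?mul1r ?mulr1//; last 2 first.
  - exact: Q1Q2.
  - exact: Q12.
  rewrite (_ : w (l *: x + h) - w x = (w (l *: x + h) - p (l *: x + h)) +
    ((p (l *: x + h) - p x) + - (w x - p x))); last by ring.
  apply: le_trans (ler_normD _ _) _; rewrite lerD2l.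
  apply: le_trans (ler_normD _ _) _; rewrite normrN addrC lerD2l.
  apply: le_trans (pL _ _) _; apply: ler_wpM2l => //.
  rewrite (_ : l *: x + h - x = (l - 1) *: x + h); last first.
    by rewrite scalerBl scale1r addrAC.
  apply: le_trans (ler_enormD _ _) _; rewrite enormZ mulrDr; apply: lerD.
    apply: ler_pM; rewrite ?enorm_ge0//; apply: ler_enorm_box => i; have := x1 i; by rewrite mxE subr0.
  by apply: le_trans (ler_enorm_box hh) _; rewrite mulrC.
have mT1' : mfunT (fun x : V => T1 (l *: x + h)) by mfun.
have k0 : 0 <= L * (dl * (n%:R * (2 * (r + 1)) + n%:R)).
  by pos.
rewrite rintD; [|sidec..].
rewrite rintD; [|sidec..].
rewrite rintZl; [|sidec..].
rewrite rint_box ?mulr_ge0 ?addr_ge0//.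
rewrite rint_dilate ?gt_eqF// gtr0_norm//.
apply: (@le_trans _ _ ((2 ^+ n)%:E * (e / 2 / c)%:E + ((e / 2 / c)%:E + (e / 2)%:E))%E).
  apply: leeD; last (apply: leeD => //).
    apply: lee_pmul => //; [by rewrite lee_fin invr_ge0 exprn_ge0// ltW|exact: rint_ge0|].
    rewrite lee_fin -exprVn; apply: lerXn2r; rewrite ?nnegrE ?invr_ge0 ?(ltW lp)//.
    by rewrite -[leRHS]invrK lef_pV2 ?posrE ?invr_gt0//; lra.
  rewrite -EFinM lee_fin; apply: le_trans dlK.
  by rewrite /K le_eqVlt; apply/orP; left; apply/eqP; ring.
rewrite -EFinM -!EFinD lee_fin le_eqVlt; apply/orP; left; apply/eqP.
by rewrite addrA -[X in _ + X + _]mul1r -mulrDl mulrC divfK ?gt_eqF// -splitr.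
Qed.

End dense_continuity.

(** * Square integrable vector fields *)

Section L2space.
Context (R : realType) (n : nat).
Local Notation V := 'rV[R]_n.
Local Notation leb := (lebesgue_rV R n).
Implicit Types (u v w : V -> V).

Definition sqL2 w : V -> \bar R := fun x => (dot (w x) (w x))%:E.

Definition L2f w := mfunT w /\ (\int[leb]_x sqL2 w x < +oo)%E.

Definition ip v w : R := \int[leb]_x dot (v x) (w x).

Definition nrm w : R := Num.sqrt (ip w w).

Lemma L2f_measurable w : L2f w -> mfunT w.
Proof. by case. Qed.

Lemma sqL2_ge0 w x : (0 <= sqL2 w x)%E.
Proof. by rewrite lee_fin dot_ge0. Qed.

Lemma integrable_sqL2 w : L2f w -> leb.-integrable setT (sqL2 w).
Proof.
move=> [mw wfin]; apply/integrableP; split; first by apply/measurable_EFinP; mfun.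
by under eq_integral => x _ do rewrite gee0_abs ?sqL2_ge0//.
Qed.

Lemma ler_dot_half (x y : V) : `|dot x y| <= 2^-1 * (dot x x + dot y y).
Proof.
have h1 := dot_ge0 (x - y); have h2 := dot_ge0 (x + y).
move: h1 h2; rewrite !(dotBl, dotBr, dotDl, dotDr) (dotC y x) ler_norml => h1 h2.
by apply/andP; split; lra.
Qed.

Lemma integrable_dot v w : L2f v -> L2f w ->
  leb.-integrable setT (fun x => (dot (v x) (w x))%:E).
Proof.
move=> hv hw; have [mv _] := hv; have [mw _] := hw.
apply: (@le_integrable _ _ _ leb setT _ _ (fun x => (2^-1%:E * (sqL2 v x + sqL2 w x))%E)) => //.
- by apply/measurable_EFinP; mfun.
- move=> x _; rewrite /sqL2 -EFinD -EFinM !abse_EFin lee_fin.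
  apply: le_trans (ler_dot_half _ _) _; exact: ler_norm.
- by apply: integrableZl => //; apply: integrableD => //; exact: integrable_sqL2.
Qed.

Lemma L2f0 : L2f 0.
Proof.
split; first exact: measurable_cst.
by under eq_integral do rewrite /sqL2 dot0l; rewrite integral0.
Qed.

Lemma L2fZ (a : R) w : L2f w -> L2f (a *: w).
Proof.
move=> [mw wfin]; split; first by apply: measurable_rVZ => //; exact: measurable_cst.
rewrite (eq_integral (fun x => (a ^+ 2 * dot (w x) (w x))%:E)); last first.
  by move=> x _; rewrite /sqL2 /= dotZl dotZr mulrA expr2.
rewrite rintZl; [|sidec..].
by rewrite lte_mul_pinfty// lee_fin sqr_ge0.
Qed.

Lemma L2fD v w : L2f v -> L2f w -> L2f (v + w).
Proof.
move=> hv hw; have [mv vf] := hv; have [mw wf] := hw; split.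
  by apply: measurable_rVD.
apply: (@le_lt_trans _ _ (\int[leb]_x (2 * dot (v x) (v x) + 2 * dot (w x) (w x))%:E)%E).
  apply: ge0_le_integralT => x; first exact: sqL2_ge0.
  rewrite lee_fin /= dotDl !dotDr (dotC (w x)).
  have := dot_ge0 (v x - w x); rewrite !(dotBl, dotBr) (dotC (w x) (v x)); lra.
rewrite rintD; [|sidec..]; rewrite rintZl; [|sidec..]; rewrite rintZl; [|sidec..].
by apply: lte_add_pinfty; apply: lte_mul_pinfty.
Qed.

Lemma L2fN w : L2f w -> L2f (- w).
Proof. by move=> hw; rewrite -scaleN1r; exact: L2fZ. Qed.

Lemma L2fB v w : L2f v -> L2f w -> L2f (v - w).
Proof. by move=> hv hw; apply: L2fD => //; exact: L2fN. Qed.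

Lemma ipC v w : ip v w = ip w v.
Proof. by apply: eq_Rintegral => x _; exact: dotC. Qed.

Lemma ipDl u v w : L2f u -> L2f v -> L2f w -> ip (u + v) w = ip u w + ip v w.
Proof.
move=> hu hv hw; rewrite /ip -RintegralD//; [|exact: integrable_dot..].
by apply: eq_Rintegral => x _; rewrite dotDl.
Qed.

Lemma ipZl (a : R) v w : L2f v -> L2f w -> ip (a *: v) w = a * ip v w.
Proof.
move=> hv hw; rewrite /ip -RintegralZl//; last exact: integrable_dot.
by apply: eq_Rintegral => x _; rewrite dotZl.
Qed.

Lemma ipDr u v w : L2f u -> L2f v -> L2f w -> ip w (u + v) = ip w u + ip w v.
Proof. by move=> hu hv hw; rewrite ipC ipDl// !(ipC w). Qed.

Lemma ipZr (a : R) v w : L2f v -> L2f w -> ip w (a *: v) = a * ip w v.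
Proof. by move=> hv hw; rewrite ipC ipZl// (ipC w). Qed.

Lemma ipNl v w : L2f v -> L2f w -> ip (- v) w = - ip v w.
Proof. by move=> hv hw; rewrite -scaleN1r ipZl// mulN1r. Qed.

Lemma ipBl u v w : L2f u -> L2f v -> L2f w -> ip (u - v) w = ip u w - ip v w.
Proof. by move=> hu hv hw; rewrite ipDl ?ipNl//; exact: L2fN. Qed.

Lemma ipBr u v w : L2f u -> L2f v -> L2f w -> ip w (u - v) = ip w u - ip w v.
Proof. by move=> hu hv hw; rewrite ipC ipBl// !(ipC w). Qed.

Lemma ip_ge0 w : 0 <= ip w w.
Proof. by apply: Rintegral_ge0 => x _; exact: dot_ge0. Qed.

Lemma nrm_ge0 w : 0 <= nrm w.
Proof. exact: sqrtr_ge0. Qed.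
Hint Resolve nrm_ge0 : core.

Lemma sqr_nrm w : nrm w ^+ 2 = ip w w.
Proof. by rewrite sqr_sqrtr// ip_ge0. Qed.

Lemma ipE v w : L2f v -> L2f w -> (\int[leb]_x (dot (v x) (w x))%:E = (ip v w)%:E)%E.
Proof.
move=> hv hw; rewrite /ip /Rintegral fineK//.
exact: integrable_fin_num (integrable_dot hv hw).
Qed.

Lemma nrmE w : L2f w -> (\int[leb]_x sqL2 w x = (nrm w ^+ 2)%:E)%E.
Proof. by move=> hw; rewrite sqr_nrm -ipE. Qed.

Lemma nrm_le w (c : R) : 0 <= c -> mfunT w ->
  (\int[leb]_x sqL2 w x <= (c ^+ 2)%:E)%E -> L2f w /\ nrm w <= c.
Proof.
move=> c0 mw h; have hw : L2f w by split=> //; apply: le_lt_trans h _; rewrite ltry.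
split => //; move: h; rewrite nrmE// lee_fin => h.
by rewrite -(@ler_pXn2r _ 2)// ?nnegrE.
Qed.

Lemma CauchySchwarz v w : L2f v -> L2f w -> `|ip v w| <= nrm v * nrm w.
Proof.
move=> hv hw.
rewrite -(@ler_pXn2r _ 2)// ?nnegrE ?mulr_ge0// exprMn !sqr_nrm real_normK ?num_real//.
set a := ip v v; set b := ip w w; set c := ip v w.
have key (s t : R) : 0 <= s ^+ 2 * a + (s * t * c) *+ 2 + t ^+ 2 * b.
  have := ip_ge0 (s *: v + t *: w).
  have h1 := L2fZ s hv; have h2 := L2fZ t hw; have h3 := L2fD h1 h2.
  rewrite ipDl// !ipDr// !ipZl// !ipZr// (ipC w v) -/a -/b -/c mulr2n.
  by rewrite !mulrA -!expr2 (mulrC t s) !addrA.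
have a0 : 0 <= a := ip_ge0 v; have b0 : 0 <= b := ip_ge0 w.
have [b1|b1] := eqVneq b 0.
  have := key 1 (- c); have := key 1 c; have := key (- (a + 1)) c.
  rewrite b1 !mulr0 !addr0 !mulr2n.
  have [->|c0] := eqVneq c 0; first by rewrite expr0n.
  have c2 : 0 < c ^+ 2 by rewrite lt_neqAle sqr_ge0 andbT eq_sym expf_eq0.
  (* For b = 0 the quadratic form is affine in its second argument, and this argument gives it the
     value -1. *)
  have := key 1 (- (a + 1) / (c *+ 2)); rewrite b1 mulr0 addr0 expr1n !mul1r.
  rewrite -mulrnAr divfK ?mulrn_eq0//; lra.
have b2 : 0 < b by rewrite lt_neqAle eq_sym b1.
have := key b (- c); have -> : b ^+ 2 * a + b * - c * c *+ 2 + (- c) ^+ 2 * b = b * (a * b - c ^+ 2).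
  by rewrite mulr2n; ring.
by rewrite pmulr_rge0// subr_ge0.
Qed.

Lemma ler_nrmD v w : L2f v -> L2f w -> nrm (v + w) <= nrm v + nrm w.
Proof.
move=> hv hw; rewrite -(@ler_pXn2r _ 2)// ?nnegrE ?addr_ge0//.
rewrite sqr_nrm sqrrD !sqr_nrm ipDl ?ipDr//; last exact: L2fD.
have := CauchySchwarz hv hw; have := ler_norm (ip v w); rewrite (ipC w v) mulr2n; lra.
Qed.

Lemma nrmZ (a : R) w : L2f w -> nrm (a *: w) = `|a| * nrm w.
Proof.
move=> hw; rewrite /nrm ipZl ?ipZr//; last exact: L2fZ.
by rewrite mulrA -expr2 sqrtrM ?sqr_ge0// sqrtr_sqr.
Qed.

Lemma nrmN w : nrm (- w) = nrm w.
Proof.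
congr Num.sqrt; apply: eq_Rintegral => x _.
by rewrite /= dotNl dotNr opprK.
Qed.

Lemma nrmBC v w : nrm (v - w) = nrm (w - v).
Proof. by rewrite -nrmN opprB. Qed.

Lemma ler_nrmB v w : L2f v -> L2f w -> nrm (v - w) <= nrm v + nrm w.
Proof. by move=> hv hw; rewrite -(nrmN w); apply: ler_nrmD => //; exact: L2fN. Qed.

Lemma nrm0 : nrm 0 = 0.
Proof. by rewrite -(scale0r 0) nrmZ ?normr0 ?mul0r//; exact: L2f0. Qed.

Lemma ler_nrm_dist v w : L2f v -> L2f w -> `|nrm v - nrm w| <= nrm (v - w).
Proof.
move=> hv hw; have := ler_nrmD (L2fB hv hw) hw; have := ler_nrmD (L2fB hw hv) hv.
by rewrite !subrK (nrmBC w v) ler_norml; lra.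
Qed.

Lemma ip_ae v v' w : mfunT v -> mfunT v' -> mfunT w ->
  {ae leb, forall x, v x = v' x} -> ip v w = ip v' w.
Proof.
move=> mv mv' mw h; congr fine; apply: ae_eq_integral => //.
- by mfun.
- by mfun.
- by apply: filterS h => x -> _.
Qed.

Lemma nrm_ae v w : mfunT v -> mfunT w ->
  {ae leb, forall x, v x = w x} -> nrm v = nrm w.
Proof.
move=> mv mw h; congr Num.sqrt; rewrite (ip_ae mv mw mv h) ipC; exact: ip_ae.
Qed.

Lemma L2f_ae v w : mfunT w -> L2f v -> {ae leb, forall x, v x = w x} -> L2f w.
Proof.
move=> mw [mv vf] h; split => //; rewrite (_ : \int[leb]_x _ = \int[leb]_x sqL2 v x)%E//.
apply/esym; apply: rint_ae_eq; [sidec..|].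
by apply: filterS h => x ->.
Qed.

Lemma nrm_eq0 w : L2f w -> nrm w = 0 -> {ae leb, forall x, w x = 0}.
Proof.
move=> hw h; have [mw _] := hw.
have : ae_eq leb setT (sqL2 w) (cst 0%E).
  apply/ae_eq_integral_abs => //; first by apply/measurable_EFinP; mfun.
  under eq_integral => x _ do rewrite gee0_abs ?sqL2_ge0//.
  by rewrite nrmE// h expr0n.
apply: filterS => x /(_ I) [] hx; apply/eqP; rewrite -enorm_eq0 -sqrf_eq0 sqr_enorm.
exact/eqP.
Qed.

(** The link between the extended real norm over D used in the statement and the real norm over the
    whole space used in the estimates. Vanishing outside D makes the two integrals equal. *)
Lemma L2norm_nrm (D : set V) w : measurable D -> mfunT w ->
  {ae leb, forall x, ~ D x -> w x = 0} ->
  (L2norm D w < +oo)%E = (\int[leb]_x sqL2 w x < +oo)%E /\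
  (L2f w -> L2norm D w = (nrm w)%:E).
Proof.
move=> mD mw h.
have E : (\int[leb]_x (`|((fun x => (enorm (w x))%:E) \_ D) x| `^ 2)%E = \int[leb]_x sqL2 w x)%E.
  transitivity (\int[leb]_x (\1_D x * dot (w x) (w x))%:E)%E.
    apply: eq_integral => x _; rewrite patchE indicE; case: ifPn => _.
      rewrite mul1r abse_EFin poweR_EFin ger0_norm ?enorm_ge0// powR_mulrn ?enorm_ge0//.
      by rewrite sqr_enorm.
    by rewrite mul0r abse0 poweR0r.
  apply: rint_ae_eq; [sidec..|].
  apply: filterS h => x hx; rewrite indicE; case: (boolP (x \in D)) => [_|xD].
    by rewrite mul1r.
  by rewrite hx ?dot0l ?mulr0// => Dx; move/negP: xD; apply; exact/mem_set.
have N0 : (0 <= \int[leb]_x sqL2 w x)%E by apply: integral_ge0 => x _; exact: sqL2_ge0.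
have LE : (L2norm D w = (\int[leb]_x sqL2 w x) `^ 2^-1)%E.
  by rewrite /L2norm unlock /= E.
split; last first.
  move=> hw; rewrite LE nrmE// poweR_EFin; congr EFin.
  rewrite -[nrm w ^+ 2]powR_mulrn// -powRrM mulfV ?pnatr_eq0// powRr1//.
rewrite LE; apply/idP/idP; last by move=> h1; rewrite poweR_lty.
apply: contraTT; rewrite -!leNgt !leye_eq => /eqP ->.
by rewrite poweRyr ?invr_eq0.
Qed.

End L2space.
#[export] Hint Resolve nrm_ge0 : core.

(** * Concavity of the potential and the derivative of the bond energy *)

Lemma near_within_dnbhs (R : realType) (A : set R) (x : R) (P : R -> Prop) :
  (\forall y \near within A x^', P y) ->
  exists2 dl : R, 0 < dl & forall y, `|y - x| < dl -> y != x -> A y -> P y.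
Proof.
move=> /nbhs_ballP[e /= e0 h]; exists e => // y yx ynx Ay.
by apply: (h y) => //; rewrite /ball/= distrC.
Qed.

Section potential_facts.
Context (R : realType) (f : R -> R) (fp0 finf rbar : R).
Hypothesis hf : cohesive_potential f fp0 finf rbar.
Implicit Types (r s t e : R).

Let fconc (t x y : R) : 0 <= t <= 1 -> 0 <= x -> 0 <= y ->
  t * f x + (1 - t) * f y <= f (t * x + (1 - t) * y).
Proof.
move=> /andP[t0 t1] x0 y0; have [_ _ hc _ _] := hf.
have h01 : Itv.spec (@Itv.num_sem R) (Itv.Real `[0%Z, 1%Z]) t.
  by apply/and3P; split => //=; rewrite ?num_real//; apply/andP; split; rewrite bnd_simp.
have := hc (Itv.mk h01) x y.
rewrite !inE/= !in_itv/= !andbT => /(_ x0 y0).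
move=> h; have : - f (t * x + (1 - t) * y) <= t * - f x + (1 - t) * - f y by exact: h.
by lra.
Qed.

Let f0 : f 0 = 0. Proof. by have [_ [? _] _ _ _] := hf. Qed.
Let fpos r : 0 < r -> 0 < f r. Proof. by have [_ [_ h] _ _ _] := hf; exact: h. Qed.

Lemma pot_ge0 r : 0 <= r -> 0 <= f r.
Proof. by rewrite le_eqVlt => /predU1P[<-|/fpos/ltW//]; rewrite f0. Qed.

(** Concavity between 0 and s together with f 0 = 0: the quotient f(r)/r does not increase. *)
Lemma pot_chord r s : 0 <= r -> 0 < s -> r <= s -> r * f s <= s * f r.
Proof.
move=> r0 s0 rs; have t01 : 0 <= r / s <= 1.
  by apply/andP; split; [pos|rewrite ler_pdivrMr// mul1r].
have := fconc t01 (ltW s0) (lexx 0).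
rewrite f0 !mulr0 !addr0 divfK ?gt_eqF// => h.
by rewrite -ler_pdivrMl// mulrA [s^-1 * _]mulrC.
Qed.

(** A concave function that decreases once decreases at least linearly from then on, and would
    become negative. *)
Lemma pot_nd r s : 0 <= r -> r <= s -> f r <= f s.
Proof.
move=> r0 rs; rewrite leNgt; apply/negP => fsr.
have {rs} rs : r < s by rewrite lt_neqAle rs andbT; apply: contraTneq fsr => ->; rewrite ltxx.
have s0 : 0 < s := le_lt_trans r0 rs.
pose g := f r - f s; have g0 : 0 < g by rewrite subr_gt0.
have fs0 : 0 <= f s by rewrite pot_ge0// ltW.
pose c := f s / g + 1; have c0 : 0 < c by rewrite /c ltr_wpDl// divr_ge0// ltW.
(* At c steps of length s - r beyond s, concavity forces f z <= f s - c g. By the choice of c this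
   equals -g, which contradicts positivity. *)
pose z := s + c * (s - r).
have sr : 0 < s - r by rewrite subr_gt0.
have z0 : 0 < z by rewrite /z addr_gt0// mulr_gt0.
have c1 : 0 < c + 1 by rewrite addr_gt0.
have t01 : 0 <= c / (c + 1) <= 1.
  by apply/andP; split; [pos|rewrite ler_pdivrMr// mul1r lerDl].
have := fconc t01 r0 (ltW z0).
have -> : c / (c + 1) * r + (1 - c / (c + 1)) * z = s by rewrite /z; field; rewrite gt_eqF.
have fz := fpos z0.
have -> : c / (c + 1) * f r + (1 - c / (c + 1)) * f z = (c * f r + f z) / (c + 1).
  by field; rewrite gt_eqF.
rewrite ler_pdivrMr// => h.
have : c * g < f s by rewrite /g; lra.
rewrite /c mulrDl mul1r divfK ?gt_eqF//; lra.
Qed.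

Lemma pot_le_finf r : 0 <= r -> f r <= finf.
Proof.
move=> r0; have [_ _ _ [_ _ h] _] := hf.
rewrite leNgt; apply/negP => hr.
have h1 : \forall s \near +oo, f s < f r by exact: (cvgr_lt _ h).
have h2 : \forall s \near +oo, r <= s by exact: nbhs_pinfty_ge (num_real r).
have h3 : \forall s \near +oo, f s < f r /\ r <= s by exact: filterI h1 h2.
have [s [hs rs]] := filter_ex h3.
by have := pot_nd r0 rs; rewrite leNgt hs.
Qed.

Lemma pot_finf_gt0 : 0 < finf.
Proof. by apply: lt_le_trans (fpos ltr01) (pot_le_finf _). Qed.

Lemma pot_fp0_gt0 : 0 < fp0.
Proof. by have [_ _ _ [_ ? _] _] := hf. Qed.

Lemma pot_le_lin r : 0 <= r -> f r <= fp0 * r.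
Proof.
rewrite le_eqVlt => /predU1P[<-|r0]; first by rewrite f0 mulr0.
have [_ _ _ [h _ _] _] := hf.
rewrite -ler_pdivrMr// leNgt; apply/negP => hr.
have h1 : \forall s \near (0 : R)^'+, f s / s < f r / r by exact: (cvgr_lt _ h).
have h2 : \forall s \near (0 : R)^'+, 0 < s by exact: nbhs_right_gt.
have h3 : \forall s \near (0 : R)^'+, s <= r by exact: nbhs_right_le.
have h4 : \forall s \near (0 : R)^'+, f s / s < f r / r /\ (0 < s /\ s <= r).
  by apply: filterI h1 _; exact: filterI h2 h3.
have [s [hs [s0 sr]]] := @filter_ex _ _ (at_right_proper_filter (0 : R)) _ h4.
have := pot_chord (ltW s0) r0 sr.
by move: hs; rewrite ltr_pdivrMr// mulrAC ltr_pdivlMr//; lra.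
Qed.

Lemma pot_subadd r s : 0 <= r -> 0 <= s -> f (r + s) <= f r + f s.
Proof.
move=> r0 s0; have [rs0|rs0] := ltP 0 (r + s); last first.
  have -> : r = 0 by lra.
  have -> : s = 0 by lra.
  by rewrite addr0 f0 addr0.
have h1 := pot_chord r0 rs0; have h2 := pot_chord s0 rs0.
rewrite -(ler_pM2l rs0).
have {}h1 : r * f (r + s) <= (r + s) * f r by apply: h1; lra.
have {}h2 : s * f (r + s) <= (r + s) * f s by apply: h2; lra.
lra.
Qed.

Lemma pot_subadd_sum (I : Type) (s : seq I) (r : I -> R) : (forall i, 0 <= r i) ->
  f (\sum_(i <- s) r i) <= \sum_(i <- s) f (r i).
Proof.
move=> r0; elim: s => [|i s IH]; first by rewrite !big_nil f0.
rewrite !big_cons; apply: le_trans (pot_subadd _ _) _ => //; first exact: sumr_ge0.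
by rewrite lerD2l.
Qed.

Lemma pot_derivative : exists f1 : R -> R,
  [/\ forall r s, 0 <= r -> 0 <= s -> f s <= f r + f1 r * (s - r),
      forall r, 0 <= r -> 0 <= f1 r <= fp0,
      forall r, 0 <= r -> r * f1 r <= f r,
      forall r s, 0 <= r -> r <= s -> f1 s <= f1 r &
      forall r e, 0 <= r -> 0 < e -> exists2 dl : R, 0 < dl &
        forall s, 0 <= s -> `|s - r| < dl -> `|f s - f r - f1 r * (s - r)| <= e * `|s - r| ].
Proof.
have [[F [F0 FS]] _ _ _ _] := hf; exists (F 1%N).
have D r e : 0 <= r -> 0 < e -> exists2 dl : R, 0 < dl &
    forall s, 0 <= s -> `|s - r| < dl -> `|f s - f r - F 1%N r * (s - r)| <= e * `|s - r|.
  move=> r0 e0; have /cvgrPdist_lt /(_ e e0) /near_within_dnbhs[dl dl0 h] := FS 0%N r r0.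
  exists dl => // s s0 sr; have [->|snr] := eqVneq s r.
    by rewrite !subrr mulr0 subrr normr0 mulr0.
  have {h} := h s sr snr; rewrite /= in_itv/= andbT !F0// => /(_ s0) h.
  have snr' : s - r != 0 by rewrite subr_eq0.
  have -> : f s - f r - F 1%N r * (s - r) = - (F 1%N r - (f s - f r) / (s - r)) * (s - r).
    by field.
  by rewrite normrM normrN ler_wpM2r// ltW.
have C r s : 0 <= r -> 0 <= s -> f s <= f r + F 1%N r * (s - r).
  move=> r0 s0; rewrite leNgt; apply/negP => hs.
  have [srE|snr] := eqVneq s r; first by move: hs; rewrite srE subrr mulr0 addr0 ltxx.
  have n0 : 0 < `|s - r| by rewrite normr_gt0 subr_eq0.
  pose g := f s - f r - F 1%N r * (s - r); have g0 : 0 < g by rewrite /g; lra.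
  have e0 : 0 < g / (2 * `|s - r|) by rewrite divr_gt0// mulr_gt0.
  have [dl dl0 h] := D r _ r0 e0.
  (* Small enough for t s + (1 - t) r to be where the derivative at r approximates f. There
     concavity gives a defect of at least t g, while differentiability allows at most t g / 2. *)
  pose t := Num.min 1 (dl / 2 / `|s - r|).
  have t0 : 0 < t by rewrite lt_min ltr01/= !divr_gt0.
  have t1 : t <= 1 by rewrite ge_min lexx.
  have tdl : t * `|s - r| < dl.
    apply: (@le_lt_trans _ _ (dl / 2 / `|s - r| * `|s - r|)).
      by rewrite ler_wpM2r// ge_min lexx orbT.
    by rewrite divfK ?gt_eqF//; lra.
  have t01 : 0 <= t <= 1 by rewrite t1 ltW.
  have y0 : 0 <= t * s + (1 - t) * r by nra.
  have := h _ y0; have -> : t * s + (1 - t) * r - r = t * (s - r) by ring.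
  rewrite normrM gtr0_norm// => /(_ tdl).
  have := fconc t01 s0 r0 => h1 /(le_trans (ler_norm _)).
  have -> : g / (2 * `|s - r|) * (t * `|s - r|) = t * g / 2 by field; rewrite gt_eqF.
  move=> h2; have : t * g <= t * g / 2 by rewrite {1}/g; lra.
  have : 0 < t * g by rewrite mulr_gt0.
  lra.
have B r : 0 <= r -> r * F 1%N r <= f r.
  by move=> r0; have := C r 0 r0 (lexx 0); rewrite f0 sub0r mulrN; lra.
have P r : 0 <= r -> 0 <= F 1%N r <= fp0.
  move=> r0; apply/andP; split.
    have := C r (r + 1) r0; have := @pot_nd r (r + 1) r0 => h1 h2.
    have h3 : f r <= f (r + 1) by apply: h1; lra.
    have := h2 (_ : 0 <= r + 1); rewrite addrAC subrr add0r mulr1 => h4.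
    by have := h4 (addr_ge0 r0 ler01); lra.
  move: r0; rewrite le_eqVlt => /predU1P[<-|r0]; last first.
    have := B r (ltW r0); have := pot_le_lin (ltW r0); rewrite [fp0 * r]mulrC => h1 h2.
    by rewrite -(ler_pM2l r0); exact: le_trans h1.
  rewrite leNgt; apply/negP => h.
  pose e := F 1%N 0 - fp0; have e0 : 0 < e / 2 by rewrite /e divr_gt0// subr_gt0.
  have [dl dl0 hd] := D 0 _ (lexx 0) e0.
  have d2 : 0 < dl / 2 by rewrite divr_gt0.
  have := hd _ (ltW d2); rewrite subr0 gtr0_norm// f0 subr0 => h1.
  have h2 : dl / 2 < dl by lra.
  have := h1 h2; rewrite ler_norml => /andP[h3 _].
  have := pot_le_lin (ltW d2); set q := dl / 2 in d2 h3 * => h4.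
  have : 0 < q * (e / 2) by rewrite mulr_gt0.
  by rewrite /e; rewrite /e in h3; nra.
split => //.
move=> r s r0; rewrite le_eqVlt => /predU1P[->//|rs].
have s0 : 0 <= s by apply: le_trans r0 (ltW rs).
have := C r s r0 s0; have := C s r s0 r0 => h1 h2.
have sr : 0 < s - r by rewrite subr_gt0.
have : 0 <= (F 1%N r - F 1%N s) * (s - r) by lra.
by rewrite pmulr_lge0// subr_ge0.
Qed.

End potential_facts.

Section records.
Context (R : realType).

Record pot_ok (f f1 : R -> R) (fp0 finf : R) : Prop := PotOk {
  pok_mf : mfunT f;
  pok_mf1 : mfunT f1;
  pok_f0 : f 0 = 0;
  pok_fp0 : 0 < fp0;
  pok_finf : 0 < finf;
  pok_pos : forall r : R, 0 < r -> 0 < f r;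
  pok_tan : forall r s : R, 0 <= r -> 0 <= s -> f s <= f r + f1 r * (s - r);
  pok_f1 : forall r : R, 0 <= r -> 0 <= f1 r <= fp0;
  pok_rf1 : forall r : R, 0 <= r -> r * f1 r <= f r;
  pok_f : forall r : R, 0 <= r -> 0 <= f r <= finf;
  pok_lin : forall r : R, 0 <= r -> f r <= fp0 * r;
  pok_sum : forall (I : Type) (s : seq I) (r : I -> R), (forall i, 0 <= r i) ->
    f (\sum_(i <- s) r i) <= \sum_(i <- s) f (r i);
  pok_nd : forall r s : R, 0 <= r -> r <= s -> f r <= f s;
  pok_chord : forall r s : R, 0 <= r -> 0 < s -> r <= s -> r * f s <= s * f r }.

Record ker_ok n (Jn : 'rV[R]_n -> R) (MJ : R) : Prop := KerOk {
  kok_m : mfunT Jn;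
  kok_ge0 : forall z, 0 <= Jn z;
  kok_le : forall z, Jn z <= MJ;
  kok_supp : forall z, 1 <= enorm z -> Jn z = 0;
  kok_rad : forall z z', enorm z = enorm z' -> Jn z = Jn z' }.

(** Both f and its derivative are composed with r -> max 0 r. They become monotone on the whole
    line, hence measurable, and agree with the originals for nonnegative r. *)
Lemma cohesive_pot_ok (f : R -> R) (fp0 finf rbar : R) :
  cohesive_potential f fp0 finf rbar ->
  exists F f1 : R -> R, [/\ pot_ok F f1 fp0 finf, forall r : R, 0 <= r -> F r = f r &
     forall r e : R, 0 <= r -> 0 < e -> exists2 dl : R, 0 < dl &
        forall s : R, 0 <= s -> `|s - r| < dl -> `|F s - F r - f1 r * (s - r)| <= e * `|s - r| ].
Proof.
move=> hf; have [f1 [h1 h2 h3 h4 h5]] := pot_derivative hf.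
pose F (r : R) : R := f (Num.max 0 r); pose G (r : R) : R := f1 (Num.max 0 r).
have m0 (r : R) : 0 <= Num.max 0 r by rewrite le_max lexx.
have FE (r : R) : 0 <= r -> F r = f r by move=> r0; rewrite /F max_r.
have GE (r : R) : 0 <= r -> G r = f1 r by move=> r0; rewrite /G max_r.
have mm (r s : R) : r <= s -> Num.max 0 r <= Num.max 0 s.
  by move=> rs; rewrite ge_max m0 le_max rs orbT.
have f00 : f 0 = 0 by have [_ [? _] _ _ _] := hf.
exists F, G; split => //; last first.
  move=> r e r0 e0; have [dl dl0 h] := h5 r e r0 e0.
  by exists dl => // s s0; rewrite !FE// GE//; exact: h.
split.
- by apply: nondecreasing_measurable => // r s rs; apply: (pot_nd hf) => //; exact: mm.
- by apply: nonincreasing_measurable => // r s rs; apply: h4 => //; exact: mm.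
- by rewrite FE.
- exact: pot_fp0_gt0 hf.
- exact: pot_finf_gt0 hf.
- by move=> r r0; rewrite FE ?ltW//; have [_ [_ h] _ _ _] := hf; exact: h.
- by move=> r s r0 s0; rewrite !FE// GE//; exact: h1.
- by move=> r r0; rewrite GE//; exact: h2.
- by move=> r r0; rewrite GE// FE//; exact: h3.
- by move=> r r0; rewrite FE// (pot_ge0 hf r0) (pot_le_finf hf r0).
- by move=> r r0; rewrite FE//; exact: pot_le_lin hf _ r0.
- move=> I s r r0; rewrite FE ?sumr_ge0//; apply: le_trans (pot_subadd_sum hf s r0) _.
  by apply: ler_sum => i _; rewrite FE.
- by move=> r s r0 rs; rewrite !FE// ?(le_trans r0 rs)//; exact: (pot_nd hf).
- by move=> r s r0 s0 rs; rewrite (FE s (ltW s0)) (FE r r0); exact: (pot_chord hf).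
Qed.

Lemma influence_ker_ok n (J : R -> R) : influence_function J ->
  exists MJ, ker_ok (fun z : 'rV[R]_n => J (enorm z)) MJ.
Proof.
move=> [mJ J0 [M JM] J1 _]; exists M; split.
- pose Jp := J \_ `[0, +oo[%classic.
  have mJp : mfunT Jp.
    by apply/(measurable_restrictT _ _).1 => //; exact: measurable_itv.
  rewrite (_ : (fun z => _) = (fun z : 'rV[R]_n => Jp (enorm z))); first by mfun.
  apply/funext => z; rewrite /Jp patchE mem_set//= in_itv/= andbT; exact: enorm_ge0.
- by move=> z; exact/J0/enorm_ge0.
- by move=> z; exact/JM/enorm_ge0.
- by move=> z; exact: J1.
- by move=> z z' ->.
Qed.

(** If the integral over R^n vanished, [radial_null] would make J vanish almost everywhere on the
    half-line. *)
Lemma influence_rint_gt0 n (J : R -> R) : (0 < n)%N -> influence_function J ->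
  (\int[lebesgue_rV R n]_z (J (enorm z))%:E != 0)%E.
Proof.
move=> n0 hJ; have [mJ J0 [M JM] J1 Jae] := hJ; apply/eqP => h; apply: Jae.
pose Jp := J \_ `[0, +oo[%classic.
have mJp : mfunT Jp.
  by apply/(measurable_restrictT _ _).1 => //; exact: measurable_itv.
have JpE (r : R) : 0 <= r -> Jp r = J r.
  by move=> r0; rewrite /Jp patchE mem_set//= in_itv/= andbT.
have Jp0 (r : R) : 0 <= Jp r.
  rewrite /Jp patchE; case: ifPn => // /set_mem; rewrite /= in_itv/= andbT; exact: J0.
have h' : (\int[lebesgue_rV R n]_z (Jp (enorm z))%:E = 0)%E.
  by rewrite -h; apply: eq_integral => z _; rewrite JpE// enorm_ge0.
have := radial_null n0 mJp Jp0 h' => h2.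
have mI : mfunT (\1_(`]0, +oo[%classic) : R -> R) by exact: measurable_indic.
have : ae_eq (@lebesgue_measure R) setT
    (fun r => (\1_(`]0, +oo[%classic) r * Jp r)%:E) (cst 0%E).
  apply/ae_eq_integral_abs => //; first by apply/measurable_EFinP; apply: measurable_funM.
  rewrite -h2; apply: eq_integral => r _; rewrite gee0_abs// lee_fin.
  by rewrite mulr_ge0// indicE.
have hz : {ae @lebesgue_measure R, forall r, r != 0}.
  exists [set 0]; split => //; first exact: lebesgue_measure_set1.
  by move=> r /= /negP; rewrite negbK => /eqP.
have aeF : Filter (almost_everywhere (@lebesgue_measure R)).
  exact: (ae_filter_ringOfSetsType [the {measure set (measurableTypeR R) -> \bar R} of @lebesgue_measure R]).
apply: (@filterS2 _ _ aeF _ _ _ _ hz) => r rn0 /(_ I) [] hr r0; move: hr.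
rewrite indicE mem_set ?mul1r ?JpE//= in_itv/= andbT lt_neqAle eq_sym rn0//.
Qed.

End records.

Section dS.
Context (R : realType) (n : nat) (f : R -> R) (J : R -> R).
Variables (F f1 : R -> R) (fp0 finf : R).
Hypothesis hF : pot_ok F f1 fp0 finf.
Hypothesis FE : forall r : R, 0 <= r -> F r = f r.
Hypothesis FD : forall r e : R, 0 <= r -> 0 < e -> exists2 dl : R, 0 < dl &
  forall s : R, 0 <= s -> `|s - r| < dl -> `|F s - F r - f1 r * (s - r)| <= e * `|s - r|.

(** The chain rule is carried out by hand: at 0 the derivative of f is one-sided, but the inner
    function c s^2 stays on the side where it is known. *)
Lemma derive1_potential_sqr (K c S : R) : 0 <= c ->
  derive1 (fun s : R => K * f (c * s ^+ 2)) S = K * (f1 (c * S ^+ 2) * (2 * c * S)).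
Proof.
move=> c0.
suff key (e : R) : 0 < e -> exists2 m : R, 0 < m & forall h : R, `|h| < m -> h != 0 ->
    `|K * (f1 (c * S ^+ 2) * (2 * c * S)) -
      h^-1 * (K * f (c * (h + S) ^+ 2) - K * f (c * S ^+ 2))| <= e.
  apply: cvg_lim => //; apply/cvgrPdist_le => e /key[m m0 hm].
  apply/nbhs_ballP; exists m => // h /=; rewrite /ball/= sub0r normrN => h1 h2.
  exact: hm.
move=> e0; pose r := c * S ^+ 2; have r0 : 0 <= r by rewrite mulr_ge0// sqr_ge0.
pose A : R := c * (1 + 2 * `|S|) + 1.
have A0 : 0 < A by rewrite ltr_wpDl// mulr_ge0// addr_ge0// mulr_ge0.
pose K1 : R := `|K| + 1; have K10 : 0 < K1 by rewrite ltr_wpDl.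
pose et : R := e / (2 * K1 * A); have et0 : 0 < et by rewrite divr_gt0// !mulr_gt0.
have [dl dl0 hdl] := FD r0 et0.
have fp0_gt0 := pok_fp0 hF.
pose B : R := fp0 * c + 1; have B0 : 0 < B by rewrite ltr_wpDl// mulr_ge0// ltW.
pose m : R := Num.min 1 (Num.min (dl / A) (e / (2 * K1 * B))).
have m0 : 0 < m by rewrite !lt_min ltr01/= !divr_gt0// !mulr_gt0.
exists m => // h hm hn0.
have [h1 h2 h3] : [/\ `|h| < 1, `|h| < dl / A & `|h| < e / (2 * K1 * B)].
  by move: hm; rewrite !lt_min => /andP[-> /andP[-> ->]].
pose s := c * (h + S) ^+ 2; have s0 : 0 <= s by rewrite mulr_ge0// sqr_ge0.
have sr : s - r = c * h * (h + 2 * S) by rewrite /s /r; ring.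
have hS : `|h + 2 * S| <= 1 + 2 * `|S|.
  apply: le_trans (ler_normD _ _) _; apply: lerD; first exact: ltW.
  by rewrite normrM ger0_norm.
have srA : `|s - r| <= A * `|h|.
  rewrite sr !normrM (ger0_norm c0) /A [(_ + 1) * _]mulrDl mul1r.
  have : c * `|h| * `|h + 2 * S| <= c * `|h| * (1 + 2 * `|S|) by rewrite ler_wpM2l// mulr_ge0.
  by have := normr_ge0 h; lra.
have := hdl s s0.
have : `|s - r| < dl by apply: le_lt_trans srA _; rewrite mulrC -ltr_pdivlMr.
move=> -> /(_ isT) hFs.
have /andP[f10 f1p] := pok_f1 hF r0.
rewrite -/r -!FE// -/r.
have hn : h != 0 by [].
have -> : K * (f1 r * (2 * c * S)) - h^-1 * (K * F (c * (h + S) ^+ 2) - K * F r) =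
   - (K / h) * ((F s - F r - f1 r * (s - r)) + f1 r * c * h ^+ 2).
  by rewrite -/s sr; field.
rewrite normrM normrN normrM normfV.
have h0 : 0 < `|h| by rewrite normr_gt0.
have : `|F s - F r - f1 r * (s - r) + f1 r * c * h ^+ 2| <= (e / K1) * `|h|.
  apply: le_trans (ler_normD _ _) _.
  have b1 : `|F s - F r - f1 r * (s - r)| <= e / (2 * K1) * `|h|.
    apply: le_trans hFs _; apply: le_trans (ler_wpM2l (ltW et0) srA) _.
    by rewrite /et le_eqVlt; apply/orP; left; apply/eqP; field; rewrite !gt_eqF.
  have b2 : `|f1 r * c * h ^+ 2| <= e / (2 * K1) * `|h|.
    rewrite normrM normrX expr2 mulrA ler_wpM2r// ger0_norm ?mulr_ge0//.
    apply: (@le_trans _ _ (B * (e / (2 * K1 * B)))).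
      by apply: ler_pM => //; [exact: mulr_ge0| |exact: ltW]; rewrite /B ler_wpDr// ler_wpM2r.
    by apply: le_of_eq; field; rewrite !gt_eqF.
  apply: le_trans (lerD b1 b2) _.
  by apply: le_of_eq; field; rewrite gt_eqF.
move=> hh.
apply: (@le_trans _ _ (`|K| * `|h|^-1 * (e / K1 * `|h|))).
  by rewrite ler_wpM2l// mulr_ge0// invr_ge0.
rewrite (_ : _ * _ = `|K| * e / K1); last by field; rewrite !gt_eqF.
by rewrite ler_pdivrMr// mulrC ler_wpM2l ?ltW// /K1 ltrDl.
Qed.

Lemma dS_cohesive_energyE (eps S : R) (xi : 'rV[R]_n) :
  dS_cohesive_energy f J eps S xi =
  eps^-1 * J (enorm xi / eps) * (enorm xi)^-1 *
    (f1 (enorm xi * S ^+ 2) * (2 * enorm xi * S)).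
Proof. by rewrite /dS_cohesive_energy /cohesive_energy derive1_potential_sqr// enorm_ge0. Qed.

End dS.

(** * Integrals over bonds *)

Section double_integral.
Context (R : realType) (n : nat).
Local Notation V := 'rV[R]_n.
Local Notation leb := (lebesgue_rV R n).
Implicit Types F G : V * V -> R.

Definition leb2 : {measure set (V * V) -> \bar R} := (leb \x leb)%E.

(** A pair (z, x) stands for the bond from x to x + e z. With this order of variables the scaled
    bond z ranges over the unit ball at every horizon. *)
Definition II F : \bar R := (\int[leb]_z \int[leb]_x (F (z, x))%:E)%E.

Lemma II_prod F : mfunT F -> (forall p, 0 <= F p) ->
  (\int[leb2]_p (F p)%:E = II F)%E.
Proof.
move=> mF F0; rewrite /leb2 fubini_tonelli1//; by mfun.
Qed.

Lemma II_swap F : mfunT F -> (forall p, 0 <= F p) ->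
  (II F = \int[leb]_x \int[leb]_z (F (z, x))%:E)%E.
Proof.
move=> mF F0; rewrite /II (fubini_tonelli (m1 := leb) (m2 := leb) (fun p => (F p)%:E))//; by mfun.
Qed.

Lemma II_ge0 F : (forall p, 0 <= F p) -> (0 <= II F)%E.
Proof. by move=> F0; apply: integral_ge0 => z _; exact: rint_ge0. Qed.

Lemma le_II F G : (forall p, 0 <= F p) -> (forall p, F p <= G p) -> (II F <= II G)%E.
Proof.
move=> F0 FG; apply: ge0_le_integralT => z; first exact: rint_ge0.
exact: le_rint.
Qed.

Lemma eq_II F G : F =1 G -> II F = II G.
Proof. by move=> FG; apply: eq_integral => z _; apply: eq_integral => x _; rewrite FG. Qed.

Lemma IIZ (c : R) F : 0 <= c -> mfunT F -> (forall p, 0 <= F p) ->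
  II (fun p => c * F p) = (c%:E * II F)%E.
Proof.
move=> c0 mF F0; rewrite -!II_prod//; [exact: rintZl|by mfun|by move=> p; pos].
Qed.

Lemma IID F G : mfunT F -> (forall p, 0 <= F p) ->
  mfunT G -> (forall p, 0 <= G p) ->
  II (fun p => F p + G p) = (II F + II G)%E.
Proof.
move=> mF F0 mG G0; rewrite -!II_prod//; [exact: rintD|by mfun|by move=> p; pos].
Qed.

Lemma II_shear (e : R) F : mfunT F -> (forall p, 0 <= F p) ->
  II (fun p => F (p.1, p.2 + e *: p.1)) = II F.
Proof.
move=> mF F0; apply: eq_integral => z _ /=.
rewrite (@rint_translate _ _ (e *: z) (fun x => F (z, x)))//.
by apply: (measurableT_comp mF); exact: pair1_measurable.
Qed.

Lemma II_opp F : mfunT F -> (forall p, 0 <= F p) ->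
  II (fun p => F (- p.1, p.2)) = II F.
Proof.
move=> mF F0.
have mG : mfunT (fun p : V * V => F (- p.1, p.2)).
  apply: (measurableT_comp mF); apply: measurable_fun_pair => /=; mfun.
rewrite (II_swap mG (fun p => F0 _)) (II_swap mF F0); apply: eq_integral => x _ /=.
have := @rint_dilate R n (-1) 0 (fun z => F (z, x)).
rewrite oppr_eq0 oner_neq0 => /(_ isT) h.
rewrite (_ : (\int[leb]_z (F (- z, x))%:E = \int[leb]_z (F (-1 *: z + 0, x))%:E)%E); last first.
  by apply: eq_integral => z _; rewrite addr0 scaleN1r.
rewrite h//; first by rewrite normrN1 expr1n invr1 mul1e.
by apply: (measurableT_comp mF); exact: pair2_measurable.
Qed.

Lemma II_tensor (g w : V -> R) : mfunT g -> (forall z, 0 <= g z) ->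
  mfunT w -> (forall z, 0 <= w z) ->
  II (fun p => g p.1 * w p.2) = (\int[leb]_z (g z)%:E * \int[leb]_x (w x)%:E)%E.
Proof.
move=> mg g0 mw w0; rewrite /II.
rewrite /=; under eq_integral => z _ do rewrite rintZl// muleC.
rewrite ge0_integralZl//; [by rewrite muleC|by mfun|by move=> z _; rewrite lee_fin|].
exact: rint_ge0.
Qed.

Lemma leb2_integrable F G : mfunT F -> mfunT G ->
  (forall p, `|F p| <= G p) -> (II G < +oo)%E -> leb2.-integrable setT (fun p => (F p)%:E).
Proof.
move=> mF mG FG Gfin; have G0 p : 0 <= G p by apply: le_trans (FG p).
apply/integrableP; split; first by mfun.
apply: le_lt_trans Gfin; rewrite -II_prod//; apply: ge0_le_integralT => p.
  exact: abse_ge0.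
by rewrite abse_EFin lee_fin.
Qed.

Definition SI F : R := \int[leb2]_p F p.

Lemma SI_le F (c : R) G : mfunT F -> mfunT G ->
  (forall p, `|F p| <= G p) -> (II G <= c%:E)%E -> `|SI F| <= c.
Proof.
move=> mF mG FG hG.
have iF : leb2.-integrable setT (fun p => (F p)%:E).
  by apply: leb2_integrable FG _ => //; apply: le_lt_trans hG _; rewrite ltry.
have G0 p : 0 <= G p by apply: le_trans (FG p).
rewrite -lee_fin; apply: le_trans hG; rewrite -II_prod//.
rewrite /SI EFin_normr_Rintegral//.
apply: le_trans (le_abse_integral _ _ _) _ => //; first by mfun.
by apply: ge0_le_integralT => p; [exact: abse_ge0|rewrite abse_EFin lee_fin].
Qed.

Lemma SI_II F : mfunT F -> (forall p, 0 <= F p) -> (II F < +oo)%E ->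
  (SI F)%:E = II F.
Proof.
move=> mF F0 Ffin; rewrite /SI /Rintegral II_prod// fineK//.
by rewrite ge0_fin_numE// II_ge0.
Qed.

(** Exchange of the two ends of a bond. The map is a reflection in z composed with a shear in x, and
    both preserve the product measure. *)
Lemma SI_flip (e : R) F : mfunT F ->
  SI (fun p => F (- p.1, p.2 + e *: p.1)) = SI F.
Proof.
move=> mF; congr fine.
have mT : mfunT (fun p : V * V => (- p.1, p.2 + e *: p.1)).
  by apply: measurable_fun_pair => /=; mfun.
have key G : mfunT G -> (forall p, 0 <= G p) ->
    (\int[leb2]_p (G (- p.1, p.2 + e *: p.1))%:E = \int[leb2]_p (G p)%:E)%E.
  move=> mG G0; rewrite !II_prod//; last first.
    exact: (measurableT_comp mG mT).
  rewrite -[RHS](II_opp mG G0) -[RHS](II_shear e)//.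
  apply: (measurableT_comp mG); apply: measurable_fun_pair => /=; mfun.
rewrite integralE [RHS]integralE.
pose Fp p := Num.max (F p) 0; pose Fm p := Num.max (- F p) 0.
have mFp : mfunT Fp by exact: measurable_funrpos.
have mFm : mfunT Fm by exact: measurable_funrneg.
have Fp0 p : 0 <= Fp p by rewrite /Fp le_max lexx orbT.
have Fm0 p : 0 <= Fm p by rewrite /Fm le_max lexx orbT.
have := key _ mFp Fp0; have := key _ mFm Fm0 => k1 k2.
congr (_ - _)%E.
- transitivity (\int[leb2]_p (Fp (- p.1, p.2 + e *: p.1))%:E)%E.
    by apply: eq_integral => p _; rewrite funeposE /Fp EFin_max.
  by rewrite k2; apply: eq_integral => p _; rewrite funeposE /Fp EFin_max.
- transitivity (\int[leb2]_p (Fm (- p.1, p.2 + e *: p.1))%:E)%E.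
    by apply: eq_integral => p _; rewrite funenegE /Fm EFin_max.
  by rewrite k1; apply: eq_integral => p _; rewrite funenegE /Fm EFin_max.
Qed.

Lemma SI_iter F : mfunT F -> leb2.-integrable setT (fun p => (F p)%:E) ->
  (\int[leb]_x \int[leb]_z (F (z, x))%:E = (SI F)%:E)%E.
Proof.
move=> mF iF; rewrite /SI /Rintegral fineK; last exact: integrable_fin_num iF.
by rewrite -(integral21_prod_meas1 iF).
Qed.

(** The common dominating weight: of the three powers of [enorm z] in the denominators below, two
    are absorbed by increments projected on z. *)
Definition kinv (z : V) : R := \1_(eball 0 1) z * (enorm z)^-1.

Lemma measurable_kinv : mfunT kinv.
Proof. by rewrite /kinv; mfun. Qed.

Lemma kinv_ge0 z : 0 <= kinv z.
Proof. by rewrite /kinv; pos. Qed.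

Hypothesis n2 : (2 <= n)%N.

Lemma rint_kinv : (\int[leb]_z (kinv z)%:E <= (2 ^+ n.+2)%:E)%E.
Proof.
apply: le_trans (invnorm_integral R n2); apply: le_of_eq.
by apply: eq_integral => z _; rewrite /kinv mulrC.
Qed.

Lemma II_kinv (e c : R) (w : V -> R) (A : R) : 0 <= c -> mfunT w -> (forall x, 0 <= w x) ->
  (\int[leb]_x (w x)%:E <= A%:E)%E ->
  (II (fun p => c * (kinv p.1 * (w (p.2 + e *: p.1) + w p.2)))%R <= (c * (2 ^+ n.+2 * (2 * A)))%:E)%E.
Proof.
move=> c0 mw w0 hw.
have A0 : 0 <= A by rewrite -lee_fin; apply: le_trans hw; exact: rint_ge0.
have mk := measurable_kinv; have k0 := kinv_ge0.
have mw' : mfunT (fun p : V * V => w (p.2 + e *: p.1)) by mfun.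
rewrite IIZ//; [|by mfun|by move=> p; pos].
rewrite EFinM; apply: lee_wpmul2l => //.
rewrite (@eq_II _ (fun p => kinv p.1 * w (p.2 + e *: p.1) + kinv p.1 * w p.2)); last first.
  by move=> p; rewrite mulrDr.
rewrite IID; [|sidec..].
rewrite (@II_shear e (fun p => kinv p.1 * w p.2)); [|sidec..].
rewrite II_tensor//.
rewrite (_ : 2 ^+ n.+2 * (2 * A) = 2 ^+ n.+2 * A + 2 ^+ n.+2 * A); last by ring.
by rewrite EFinD; apply: leeD; rewrite EFinM; apply: lee_pmul => //; first [exact: rint_ge0|exact: rint_kinv].
Qed.

End double_integral.

(** * The rescaled peridynamic energy *)

Lemma sqr_mono (R : realType) (a b : R) : 0 <= a -> a <= b -> a ^+ 2 <= b ^+ 2.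
Proof. by move=> a0 ab; rewrite lerXn2r// nnegrE// (le_trans a0). Qed.

Lemma sqr_sum_le (R : realType) (m : nat) (a : 'I_m -> R) :
  (\sum_(j < m) a j) ^+ 2 <= m%:R * \sum_(j < m) a j ^+ 2.
Proof.
have := ler_dot_enorm (\row_j a j) (const_mx 1).
have E1 : dot (\row_j a j) (const_mx 1) = \sum_(j < m) a j.
  by apply: eq_bigr => j _; rewrite !mxE mulr1.
rewrite E1 => h; rewrite -real_normK ?num_real//.
apply: (@le_trans _ _ ((enorm (\row_j a j) * enorm (const_mx 1 : 'rV[R]_m)) ^+ 2)).
  exact: sqr_mono.
rewrite exprMn !sqr_enorm mulrC.
have -> : dot (const_mx 1) (const_mx 1 : 'rV[R]_m) = m%:R.
  rewrite /dot (eq_bigr (fun=> 1)) ?sumr_const ?card_ord// => i _.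
  by rewrite mxE mulr1.
by have -> : dot (\row_j a j) (\row_j a j) = \sum_(j < m) a j ^+ 2
  by apply: eq_bigr => j _; rewrite !mxE expr2.
Qed.

Section PD.
Context (R : realType) (n : nat).
Local Notation V := 'rV[R]_n.
Local Notation leb := (lebesgue_rV R n).
Local Notation omega := (unit_ball_volume R n).
Variables (f f1 : R -> R) (fp0 finf : R) (Jn : V -> R) (MJ : R).
Implicit Types (u v psi : V -> V) (e q D : R) (p : V * V) (z x : V).

Definition dlt u e p : R := dot (u (p.2 + e *: p.1) - u p.2) p.1.
(** For y = x + e z and q the increment projected on z, the strain is q / (e |z|^2). This expression
    is then |y - x| S^2, the argument of f. *)
Definition parg e q z : R := q ^+ 2 / (e * enorm z ^+ 3).
Definition PDd e (q : V * V -> R) p : R := Jn p.1 * f (parg e (q p) p.1).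
(** PD^e after the substitution y = x + e z, with x ranging over the whole space. The Jacobian e^n
    cancels the one in V_d and leaves the factor 1/e. *)
Definition PDe e u : \bar R := ((e * omega)^-1%:E * II (PDd e (dlt u e)))%E.
Definition PDr e u : R := fine (PDe e u).
Definition PDk e u p : R := Jn p.1 * f1 (parg e (dlt u e p) p.1) * dlt u e p / enorm p.1 ^+ 3.
(** The derivative of [PDe] at u in the direction psi. The factor 2/e comes from the square in
    [parg]. *)
Definition Lin e u psi : R := 2 / (e ^+ 2 * omega) * SI (fun p => PDk e u p * dlt psi e p).

Hypothesis n2 : (2 <= n)%N.
Hypothesis hp : pot_ok f f1 fp0 finf.
Hypothesis hk : ker_ok Jn MJ.

Let w0 : 0 < omega. Proof. exact: unit_ball_volume_gt0. Qed.
Let fp0_gt0 : 0 < fp0 := pok_fp0 hp.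
Let finf_gt0 : 0 < finf := pok_finf hp.
Let J0 z : 0 <= Jn z. Proof. exact: kok_ge0 hk z. Qed.
Let mJ : mfunT Jn := kok_m hk.
Let mf : mfunT f := pok_mf hp.
Let mf1 : mfunT f1 := pok_mf1 hp.
Let MJ0 : 0 <= MJ. Proof. exact: le_trans (J0 0) (kok_le hk 0). Qed.

Lemma Jn_le z : Jn z <= MJ * \1_(eball 0 1) z.
Proof.
rewrite indicE mem_eball0; have [z1|z1] := ltP (enorm z) 1; first by rewrite mulr1; exact: kok_le.
by rewrite (kok_supp hk z1) mulr0.
Qed.

Lemma Jn_inv_le z : Jn z * (enorm z)^-1 <= MJ * kinv z.
Proof. by rewrite /kinv mulrA ler_wpM2r ?invr_ge0 ?enorm_ge0//; exact: Jn_le. Qed.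

Lemma measurable_dlt u e : mfunT u -> mfunT (dlt u e).
Proof. by move=> mu; rewrite /dlt; mfun. Qed.

Lemma measurable_parg e (q : V * V -> R) : mfunT q ->
  mfunT (fun p => parg e (q p) p.1).
Proof. by move=> mq; rewrite /parg; mfun. Qed.

Lemma measurable_PDd e (q : V * V -> R) : mfunT q -> mfunT (PDd e q).
Proof. by move=> mq; have := measurable_parg e mq => ?; rewrite /PDd; mfun. Qed.

Lemma measurable_PDk e u : mfunT u -> mfunT (PDk e u).
Proof.
move=> mu; have := measurable_dlt e mu => h; have := measurable_parg e h => h'.
rewrite /PDk; apply: measurable_funM; last by mfun.
by apply: measurable_funM => //; apply: measurable_funM; mfun.
Qed.

Lemma parg_ge0 e q z : 0 < e -> 0 <= parg e q z.
Proof. by move=> e0; rewrite /parg; apply: divr_ge0; [exact: sqr_ge0|pos]. Qed.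

Lemma f_parg_ge0 e q z : 0 < e -> 0 <= f (parg e q z).
Proof. by move=> e0; have /andP[] := pok_f hp (parg_ge0 q z e0). Qed.

Lemma f1_parg e q z : 0 < e -> 0 <= f1 (parg e q z) <= fp0.
Proof. by move=> e0; exact: pok_f1 hp _ (parg_ge0 q z e0). Qed.

Lemma PDd_ge0 e (q : V * V -> R) p : 0 < e -> 0 <= PDd e q p.
Proof. by move=> e0; rewrite /PDd mulr_ge0// f_parg_ge0. Qed.

Lemma dlt_le u e p : `|dlt u e p| <= enorm (u (p.2 + e *: p.1) - u p.2) * enorm p.1.
Proof. exact: ler_dot_enorm. Qed.

Lemma quotient_le (a b : R) z : 0 <= a -> a <= b * enorm z ^+ 2 -> a / enorm z ^+ 3 <= b / enorm z.
Proof.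
move=> a0 ab; have [->|z0] := eqVneq z 0; first by rewrite enorm0 expr0n/= invr0 !mulr0.
have z1 : 0 < enorm z by rewrite enorm_gt0.
rewrite ler_pdivrMr ?exprn_gt0// (_ : b / _ * _ = b * enorm z ^+ 2)//.
by field; rewrite gt_eqF.
Qed.

Lemma parg_le e q D z : 0 < e -> 0 <= D -> `|q| <= D * enorm z -> parg e q z <= D ^+ 2 / e / enorm z.
Proof.
move=> e0 D0 hq; rewrite /parg invfM mulrA; apply: quotient_le.
  by rewrite divr_ge0 ?sqr_ge0// ltW.
rewrite [leRHS]mulrAC ler_pM2r ?invr_gt0// -exprMn -real_normK ?num_real//.
exact: sqr_mono.
Qed.

Lemma ler_dotB2 (a b : V) : enorm (a - b) ^+ 2 <= 2 * (dot a a + dot b b).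
Proof.
rewrite sqr_enorm; have := dot_ge0 (a + b); rewrite !(dotDl, dotDr, dotNl, dotNr) (dotC b a); lra.
Qed.

Lemma II_PDd_le e u : 0 < e -> L2f u ->
  (II (PDd e (dlt u e)) <= (2 * fp0 * MJ / e * (2 ^+ n.+2 * (2 * nrm u ^+ 2)))%:E)%E.
Proof.
move=> e0 hu; have [mu _] := hu.
apply: le_trans (II_kinv n2 e (c := 2 * fp0 * MJ / e) (w := fun x => dot (u x) (u x)) _ _ _ _).
- apply: le_II => p; first exact: PDd_ge0.
  rewrite /PDd; have /= h1 := parg_le e0 (enorm_ge0 _) (dlt_le u e p).
  have h2 := pok_lin hp (parg_ge0 (dlt u e p) p.1 e0).
  have h3 := ler_dotB2 (u (p.2 + e *: p.1)) (u p.2).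
  set w := dot _ _ + _ in h3 *; set D := enorm (_ - _) ^+ 2 in h1 h3.
  have w1 : 0 <= w by rewrite addr_ge0// dot_ge0.
  apply: (@le_trans _ _ (Jn p.1 * (fp0 * (2 * w / e / enorm p.1)))).
    apply: ler_wpM2l => //; apply: le_trans h2 _; apply: ler_wpM2l; first exact: ltW.
    apply: le_trans h1 _; rewrite ler_wpM2r ?invr_ge0 ?enorm_ge0//.
    by rewrite ler_wpM2r// invr_ge0 ltW.
  have := Jn_inv_le p.1 => h4.
  have := ler_wpM2l (_ : 0 <= fp0 * 2 * w / e) h4 => h5.
  have {}h5 : fp0 * 2 * w / e * (Jn p.1 / enorm p.1) <= fp0 * 2 * w / e * (MJ * kinv p.1).
    by apply: h5; pos.
  apply: le_trans (le_trans h5 _); apply: le_of_eq; ring.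
- by pos.
- by mfun.
- by move=> x; exact: dot_ge0.
- by rewrite -nrmE.
Qed.

Lemma II_PDd_fin e u : 0 < e -> L2f u -> (II (PDd e (dlt u e)) < +oo)%E.
Proof. by move=> e0 hu; apply: le_lt_trans (II_PDd_le e0 hu) _; rewrite ltry. Qed.

Lemma PDeE e u : 0 < e -> L2f u -> PDe e u = (PDr e u)%:E.
Proof.
move=> e0 hu; rewrite /PDr fineK// ge0_fin_numE; last first.
  apply: mule_ge0; first by rewrite lee_fin invr_ge0; pos.
  by apply: II_ge0 => p; exact: PDd_ge0.
by apply: lte_mul_pinfty (II_PDd_fin e0 hu) => //; rewrite lee_fin invr_ge0; pos.
Qed.

Lemma SI_PDd e u : 0 < e -> L2f u -> SI (PDd e (dlt u e)) = e * omega * PDr e u.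
Proof.
move=> e0 hu; have [mu _] := hu; rewrite /PDr /PDe.
rewrite -SI_II//; [|exact: measurable_PDd (measurable_dlt e mu)
  |by move=> p; exact: PDd_ge0|exact: II_PDd_fin].
by rewrite -EFinM /= mulrA mulfV ?mul1r// gt_eqF// mulr_gt0.
Qed.

Lemma II_PDd e u : 0 < e -> L2f u -> II (PDd e (dlt u e)) = (e * omega * PDr e u)%:E.
Proof.
move=> e0 hu; have [mu _] := hu; rewrite -SI_PDd// SI_II//; last exact: II_PDd_fin.
  exact: measurable_PDd (measurable_dlt e mu).
by move=> p; exact: PDd_ge0.
Qed.

Lemma PDr_ge0 e u : 0 < e -> 0 <= PDr e u.
Proof.
move=> e0; apply: fine_ge0; apply: mule_ge0; first by rewrite lee_fin invr_ge0; pos.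
by apply: II_ge0 => p; exact: PDd_ge0.
Qed.

Lemma Lin_integrand_le e u psi p : 0 < e ->
  `|PDk e u p * dlt psi e p| <= fp0 * MJ * (kinv p.1 *
    ((dot (u (p.2 + e *: p.1)) (u (p.2 + e *: p.1)) + dot (psi (p.2 + e *: p.1)) (psi (p.2 + e *: p.1))) +
     (dot (u p.2) (u p.2) + dot (psi p.2) (psi p.2)))).
Proof.
move=> e0; rewrite /PDk.
have /andP[g0 g1] := f1_parg (dlt u e p) p.1 e0.
have h1 := dlt_le u e p; have h2 := dlt_le psi e p.
have h3 := ler_dotB2 (u (p.2 + e *: p.1)) (u p.2).
have h4 := ler_dotB2 (psi (p.2 + e *: p.1)) (psi p.2).
set a := enorm (u _ - u _) in h1 h3; set b := enorm (psi _ - psi _) in h2 h4.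
have a0 : 0 <= a by exact: enorm_ge0.
have b0 : 0 <= b by exact: enorm_ge0.
set W := (_ + _ + _).
have hW : a * b <= W by rewrite /W; have := sqr_ge0 (a - b); rewrite sqrrB; lra.
have J1 := Jn_inv_le p.1.
rewrite !normrM normfV normrX (ger0_norm (enorm_ge0 _)) (ger0_norm (J0 _)) (ger0_norm g0).
have : `|dlt u e p| * `|dlt psi e p| / enorm p.1 ^+ 3 <= W / enorm p.1.
  apply: quotient_le; first by rewrite mulr_ge0.
  apply: (@le_trans _ _ ((a * enorm p.1) * (b * enorm p.1))); first exact: ler_pM.
  by rewrite (_ : _ * _ = a * b * enorm p.1 ^+ 2) ?ler_wpM2r ?exprn_ge0 ?enorm_ge0//; ring.
set Q := _ / _ ^+ 3 => hQ.
have -> : Jn p.1 * f1 (parg e (dlt u e p) p.1) * `|dlt u e p| / enorm p.1 ^+ 3 * `|dlt psi e p|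
  = f1 (parg e (dlt u e p) p.1) * (Jn p.1 * Q) by rewrite /Q; ring.
have W00 : 0 <= W by rewrite /W !addr_ge0 ?dot_ge0.
rewrite -mulrA; apply: ler_pM => //; first by rewrite mulr_ge0// /Q mulr_ge0 ?invr_ge0 ?exprn_ge0 ?enorm_ge0// mulr_ge0.
apply: (@le_trans _ _ (Jn p.1 * (W / enorm p.1))); first by rewrite ler_wpM2l.
rewrite (_ : _ * (W / _) = W * (Jn p.1 / enorm p.1)); last by ring.
apply: le_trans (ler_wpM2l W00 J1) _.
by apply: le_of_eq; ring.
Qed.

Let W2 u psi x : R := dot (u x) (u x) + dot (psi x) (psi x).

Let W2_fin u psi : L2f u -> L2f psi -> (\int[leb]_x (W2 u psi x)%:E <= (nrm u ^+ 2 + nrm psi ^+ 2)%:E)%E.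
Proof.
move=> hu hpsi; have [mu _] := hu; have [mp _] := hpsi.
rewrite /W2 rintD; [|sidec..].
by rewrite EFinD leeD// -nrmE.
Qed.

Let mW2 u psi : L2f u -> L2f psi -> mfunT (W2 u psi).
Proof. by move=> [mu _] [mp _]; rewrite /W2; mfun. Qed.

Let W2_ge0 u psi x : 0 <= W2 u psi x.
Proof. by rewrite addr_ge0 ?dot_ge0. Qed.

Let mLin_integrand e u psi : L2f u -> L2f psi ->
  mfunT (fun p => PDk e u p * dlt psi e p).
Proof.
by move=> [mu _] [mp _]; apply: measurable_funM; [exact: measurable_PDk|exact: measurable_dlt].
Qed.

Let mdom e u psi (c : R) : L2f u -> L2f psi ->
  mfunT (fun p : V * V => c * (kinv p.1 * (W2 u psi (p.2 + e *: p.1) + W2 u psi p.2))).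
Proof.
move=> hu hpsi; have := mW2 hu hpsi => h; have := @measurable_kinv R n => h'; mfun.
Qed.

Lemma Lin_integrable e u psi : 0 < e -> L2f u -> L2f psi ->
  (@leb2 R n).-integrable setT (fun p => (PDk e u p * dlt psi e p)%:E).
Proof.
move=> e0 hu hpsi; apply: leb2_integrable.
- exact: mLin_integrand.
- exact: (mdom e (fp0 * MJ) hu hpsi).
- by move=> p; exact: Lin_integrand_le.
- apply: le_lt_trans (II_kinv n2 e _ (mW2 hu hpsi) (W2_ge0 u psi) (W2_fin hu hpsi)) _; last exact: ltry.
  by pos.
Qed.

(** The concave f lies below its tangent. Since the argument is quadratic in the increment, the part
    linear in psi is [Lin], and the square of the increment of psi carries a slope between 0 and
    f'(0). The last constant grows like e^-2, but it is applied at a fixed horizon to a psi of the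
    size of a time step, where it is of second order. *)
Lemma PDr_semiconcave e u psi : 0 < e -> L2f u -> L2f psi ->
  PDr e (u + psi) <= PDr e u + Lin e u psi +
    (e ^+ 2 * omega)^-1 * (2 * fp0 * MJ * (2 ^+ n.+2 * (2 * nrm psi ^+ 2))) .
Proof.
move=> e0 hu hpsi; have hs := L2fD hu hpsi.
have [mu _] := hu; have [mp _] := hpsi; have [ms _] := hs.
pose Q p : R := fp0 * (Jn p.1 * (dlt psi e p ^+ 2 / enorm p.1 ^+ 3)).
have mdu := measurable_dlt e mu; have mdp := measurable_dlt e mp; have mds := measurable_dlt e ms.
have mQ : mfunT Q.
  by rewrite /Q; apply: measurable_funM; mfun.
have Q0 p : 0 <= Q p by rewrite /Q; have := J0 p.1 => ?; pos.
have QII : (II Q <= (2 * fp0 * MJ * (2 ^+ n.+2 * (2 * nrm psi ^+ 2)))%:E)%E.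
  apply: le_trans (II_kinv n2 e (c := 2 * fp0 * MJ) (w := fun x => dot (psi x) (psi x)) _ _ _ _).
  - apply: le_II => // p; rewrite /Q.
    have h2 := dlt_le psi e p; have h4 := ler_dotB2 (psi (p.2 + e *: p.1)) (psi p.2).
    set w := dot _ _ + _ in h4 *; set D := enorm (_ - _) in h2 h4.
    have w1 : 0 <= w by rewrite addr_ge0// dot_ge0.
    have h5 : dlt psi e p ^+ 2 / enorm p.1 ^+ 3 <= 2 * w / enorm p.1.
      apply: quotient_le; first exact: sqr_ge0.
      apply: le_trans (_ : D ^+ 2 * enorm p.1 ^+ 2 <= _); last by rewrite ler_wpM2r ?sqr_ge0.
      by rewrite -exprMn -real_normK ?num_real//; exact: sqr_mono.
    apply: (@le_trans _ _ (fp0 * (Jn p.1 * (2 * w / enorm p.1)))).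
      by rewrite ler_wpM2l ?(ltW fp0_gt0)// ler_wpM2l.
    have h6 := Jn_inv_le p.1.
    have h7 : fp0 * 2 * w * (Jn p.1 / enorm p.1) <= fp0 * 2 * w * (MJ * kinv p.1).
      by apply: ler_wpM2l => //; pos.
    apply: le_trans (le_trans h7 _); apply: le_of_eq; ring.
  - by pos.
  - by mfun.
  - by move=> x; exact: dot_ge0.
  - by rewrite -nrmE.
have pw p : PDd e (dlt (u + psi) e) p <=
    PDd e (dlt u e) p + (2 / e * (PDk e u p * dlt psi e p) + e^-1 * Q p).
  rewrite /PDd /PDk /Q.
  have -> : dlt (u + psi) e p = dlt u e p + dlt psi e p.
    by rewrite /dlt -dotDl /= addrACA opprD.
  set a := dlt u e p; set b := dlt psi e p; set c := enorm p.1 ^+ 3.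
  have h := pok_tan hp (parg_ge0 a p.1 e0) (parg_ge0 (a + b) p.1 e0).
  have /andP[g0 g1] := f1_parg a p.1 e0.
  have E : parg e (a + b) p.1 - parg e a p.1 = 2 / e * (a * b / c) + e^-1 * (b ^+ 2 / c).
    by rewrite /parg -/c invfM; ring.
  have {}h : f (parg e (a + b) p.1) <= f (parg e a p.1) + f1 (parg e a p.1) * (2 / e * (a * b / c)) +
     fp0 * (e^-1 * (b ^+ 2 / c)).
    apply: le_trans h _; rewrite E mulrDr addrA lerD2l ler_wpM2r//.
    by rewrite /c; pos.
  have := ler_wpM2l (J0 p.1) h; move=> /le_trans; apply.
  by apply: le_of_eq; ring.
have iS : (@leb2 R n).-integrable setT (fun p => (PDd e (dlt (u + psi) e) p)%:E).
  apply: leb2_integrable (II_PDd_fin e0 hs) => [|p|p].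
  - exact: measurable_PDd.
  - exact: measurable_PDd.
  - by rewrite ger0_norm// PDd_ge0.
have iU : (@leb2 R n).-integrable setT (fun p => (PDd e (dlt u e) p)%:E).
  apply: leb2_integrable (II_PDd_fin e0 hu) => [|p|p].
  - exact: measurable_PDd.
  - exact: measurable_PDd.
  - by rewrite ger0_norm// PDd_ge0.
have iQ : (@leb2 R n).-integrable setT (fun p => (Q p)%:E).
  apply: leb2_integrable (le_lt_trans QII (ltry _)) => //.
  by move=> p; rewrite ger0_norm.
have iL := Lin_integrable e0 hu hpsi.
have iL2 : (@leb2 R n).-integrable setT (EFin \o (fun p => 2 / e * (PDk e u p * dlt psi e p))).
  by rewrite (_ : _ \o _ = (fun p => (2 / e)%:E * (PDk e u p * dlt psi e p)%:E)%E)//; exact: integrableZl.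
have iQ2 : (@leb2 R n).-integrable setT (EFin \o (fun p => e^-1 * Q p)).
  by rewrite (_ : _ \o _ = (fun p => (e^-1)%:E * (Q p)%:E)%E)//; exact: integrableZl.
have key : SI (PDd e (dlt (u + psi) e)) <=
   SI (PDd e (dlt u e)) + (2 / e * SI (fun p => PDk e u p * dlt psi e p) + e^-1 * SI Q).
  rewrite /SI -[in X in _ <= X]RintegralZl// -[in X in _ <= X]RintegralZl//.
  have E1 := RintegralD measurableT iL2 iQ2; rewrite /= in E1; rewrite -E1.
  have iLQ : (@leb2 R n).-integrable setT
      (EFin \o (fun p => 2 / e * (PDk e u p * dlt psi e p) + e^-1 * Q p)).
    exact: integrableD iL2 iQ2.
  have E2 := RintegralD measurableT iU iLQ; rewrite /= in E2; rewrite -E2.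
  have iR := integrableD measurableT iU iLQ.
  by apply: le_Rintegral => // p _; exact: pw.
rewrite !SI_PDd// in key.
have SQ : SI Q <= 2 * fp0 * MJ * (2 ^+ n.+2 * (2 * nrm psi ^+ 2)).
  by rewrite -lee_fin SI_II//; exact: le_lt_trans QII (ltry _).
have ew : 0 < e * omega by rewrite mulr_gt0.
rewrite -(ler_pM2l ew) /Lin.
apply: le_trans key _; rewrite mulrDr mulrDr -addrA lerD2l.
apply: lerD.
  by apply: le_of_eq; field; rewrite !gt_eqF.
rewrite (_ : e * omega * _ = e^-1 * (2 * fp0 * MJ * (2 ^+ n.+2 * (2 * nrm psi ^+ 2)))).
  by rewrite ler_wpM2l// invr_ge0 ltW.
by field; rewrite !gt_eqF.
Qed.

(** The increment over m e z is the sum of m increments over e z. Cauchy-Schwarz bounds the argument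
    of f at scale m e by the sum of the m arguments at scale e, and f is monotone and subadditive.
    Each of the m terms has the same integral by translation, and this m cancels the one in the
    normalisation. *)
Lemma PDe_multiple (m : nat) e u : (0 < m)%N -> 0 < e -> mfunT u ->
  (PDe (m%:R * e) u <= PDe e u)%E.
Proof.
move=> m0 e0 mu; have mr : 0 < m%:R :> R by rewrite ltr0n.
have me : 0 < m%:R * e by rewrite mulr_gt0.
have md := measurable_dlt e mu; have mP := measurable_PDd e md.
have P0 p : 0 <= PDd e (dlt u e) p by exact: PDd_ge0.
have pw p : PDd (m%:R * e) (dlt u (m%:R * e)) p <=
    \sum_(j < m) PDd e (dlt u e) (p.1, p.2 + (j%:R * e) *: p.1).
  rewrite /PDd /= -mulr_sumr; apply: ler_wpM2l => //.
  pose dj (j : 'I_m) := dlt u e (p.1, p.2 + (j%:R * e) *: p.1).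
  have E : dlt u (m%:R * e) p = \sum_(j < m) dj j.
    rewrite /dj /dlt /= -(big_mkord xpredT (fun j => dot (u (p.2 + (j%:R * e) *: p.1 + e *: p.1) -
      u (p.2 + (j%:R * e) *: p.1)) p.1)).
    rewrite (eq_bigr (fun j => dot (u (p.2 + (j.+1%:R * e) *: p.1)) p.1 -
       dot (u (p.2 + (j%:R * e) *: p.1)) p.1)).
      by rewrite telescope_sumr// mul0r scale0r addr0 dotBl.
    move=> j _; rewrite dotBl; congr (dot (u _) _ - _).
    by rewrite -addrA -scalerDl -natr1 mulrDl mul1r.
  apply: (@le_trans _ _ (f (\sum_(j < m) parg e (dj j) p.1))); last first.
    by apply: pok_sum hp _ _ _ _ => j; exact: parg_ge0.
  apply: pok_nd hp _ _ _ _; first exact: parg_ge0.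
  rewrite /parg E -mulr_suml -mulrA invfM mulrA.
  apply: ler_wpM2r; first by rewrite invr_ge0; pos.
  by rewrite ler_pdivrMr// mulrC; exact: sqr_sum_le.
have : (II (PDd (m%:R * e) (dlt u (m%:R * e))) <= m%:R%:E * II (PDd e (dlt u e)))%E.
  apply: le_trans (le_II _ pw) _; first by move=> p; exact: PDd_ge0.
  have mj (j : 'I_m) : mfunT (fun p : V * V => PDd e (dlt u e) (p.1, p.2 + (j%:R * e) *: p.1)).
    apply: (measurableT_comp mP); apply: measurable_fun_pair => /=; mfun.
  rewrite -II_prod; [|exact: measurable_sum|by move=> p; exact: sumr_ge0].
  rewrite rint_sum//.
  rewrite (eq_bigr (fun=> II (PDd e (dlt u e)))).
    have := II_ge0 P0; case: (II _) => [r| |]//= _.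
      by rewrite sumEFin sumr_const card_ord -EFinM lee_fin mulr_natl.
    by rewrite gt0_muley ?lte_fin// leey.
  move=> j _; transitivity (II (fun p => PDd e (dlt u e) (p.1, p.2 + (j%:R * e) *: p.1))).
    by apply: (II_prod (mj j)) => p; exact: P0.
  exact: (II_shear (j%:R * e) mP P0).
move=> h; rewrite /PDe.
apply: (@le_trans _ _ ((m%:R * e * omega)^-1%:E * (m%:R%:E * II (PDd e (dlt u e))))%E).
  by apply: lee_wpmul2l => //; rewrite lee_fin invr_ge0; pos.
rewrite muleA -EFinM (_ : _ * _ = (e * omega)^-1)//.
by field; rewrite !gt_eqF.
Qed.

End PD.

(** * The peridynamic force as gradient of the energy *)

Lemma Rint_dilate (R : realType) n (l : R) (h : 'rV[R]_n) (F : 'rV[R]_n -> R) : l != 0 ->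
  (lebesgue_rV R n).-integrable setT (EFin \o F) ->
  \int[lebesgue_rV R n]_z F (l *: z + h) = (`|l| ^+ n)^-1 * \int[lebesgue_rV R n]_z F z.
Proof.
move=> l0 iF.
have mF : mfunT F by apply/measurable_EFinP; exact: measurable_int iF.
pose Fp p := Num.max (F p) 0; pose Fm p := Num.max (- F p) 0.
have mFp : mfunT Fp by exact: measurable_funrpos.
have mFm : mfunT Fm by exact: measurable_funrneg.
have Fp0 p : 0 <= Fp p by rewrite /Fp le_max lexx orbT.
have Fm0 p : 0 <= Fm p by rewrite /Fm le_max lexx orbT.
have EP (G : 'rV[R]_n -> R) x : (EFin \o G)^\+%E x = (Num.max (G x) 0)%:E.
  by rewrite funeposE /= EFin_max.
have EN (G : 'rV[R]_n -> R) x : (EFin \o G)^\-%E x = (Num.max (- G x) 0)%:E.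
  by rewrite funenegE /= EFin_max.
have fp : (\int[lebesgue_rV R n]_x (Fp x)%:E)%E \is a fin_num.
  have := integrable_pos_fin_num measurableT iF.
  by under eq_integral => x _ do rewrite EP.
have fm : (\int[lebesgue_rV R n]_x (Fm x)%:E)%E \is a fin_num.
  have := integrable_neg_fin_num measurableT iF.
  by under eq_integral => x _ do rewrite EN.
rewrite /Rintegral.
have -> : (\int[lebesgue_rV R n]_x (F (l *: x + h))%:E =
   (`|l| ^+ n)^-1%:E * \int[lebesgue_rV R n]_x (F x)%:E)%E.
  rewrite integralE [in RHS]integralE.
  under eq_integral => x _ do rewrite (EP (fun x => F (l *: x + h))).
  under [X in (_ - X)%E]eq_integral => x _ do rewrite (EN (fun x => F (l *: x + h))).
  under [X in (_ = _ * (X - _))%E]eq_integral => x _ do rewrite EP.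
  under [X in (_ = _ * (_ - X))%E]eq_integral => x _ do rewrite EN.
  rewrite muleBr//; last exact: fin_num_adde_defr.
  by rewrite (rint_dilate h l0 mFp Fp0) (rint_dilate h l0 mFm Fm0).
by rewrite fineM//; exact: integrable_fin_num iF.
Qed.

Section gradient.
Context (R : realType) (n : nat).
Local Notation V := 'rV[R]_n.
Local Notation leb := (lebesgue_rV R n).
Local Notation omega := (unit_ball_volume R n).
Variables (f0 : R -> R) (J : R -> R) (f f1 : R -> R) (fp0 finf : R) (MJ : R).
Implicit Types (u v psi : V -> V) (e q D : R) (p : V * V) (z x : V).
Local Notation Jn := (fun z : V => J (enorm z)).

Hypothesis n2 : (2 <= n)%N.
Hypothesis hp : pot_ok f f1 fp0 finf.
Hypothesis FE : forall r : R, 0 <= r -> f r = f0 r.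
Hypothesis FD : forall r e : R, 0 <= r -> 0 < e -> exists2 dl : R, 0 < dl &
  forall s : R, 0 <= s -> `|s - r| < dl -> `|f s - f r - f1 r * (s - r)| <= e * `|s - r|.
Hypothesis hk : ker_ok Jn MJ.

Let w0 : 0 < omega. Proof. exact: unit_ball_volume_gt0. Qed.
Let fp0_gt0 : 0 < fp0 := pok_fp0 hp.
Let finf_gt0 : 0 < finf := pok_finf hp.
Let J0 z : 0 <= J (enorm z). Proof. exact: (kok_ge0 hk z). Qed.
Let MJ0 : 0 <= MJ. Proof. exact: le_trans (J0 0) (kok_le hk 0). Qed.

(** Young's inequality for |q|, weighted so that the product of [parg] with [f1] appears; by
    concavity this product is at most f, hence at most f_oo. The resulting bound is independent of
    q, so the force is integrable over bonds for every measurable u. *)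
Lemma f1_arg_le e q z : 0 < e -> z != 0 ->
  f1 (parg e q z) * `|q| <= 2^-1 * (finf * e * enorm z ^+ 2 + fp0 * enorm z).
Proof.
move=> e0 z0; have z1 : 0 < enorm z by rewrite enorm_gt0.
have a0 := parg_ge0 q z e0.
have /andP[g0 g1] := pok_f1 hp a0.
have h1 : parg e q z * f1 (parg e q z) <= finf.
  by apply: le_trans (pok_rf1 hp a0) _; have /andP[] := pok_f hp a0.
have h2 : `|q| <= 2^-1 * (parg e q z * e * enorm z ^+ 2 + enorm z).
  have -> : parg e q z * e * enorm z ^+ 2 = `|q| ^+ 2 / enorm z.
    by rewrite /parg real_normK ?num_real//; field; rewrite !gt_eqF.
  have : 0 <= (`|q| - enorm z) ^+ 2 / enorm z by apply: divr_ge0; [exact: sqr_ge0|exact: ltW].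
  have -> : (`|q| - enorm z) ^+ 2 / enorm z = `|q| ^+ 2 / enorm z - 2 * `|q| + enorm z.
    by field; rewrite gt_eqF.
  by move=> h; lra.
have h3 := ler_wpM2l g0 h2; apply: le_trans h3 _.
have h4 : 0 <= (finf - parg e q z * f1 (parg e q z)) * (e * enorm z ^+ 2).
  by rewrite mulr_ge0 ?subr_ge0// mulr_ge0 ?exprn_ge0// ltW.
have h5 : 0 <= (fp0 - f1 (parg e q z)) * enorm z by apply: mulr_ge0; rewrite ?subr_ge0// ltW.
lra.
Qed.

Lemma PDk_coord_le e u p (t : R) : 0 < e -> `|t| <= enorm p.1 ->
  `|PDk f1 Jn e u p * t| <= MJ * (finf * e + fp0) * kinv p.1.
Proof.
move=> e0 ht; set z := p.1 in ht *.
have K0 : 0 <= MJ * (finf * e + fp0) * kinv z.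
  by have := kinv_ge0 z => ?; pos.
have [z0|z0] := eqVneq z 0.
  by rewrite /PDk -/z z0 enorm0 expr0n/= invr0 mulr0 mul0r normr0 -z0.
have [z1|z1] := leP 1 (enorm z).
  by rewrite /PDk -/z (kok_supp hk z1) !mul0r normr0.
have zp : 0 < enorm z by rewrite enorm_gt0.
have h := f1_arg_le (dlt u e p) e0 z0.
have /andP[g0 _] := pok_f1 hp (parg_ge0 (dlt u e p) z e0).
rewrite /PDk -/z !normrM normfV normrX (ger0_norm (ltW zp)) (ger0_norm (J0 _)) (ger0_norm g0).
set g := f1 _ in h g0 *.
apply: (@le_trans _ _ (Jn z * (g * `|dlt u e p|) / enorm z ^+ 3 * enorm z)).
  rewrite -[Jn z * g * _]mulrA; apply: ler_wpM2l => //; pos; exact: J0.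
apply: (@le_trans _ _ (Jn z * (2^-1 * (finf * e * enorm z ^+ 2 + fp0 * enorm z)) / enorm z ^+ 3 * enorm z)).
  rewrite ler_wpM2r ?(ltW zp)// ler_wpM2r ?invr_ge0 ?exprn_ge0 ?(ltW zp)//.
  by rewrite ler_wpM2l//; exact: J0.
have -> : Jn z * (2^-1 * (finf * e * enorm z ^+ 2 + fp0 * enorm z)) / enorm z ^+ 3 * enorm z =
   2^-1 * (finf * e * enorm z + fp0) * (Jn z / enorm z).
  by field; rewrite gt_eqF.
have hJ := Jn_inv_le hk z.
have c1 : 2^-1 * (finf * e * enorm z + fp0) <= finf * e + fp0.
  have k1 : 0 <= finf * e * (1 - enorm z) by rewrite mulr_ge0 ?subr_ge0 ?(ltW z1)// mulr_ge0// ltW.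
  have k2 : 0 < finf * e by rewrite mulr_gt0.
  by have := fp0_gt0; lra.
rewrite (_ : MJ * _ * _ = (finf * e + fp0) * (MJ * kinv z)); last by ring.
apply: ler_pM => //.
- by pos.
- by have := J0 z => ?; pos.
Qed.

Lemma integrable_kinv (c : R) : leb.-integrable setT (fun z => (c * kinv z)%:E).
Proof.
apply: (@integrableZl _ _ _ leb _ measurableT c (EFin \o @kinv R n)).
apply/integrableP; split; first by apply/measurable_EFinP; exact: measurable_kinv.
apply: le_lt_trans (ltry (2 ^+ n.+2)); apply: le_trans (rint_kinv R n2).
by apply: ge0_le_integralT => z; rewrite ?abse_ge0//= ger0_norm ?kinv_ge0.
Qed.

Lemma PDk_coord_integrable e u x (t : V -> R) : 0 < e -> mfunT u ->
  mfunT t -> (forall z, `|t z| <= enorm z) ->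
  leb.-integrable setT (EFin \o (fun z => PDk f1 Jn e u (z, x) * t z)).
Proof.
move=> e0 mu mt ht; have mP := measurable_PDk hp hk e mu.
apply: le_integrable (integrable_kinv (MJ * (finf * e + fp0))) => //.
  apply/measurable_EFinP; apply: measurable_funM => //.
  by apply: (measurableT_comp mP); exact: pair2_measurable.
move=> z _; rewrite /= lee_fin.
by apply: le_trans (PDk_coord_le u (p := (z, x)) e0 (ht z)) (ler_norm _).
Qed.

Definition PDkk e u x : V := \row_i \int[leb]_z (PDk f1 Jn e u (z, x) * z ord0 i).

(** The substitution y = x + e z. The 4 collects the 2 in the definition of the gradient and the 2
    from differentiating S^2. *)
Lemma gradPDE e u x : 0 < e -> mfunT u ->
  gradPD f0 J e u x = (- (4 / (e ^+ 2 * omega))) *: PDkk e u x.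
Proof.
move=> e0 mu; apply/rowP => i; rewrite !mxE.
have en0 : e != 0 by rewrite gt_eqF.
pose H z := PDk f1 Jn e u (z, x) * z ord0 i.
have iH : leb.-integrable setT (EFin \o H).
  apply: PDk_coord_integrable => //; first exact: measurable_rV_coord.
  by move=> z; exact: ler_coord_enorm.
have pw y : ((fun y => dS_cohesive_energy f0 J e (strain u y x) (y - x) *
       ((enorm (y - x))^-1 *: (y - x)) ord0 i) \_ (eball x e)) y =
    2 / e ^+ 2 * H (e^-1 *: y + (- (e^-1 *: x))).
  set z := e^-1 *: y + _.
  have zE : z = e^-1 *: (y - x) by rewrite /z scalerBr.
  have yE : y - x = e *: z by rewrite zE scalerA mulfV// scale1r.
  have yE' : x + e *: z = y by rewrite -yE addrC subrK.
  have nE : enorm (y - x) = e * enorm z by rewrite yE enormZ gtr0_norm.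
  rewrite patchE; case: ifPn => [/set_mem yb|yb]; last first.
    rewrite /H /PDk /= (kok_supp hk) ?mul0r ?mulr0//.
    move/negP: yb => yb; rewrite leNgt; apply/negP => z1; apply: yb; apply/mem_set.
    by rewrite /eball/= nE -[ltRHS]mulr1 ltr_pM2l.
  have [z0|z0] := eqVneq z 0.
    by rewrite /H z0 yE z0 scaler0 scaler0 !mxE !mulr0.
  have zp : 0 < enorm z by rewrite enorm_gt0.
  clearbody z; rewrite (dS_cohesive_energyE J hp FE FD) /H /PDk /= !mxE nE.
  have -> : e * enorm z / e = enorm z by field.
  have SE : strain u y x = dlt u e (z, x) / (e * enorm z ^+ 2).
    rewrite /strain /dlt /= yE' dotZl dotZr nE yE dotZr.
    by field; rewrite en0 gt_eqF.
  have pE : e * enorm z * strain u y x ^+ 2 = parg e (dlt u e (z, x)) z.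
    by rewrite SE /parg; field; rewrite en0 gt_eqF.
  rewrite pE SE (_ : y ord0 i - x ord0 i = e * z ord0 i); last first.
    by have := congr1 (fun v : V => v ord0 i) yE; rewrite !mxE.
  by field; rewrite en0 gt_eqF.
rewrite Rintegral_mkcond (_ : _ \_ _ = fun y => 2 / e ^+ 2 * H (e^-1 *: y + - (e^-1 *: x))); last first.
  by apply/funext => y; exact: pw.
have iH' : leb.-integrable setT (EFin \o (fun y => H (e^-1 *: y + - (e^-1 *: x)))).
  have mH : mfunT H by apply/measurable_EFinP; exact: measurable_int iH.
  apply/integrableP; split; first by apply/measurable_EFinP; mfun.
  have := rint_dilate (- (e^-1 *: x)) (_ : e^-1 != 0) (f := fun z => `|H z|).
  rewrite invr_eq0 => /(_ en0) h; rewrite /= h; [|by mfun|by []].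
  apply: lte_mul_pinfty => //.
  by have /integrableP[_] := iH.
rewrite RintegralZl// Rint_dilate ?invr_eq0//.
rewrite gtr0_norm ?invr_gt0//  exprVn invrK.
by field; rewrite !gt_eqF ?exprn_gt0.
Qed.

(** Nonlocal integration by parts. The increment of psi has a contribution from each end of the
    bond, the exchange of the ends turns one into the other, and Fubini leaves psi paired with the
    force. The disjunction in the hypothesis reflects that the equation of motion holds on the
    interior only, while test fields vanish elsewhere. *)
Lemma Lin_ip e u psi g : 0 < e -> L2f u -> L2f psi -> L2f g ->
  {ae leb, forall x, psi x = 0 \/ g x = gradPD f0 J e u x} ->
  Lin f1 Jn e u psi = ip g psi.
Proof.
move=> e0 hu hpsi hg hae; have [mu _] := hu; have [mp _] := hpsi; have [mg _] := hg.
have en0 : e != 0 by rewrite gt_eqF.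
have mk := measurable_PDk hp hk e mu.
pose A p := PDk f1 Jn e u p * dot (psi p.2) p.1.
have mA : mfunT A by rewrite /A; apply: measurable_funM => //; mfun.
pose w x := dot (u x) (u x) + dot (psi x) (psi x).
have mw : mfunT w by rewrite /w; mfun.
have ww x : 0 <= w x by rewrite addr_ge0 ?dot_ge0.
have mdom : mfunT (fun p : V * V => fp0 * MJ * (kinv p.1 * (w (p.2 + e *: p.1) + w p.2))).
  by have := @measurable_kinv R n => ?; mfun.
have Adom p : `|A p| <= fp0 * MJ * (kinv p.1 * (w (p.2 + e *: p.1) + w p.2)).
  have /andP[g0 g1] := f1_parg hp (dlt u e p) p.1 e0.
  have h1 := dlt_le u e p.
  have h3 := ler_dotB2 (u (p.2 + e *: p.1)) (u p.2).
  have h4 := ler_dot_enorm (psi p.2) p.1.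
  have h5 := sqr_enorm (psi p.2).
  set a := enorm (u _ - u _) in h1 h3; set b := enorm (psi _) in h4 h5.
  have a0 : 0 <= a by exact: enorm_ge0.
  have b0 : 0 <= b by exact: enorm_ge0.
  set W := _ + w p.2.
  have hW : a * b <= W.
    rewrite /W /w; have := sqr_ge0 (a - b); rewrite sqrrB -h5.
    by have := dot_ge0 (psi (p.2 + e *: p.1)); have := sqr_ge0 b; lra.
  have J1 := Jn_inv_le hk p.1.
  rewrite /A /PDk !normrM normfV normrX (ger0_norm (enorm_ge0 _)) (ger0_norm (J0 _)) (ger0_norm g0).
  have : `|dlt u e p| * `|dot (psi p.2) p.1| / enorm p.1 ^+ 3 <= W / enorm p.1.
    apply: quotient_le; first by rewrite mulr_ge0.
    apply: (@le_trans _ _ ((a * enorm p.1) * (b * enorm p.1))); first exact: ler_pM.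
    by rewrite (_ : _ * _ = a * b * enorm p.1 ^+ 2) ?ler_wpM2r ?exprn_ge0 ?enorm_ge0//; ring.
  pose Q : R := `|dlt u e p| * `|dot (psi p.2) p.1| / enorm p.1 ^+ 3; rewrite -/Q => hQ.
  have W00 : 0 <= W by apply: addr_ge0; exact: ww.
  have EQ (j0 g2 t0 k0 m0 : R) : j0 * g2 * t0 / k0 * m0 = g2 * (j0 * (t0 * m0 / k0)) by ring.
  rewrite EQ -/Q.
  rewrite -mulrA; apply: ler_pM => //.
    by have := J0 p.1 => ?; rewrite /Q; pos.
  apply: (@le_trans _ _ (J (enorm p.1) * (W / enorm p.1))).
    by rewrite ler_wpM2l//; exact: J0.
  rewrite (_ : _ * (W / _) = W * (J (enorm p.1) / enorm p.1)); last by ring.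
  apply: le_trans (ler_wpM2l W00 J1) _.
  by apply: le_of_eq; ring.
have wfin : (\int[leb]_x (w x)%:E <= (nrm u ^+ 2 + nrm psi ^+ 2)%:E)%E.
  rewrite /w rintD; [|sidec..].
  by rewrite EFinD leeD// -nrmE.
have iA : (@leb2 R n).-integrable setT (fun p => (A p)%:E).
  apply: (leb2_integrable mA mdom Adom).
  by apply: le_lt_trans (II_kinv n2 e _ mw ww wfin) _; [rewrite mulr_ge0// ltW|rewrite ltry].
pose B p := A (- p.1, p.2 + e *: p.1).
have TE p : PDk f1 Jn e u p * dlt psi e p = - B p - A p.
  rewrite /B /A /PDk /= /dlt /=.
  have -> : p.2 + e *: p.1 + e *: - p.1 = p.2 by rewrite scalerN addrK.
  rewrite enormN.
  have -> : dot (u p.2 - u (p.2 + e *: p.1)) (- p.1) = dot (u (p.2 + e *: p.1) - u p.2) p.1.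
    by rewrite dotNr -dotNl opprB.
  have -> : parg e (dot (u (p.2 + e *: p.1) - u p.2) p.1) (- p.1) =
     parg e (dot (u (p.2 + e *: p.1) - u p.2) p.1) p.1 by rewrite /parg enormN.
  set tau := dot (u _ - u _) _; rewrite dotNr dotBl; ring.
have iT := Lin_integrable n2 hp hk e0 hu hpsi.
have BE p : B p = (-1) * (PDk f1 Jn e u p * dlt psi e p) + (-1) * A p by rewrite TE; ring.
have iN (F : V * V -> R) : (@leb2 R n).-integrable setT (fun p => (F p)%:E) ->
    (@leb2 R n).-integrable setT (EFin \o (fun p => -1 * F p)).
  move=> iF; rewrite (_ : _ \o _ = (fun p => (-1)%:E * (F p)%:E)%E)//; exact: integrableZl.
have SIT : SI (fun p => PDk f1 Jn e u p * dlt psi e p) = - 2 * SI A.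
  have : SI B = SI A by exact: SI_flip.
  have -> : SI B = -1 * SI (fun p => PDk f1 Jn e u p * dlt psi e p) + -1 * SI A.
    rewrite /SI -RintegralZl// -RintegralZl//.
    have E1 := RintegralD measurableT (iN _ iT) (iN _ iA); rewrite /= in E1; rewrite -E1.
    by apply: eq_Rintegral => p _; exact: BE.
  lra.
rewrite /Lin SIT.
have ptw x : (\int[leb]_z (A (z, x))%:E = (dot (psi x) (PDkk e u x))%:E)%E.
  have iz i : leb.-integrable setT (EFin \o (fun z => PDk f1 Jn e u (z, x) * z ord0 i)).
    apply: PDk_coord_integrable => //; first exact: measurable_rV_coord.
    by move=> z; exact: ler_coord_enorm.
  have iz' i : leb.-integrable setT (fun z => (psi x ord0 i * (PDk f1 Jn e u (z, x) * z ord0 i))%:E).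
    exact: (integrableZl measurableT (psi x ord0 i) (iz i)).
  transitivity (\int[leb]_z \sum_i (psi x ord0 i * (PDk f1 Jn e u (z, x) * z ord0 i))%:E)%E.
    apply: eq_integral => z _; rewrite sumEFin /A /dot /= mulr_sumr; congr EFin.
    by apply: eq_bigr => i _; ring.
  rewrite integral_sum// /dot -sumEFin; apply: eq_bigr => i _.
  rewrite mxE EFinM /Rintegral fineK; last exact: (integrable_fin_num measurableT (iz i)).
  rewrite -integralZl//; exact: iz.
have iPk : leb.-integrable setT (EFin \o (fun x => dot (psi x) (PDkk e u x))).
  have mAE : mfunT (fun p => (A p)%:E) by apply/measurable_EFinP.
  apply/integrableP; split.
    have := measurable_fubini_G iA; congr (measurable_fun _ _).
    by apply/funext => x; rewrite /fubini_G ptw.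
  have h21 : (\int[leb]_x \int[leb]_z `|(A (z, x))%:E| < +oo)%E.
    exact: (integrable21ltyP leb leb mAE).1 iA.
  apply: le_lt_trans h21; apply: ge0_le_integralT => x.
    exact: abse_ge0.
  rewrite (_ : (EFin \o _) x = \int[leb]_z (A (z, x))%:E)%E; last by rewrite ptw.
  apply: le_abse_integral => //.
  by apply: (measurableT_comp mAE); exact: pair2_measurable.
have SA : SI A = \int[leb]_x dot (psi x) (PDkk e u x).
  apply: EFin_inj; rewrite -(SI_iter mA iA) /Rintegral fineK; last exact: integrable_fin_num iPk.
  by apply: eq_integral => x _; exact: ptw.
have mPk : mfunT (fun x => dot (psi x) (PDkk e u x)).
  by apply/measurable_EFinP; exact: measurable_int iPk.
rewrite SA mulrA (_ : 2 / _ * _ = - (4 / (e ^+ 2 * omega))); last first.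
  by field; rewrite en0 gt_eqF.
rewrite -RintegralZl// /ip; congr fine; apply: ae_eq_integral => //.
- by apply/measurable_EFinP; mfun.
- by apply/measurable_EFinP; mfun.
apply: filterS hae => x [hx|hx] _; first by rewrite hx !(dot0l, dot0r) mulr0.
by rewrite hx gradPDE// dotZl dotC.
Qed.

End gradient.

(** * Estimates uniform in the horizon *)

Section estimates.
Context (R : realType) (n : nat).
Local Notation V := 'rV[R]_n.
Local Notation leb := (lebesgue_rV R n).
Local Notation omega := (unit_ball_volume R n).
Variables (f f1 : R -> R) (fp0 finf : R) (Jn : V -> R) (MJ : R).
Implicit Types (u v psi : V -> V) (e q D : R) (p : V * V) (z x : V).

Hypothesis n2 : (2 <= n)%N.
Hypothesis hp : pot_ok f f1 fp0 finf.
Hypothesis hk : ker_ok Jn MJ.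

Let w0 : 0 < omega. Proof. exact: unit_ball_volume_gt0. Qed.
Let fp0_gt0 : 0 < fp0. Proof. exact: pok_fp0 hp. Qed.
Let finf_gt0 : 0 < finf. Proof. exact: pok_finf hp. Qed.
Let J0 z : 0 <= Jn z. Proof. exact: (kok_ge0 hk z). Qed.
Let MJ0 : 0 <= MJ. Proof. exact: le_trans (J0 0) (kok_le hk 0). Qed.
Let mJ : mfunT Jn. Proof. exact: kok_m hk. Qed.

(** Same inequality as [f1_arg_le] with another weight and f kept on the right, so that the energy
    density itself dominates the force. *)
Lemma f1_arg_le_f e q z : 0 < e -> z != 0 ->
  f1 (parg e q z) * `|q| <= 2^-1 * (f (parg e q z) * enorm z ^+ 2 + fp0 * e * enorm z).
Proof.
move=> e0 z0; have z1 : 0 < enorm z by rewrite enorm_gt0.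
have a0 := parg_ge0 q z e0.
have /andP[g0 g1] := pok_f1 hp a0.
have h1 := pok_rf1 hp a0.
have h2 : `|q| <= 2^-1 * (parg e q z * enorm z ^+ 2 + e * enorm z).
  have -> : parg e q z * enorm z ^+ 2 = `|q| ^+ 2 / (e * enorm z).
    by rewrite /parg real_normK ?num_real//; field; rewrite !gt_eqF.
  have : 0 <= (`|q| - e * enorm z) ^+ 2 / (e * enorm z).
    by apply: divr_ge0; [exact: sqr_ge0|pos].
  have -> : (`|q| - e * enorm z) ^+ 2 / (e * enorm z) = `|q| ^+ 2 / (e * enorm z) - 2 * `|q| + e * enorm z.
    by field; rewrite !gt_eqF.
  by move=> h; lra.
have h3 := ler_wpM2l g0 h2; apply: le_trans h3 _.
have h4 : 0 <= (f (parg e q z) - parg e q z * f1 (parg e q z)) * (enorm z ^+ 2).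
  by apply: mulr_ge0; rewrite ?subr_ge0// exprn_ge0// ltW.
have h5 : 0 <= (fp0 - f1 (parg e q z)) * (e * enorm z).
  by apply: mulr_ge0; [rewrite subr_ge0|pos].
lra.
Qed.

(** The increment of a Lipschitz field over a bond is at most L e |z|. This e and the one in the
    normalisation of [PDe] absorb the factor e^-2 of [Lin], and [f1_arg_le_f] bounds the rest by the
    energy density and a constant on the bonds near the support. *)
Lemma Lin_test e u psi (L r : R) : 0 < e -> e <= 1 -> L2f u -> mfunT psi ->
  0 <= L -> (forall x y : V, enorm (psi x - psi y) <= L * enorm (x - y)) ->
  0 <= r -> (forall x, ~ rV_box 0 r x -> psi x = 0) ->
  `|Lin f1 Jn e u psi| <= L * PDr f Jn e u + L * (fp0 * MJ * (2 * (r + 1)) ^+ n).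
Proof.
move=> e0 e1 hu mpsi L0 hL r0 hr; have [mu _] := hu.
have md := measurable_dlt e mu; have mP := measurable_PDd hp hk e md.
pose G p : R := L * e / 2 * (PDd f Jn e (dlt u e) p + e * (fp0 * MJ) *
   (\1_(eball 0 1) p.1 * \1_(rV_box 0 (r + 1)) p.2)).
pose c : R := L * e / 2 * (e * omega * PDr f Jn e u + e * (fp0 * MJ) * (omega * (2 * (r + 1)) ^+ n)).
have mTT : mfunT (fun p : V * V => (\1_(eball 0 1) p.1 * \1_(rV_box 0 (r + 1)) p.2 : R)).
  have mB1 : mfunT (\1_(eball (0 : V) 1) : V -> R) by mfun.
  have mB2 : mfunT (\1_(rV_box (0 : V) (r + 1)) : V -> R) by mfun.
  by mfun.
have P0 p : 0 <= PDd f Jn e (dlt u e) p by exact: (PDd_ge0 hp hk).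
have IIG : (II G = c%:E)%E.
  rewrite /G IIZ; [|sidec..].
  rewrite IID//; [|sidec..].
  rewrite IIZ//; [|sidec..].
  rewrite (II_PDd n2 hp hk)// II_tensor; [|sidec..].
  have hB : (\int[leb]_z (\1_(eball (0 : V) 1) z)%:E = omega%:E)%E.
    rewrite rint_indic; last exact: measurable_eball.
    exact: unit_ball_volumeE.
  have hQ : (\int[leb]_x (\1_(rV_box (0 : V) (r + 1)) x)%:E = ((2 * (r + 1)) ^+ n)%:E)%E.
    rewrite rint_indic; last exact: measurable_rV_box.
    by apply: lebesgue_rV_box; rewrite addr_ge0.
  by rewrite hB hQ.
have key p : `|PDk f1 Jn e u p * dlt psi e p| <= G p.
  have G0 : 0 <= G p by rewrite /G; have := P0 p => ?; pos.
  rewrite /PDk; set z := p.1 in G0 *; set x := p.2 in G0 *.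
  have [z1|z1] := leP 1 (enorm z); first by rewrite (kok_supp hk z1) !mul0r normr0.
  have [z0|z0] := eqVneq z 0.
    have -> : dlt psi e p = 0 by rewrite /dlt -/z z0 dot0r.
    by rewrite mulr0 normr0.
  have zp : 0 < enorm z by rewrite enorm_gt0.
  have [xb|xb] := boolP (x \in rV_box 0 (r + 1)); last first.
    have xo : psi x = 0.
      apply: hr => h; move/negP: xb; apply; apply/mem_set => i.
      by apply: le_trans (h i) _; rewrite lerDl.
    have xo' : psi (x + e *: z) = 0.
      apply: hr => h; move/negP: xb; apply; apply/mem_set => i.
      have := h i; rewrite !mxE !subr0 => h'.
      have zi : `|e * z ord0 i| <= 1.
        rewrite normrM gtr0_norm//; apply: (@le_trans _ _ (1 * enorm z)); last by rewrite mul1r ltW.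
        by apply: ler_pM => //; [exact: ltW|exact: ler_coord_enorm].
      have := ler_normB (x ord0 i + e * z ord0 i) (e * z ord0 i).
      by rewrite addrK; lra.
    have -> : dlt psi e p = 0 by rewrite /dlt -/z -/x xo xo' subr0 dot0l.
    by rewrite mulr0 normr0.
  have dp : `|dlt psi e p| <= L * (e * enorm z ^+ 2).
    apply: le_trans (dlt_le psi e p) _; rewrite -/z -/x.
    have := hL (x + e *: z) x; rewrite addrAC subrr add0r enormZ gtr0_norm// => h.
    rewrite (_ : L * _ = L * (e * enorm z) * enorm z); last by ring.
    by rewrite ler_wpM2r// ltW.
  have /andP[g0 _] := f1_parg hp (dlt u e p) z e0.
  have h := f1_arg_le_f (dlt u e p) e0 z0.
  rewrite !normrM normfV normrX (ger0_norm (ltW zp)) (ger0_norm (J0 _)) (ger0_norm g0).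
  set g := f1 _ in h g0 *; set F := f _ in h.
  have JM : Jn z <= MJ by exact: kok_le hk z.
  apply: (@le_trans _ _ (Jn z * (2^-1 * (F * enorm z ^+ 2 + fp0 * e * enorm z)) / enorm z ^+ 3 *
     (L * (e * enorm z ^+ 2)))).
    apply: ler_pM => //; first by have := J0 z => ?; pos.
    rewrite ler_wpM2r ?invr_ge0 ?exprn_ge0 ?(ltW zp)//.
    by rewrite -mulrA ler_wpM2l.
  rewrite /G /PDd -/z -/x -/F !indicE xb mem_eball0 z1 /= !mulr1.
  have -> : Jn z * (2^-1 * (F * enorm z ^+ 2 + fp0 * e * enorm z)) / enorm z ^+ 3 * (L * (e * enorm z ^+ 2))
     = L * e / 2 * (Jn z * F * enorm z + fp0 * e * Jn z).
    by field; rewrite gt_eqF.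
  have F0 : 0 <= F by exact: (f_parg_ge0 hp).
  apply: ler_wpM2l; first by pos.
  apply: lerD.
    by rewrite -[leRHS]mulr1; apply: ler_wpM2l; [exact: mulr_ge0|exact: ltW].
  rewrite (_ : e * (fp0 * MJ) = fp0 * e * MJ); last by ring.
  by apply: ler_wpM2l => //; pos.
have mG : mfunT G by rewrite /G; mfun.
have mT : mfunT (fun p => PDk f1 Jn e u p * dlt psi e p).
  by apply: measurable_funM; [exact: (measurable_PDk hp hk)|exact: measurable_dlt].
have h : `|SI (fun p => PDk f1 Jn e u p * dlt psi e p)| <= c by apply: SI_le mT mG key _; rewrite IIG.
rewrite /Lin normrM ger0_norm; last by pos.
apply: (@le_trans _ _ (2 / (e ^+ 2 * omega) * c)); first by rewrite ler_wpM2l//; pos.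
by apply: le_of_eq; rewrite /c; field; rewrite !gt_eqF.
Qed.

(** Replacing e by the smaller eta in the denominator of the argument can only increase f. The
    remaining change of increments is paid through the tangent inequality, with L^1 size t1 for the
    displacement of the far end in u and t2 for u - v at each of the two ends. The sup bound M makes
    the quadratic term of the tangent estimate linear. *)
Lemma PDr_lsc e eta u v (M t1 t2 : R) : 0 < eta -> eta <= e ->
  L2f u -> L2f v -> (forall x, enorm (u x) <= M) -> (forall x, enorm (v x) <= M) ->
  (forall z, enorm z < 1 -> (\int[leb]_x (enorm (u (x + e *: z)%R - u (x + eta *: z)%R)%R)%:E <= t1%:E)%E) ->
  (\int[leb]_x (enorm (u x - v x)%R)%:E <= t2%:E)%E ->
  PDr f Jn e u <= PDr f Jn eta v +
    (e * omega)^-1 * (MJ * (finf + fp0 / e * (1 + 4 * M)) * 2 ^+ n.+2) * (t1 + 2 * t2).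
Proof.
move=> eta0 etae hu hv uM vM ht1 ht2; have [mu _] := hu; have [mv _] := hv.
have e0 : 0 < e by exact: lt_le_trans eta0 etae.
have M0 : 0 <= M by apply: le_trans (uM 0); exact: enorm_ge0.
pose K : R := MJ * (finf + fp0 / e * (1 + 4 * M)).
have K0 : 0 <= K by rewrite /K; pos.
pose W x : R := enorm (u x - v x).
pose W1 p : R := enorm (u (p.2 + e *: p.1) - u (p.2 + eta *: p.1)).
have mW : mfunT W by rewrite /W; mfun.
have mW1 : mfunT W1 by rewrite /W1; mfun.
pose D p : R := W1 p + (W (p.2 + eta *: p.1) + W p.2).
have mD : mfunT D.
  rewrite /D; apply: measurable_funD => //.
  by apply: measurable_funD; mfun.
have D0 p : 0 <= D p by rewrite /D /W1 /W; pos.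
have W0 x : 0 <= W x by exact: enorm_ge0.
have mk := @measurable_kinv R n.
have k0 := @kinv_ge0 R n.
have t10 : 0 <= t1.
  rewrite -lee_fin; apply: le_trans (ht1 0 _); last by rewrite enorm0.
  exact: rint_ge0.
have t20 : 0 <= t2 by rewrite -lee_fin; apply: le_trans ht2; exact: rint_ge0.
have bound : (II (fun p => (K * (kinv p.1 * D p))%R) <= (K * (2 ^+ n.+2 * (t1 + 2 * t2)))%:E)%E.
  apply: (@le_trans _ _ (\int[leb]_z (K * (t1 + 2 * t2) * kinv z)%:E)%E); last first.
    rewrite rintZl//; last by pos.
    rewrite (_ : K * (2 ^+ n.+2 * _) = K * (t1 + 2 * t2) * 2 ^+ n.+2); last by ring.
    rewrite [in leRHS]EFinM; apply: lee_wpmul2l; last exact: rint_kinv.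
    by rewrite lee_fin; pos.
  apply: ge0_le_integralT => z.
    by apply: rint_ge0 => x /=; have := D0 (z, x) => ?; have := k0 z => ?; pos.
  have mDz : mfunT (fun x => D (z, x)).
    by apply: (measurableT_comp mD); exact: pair1_measurable.
  have kz := k0 z.
  have Kz : 0 <= K * kinv z by pos.
  have -> : (\int[leb]_x (K * (kinv (z, x).1 * D (z, x)))%:E = (K * kinv z)%:E * \int[leb]_x (D (z, x))%:E)%E.
    rewrite -rintZl//; by apply: eq_integral => x _; rewrite /= mulrA.
  have [z1|z1] := ltP (enorm z) 1; last first.
    have -> : kinv z = 0 by rewrite /kinv indicE mem_eball0 ltNge z1 mul0r.
    by rewrite !mulr0 mul0e.
  rewrite (_ : K * (t1 + 2 * t2) * kinv z = K * kinv z * (t1 + 2 * t2)); last by ring.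
  rewrite [leRHS]EFinM; apply: lee_wpmul2l; first by rewrite lee_fin.
  rewrite /D /=.
  have m1 : mfunT (fun x => W1 (z, x)).
    by apply: (measurableT_comp mW1); exact: pair1_measurable.
  have m2 : mfunT (fun x => W (x + eta *: z)) by mfun.
  rewrite rintD//; [|by move=> x; exact: enorm_ge0|by apply: measurable_funD|by move=> x; pos].
  rewrite rintD// EFinD; apply: leeD; first exact: ht1.
  rewrite (rint_translate (eta *: z) mW W0) mulr_natl mulr2n EFinD.
  exact: leeD.
have md := measurable_dlt e mu; have mP := measurable_PDd hp hk e md.
have mdv := measurable_dlt eta mv; have mPv := measurable_PDd hp hk eta mdv.
have P0 p : 0 <= PDd f Jn e (dlt u e) p by exact: (PDd_ge0 hp hk).
have Pv0 p : 0 <= PDd f Jn eta (dlt v eta) p by exact: (PDd_ge0 hp hk).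
have key p : PDd f Jn e (dlt u e) p <= PDd f Jn eta (dlt v eta) p + K * (kinv p.1 * D p).
  have KD : 0 <= K * (kinv p.1 * D p) by have := D0 p => ?; have := k0 p.1 => ?; pos.
  rewrite /PDd; set z := p.1 in KD *; set x := p.2 in KD *.
  set a := dlt u e p; set b := dlt v eta p.
  have [z1|z1] := leP 1 (enorm z); first by rewrite (kok_supp hk z1) !mul0r add0r.
  have [z0|z0] := eqVneq z 0.
    have -> : a = 0 by rewrite /a /dlt -/z z0 dot0r.
    rewrite /parg expr0n/= mul0r (pok_f0 hp) mulr0 addr_ge0// mulr_ge0//.
    exact: (f_parg_ge0 hp).
  have zp : 0 < enorm z by rewrite enorm_gt0.
  have abD : `|a - b| <= D p * enorm z.
    rewrite /a /b /dlt -/z -/x -dotBl; apply: le_trans (ler_dot_enorm _ _) _.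
    rewrite ler_wpM2r ?enorm_ge0//.
    have -> : u (x + e *: z) - u x - (v (x + eta *: z) - v x) =
      (u (x + e *: z) - u (x + eta *: z)) + ((u (x + eta *: z) - v (x + eta *: z)) - (u x - v x)).
      by apply/rowP => i; rewrite !mxE; ring.
    apply: le_trans (ler_enormD _ _) _; rewrite /D /W1 /W -/z -/x lerD2l.
    by apply: le_trans (ler_enormD _ _) _; rewrite enormN.
  have ab4 : `|a - b| <= 4 * M * enorm z.
    rewrite /a /b /dlt -/z -/x -dotBl; apply: le_trans (ler_dot_enorm _ _) _.
    rewrite ler_wpM2r ?enorm_ge0//.
    have t (y y' : V) : enorm (y - y') <= enorm y + enorm y'.
      by apply: le_trans (ler_enormD _ _) _; rewrite enormN.
    apply: le_trans (t _ _) _; have := t (u (x + e *: z)) (u x); have := t (v (x + eta *: z)) (v x).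
    have := uM x; have := uM (x + e *: z); have := vM x; have := vM (x + eta *: z); lra.
  have mono : f (parg e b z) <= f (parg eta b z).
    apply: pok_nd hp _ _ _ _; first exact: parg_ge0.
    rewrite /parg ler_wpM2l ?sqr_ge0// lef_pV2 ?posrE ?mulr_gt0 ?exprn_gt0//.
    by rewrite ler_wpM2r// exprn_ge0// ltW.
  have tan := pok_tan hp (parg_ge0 b z e0) (parg_ge0 a z e0).
  have h1 := f1_arg_le hp b e0 z0.
  have /andP[g0 g1] := f1_parg hp b z e0.
  set g := f1 _ in tan h1 g0 g1.
  have E : parg e a z - parg e b z = (2 * b * (a - b) + (a - b) ^+ 2) / (e * enorm z ^+ 3).
    by rewrite /parg; field; rewrite !gt_eqF.
  have c0 : 0 <= (e * enorm z ^+ 3)^-1 by pos.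
  have step : g * (parg e a z - parg e b z) <= D p * (finf + fp0 / e * (1 + 4 * M)) / enorm z.
    rewrite E mulrA.
    have t1' : g * (2 * b * (a - b) + (a - b) ^+ 2) <=
       (finf * e * enorm z ^+ 2 + fp0 * enorm z) * (D p * enorm z) + fp0 * (D p * enorm z * (4 * M * enorm z)).
      rewrite mulrDr; apply: lerD.
        apply: le_trans (ler_norm _) _; rewrite !normrM (ger0_norm g0) ger0_norm//.
        rewrite (_ : g * _ = (g * `|b|) * 2 * `|a - b|); last by ring.
        apply: ler_pM => //; first by pos.
        by rewrite mulrC -ler_pdivlMl.
      apply: ler_pM => //; first exact: sqr_ge0.
      by rewrite -real_normK ?num_real// expr2; apply: ler_pM.
    apply: le_trans (ler_wpM2r c0 t1') _.
    have -> : ((finf * e * enorm z ^+ 2 + fp0 * enorm z) * (D p * enorm z) + fp0 * (D p * enorm z * (4 * M * enorm z)))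
       / (e * enorm z ^+ 3) = D p * finf + D p * (fp0 / e * (1 + 4 * M)) / enorm z.
      by field; rewrite !gt_eqF.
    rewrite [D p * (finf + _)]mulrDr [(D p * finf + _) / enorm z]mulrDl lerD2r -[leLHS]mulr1; apply: ler_wpM2l; first by have := D0 p => ?; pos.
    by rewrite invf_ge1 ?ltW.
  have J1 := Jn_inv_le hk z.
  have tt : f (parg e a z) <= f (parg eta b z) + D p * (finf + fp0 / e * (1 + 4 * M)) / enorm z.
    by apply: le_trans tan _; apply: lerD.
  have := ler_wpM2l (J0 z) tt => tt'; apply: le_trans tt' _; rewrite mulrDr lerD2l.
  rewrite (_ : Jn z * _ = D p * (finf + fp0 / e * (1 + 4 * M)) * (Jn z / enorm z)); last by ring.
  rewrite (_ : K * (kinv z * D p) = D p * (finf + fp0 / e * (1 + 4 * M)) * (MJ * kinv z)); last by rewrite /K; ring.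
  by apply: ler_wpM2l => //; have := D0 p => ?; pos.
have mKD : mfunT (fun p => K * (kinv p.1 * D p)) by mfun.
have KD0 p : 0 <= K * (kinv p.1 * D p) by have := D0 p => ?; have := k0 p.1 => ?; pos.
have := le_II P0 key; rewrite IID// (II_PDd n2 hp hk)// (II_PDd n2 hp hk)// => h.
have {}h := le_trans h (leeD2l _ bound); rewrite -EFinD lee_fin in h.
have ew : 0 < e * omega by rewrite mulr_gt0.
rewrite -(ler_pM2l ew); apply: le_trans h _.
rewrite [leRHS]mulrDr; apply: lerD.
  by apply: ler_wpM2r; [exact: (PDr_ge0 hp hk)|rewrite ler_pM2r].
by apply: le_of_eq; rewrite /K; field; rewrite !gt_eqF.
Qed.

End estimates.

(** * Dini derivatives and mean value inequalities in L^2 *)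

Lemma growth (R : realType) (g : R -> R) (a b c : R) : a <= b -> 0 <= c ->
  (forall t dl : R, a <= t -> t < b -> 0 < dl -> exists2 m : R, 0 < m &
     forall s : R, t < s -> s < t + m -> s <= b -> g s <= g t + (c + dl) * (s - t)) ->
  (forall t dl : R, a < t -> t <= b -> 0 < dl -> exists2 m : R, 0 < m &
     forall s : R, t - m < s -> s < t -> a <= s -> g t <= g s + dl) ->
  g b <= g a + c * (b - a).
Proof.
move=> ab c0 hr hl; apply/ler_addgt0Pr => e e0.
pose dl : R := e / (b - a + 1).
have ba1 : 0 < b - a + 1 by rewrite ltr_wpDl// subr_ge0.
have dl0 : 0 < dl by rewrite divr_gt0.
suff : g b <= g a + (c + dl) * (b - a).
  move/le_trans; apply; rewrite mulrDl addrA lerD2l /dl mulrAC ler_pdivrMr// ler_wpM2l ?ltW//.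
  by rewrite ltrDl.
pose ok (t : R) := forall s : R, a <= s -> s <= t -> g s <= g a + (c + dl) * (s - a).
pose S : set R := [set t : R | a <= t <= b /\ ok t].
have Sa : S a.
  split; first by rewrite lexx.
  move=> s s1 s2; have -> : s = a by apply/eqP; rewrite eq_le s1 s2.
  by rewrite subrr mulr0 addr0.
have hS : has_sup S.
  by split; [exists a|exists b => t -[/andP[]]].
pose t := sup S.
have at_ : a <= t by exact: sup_upper_bound hS _ Sa.
have tb : t <= b by apply: ge_sup => //; [exists a|move=> s [/andP[]]].
have okl (s : R) : a <= s -> s < t -> g s <= g a + (c + dl) * (s - a).
  move=> as_ st; have st0 : 0 < t - s by rewrite subr_gt0.
  have [x [_ okx] hx] := sup_adherent st0 hS.
  apply: okx => //; move: hx; rewrite -/t; lra.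
have okt : ok t.
  move=> s as_ st; have [|st'] := ltP s t; first exact: okl.
  have -> : s = t by apply/eqP; rewrite eq_le st st'.
  have [at1|at1] := ltP a t; last first.
    by have -> : t = a by [apply/eqP; rewrite eq_le at_ at1]; rewrite subrr mulr0 addr0.
  apply/ler_addgt0Pr => e' e'0; have [m m0 hm] := hl t e' at1 tb e'0.
  pose x : R := Num.max a (t - m / 2).
  have xt : x < t by rewrite /x gt_max at1/= ltrBlDr ltrDl divr_gt0.
  have ax : a <= x by rewrite /x le_max lexx.
  have mx : t - m < x by rewrite /x lt_max; apply/orP; right; lra.
  have h1 := hm x mx xt ax; have h2 := okl x ax xt.
  have h3 : (c + dl) * (x - a) <= (c + dl) * (t - a).
    by apply: ler_wpM2l; [rewrite addr_ge0// ltW|lra].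
  lra.
have [tb'|] := ltP t b; last first.
  by move=> bt; apply: okt.
have [m m0 hm] := hr t dl at_ tb' dl0.
pose x : R := Num.min b (t + m / 2).
have tx : t < x by rewrite /x lt_min tb'/= ltrDl divr_gt0.
have xb : x <= b by rewrite /x ge_min lexx.
have xm : x < t + m by rewrite /x gt_min; apply/orP; right; lra.
have Sx : S x.
  split; first by rewrite xb andbT (le_trans at_)// ltW.
  move=> s as_ sx; have [st|ts] := leP s t; first exact: okt.
  have h1 := hm s ts (le_lt_trans sx xm) (le_trans sx xb).
  have h2 := okt t at_ (lexx t).
  by rewrite mulrBr in h1 *; rewrite mulrBr in h2; lra.
have := sup_upper_bound hS Sx; rewrite -/t; lra.
Qed.

Lemma half_bound (R : realType) (a dl : R) : 0 <= dl -> a * dl <= dl / 2 * (2 * (a + 1)).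
Proof. by move=> dl0; have -> : dl / 2 * (2 * (a + 1)) = a * dl + dl by [field]; rewrite lerDl. Qed.

Lemma dini_arith (R : realDomainType) (Ps Pt I K2 N A y3 z y6 w1 w2 y5 D1 D P : R) :
  Ps <= Pt + I + K2 -> N <= A + y3 + z + y6 -> y6 <= w1 -> K2 <= w2 ->
  z + y5 <= D1 -> w1 + w2 <= D1 -> I <= P - y3 + y5 -> D = D1 + D1 ->
  N + Ps <= A + Pt + (P + D).
Proof. lra. Qed.

Lemma left_arith (R : realDomainType) (Pt Ps I K2 N A z c2 w D : R) :
  Pt <= Ps + I + K2 -> I <= w -> K2 <= c2 -> z + w + c2 <= D -> 2 * N - 2 * A <= 2 * z ->
  N + Pt <= A + Ps + D.
Proof. lra. Qed.

Lemma four_arith (R : realDomainType) (x y : R) : 0 <= y -> 4 * x <= 2 ^+ 2 * (x + y + 1).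
Proof. lra. Qed.

Lemma sqrt_tangent (R : realFieldType) (g g' E E' : R) : 0 < g' ->
  g ^+ 2 = E + 1 -> g' ^+ 2 = E' + 1 -> g <= g' + (E - E') / (2 * g').
Proof.
move=> g0 h h'; rewrite -subr_ge0.
have -> : E - E' = g ^+ 2 - g' ^+ 2 by rewrite h h'; ring.
have -> : g' + (g ^+ 2 - g' ^+ 2) / (2 * g') - g = (g - g') ^+ 2 / (2 * g') by field; rewrite gt_eqF.
by rewrite divr_ge0 ?sqr_ge0 ?mulr_ge0 ?ltW.
Qed.

Section L2.
Context (R : realType) (n : nat).
Local Notation V := 'rV[R]_n.
Implicit Types (v w : V -> V).

Lemma sqr_nrmD v w : L2f v -> L2f w -> nrm (v + w) ^+ 2 = nrm v ^+ 2 + 2 * ip v w + nrm w ^+ 2.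
Proof.
move=> hv hw; rewrite !sqr_nrm ipDl// ?ipDr//; first by rewrite (ipC w v); ring.
exact: L2fD.
Qed.

Lemma ip_le v w : L2f v -> L2f w -> ip v w <= nrm v * nrm w.
Proof. by move=> hv hw; apply: le_trans (ler_norm _) (CauchySchwarz hv hw). Qed.

Lemma sqr_nrmB v w : L2f v -> L2f w -> nrm v ^+ 2 - nrm w ^+ 2 <= 2 * nrm v * nrm (v - w).
Proof.
move=> hv hw; have := ler_norm (nrm v - nrm w); have := ler_nrm_dist hv hw.
move=> h1 h2; have h3 : nrm v - nrm w <= nrm (v - w) by exact: le_trans h2 h1.
have := ler_wpM2l (nrm_ge0 v) h3; have := sqr_ge0 (nrm v - nrm w); rewrite sqrrB; lra.
Qed.
End L2.

Definition in0 (R : realType) (T t : R) := 0 <= t <= T.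

(** Differentiability in L^2 stated through the remainder, which avoids the division by s - t and
    makes the case s = t harmless. *)
Definition ndiff (R : realType) n (T : R) (w w1 : R -> 'rV[R]_n -> 'rV[R]_n) :=
  forall t dl : R, 0 <= t <= T -> 0 < dl -> exists2 m : R, 0 < m &
    forall s : R, 0 <= s <= T -> `|s - t| < m ->
      nrm (w s - w t - (s - t) *: w1 t) <= dl * `|s - t|.

Section ndiff.
Context (R : realType) (n : nat).
Local Notation V := 'rV[R]_n.
Variables (T : R) (w w1 : R -> V -> V).
Hypothesis hw : forall t : R, 0 <= t <= T -> L2f (w t).
Hypothesis hw1 : forall t : R, 0 <= t <= T -> L2f (w1 t).
Hypothesis hd : ndiff T w w1.

Lemma ndiff_lip (t dl : R) : 0 <= t <= T -> 0 < dl -> exists2 m : R, 0 < m &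
  forall s : R, 0 <= s <= T -> `|s - t| < m -> nrm (w s - w t) <= (nrm (w1 t) + dl) * `|s - t|.
Proof.
move=> tT dl0; have [m m0 hm] := hd tT dl0; exists m => // s sT st.
have h := hm s sT st.
have h1 := L2fB (hw sT) (hw tT); have h2 := L2fZ (s - t) (hw1 tT).
have -> : w s - w t = (w s - w t - (s - t) *: w1 t) + (s - t) *: w1 t by rewrite subrK.
apply: le_trans (ler_nrmD (L2fB h1 h2) h2) _.
by rewrite nrmZ; [rewrite mulrDl addrC [nrm _ * _]mulrC lerD2l|exact: hw1].
Qed.

Lemma ndiff_cont (t dl : R) : 0 <= t <= T -> 0 < dl -> exists2 m : R, 0 < m &
  forall s : R, 0 <= s <= T -> `|s - t| < m -> nrm (w s - w t) <= dl.
Proof.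
move=> tT dl0; have [m m0 hm] := ndiff_lip tT ltr01.
have A0 : 0 < nrm (w1 t) + 1 by have := nrm_ge0 (w1 t); lra.
exists (Num.min m (dl / (nrm (w1 t) + 1))); first by rewrite lt_min m0 divr_gt0.
move=> s sT; rewrite lt_min => /andP[s1 s2]; apply: le_trans (hm s sT s1) _.
by rewrite mulrC -ler_pdivlMr// ltW.
Qed.

Lemma ndiff_bound (L a b : R) : 0 <= a -> a <= b -> b <= T -> 0 <= L ->
  (forall t : R, a <= t <= b -> nrm (w1 t) <= L) -> nrm (w b - w a) <= L * (b - a).
Proof.
move=> a0 ab bT L0 hL.
have inT (t : R) : a <= t -> t <= b -> 0 <= t <= T by lra.
have := @growth R (fun t : R => nrm (w t - w a)) a b L ab L0.
rewrite /= subrr nrm0 add0r; apply.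
- move=> t dl at_ tb dl0; have tT : 0 <= t <= T by apply: inT; lra.
  have [m m0 hm] := ndiff_lip tT dl0; exists m => // s ts sm sb.
  have sT : 0 <= s <= T by apply: inT; lra.
  have st : `|s - t| < m by rewrite gtr0_norm; lra.
  have aT : 0 <= a <= T by apply: inT.
  have -> : w s - w a = (w t - w a) + (w s - w t) by rewrite [RHS]addrC subrKA.
  apply: le_trans (ler_nrmD (L2fB (hw tT) (hw aT)) (L2fB (hw sT) (hw tT))) _.
  rewrite lerD2l; apply: le_trans (hm s sT st) _.
  rewrite gtr0_norm ?subr_gt0//; apply: ler_wpM2r; first lra.
  by rewrite lerD2r; apply: hL; lra.
- move=> t dl at_ tb dl0; have tT : 0 <= t <= T by apply: inT; lra.
  have [m m0 hm] := ndiff_cont tT dl0; exists m => // s ms st as_.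
  have sT : 0 <= s <= T by apply: inT; lra.
  have aT : 0 <= a <= T by apply: inT.
  have -> : w t - w a = (w s - w a) + (w t - w s) by rewrite [RHS]addrC subrKA.
  apply: le_trans (ler_nrmD (L2fB (hw sT) (hw aT)) (L2fB (hw tT) (hw sT))) _.
  rewrite lerD2l nrmBC; apply: hm => //; rewrite ltr0_norm; lra.
Qed.

Lemma ndiff_ip_bound (psi : V -> V) (L a b : R) : 0 <= a -> a <= b -> b <= T -> 0 <= L -> L2f psi ->
  (forall t : R, a <= t <= b -> `|ip (w1 t) psi| <= L) -> `|ip (w b - w a) psi| <= L * (b - a).
Proof.
move=> a0 ab bT L0 hpsi hL.
have inT (t : R) : a <= t -> t <= b -> 0 <= t <= T by lra.
have aT : 0 <= a <= T by apply: inT.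
have := @growth R (fun t : R => `|ip (w t - w a) psi|) a b L ab L0.
have -> : ip (w a - w a) psi = 0 by rewrite (ipBl (hw aT) (hw aT) hpsi) subrr.
rewrite /= normr0 add0r; apply.
- move=> t dl at_ tb dl0; have tT : 0 <= t <= T by apply: inT; lra.
  have P1 : 0 < nrm psi + 1 by have := nrm_ge0 psi; lra.
  have [m m0 hm] := hd tT (divr_gt0 dl0 P1); exists m => // s ts sm sb.
  have sT : 0 <= s <= T by apply: inT; lra.
  have st : `|s - t| < m by rewrite gtr0_norm; lra.
  have h1 := L2fB (hw sT) (hw tT); have h2 := L2fZ (s - t) (hw1 tT).
  have h3 := L2fB h1 h2.
  have E : ip (w s - w a) psi = ip (w t - w a) psi + ((s - t) * ip (w1 t) psi
       + ip (w s - w t - (s - t) *: w1 t) psi).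
    rewrite (ipBl h1 h2 hpsi) (ipZl (s - t) (hw1 tT) hpsi).
    rewrite (ipBl (hw sT) (hw aT) hpsi) (ipBl (hw tT) (hw aT) hpsi) (ipBl (hw sT) (hw tT) hpsi); ring.
  rewrite E; apply: le_trans (ler_normD _ _) _; rewrite lerD2l.
  apply: le_trans (ler_normD _ _) _; rewrite normrM gtr0_norm ?subr_gt0// [leRHS]mulrDl; apply: lerD.
    by rewrite mulrC; apply: ler_wpM2r; [lra|apply: hL; lra].
  apply: le_trans (CauchySchwarz h3 hpsi) _.
  have := hm s sT st; rewrite gtr0_norm ?subr_gt0// => h4.
  apply: le_trans (ler_wpM2r (nrm_ge0 psi) h4) _.
  rewrite -mulrA [(s - t) * _]mulrC mulrA; apply: ler_wpM2r; first lra.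
  by rewrite mulrAC ler_pdivrMr// ler_wpM2l ?ltW// ltrDl.
- move=> t dl at_ tb dl0; have tT : 0 <= t <= T by apply: inT; lra.
  have P1 : 0 < nrm psi + 1 by have := nrm_ge0 psi; lra.
  have [m m0 hm] := ndiff_cont tT (divr_gt0 dl0 P1); exists m => // s ms st as_.
  have sT : 0 <= s <= T by apply: inT; lra.
  have h1 := L2fB (hw tT) (hw sT).
  have E : ip (w t - w a) psi = ip (w s - w a) psi + ip (w t - w s) psi.
    rewrite (ipBl (hw sT) (hw aT) hpsi) (ipBl (hw tT) (hw aT) hpsi) (ipBl (hw tT) (hw sT) hpsi); ring.
  rewrite E; apply: le_trans (ler_normD _ _) _; rewrite lerD2l.
  apply: le_trans (CauchySchwarz h1 hpsi) _.
  have : nrm (w t - w s) <= dl / (nrm psi + 1).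
    by rewrite nrmBC; apply: (hm s sT); rewrite ltr0_norm; lra.
  move=> h4; apply: le_trans (ler_wpM2r (nrm_ge0 psi) h4) _.
  by rewrite mulrAC ler_pdivrMr// ler_wpM2l ?ltW// ltrDl.
Qed.

End ndiff.

(** * Energy inequality for an evolution at a fixed horizon *)

Section evolution.
Context (R : realType) (n : nat).
Local Notation V := 'rV[R]_n.
Local Notation leb := (lebesgue_rV R n).
Local Notation omega := (unit_ball_volume R n).
Variables (f f1 : R -> R) (fp0 finf : R) (Jn : V -> R) (MJ : R).
Hypothesis n2 : (2 <= n)%N.
Hypothesis hp : pot_ok f f1 fp0 finf.
Hypothesis hk : ker_ok Jn MJ.
Variables (e rho T B : R) (S : set V) (u ut utt b : R -> V -> V).
Local Notation PDr := (PDr f Jn).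
Local Notation Lin := (Lin f1 Jn).

(** [evo_eq] is the weak form of the equation: the force enters only through [Lin], and tests are
    fields vanishing almost everywhere outside S. Everything below uses the energy and its
    directional derivative and no longer the pointwise gradient. *)
Record evo : Prop := Evo {
  evo_e : 0 < e; evo_rho : 0 < rho; evo_B0 : 0 <= B;
  evo_u : forall t : R, 0 <= t <= T -> L2f (u t);
  evo_ut : forall t : R, 0 <= t <= T -> L2f (ut t);
  evo_utt : forall t : R, 0 <= t <= T -> L2f (utt t);
  evo_b : forall t : R, 0 <= t <= T -> L2f (b t);
  evo_bB : forall t : R, 0 <= t <= T -> nrm (b t) <= B;
  evo_d : ndiff T u ut;
  evo_d1 : ndiff T ut utt;
  evo_c : forall t dl : R, 0 <= t <= T -> 0 < dl -> exists2 m : R, 0 < m &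
    forall s : R, 0 <= s <= T -> `|s - t| < m -> nrm (utt s - utt t) <= dl;
  evo_su : forall t : R, 0 <= t <= T -> {ae leb, forall x, ~ S x -> u t x = 0};
  evo_sut : forall t : R, 0 <= t <= T -> {ae leb, forall x, ~ S x -> ut t x = 0};
  evo_eq : forall (t : R) (psi : V -> V), 0 <= t <= T -> L2f psi ->
    {ae leb, forall x, ~ S x -> psi x = 0} ->
    Lin e (u t) psi = ip (b t - rho *: utt t) psi }.

Hypothesis he : evo.
Let e0 := evo_e he.
Let rho0 := evo_rho he.
Let hu := evo_u he.
Let hut := evo_ut he.
Let hutt := evo_utt he.
Let hb := evo_b he.

Let w0 : 0 < omega. Proof. exact: unit_ball_volume_gt0. Qed.

Definition Etot (t : R) : R := rho / 2 * nrm (ut t) ^+ 2 + PDr e (u t).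

Lemma Etot_ge0 t : 0 <= Etot t.
Proof.
rewrite /Etot; have := PDr_ge0 hp hk (u t) e0; have := rho0; have := sqr_ge0 (nrm (ut t)) => ? ? ?; pos.
Qed.

Let K : R := (e ^+ 2 * omega)^-1 * (2 * fp0 * MJ * (2 ^+ n.+2 * 2)).

Let K0 : 0 <= K.
Proof.
have := pok_fp0 hp => ?; have MJ0 : 0 <= MJ by exact: le_trans (kok_ge0 hk 0) (kok_le hk 0).
have := e0 => ?; rewrite /K; pos.
Qed.

(** Semiconcavity with [Lin] replaced through the equation of motion. The difference u s - u t is an
    admissible test because both terms vanish outside S. *)
Let step (s t : R) : 0 <= s <= T -> 0 <= t <= T ->
  PDr e (u s) <= PDr e (u t) + ip (b t - rho *: utt t) (u s - u t) + K * nrm (u s - u t) ^+ 2.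
Proof.
move=> sT tT; have hst := L2fB (hu sT) (hu tT).
have := PDr_semiconcave n2 hp hk e0 (hu tT) hst.
have -> : u t + (u s - u t) = u s by rewrite addrC subrK.
rewrite (evo_eq he) => //.
  by move/le_trans; apply; rewrite lerD2l /K; apply: le_of_eq; ring.
by apply: filterS2 (evo_su he sT) (evo_su he tT) => x h1 h2 h3; rewrite -[LHS]/(u s x - u t x) h1// h2// subrr.
Qed.

(** The contribution of the acceleration to the kinetic energy cancels the one that [step] produces
    in the potential energy, and only the power of the body force remains. The one-sided inequality
    of [step] is enough for a right Dini derivative. *)
Lemma Etot_dini (t dl : R) : 0 <= t <= T -> 0 < dl -> exists2 m : R, 0 < m &
  forall s : R, t < s -> s < t + m -> s <= T ->
    Etot s <= Etot t + (ip (b t) (ut t) + dl) * (s - t).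
Proof.
move=> tT dl0.
have hbr := L2fB (hb tT) (L2fZ rho (hutt tT)).
pose a0 : R := nrm (ut t); pose a1 : R := nrm (utt t); pose a2 : R := nrm (b t - rho *: utt t).
have [p0 p1 p2] : [/\ 0 <= a0, 0 <= a1 & 0 <= a2] by rewrite !nrm_ge0.
(* With h = s - t, A collects the coefficients of the remainders of size d h and H those of the
   terms in h^2. The choices of d and of m3 make each of the two sums at most h dl / 2. *)
pose A : R := rho * a0 + a2.
have A0 : 0 <= A by rewrite /A; have := rho0 => ?; pos.
pose H : R := rho / 2 * (a1 + 1) ^+ 2 + K * (a0 + 1) ^+ 2.
have H0 : 0 <= H by rewrite /H; have := rho0 => ?; have := K0 => ?; pos.
pose d : R := Num.min 1 (dl / (2 * (A + 1))).
have A1 : 0 < 2 * (A + 1) by lra.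
have H1 : 0 < 2 * (H + 1) by lra.
have d0 : 0 < d by rewrite lt_min ltr01 divr_gt0.
have d1 : d <= 1 by rewrite ge_min lexx.
have dA : A * d <= dl / 2.
  have h : d <= dl / (2 * (A + 1)) by rewrite ge_min lexx orbT.
  have h2 := ler_wpM2l A0 h; apply: le_trans h2 _.
  by rewrite mulrA ler_pdivrMr//; exact: half_bound (ltW dl0).
have [m1 m10 h1] := evo_d he tT d0; have [m2 m20 h2] := evo_d1 he tT d0.
pose m3 : R := dl / (2 * (H + 1)).
have m30 : 0 < m3 by rewrite divr_gt0.
exists (Num.min m1 (Num.min m2 m3)); first by rewrite !lt_min m10 m20.
move=> s ts sm sT'.
have [sm1 sm2 sm3] : [/\ s - t < m1, s - t < m2 & s - t < m3].
  have : s - t < Num.min m1 (Num.min m2 m3) by lra.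
  by rewrite !lt_min => /andP[-> /andP[-> ->]].
have sT : 0 <= s <= T by move: tT; lra.
have st0 : 0 < s - t by lra.
pose h : R := s - t.
have hn : `|s - t| = h by rewrite gtr0_norm.
have := h1 s sT; rewrite hn -/h => /(_ sm1) r1.
have := h2 s sT; rewrite hn -/h => /(_ sm2) r2.
have hus := L2fB (hu sT) (hu tT); have hZ := L2fZ h (hut tT).
have huts := L2fB (hut sT) (hut tT); have hZt := L2fZ h (hutt tT).
have hr1 := L2fB hus hZ; have hr2 := L2fB huts hZt.
have E1 : u s - u t = (u s - u t - h *: ut t) + h *: ut t by rewrite subrK.
have E2 : ut s - ut t = (ut s - ut t - h *: utt t) + h *: utt t by rewrite subrK.
have n1 : nrm (u s - u t) <= h * (a0 + 1).
  rewrite E1; apply: le_trans (ler_nrmD hr1 hZ) _.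
  rewrite nrmZ; last exact: hut.
  rewrite gtr0_norm// -/a0 mulrDr mulr1 addrC lerD2l; apply: le_trans r1 _.
  by rewrite -[leRHS]mul1r; apply: ler_wpM2r => //; exact: ltW.
have n2' : nrm (ut s - ut t) <= h * (a1 + 1).
  rewrite E2; apply: le_trans (ler_nrmD hr2 hZt) _.
  rewrite nrmZ; last exact: hutt.
  rewrite gtr0_norm// -/a1 mulrDr mulr1 addrC lerD2l; apply: le_trans r2 _.
  by rewrite -[leRHS]mul1r; apply: ler_wpM2r => //; exact: ltW.
have s1 := sqr_mono (nrm_ge0 _) n1; have s2 := sqr_mono (nrm_ge0 _) n2'.
have i1 : ip (b t - rho *: utt t) (u s - u t) <= h * (ip (b t) (ut t) - rho * ip (utt t) (ut t)) + a2 * (d * h).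
  rewrite {1}E1 (ipDr hr1 hZ hbr) (ipZr h (hut tT) hbr).
  rewrite (ipBl (hb tT) (L2fZ rho (hutt tT)) (hut tT)) (ipZl rho (hutt tT) (hut tT)).
  rewrite addrC lerD2l; apply: le_trans (ip_le hbr hr1) _.
  exact: (ler_wpM2l p2 r1).
have i2 : nrm (ut s) ^+ 2 <= a0 ^+ 2 + 2 * (h * ip (utt t) (ut t) + a0 * (d * h)) + nrm (ut s - ut t) ^+ 2.
  have {1}-> : ut s = ut t + (ut s - ut t) by rewrite addrC subrK.
  rewrite (sqr_nrmD (hut tT) huts) lerD2r lerD2l ler_pM2l//.
  rewrite {1}E2 (ipDr hr2 hZt (hut tT)) (ipZr h (hutt tT) (hut tT)) (ipC (ut t) (utt t)).
  rewrite addrC lerD2l; apply: le_trans (ip_le (hut tT) hr2) _.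
  by apply: ler_wpM2l.
have st := step sT tT.
have rh : 0 <= rho / 2 by rewrite divr_ge0// ltW.
have j1 := ler_wpM2l rh i2; have j2 := ler_wpM2l rh s2; have j3 := ler_wpM2l K0 s1.
have j4 : A * d * h <= dl / 2 * h by apply: ler_wpM2r => //; exact: ltW.
have j5 : H * h ^+ 2 <= dl / 2 * h.
  rewrite expr2 mulrA; apply: ler_wpM2r; first exact: ltW.
  have hm3 : h <= m3 by exact: ltW.
  apply: le_trans (ler_wpM2l H0 hm3) _; rewrite /m3 mulrA ler_pdivrMr//.
  exact: half_bound (ltW dl0).
rewrite /Etot -/a0 -/h; rewrite /A in j4; rewrite /H in j5.
set P := ip (b t) (ut t) in i1 *; set Q := ip (utt t) (ut t) in i1 j1.
set X1 := nrm (ut s - ut t) ^+ 2 in j1 j2; set X2 := nrm (u s - u t) ^+ 2 in st j3.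
have k1 : (rho * a0 + a2) * d * h = rho / 2 * (2 * (a0 * (d * h))) + a2 * (d * h) by field.
have k2 : (rho / 2 * (a1 + 1) ^+ 2 + K * (a0 + 1) ^+ 2) * h ^+ 2 =
   rho / 2 * (h * (a1 + 1)) ^+ 2 + K * (h * (a0 + 1)) ^+ 2 by ring.
rewrite k1 in j4; rewrite k2 in j5.
have k3 : rho / 2 * (a0 ^+ 2 + 2 * (h * Q + a0 * (d * h)) + X1) =
   rho / 2 * a0 ^+ 2 + h * (rho * Q) + rho / 2 * (2 * (a0 * (d * h))) + rho / 2 * X1 by field.
rewrite k3 in j1.
rewrite mulrBr in i1; rewrite mulrDl [P * h]mulrC.
by apply: dini_arith st j1 j2 j3 j4 j5 i1 _; field.
Qed.

(** Here [step] is based at the earlier time s, where the acceleration is bounded thanks to its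
    continuity at t. *)
Lemma Etot_left (t dl : R) : 0 <= t <= T -> 0 < dl -> exists2 m : R, 0 < m &
  forall s : R, t - m < s -> s < t -> 0 <= s -> Etot t <= Etot s + dl.
Proof.
move=> tT dl0.
pose a0 : R := nrm (ut t); pose a1 : R := nrm (utt t).
have [p0 p1] : [/\ 0 <= a0 & 0 <= a1] by rewrite !nrm_ge0.
have rh := rho0.
pose C : R := rho * a0 + (B + rho * (a1 + 1)) + K.
have C0 : 0 <= C by rewrite /C; have := K0 => ?; have := evo_B0 he => ?; pos.
pose d : R := Num.min 1 (dl / (C + 1)).
have C1 : 0 < C + 1 by lra.
have d0 : 0 < d by rewrite lt_min ltr01 divr_gt0.
have d1 : d <= 1 by rewrite ge_min lexx.
have dC : C * d <= dl.
  have h : d <= dl / (C + 1) by rewrite ge_min lexx orbT.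
  have h2 := ler_wpM2l C0 h; apply: le_trans h2 _.
  by rewrite mulrA ler_pdivrMr// mulrDr mulr1 mulrC lerDl ltW.
have [m1 m10 h1] := ndiff_cont hu hut (evo_d he) tT d0.
have [m2 m20 h2] := ndiff_cont hut hutt (evo_d1 he) tT d0.
have [m3 m30 h3] := evo_c he tT ltr01.
exists (Num.min m1 (Num.min m2 m3)); first by rewrite !lt_min m10 m20.
move=> s sm st s0.
have sT : 0 <= s <= T by move: tT; lra.
have hn : `|s - t| = t - s by rewrite ltr0_norm; lra.
have [sm1 sm2 sm3] : [/\ t - s < m1, t - s < m2 & t - s < m3].
  have : t - s < Num.min m1 (Num.min m2 m3) by lra.
  by rewrite !lt_min => /andP[-> /andP[-> ->]].
have := h1 s sT; rewrite hn nrmBC => /(_ sm1) {}h1.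
have := h2 s sT; rewrite hn nrmBC => /(_ sm2) {}h2.
have := h3 s sT; rewrite hn => /(_ sm3) {}h3.
have hbs := L2fB (hb sT) (L2fZ rho (hutt sT)).
have hus := L2fB (hu tT) (hu sT).
have st' := step tT sT.
have nn : nrm (b s - rho *: utt s) <= B + rho * (a1 + 1).
  apply: le_trans (ler_nrmB (hb sT) (L2fZ rho (hutt sT))) _; apply: lerD; first exact: (evo_bB he).
  rewrite nrmZ; last exact: hutt.
  rewrite gtr0_norm//; apply: ler_wpM2l; first exact: ltW.
  have -> : utt s = utt t + (utt s - utt t) by rewrite addrC subrK.
  apply: le_trans (ler_nrmD (hutt tT) (L2fB (hutt sT) (hutt tT))) _; rewrite lerD2l.
  exact: h3.
have i1 : ip (b s - rho *: utt s) (u t - u s) <= (B + rho * (a1 + 1)) * d.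
  by apply: le_trans (ip_le hbs hus) _; apply: ler_pM => //; exact: nrm_ge0.
have i2 : nrm (ut t) ^+ 2 - nrm (ut s) ^+ 2 <= 2 * a0 * d.
  apply: le_trans (sqr_nrmB (hut tT) (hut sT)) _; by apply: ler_wpM2l => //; rewrite mulr_ge0.
have i3 : nrm (u t - u s) ^+ 2 <= d.
  apply: le_trans (sqr_mono (nrm_ge0 _) h1) _; rewrite expr2 -[leRHS]mulr1; apply: ler_wpM2l => //; exact: ltW.
have j2 := ler_wpM2l (ltW rh) i2; have j3 := ler_wpM2l K0 i3.
rewrite /Etot; rewrite /C in dC.
set X := nrm (ut t) ^+ 2 in j2 *; set Y := nrm (ut s) ^+ 2 in j2 *.
have k : (rho * a0 + (B + rho * (a1 + 1)) + K) * d = rho * a0 * d + (B + rho * (a1 + 1)) * d + K * d by ring.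
rewrite k in dC; move: j2.
have -> : rho * (X - Y) = 2 * (rho / 2 * X) - 2 * (rho / 2 * Y) by field.
have -> : rho * (2 * a0 * d) = 2 * (rho * a0 * d) by ring.
exact: left_arith st' i1 j3 dC.
Qed.

(** The function g = sqrt(Etot + 1) grows with slope at most B / sqrt(2 rho): the power of the body
    force is at most B |u_t|, and rho |u_t|^2 / 2 <= g^2. The 1 keeps g away from 0, so that its
    increments can be bounded by the tangent of the square root. *)
Definition Ebound (E0 : R) : R := (Num.sqrt (E0 + 1) + B / Num.sqrt (2 * rho) * T) ^+ 2.

Lemma Etot_bound (t : R) : 0 <= t <= T -> Etot t <= Ebound (Etot 0).
Proof.
move=> tT; have T0 : 0 <= T by move: tT; lra.
pose c : R := B / Num.sqrt (2 * rho).
have r2 : 0 < Num.sqrt (2 * rho) by rewrite sqrtr_gt0 mulr_gt0//; exact: rho0.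
have c0 : 0 <= c by rewrite divr_ge0// ?(evo_B0 he)// ltW.
pose g (s : R) : R := Num.sqrt (Etot s + 1).
have E1 s : 0 < Etot s + 1 by have := Etot_ge0 s; lra.
have g1 s : 1 <= g s.
  by rewrite -[leLHS]sqrtr1 ler_wsqrtr// lerDr Etot_ge0.
have g2 s : g s ^+ 2 = Etot s + 1 by rewrite sqr_sqrtr// ltW.
have gE : g 0 = Num.sqrt (Etot 0 + 1) by [].
clearbody g.
have tang (s s' : R) : g s <= g s' + (Etot s - Etot s') / (2 * g s').
  exact: sqrt_tangent (lt_le_trans ltr01 (g1 s')) (g2 s) (g2 s').
have flux s : 0 <= s <= T -> ip (b s) (ut s) / (2 * g s) <= c.
  move=> sT; have gs : 0 < 2 * g s by have := g1 s; lra.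
  rewrite ler_pdivrMr//; apply: le_trans (ip_le (hb sT) (hut sT)) _.
  rewrite /c -mulrA [B * (_ * _)]mulrC [nrm (b s) * _]mulrC; apply: ler_pM => //; [exact: nrm_ge0|exact: nrm_ge0| |exact: (evo_bB he)].
  rewrite mulrC ler_pdivlMr//.
  have q : Num.sqrt (2 * rho) * nrm (ut s) <= 2 * g s.
    rewrite -(@ler_pXn2r _ 2)// ?nnegrE; [|by have := nrm_ge0 (ut s) => ?; pos|exact: ltW].
    rewrite !exprMn (g2 s) sqr_sqrtr; last by have := rho0; lra.
    have := PDr_ge0 hp hk (u s) e0; rewrite /Etot.
    rewrite (_ : 2 * rho * _ = 4 * (rho / 2 * nrm (ut s) ^+ 2)); last by field.
    exact: four_arith.
  by rewrite mulrC.
have G := @growth R g 0 t c (proj1 (andP tT)) c0.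
have {}G : g t <= g 0 + c * (t - 0).
  apply: G.
  - move=> s dl s0 st dl0; have sT : 0 <= s <= T by move: tT; lra.
    have gs : 0 < 2 * g s by have := g1 s; lra.
    have [m m0 hm] := Etot_dini sT dl0; exists m => // x sx xm xt.
    have h := hm x sx xm (_ : x <= T); have {}h := h (le_trans xt (proj2 (andP tT))).
    apply: le_trans (tang x s) _; rewrite lerD2l.
    have x0 : 0 <= x - s by rewrite subr_ge0 ltW.
    apply: (@le_trans _ _ ((ip (b s) (ut s) + dl) * (x - s) / (2 * g s))).
      by apply: ler_wpM2r; [rewrite invr_ge0 ltW|rewrite lerBlDl].
    rewrite mulrAC; apply: ler_wpM2r => //; rewrite mulrDl; apply: lerD; first exact: flux.
    rewrite ler_pdivrMr// -[leLHS]mulr1; apply: ler_wpM2l; first exact: ltW.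
    by apply: le_trans (g1 s) _; rewrite mulr_natl mulr2n lerDl (le_trans ler01).
  - move=> s dl s0 st dl0; have sT : 0 <= s <= T by move: tT; lra.
    have [m m0 hm] := Etot_left sT dl0; exists m => // x xm xs x0.
    have h := hm x xm xs x0.
    have gx := g1 x; have gx' : 0 < 2 * g x by rewrite mulr_gt0// (lt_le_trans ltr01).
    apply: le_trans (tang s x) _; rewrite lerD2l.
    apply: (@le_trans _ _ (dl / (2 * g x))); first by rewrite ler_pM2r ?invr_gt0// lerBlDl.
    by rewrite ler_pdivrMr// -[leLHS]mulr1; apply: ler_wpM2l; [exact: ltW|apply: le_trans gx _; rewrite mulr_natl mulr2n lerDl (le_trans ler01)].
have GG : g t <= Num.sqrt (Etot 0 + 1) + c * T.
  by apply: le_trans G _; rewrite gE lerD2l; apply: ler_wpM2l => //; move: tT; lra.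
have := sqr_mono (le_trans ler01 (g1 t)) GG; rewrite g2 /Ebound -/c; apply: le_trans; rewrite lerDl; exact: ler01.
Qed.

Lemma evo_ut_bound (M t : R) : 0 <= t <= T -> Ebound (Etot 0) <= M -> nrm (ut t) <= Num.sqrt (2 / rho * M).
Proof.
move=> tT hM; have rh := rho0.
have M0 : 0 <= M by apply: le_trans _ hM; exact: sqr_ge0.
have MM : 0 <= 2 / rho * M by pos.
rewrite -(@ler_pXn2r _ 2)// ?nnegrE ?nrm_ge0 ?sqrtr_ge0//.
rewrite (sqr_sqrtr MM); have := Etot_bound tT; rewrite /Etot => h.
have := PDr_ge0 hp hk (u t) e0 => h2.
have h3 : rho / 2 * nrm (ut t) ^+ 2 <= M by apply: le_trans _ hM; apply: le_trans _ h; rewrite lerDl.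
have r2 : 0 < rho / 2 by rewrite divr_gt0.
rewrite -(ler_pM2l r2); apply: le_trans h3 _.
by apply: le_of_eq; field; rewrite gt_eqF.
Qed.

(** A second use of [Etot_dini], once the velocities are bounded. Unlike [Ebound], the right-hand
    side tends to the initial energy as t tends to 0, which the analysis of the initial velocity
    requires. *)
Lemma Etot_le (L t : R) : 0 <= t <= T -> 0 <= L -> (forall s, 0 <= s <= T -> nrm (ut s) <= L) ->
  Etot t <= Etot 0 + B * L * t.
Proof.
move=> tT L0 hL; have t0 : 0 <= t by move: tT; lra.
have BL : 0 <= B * L by rewrite mulr_ge0// (evo_B0 he).
have := @growth R Etot 0 t (B * L) t0 BL; rewrite subr0; apply.
- move=> s dl s0 st dl0; have sT : 0 <= s <= T by move: tT; lra.
  have [m m0 hm] := Etot_dini sT dl0; exists m => // x sx xm xt.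
  have h := hm x sx xm (le_trans xt (proj2 (andP tT))).
  apply: le_trans h _; rewrite lerD2l; apply: ler_wpM2r; first lra.
  rewrite lerD2r; apply: le_trans (ip_le (hb sT) (hut sT)) _.
  by apply: ler_pM; rewrite ?nrm_ge0//; [exact: (evo_bB he)|exact: hL].
- move=> s dl s0 st dl0; have sT : 0 <= s <= T by move: tT; lra.
  exact: Etot_left.
Qed.

(* Tested against a fixed Lipschitz field the peridynamic force is bounded by the energy,
   uniformly in the horizon. *)
Lemma evo_weak (psi : V -> V) (Lp r M s : R) : e <= 1 -> 0 <= s <= T ->
  0 <= Lp -> (forall x y : V, enorm (psi x - psi y) <= Lp * enorm (x - y)) ->
  0 <= r -> (forall x, ~ rV_box 0 r x -> psi x = 0) -> (forall x, ~ S x -> psi x = 0) ->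
  L2f psi -> Ebound (Etot 0) <= M ->
  `|ip (u s - u 0 - s *: ut 0) psi| <=
     (B * nrm psi + Lp * M + Lp * (fp0 * MJ * (2 * (r + 1)) ^+ n)) / rho * s ^+ 2.
Proof.
move=> e1 sT Lp0 hL r0 hr hS hpsi hM; have rh := rho0.
have T0 : 0 <= T by move: sT; lra.
have MJ0 : 0 <= MJ by exact: le_trans (kok_ge0 hk 0) (kok_le hk 0).
have f0 := pok_fp0 hp.
have M0 : 0 <= M by apply: le_trans _ hM; exact: sqr_ge0.
pose C : R := (B * nrm psi + Lp * M + Lp * (fp0 * MJ * (2 * (r + 1)) ^+ n)) / rho.
have C0 : 0 <= C by rewrite /C; have := evo_B0 he => ?; have := nrm_ge0 psi => ?; pos.
have s0 : 0 <= s by move: sT; lra.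
have T00 : 0 <= (0 : R) <= T by rewrite lexx.
have mpsi := L2f_measurable hpsi.
have force (t : R) : 0 <= t <= T -> `|ip (utt t) psi| <= C.
  move=> tT; have hbt := CauchySchwarz (hb tT) hpsi.
  have E : Lin e (u t) psi = ip (b t) psi - rho * ip (utt t) psi.
    rewrite (evo_eq he)//; first by rewrite (ipBl (hb tT) (L2fZ rho (hutt tT)) hpsi) (ipZl rho (hutt tT) hpsi).
    by apply/nearW => x; exact: hS.
  have hl := Lin_test n2 hp hk e0 e1 (hu tT) mpsi Lp0 hL r0 hr.
  have hP : PDr e (u t) <= M.
    have := Etot_bound tT; have h' : 0 <= rho / 2 * nrm (ut t) ^+ 2 by pos.
    by rewrite /Etot => h2; apply: le_trans _ hM; apply: le_trans _ h2; rewrite lerDr.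
  have hP' := ler_wpM2l Lp0 hP.
  have hB : nrm (b t) * nrm psi <= B * nrm psi by apply: ler_wpM2r; [exact: nrm_ge0|exact: (evo_bB he)].
  rewrite /C ler_pdivlMr// mulrC -[rho in rho * _]gtr0_norm// -normrM.
  have -> : rho * ip (utt t) psi = ip (b t) psi - Lin e (u t) psi by rewrite E; ring.
  apply: le_trans (ler_normB _ _) _; rewrite -addrA; apply: lerD; first exact: le_trans hbt hB.
  by apply: le_trans hl _; rewrite lerD2r.
have vel (t : R) : 0 <= t <= s -> `|ip (ut t - ut 0) psi| <= C * s.
  move=> /andP[t0 ts]; have tT : t <= T by move: sT; lra.
  apply: le_trans (ndiff_ip_bound hut hutt (evo_d1 he) (a := 0) (b := t) _ t0 tT C0 hpsi _) _ => //.
    by move=> x /andP[x0 xt]; apply: force; lra.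
  by rewrite subr0; apply: ler_wpM2l.
(* Removing the uniform motion makes ut t - ut 0 the derivative. It is of order s against psi by one
   mean value inequality, and a second one gives the order s^2. *)
pose w (t : R) : V -> V := u t - t *: ut 0; pose w1 (t : R) : V -> V := ut t - ut 0.
have hw (t : R) : 0 <= t <= T -> L2f (w t).
  by move=> tT; apply: L2fB; [exact: hu|apply: L2fZ; exact: hut].
have hw1 (t : R) : 0 <= t <= T -> L2f (w1 t) by move=> tT; apply: L2fB; exact: hut.
have hwd : ndiff T w w1.
  move=> t dl tT dl0; have [m m0 hm] := evo_d he tT dl0; exists m; first exact: m0.
  move=> x xT xt; have h := hm x xT xt.
  have E : w x - w t - (x - t) *: w1 t = u x - u t - (x - t) *: ut t.
    apply/funext => y; rewrite -[RHS]/(u x y - u t y - (x - t) *: ut t y).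
    rewrite -[LHS]/(u x y - x *: ut 0 y - (u t y - t *: ut 0 y) - (x - t) *: (ut t y - ut 0 y)).
    by apply/rowP => i; rewrite !mxE; ring.
  by rewrite E.
have fin := ndiff_ip_bound hw hw1 hwd (a := 0) (b := s) (lexx 0) s0 (proj2 (andP sT)) (mulr_ge0 C0 s0) hpsi vel.
have E : w s - w 0 = u s - u 0 - s *: ut 0.
  apply/funext => y; rewrite -[LHS]/(u s y - s *: ut 0 y - (u 0 y - 0 *: ut 0 y)).
  by rewrite -[RHS]/(u s y - u 0 y - s *: ut 0 y); apply/rowP => i; rewrite !mxE; ring.
rewrite E subr0 in fin; apply: le_trans fin _.
by rewrite expr2 mulrA.
Qed.

End evolution.

(** * Coercivity of the energy on bounded fields *)

Section coercivity.
Context (R : realType) (n : nat).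
Local Notation V := 'rV[R]_n.
Local Notation leb := (lebesgue_rV R n).
Local Notation omega := (unit_ball_volume R n).
Variables (f f1 : R -> R) (fp0 finf : R) (Jn : V -> R) (MJ : R).
Implicit Types (u v : V -> V) (e q D : R) (p : V * V) (z x : V).

Hypothesis n2 : (2 <= n)%N.
Hypothesis hp : pot_ok f f1 fp0 finf.
Hypothesis hk : ker_ok Jn MJ.
Hypothesis hJ : (\int[leb]_z (Jn z)%:E != 0)%E.

Let w0 : 0 < omega. Proof. exact: unit_ball_volume_gt0. Qed.
Let J0 z : 0 <= Jn z. Proof. exact: (kok_ge0 hk z). Qed.
Let MJ0 : 0 <= MJ. Proof. exact: le_trans (J0 0) (kok_le hk 0). Qed.
Let mJ : mfunT Jn. Proof. exact: kok_m hk. Qed.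

(** The integrand of the quadratic form of the matrix obtained by integrating J(z) z z^T / |z|^2. *)
Definition quad (v : V) z : R := Jn z * (dot z v ^+ 2 / enorm z ^+ 2).

Lemma quad_ge0 (v : V) z : 0 <= quad v z.
Proof. by rewrite /quad; have := J0 z => ?; have := sqr_ge0 (dot z v) => ?; pos. Qed.

Lemma measurable_quad (v : V) : mfunT (quad v).
Proof. by rewrite /quad; mfun. Qed.

Definition flip (i : 'I_n) (v : V) : V := \row_j (if j == i then - v ord0 j else v ord0 j).

Lemma quad_flip_integral (v : V) i : (\int[leb]_z (quad (flip i v) z)%:E = \int[leb]_z (quad v z)%:E)%E.
Proof.
pose l : V := \row_j (if j == i then - 1 else 1).
have l1 j : `|l ord0 j| = 1 by rewrite mxE; case: ifP => _; rewrite ?normrN normr1.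
have h := @ge0_integral_affine R n l 0 (fun z => (quad v z)%:E).
have aE z j : rV_affine l 0 z ord0 j = (if j == i then - z ord0 j else z ord0 j).
  by rewrite !mxE addr0; case: ifP => _; rewrite ?mulN1r ?mul1r.
have nE z : dot (rV_affine l 0 z) (rV_affine l 0 z) = dot z z.
  by apply: eq_bigr => j _; rewrite aE; case: ifP => _; rewrite ?mulrNN.
have dE z : dot (rV_affine l 0 z) v = dot z (flip i v).
  apply: eq_bigr => j _; rewrite aE [flip i v _ _]mxE; case: ifP => _ //.
  by rewrite mulrN mulNr.
transitivity (\int[leb]_z (quad v (rV_affine l 0 z))%:E)%E.
  apply: eq_integral => z _; rewrite /quad dE.
  have nn : enorm (rV_affine l 0 z) = enorm z by rewrite /enorm nE.
  by rewrite nn (kok_rad hk nn).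
rewrite h.
- rewrite big1 ?invr1 ?mul1e//.
- by move=> j; rewrite -normr_gt0 l1.
- by have := measurable_quad v => ?; mfun.
- by move=> z; rewrite lee_fin quad_ge0.
Qed.

Lemma quad_coordinate_neq0 (i : 'I_n) : (\int[leb]_z (quad (delta_mx ord0 i) z)%:E != 0)%E.
Proof.
apply/eqP => h; move/eqP: hJ; apply.
have mq := measurable_quad (delta_mx ord0 i).
have hae : ae_eq leb setT (fun z => (quad (delta_mx ord0 i) z)%:E) (cst 0%E).
  apply/ae_eq_integral_abs => //; first by mfun.
  by rewrite -h; apply: eq_integral => z _; rewrite gee0_abs// lee_fin quad_ge0.
rewrite -[RHS](integral0 leb setT); apply: ae_eq_integral => //; first by mfun.
apply: filterS2 hae (hyperplane_ae R i) => z /(_ I) h1 h2 _.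
have zi : dot z (delta_mx ord0 i) = z ord0 i.
  rewrite /dot (bigD1 i)//= mxE !eqxx mulr1 big1 ?addr0// => j ji.
  by rewrite mxE eqxx /= (negbTE ji) mulr0.
have z0 : enorm z != 0.
  apply/eqP => h3; move/eqP: h2; apply; have := ler_coord_enorm z i.
  by rewrite h3 normr_le0 => /eqP.
move: h1; rewrite /quad zi /= => -[] /eqP.
rewrite mulf_eq0 => /orP[/eqP ->//|].
rewrite mulf_eq0 sqrf_eq0 (negbTE h2)/= invr_eq0 sqrf_eq0 (negbTE z0)//.
Qed.

Lemma quad_le (v : V) z : quad v z <= MJ * enorm v ^+ 2 * \1_(eball 0 1) z.
Proof.
have [->|z0] := eqVneq z 0.
  rewrite /quad dot0l expr0n/= mul0r mulr0; have := MJ0 => ?; pos.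
have z1 : 0 < enorm z by rewrite enorm_gt0.
rewrite mulrAC /quad; apply: ler_pM => //; first by have := sqr_ge0 (dot z v) => ?; pos.
  exact: Jn_le hk z.
rewrite ler_pdivrMr ?exprn_gt0// -exprMn -real_normK ?num_real// mulrC.
by apply: sqr_mono => //; exact: ler_dot_enorm.
Qed.

Lemma rint_ball : (\int[leb]_z (\1_(eball (0 : V) 1) z)%:E = omega%:E)%E.
Proof. by rewrite rint_indic; [exact: unit_ball_volumeE|exact: measurable_eball]. Qed.

Lemma quad_int_le (v : V) : (\int[leb]_z (quad v z)%:E <= (MJ * enorm v ^+ 2 * omega)%:E)%E.
Proof.
apply: le_trans (le_rint _ (quad_ge0 v) (quad_le v)) _.
rewrite rintZl; [by rewrite rint_ball EFinM|pos|by mfun|by move=> z; pos].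
Qed.

(** J is radial, so v and its reflection in coordinate i have the same integral. Their sum has no
    cross terms and dominates twice v_i^2 times the value on the i-th basis vector. That value is
    positive, since J is not null and coordinate hyperplanes are. Averaging over i gives the factor
    1/n. *)
Lemma quad_lower : exists2 al : R, 0 < al & forall v : V,
  ((al * dot v v)%:E <= \int[leb]_z (quad v z)%:E)%E.
Proof.
pose A (i : 'I_n) : R := fine (\int[leb]_z (quad (delta_mx ord0 i) z)%:E)%E.
have AE i : (\int[leb]_z (quad (delta_mx ord0 i) z)%:E = (A i)%:E)%E.
  rewrite /A fineK// ge0_fin_numE; first by apply: le_lt_trans (quad_int_le _) _; rewrite ltry.
  by apply: rint_ge0 => z; exact: quad_ge0.
have A0 i : 0 < A i.
  rewrite -lte_fin -AE lt_neqAle eq_sym quad_coordinate_neq0/=.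
  by apply: rint_ge0 => z; exact: quad_ge0.
have ex : exists2 a : R, 0 < a & forall i, a <= A i.
  exists (\big[Num.min/1]_i A i); first by apply/bigmin_gtP; split => // i _; exact: A0.
  by move=> i; exact: bigmin_le_cond.
have [a a0 ha] := ex.
have nr : 0 < n%:R :> R by rewrite ltr0n (leq_trans _ n2).
have coord (v : V) i : ((A i * v ord0 i ^+ 2)%:E <= \int[leb]_z (quad v z)%:E)%E.
  have mq := measurable_quad.
  have h : (\int[leb]_z (2 * (v ord0 i ^+ 2 * quad (delta_mx ord0 i) z))%:E <=
     \int[leb]_z (quad v z + quad (flip i v) z)%:E)%E.
    apply: le_rint => z; first by have := quad_ge0 (delta_mx ord0 i) z => ?; have := sqr_ge0 (v ord0 i) => ?; pos.
    rewrite /quad; pose s : R := dot z v - z ord0 i * v ord0 i.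
    have e1 : dot z v = s + z ord0 i * v ord0 i by rewrite /s subrK.
    have e2 : dot z (flip i v) = s - z ord0 i * v ord0 i.
      rewrite /s /dot (bigD1 i)//= [in RHS](bigD1 i)//= mxE eqxx.
      rewrite (eq_bigr (fun j => z ord0 j * v ord0 j)); first by ring.
      by move=> j ji; rewrite mxE (negbTE ji).
    have e3 : dot z (delta_mx ord0 i) = z ord0 i.
      rewrite /dot (bigD1 i)//= mxE !eqxx mulr1 big1 ?addr0// => j ji.
      by rewrite mxE eqxx /= (negbTE ji) mulr0.
    rewrite e1 e2 e3.
    have -> : Jn z * ((s + z ord0 i * v ord0 i) ^+ 2 / enorm z ^+ 2) +
      Jn z * ((s - z ord0 i * v ord0 i) ^+ 2 / enorm z ^+ 2) =
      2 * (v ord0 i ^+ 2 * (Jn z * (z ord0 i ^+ 2 / enorm z ^+ 2))) +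
      2 * (Jn z * (s ^+ 2 / enorm z ^+ 2)) by ring.
    by rewrite lerDl; have := J0 z => ?; have := sqr_ge0 s => ?; pos.
  have hq (w : V) z := quad_ge0 w z.
  rewrite rintZl// in h; [|by have := mq (delta_mx ord0 i) => ?; mfun
    |by move=> z; have := hq (delta_mx ord0 i) z => ?; have := sqr_ge0 (v ord0 i) => ?; pos].
  rewrite rintZl// ?sqr_ge0// AE rintD// quad_flip_integral in h.
  have F : (\int[leb]_z (quad v z)%:E)%E \is a fin_num.
    rewrite ge0_fin_numE; last by apply: rint_ge0.
    by apply: le_lt_trans (quad_int_le _) _; rewrite ltry.
  move: h; rewrite -(fineK F) -!EFinM -EFinD !lee_fin; lra.
exists (a / n%:R) => [|v]; first exact: divr_gt0.
have F : (\int[leb]_z (quad v z)%:E)%E \is a fin_num.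
  rewrite ge0_fin_numE; last by apply: rint_ge0 => z; exact: quad_ge0.
  by apply: le_lt_trans (quad_int_le _) _; rewrite ltry.
rewrite -(fineK F) lee_fin; set I := fine _.
have hI i : a * v ord0 i ^+ 2 <= I.
  have := coord v i; rewrite -(fineK F) lee_fin -/I; apply: le_trans.
  by rewrite ler_wpM2r ?sqr_ge0.
rewrite mulrAC ler_pdivrMr// /dot mulr_sumr.
apply: (@le_trans _ _ (\sum_(i < n) I)); first by apply: ler_sum => i _; rewrite -expr2.
by rewrite sumr_const card_ord mulr_natr.
Qed.

(** The sup bound keeps the argument of f below s = 4 M^2 / (e |z|), which is at least 4 M^2 for
    bonds in the unit ball and e <= 1. By the chord inequality f lies above the line through (s, f
    s) there, and f s >= f(4 M^2). *)
Lemma PDd_lower e u (M : R) p : 0 < e -> e <= 1 -> 0 < M -> (forall x, enorm (u x) <= M) ->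
  Jn p.1 * (dlt u e p ^+ 2 / enorm p.1 ^+ 2) <= (4 * M ^+ 2 / f (4 * M ^+ 2)) * PDd f Jn e (dlt u e) p.
Proof.
move=> e0 e1 M0 uM; rewrite /PDd; set z := p.1; set q := dlt u e p.
have M2 : 0 < 4 * M ^+ 2 by rewrite mulr_gt0// exprn_gt0.
have c0 : 0 < f (4 * M ^+ 2) by exact: pok_pos hp _ M2.
have [z0|z0] := eqVneq z 0.
  have -> : q = 0 by rewrite /q /dlt -/z z0 dot0r.
  rewrite expr0n/= mul0r mulr0; have := J0 z => ?; have := f_parg_ge0 hp 0 z e0 => ?.
  by rewrite mulr_ge0 ?divr_ge0 ?mulr_ge0// ltW.
have zp : 0 < enorm z by rewrite enorm_gt0.
have [z1|z1] := leP 1 (enorm z); first by rewrite (kok_supp hk z1) !mul0r mulr0.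
rewrite [leRHS]mulrCA; apply: ler_wpM2l; first exact: J0.
have qM : `|q| <= 2 * M * enorm z.
  apply: le_trans (dlt_le u e p) _; rewrite ler_wpM2r ?enorm_ge0//.
  apply: le_trans (ler_enormD _ _) _; rewrite enormN.
  by have := uM (p.2 + e *: p.1); have := uM p.2; lra.
have q2 : q ^+ 2 <= 4 * M ^+ 2 * enorm z ^+ 2.
  have := sqr_mono (normr_ge0 q) qM; rewrite real_normK ?num_real// => /le_trans; apply.
  by apply: le_of_eq; ring.
pose s : R := 4 * M ^+ 2 / (e * enorm z).
have ez : 0 < e * enorm z by rewrite mulr_gt0.
have ez1 : e * enorm z <= 1 by rewrite -[leRHS]mulr1; apply: ler_pM => //; exact: ltW.
have s0 : 0 < s by rewrite divr_gt0.
have sM : 4 * M ^+ 2 <= s by rewrite /s ler_pdivlMr// -[leRHS]mulr1 ler_wpM2l// ltW.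
have rs : parg e q z <= s.
  have -> : parg e q z = q ^+ 2 / enorm z ^+ 2 / (e * enorm z).
    by rewrite /parg; field; rewrite !gt_eqF.
  rewrite /s ler_wpM2r ?invr_ge0 ?(ltW ez)// ler_pdivrMr ?exprn_gt0//.
have r0 := parg_ge0 q z e0.
have h := pok_chord hp r0 s0 rs.
have h2 := pok_nd hp (ltW M2) sM.
have h3 : parg e q z * f (4 * M ^+ 2) <= s * f (parg e q z).
  by apply: le_trans h; apply: ler_wpM2l.
rewrite [leRHS]mulrAC ler_pdivlMr//.
have -> : q ^+ 2 / enorm z ^+ 2 * f (4 * M ^+ 2) = e * enorm z * (parg e q z * f (4 * M ^+ 2)).
  by rewrite /parg; field; rewrite !gt_eqF.
apply: le_trans (ler_wpM2l (ltW ez) h3) _.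
by apply: le_of_eq; rewrite /s; field; rewrite !gt_eqF.
Qed.

Definition strain1 u e p : R := Jn p.1 * (`|dlt u e p| / enorm p.1).

Lemma strain1_ge0 u e p : 0 <= strain1 u e p.
Proof. by rewrite /strain1; have := J0 p.1 => ?; pos. Qed.

Lemma measurable_strain1 u e : mfunT u -> mfunT (strain1 u e).
Proof. by move=> mu; have := measurable_dlt e mu => ?; rewrite /strain1; mfun. Qed.

(** Young's inequality with weight la. The energy carries a factor e, so a small la followed by a
    much smaller e makes the L^1 norm of the projected increments as small as desired. *)
Lemma strain1_le e u (M r la : R) : 0 < e -> e <= 1 -> 0 < M -> L2f u -> (forall x, enorm (u x) <= M) ->
  0 <= r -> 0 < la ->
  (II (fun p => (\1_(rV_box 0 r) p.2 * strain1 u e p)%R) <=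
    (2^-1 * (la * MJ * omega * (2 * r) ^+ n +
      la^-1 * (4 * M ^+ 2 / f (4 * M ^+ 2)) * (e * omega * PDr f Jn e u)))%:E)%E.
Proof.
move=> e0 e1 M0 hu uM r0 la0; have [mu _] := hu.
have M2 : 0 < 4 * M ^+ 2 by rewrite mulr_gt0// exprn_gt0.
have c0 : 0 < f (4 * M ^+ 2) by exact: pok_pos hp _ M2.
have md := measurable_dlt e mu; have mP := measurable_PDd hp hk e md.
have P0 p : 0 <= PDd f Jn e (dlt u e) p by exact: (PDd_ge0 hp hk).
have mB1 : mfunT (\1_(eball (0 : V) 1) : V -> R) by mfun.
have mB2 : mfunT (\1_(rV_box (0 : V) r) : V -> R) by mfun.
have mTT : mfunT (fun p : V * V => (\1_(eball 0 1) p.1 * \1_(rV_box 0 r) p.2 : R)) by mfun.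
have C0 : 0 <= 4 * M ^+ 2 / f (4 * M ^+ 2) by rewrite divr_ge0// ltW.
apply: (@le_trans _ _ (II (fun p => (2^-1 * la * MJ * (\1_(eball 0 1) p.1 * \1_(rV_box 0 r) p.2) +
   2^-1 * la^-1 * (4 * M ^+ 2 / f (4 * M ^+ 2)) * PDd f Jn e (dlt u e) p)%R))).
  apply: le_II => p; first by have := strain1_ge0 u e p => ?; pos.
  have h := PDd_lower p e0 e1 M0 uM.
  have hJ1 := Jn_le hk p.1; have j0 := J0 p.1.
  set F := PDd _ _ _ _ _ in h *; set q := dlt u e p in h *.
  have k1 : strain1 u e p <= 2^-1 * la * Jn p.1 + 2^-1 * la^-1 * (Jn p.1 * (q ^+ 2 / enorm p.1 ^+ 2)).
    rewrite /strain1 -/q; set y := `|q| / enorm p.1.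
    have -> : q ^+ 2 / enorm p.1 ^+ 2 = y ^+ 2 by rewrite /y exprMn real_normK ?num_real// exprVn.
    have -> : 2^-1 * la * Jn p.1 + 2^-1 * la^-1 * (Jn p.1 * y ^+ 2) = Jn p.1 * (2^-1 * (la + la^-1 * y ^+ 2)).
      by ring.
    apply: ler_wpM2l => //; have : 0 <= la^-1 * (la - y) ^+ 2 by rewrite mulr_ge0 ?sqr_ge0// invr_ge0 ltW.
    have -> : la^-1 * (la - y) ^+ 2 = la - 2 * y + la^-1 * y ^+ 2 by field; rewrite gt_eqF.
    by move=> h4; lra.
  have l0 : 0 <= 2^-1 * la^-1 by pos.
  have k2 := ler_wpM2l l0 h.
  have k3 : 0 <= 2^-1 * la by pos.
  have k4 := ler_wpM2l k3 hJ1.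
  have F0 : 0 <= 2^-1 * la^-1 * (4 * M ^+ 2 / f (4 * M ^+ 2)) * F by have := P0 p => ?; rewrite mulr_ge0// mulr_ge0.
  have [->|->] : \1_(rV_box 0 r) p.2 = 0 :> R \/ \1_(rV_box 0 r) p.2 = 1 :> R.
  - by rewrite indicE; case: (_ \in _); [right|left].
  - by rewrite !mulr0 mul0r add0r.
  rewrite mul1r mulr1; apply: le_trans k1 _; apply: lerD; first by rewrite -[leRHS]mulrA.
  by rewrite -[leRHS]mulrA.
rewrite IID; [|sidec..].
rewrite IIZ; [|sidec..].
rewrite IIZ; [|sidec..].
rewrite (II_PDd n2 hp hk)// II_tensor; [|sidec..].
rewrite rint_ball rint_box// -!EFinM -EFinD lee_fin.
by apply: le_of_eq; field; rewrite !gt_eqF.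
Qed.

End coercivity.

(** * Diagonal extraction and completeness of L^2 *)

Lemma cvg_sum_seq (R : realType) (I : Type) (r : seq I) (a : I -> nat -> R) (l : I -> R) :
  (forall i, a i @ \oo --> l i) -> (fun j => \sum_(i <- r) a i j) @ \oo --> \sum_(i <- r) l i.
Proof.
move=> al; elim: r => [|i r IH].
  by rewrite big_nil; under eq_fun do rewrite big_nil; exact: cvg_cst.
by rewrite big_cons; under eq_fun do rewrite big_cons; exact: cvgD.
Qed.

Lemma half_series (R : realFieldType) (n : nat) : \sum_(0 <= j < n) (2^-1 : R) ^+ j <= 2.
Proof.
suff -> : \sum_(0 <= j < n) (2^-1 : R) ^+ j = 2 - 2 * 2^-1 ^+ n.
  by rewrite lerBlDr lerDl mulr_ge0// exprn_ge0.
elim: n => [|n IH]; first by rewrite big_geq// expr0; ring.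
by rewrite big_nat_recr//= IH exprS; field.
Qed.

Lemma increasing_seq_le (s : nat -> nat) : {homo s : m n / (m < n)%N} -> forall j, (j <= s j)%N.
Proof. by move=> hs; elim=> // j IH; apply: leq_ltn_trans IH _; exact: hs. Qed.

(* Tychonoff provides a cluster point of the sequence in the countable product, and a
   subsequence is then picked coordinate block by coordinate block. *)
Lemma diagonal_subsequence (R : realType) (C : countType) (F : C -> nat -> R) (B : C -> R) :
  (forall c k, `|F c k| <= B c) ->
  exists phi : nat -> nat, {homo phi : m n / (m < n)%N} /\ exists p : C -> R,
    forall c (e : R), 0 < e -> \forall j \near \oo, `|F c (phi j) - p c| <= e.
Proof.
move=> FB; pose T := fun _ : C => (R : topologicalType).
pose K : set (prod_topology T) := [set f : forall c, T c | forall c, `[- B c, B c]%classic (f c)].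
have cK : compact K by apply: (@tychonoff C T (fun c => `[- B c, B c]%classic)) => c; exact: segment_compact.
pose G (k : nat) : prod_topology T := fun c => F c k.
have GK : (G @ \oo) K.
  by exists 0%N => // k _ c; rewrite /= in_itv/= -ler_norml; exact: FB.
have [p [_ clp]] := cK (G @ \oo) _ GK.
have ex (j N : nat) : exists k : nat, (N <= k)%N /\ forall c, (pickle c < j)%N -> `|F c k - p c| <= j.+1%:R^-1.
  pose P (i : 'I_j) (f : prod_topology T) : Prop :=
     if unpickle i is Some c then `|(f c : R) - (p c : R)| <= j.+1%:R^-1 else true.
  pose U : set (prod_topology T) := [set f | forall i : 'I_j, P i f].
  have nU : nbhs (p : prod_topology T) U.
    apply: (@filter_forall _ _ P (nbhs (p : prod_topology T)) _) => i; rewrite /P.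
    case: (unpickle i) => [c|]; last by apply: filterE.
    have hc : proj c @ (p : prod_topology T) --> proj c (p : prod_topology T) by exact: (@proj_continuous C T c).
    have nb : nbhs (p c : R) [set y : R | `|y - (p c : R)| <= j.+1%:R^-1].
      apply/nbhs_ballP; exists (j.+1%:R^-1) => /=; first by rewrite invr_gt0.
      by move=> y; rewrite /ball/= distrC; exact: ltW.
    exact: (hc _ nb).
  have GN : (G @ \oo) [set f | exists2 k, (N <= k)%N & f = G k].
    by exists N => // k /= Nk; exists k.
  have [_ [[k Nk ->] Uk]] := clp _ _ GN nU.
  exists k; split => // c cj; have := Uk (Ordinal cj).
  by rewrite /P /= pickleK.
have [h hh] := choice (fun jN : nat * nat => ex jN.1 jN.2).
pose phi := fix phi (j : nat) : nat := if j is j'.+1 then h (j, (phi j').+1) else h (0%N, 0%N).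
exists phi; split.
  by apply: homo_ltn => [y x z|j]; [exact: ltn_trans|have [] := hh (j.+1, (phi j).+1)].
exists p => c e e0.
have ne : \forall j \near \oo, j.+1%:R^-1 <= e :> R.
  by apply: filterS (near_infty_natSinv_lt (PosNum e0)) => j; exact: ltW.
apply: filterS2 ne (nbhs_infty_gt (pickle c)) => j je jc; apply: le_trans je.
case: j jc => // j jc.
by have [_] := hh (j.+1, (phi j).+1); apply.
Qed.

Lemma limn_einf_le (R : realType) (u : (\bar R)^nat) (c : \bar R) : (forall n, (u n <= c)%E) -> (limn_einf u <= c)%E.
Proof.
move=> uc; rewrite limn_einf_lim; apply: lime_le; first exact: is_cvg_einfs.
by apply: nearW => n; apply: le_trans (uc n); apply: ereal_inf_lbound; exists n => /=.
Qed.

Section completeness.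
Context (R : realType) (n : nat).
Local Notation V := 'rV[R]_n.
Local Notation leb := (lebesgue_rV R n).

(** Riesz-Fischer along a subsequence with summable increments, the common support turning L^2 into
    L^1 bounds. By Fatou each estimate passes to the limit with its own threshold N. A Cauchy
    property that is uniform in time therefore stays uniform although the limit is taken separately
    at each time. *)
Lemma L2_complete (w : nat -> V -> V) (r : R) : 0 <= r ->
  (forall k, L2f (w k)) -> (forall k x, ~ rV_box 0 r x -> w k x = 0) ->
  (forall e : R, 0 < e -> exists N : nat, forall k l : nat, (N <= k)%N -> (N <= l)%N -> nrm (w k - w l) <= e) ->
  exists wl : V -> V, L2f wl /\
   forall (e : R) (k N : nat), (forall l : nat, (N <= l)%N -> nrm (w k - w l) <= e) -> nrm (w k - wl) <= e.
Proof.
move=> r0 hw wr cau; have mw k := L2f_measurable (hw k).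
have h2 j : 0 < (2^-1 : R) ^+ j by rewrite exprn_gt0.
have [N0 hN0] := choice (fun j : nat => cau _ (h2 j)).
pose s := fix s (j : nat) : nat := if j is j'.+1 then maxn (N0 j) (s j').+1 else N0 0%N.
have s_inc : {homo s : m k / (m < k)%N}.
  by apply: homo_ltn => [y x z|j]; [exact: ltn_trans|rewrite leq_maxr].
have sN j : (N0 j <= s j)%N by case: j => // j; rewrite leq_maxl.
have s_ge := increasing_seq_le s_inc.
pose g (j : nat) (x : V) : R := enorm (w (s j.+1) x - w (s j) x).
have mg j : mfunT (g j) by rewrite /g; have := mw (s j.+1) => ?; have := mw (s j) => ?; mfun.
have g0 j x : 0 <= g j x by exact: enorm_ge0.
pose C : R := (2 * r) ^+ n + 1.
have C0 : 0 <= C by rewrite /C; pos.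
have gint j : (\int[leb]_x (g j x)%:E <= (2^-1 ^+ j * C)%:E)%E.
  have hj : nrm (w (s j.+1) - w (s j)) <= 2^-1 ^+ j.
    by apply: hN0; rewrite ?sN// (leq_trans (sN j))// ltnW// s_inc.
  have hd := L2fB (hw (s j.+1)) (hw (s j)).
  set la : R := 2^-1 ^+ j in hj *; have la0 : 0 < la by exact: h2.
  have mb : mfunT (\1_(rV_box (0 : V) r) : V -> R) by mfun.
  have md : mfunT (fun x => dot (w (s j.+1) x - w (s j) x) (w (s j.+1) x - w (s j) x)).
    by have := mw (s j.+1) => ?; have := mw (s j) => ?; mfun.
  apply: (@le_trans _ _ (\int[leb]_x (2^-1 * la * \1_(rV_box 0 r) x +
     2^-1 * la^-1 * dot (w (s j.+1) x - w (s j) x) (w (s j.+1) x - w (s j) x))%:E)%E).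
    apply: le_rint => // x; rewrite -sqr_enorm -/(g j x).
    have [xb|xb] := boolP (x \in rV_box 0 r); last first.
      have xo : ~ rV_box 0 r x by move=> h; move/negP: xb; apply; exact/mem_set.
      by rewrite /g !wr// subrr enorm0 expr0n/= mulr0 addr0; pos.
    rewrite indicE xb mulr1; have : 0 <= la^-1 * (la - g j x) ^+ 2 by rewrite mulr_ge0 ?sqr_ge0// invr_ge0 ltW.
    have -> : la^-1 * (la - g j x) ^+ 2 = la - 2 * g j x + la^-1 * g j x ^+ 2 by field; rewrite gt_eqF.
    have -> : 2^-1 * la^-1 * g j x ^+ 2 = 2^-1 * (la^-1 * g j x ^+ 2) by rewrite mulrA.
    by move=> h; lra.
  rewrite rintD; [|by mfun|by move=> x; pos|by mfun|by move=> x; pos].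
  rewrite rintZl; [|by pos|by mfun|by move=> x; pos].
  rewrite rintZl; [|by pos|by mfun|by move=> x; pos].
  rewrite rint_box//.
  have -> : (\int[leb]_x (dot (w (s j.+1) x - w (s j) x) (w (s j.+1) x - w (s j) x))%:E =
     (nrm (w (s j.+1) - w (s j)) ^+ 2)%:E)%E by rewrite -nrmE.
  rewrite -!EFinM -EFinD lee_fin /C.
  have h : nrm (w (s j.+1) - w (s j)) ^+ 2 <= la ^+ 2 by apply: sqr_mono (nrm_ge0 _) hj.
  have h3 : 2^-1 * la^-1 * nrm (w (s j.+1) - w (s j)) ^+ 2 <= 2^-1 * la^-1 * la ^+ 2.
    by apply: ler_wpM2l => //; pos.
  have h4 : 2^-1 * la^-1 * la ^+ 2 = 2^-1 * la by field; rewrite gt_eqF.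
  rewrite h4 in h3.
  have h5 : 0 <= la * (2 * r) ^+ n by pos.
  have -> : 2^-1 * la * (2 * r) ^+ n = 2^-1 * (la * (2 * r) ^+ n) by rewrite mulrA.
  rewrite mulrDr mulr1; lra.
have mgE j : mfunT (fun x => (g j x)%:E) by exact/measurable_EFinP.
pose S x : \bar R := (\sum_(0 <= j <oo) (g j x)%:E)%E.
have S0 x : (0 <= S x)%E by apply: nneseries_ge0 => j _ _; rewrite lee_fin.
have mS : mfunT S.
  by apply: ge0_emeasurable_sum => // j x _ _; rewrite lee_fin.
have Sint : leb.-integrable setT S.
  apply/integrableP; split => //.
  apply: (@le_lt_trans _ _ (2 * C)%:E); last exact: ltry.
  rewrite (eq_integral S); last by move=> x _; rewrite gee0_abs.
  rewrite integral_nneseries//; last by move=> j x _; rewrite lee_fin.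
  apply: lime_le; first by apply: is_cvg_nneseries => j _ _; apply: integral_ge0 => x _; rewrite lee_fin.
  apply: nearW => m; apply: (@le_trans _ _ (\sum_(0 <= j < m) (2^-1 ^+ j * C)%:E)%E).
    by apply: lee_sum => j _; exact: gint.
  by rewrite sumEFin -mulr_suml lee_fin; apply: ler_wpM2r => //; exact: half_series.
have aeS := integrable_ae measurableT Sint.
(* The upper limit is a measurable function defined at every point, and it equals the limit at
   almost every one. *)
pose wl (x : V) : V := \row_i fine (limn_esup (fun j => (w (s j) x ord0 i)%:E)).
have mwl : mfunT wl.
  apply/measurable_fun_rVP => i; under eq_fun do rewrite mxE.
  apply: measurableT_comp => //; apply: measurable_fun_limn_esup => j.
  by apply/measurable_EFinP; move/measurable_fun_rVP: (mw (s j)); apply.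
have wlim : {ae leb, forall x, forall i, (fun j => w (s j) x ord0 i) @ \oo --> wl x ord0 i}.
  apply: filterS aeS => x /(_ I) Sx i.
  pose t (j : nat) : R := w (s j) x ord0 i.
  have ct : cvgn t.
    have -> : t = (fun j => t 0%N + series (telescope t) j).
      by apply/funext => j; exact: eq_sum_telescope.
    apply: is_cvgD; first exact: is_cvg_cst.
    apply: normed_cvg; apply: nondecreasing_is_cvgn.
      by apply: nondecreasing_series => j _ _; exact: normr_ge0.
    exists (fine (S x)) => _ [j _ <-].
    rewrite -lee_fin fineK//; apply: (@le_trans _ _ (\sum_(0 <= k < j) (g k x)%:E)%E); last first.
      by apply: nneseries_lim_ge => k _ _; rewrite lee_fin.
    rewrite /series/= -sumEFin; apply: lee_sum => k _; rewrite lee_fin /telescope /t /g.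
    have := ler_coord_enorm (w (s k.+1) x - w (s k) x) i.
    by rewrite !mxE.
  have -> : wl x ord0 i = limn t.
    rewrite mxE; have h : (fun j => (t j)%:E) @ \oo --> (limn t)%:E by apply: cvg_EFin => //; exact: nearW.
    by have [_ ->] := cvg_limn_einf_sup h.
  exact: ct.
have fat (e : R) (k N : nat) : 0 <= e -> (forall l : nat, (N <= l)%N -> nrm (w k - w l) <= e) ->
    (\int[leb]_x sqL2 (w k - wl)%R x <= (e ^+ 2)%:E)%E.
  move=> e0 hl.
  pose F (j : nat) (x : V) : \bar R := sqL2 (w k - w (s (N + j)%N)) x.
  have mF j : mfunT (F j).
    by apply/measurable_EFinP; have := mw k => ?; have := mw (s (N + j)%N) => ?; mfun.
  have F0 j x : (0 <= F j x)%E by exact: sqL2_ge0.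
  apply: (@le_trans _ _ (\int[leb]_x limn_einf (F^~ x))%E).
    apply: le_of_eq; apply: ae_eq_integral => //.
    - by apply/measurable_EFinP; have := mw k => ?; mfun.
    - rewrite (_ : (fun x => limn_einf _) = (fun x : V => - limn_esup (fun j => - F j x))%E); last first.
        by apply/funext => x; rewrite -[X in limn_esup X]/(-%E \o F^~ x) limn_esupN oppeK.
      apply: measurableT_comp => //; apply: measurable_fun_limn_esup => j.
      by apply: measurableT_comp => //; exact: mF.
    apply: filterS wlim => x hx _.
    have h : (fun j => F j x) @ \oo --> sqL2 (w k - wl) x.
      rewrite /F /sqL2 /=; apply: cvg_EFin; first exact: nearW.
      rewrite /dot -[X in X @ _ --> _]/(fun j => \sum_i (w k - w (s (N + j)%N)) x ord0 i * (w k - w (s (N + j)%N)) x ord0 i).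
      apply: (cvg_sum_seq (a := fun i j => (w k - w (s (N + j)%N)) x ord0 i * (w k - w (s (N + j)%N)) x ord0 i)) => i.
      have ci : (fun j => (w k - w (s (N + j)%N)) x ord0 i) @ \oo --> (w k - wl) x ord0 i.
        rewrite -[X in _ --> X]/((w k x - wl x) ord0 i) !mxE.
        rewrite (_ : (fun j => _) = (fun j => w k x ord0 i - w (s (N + j)%N) x ord0 i)); last first.
          by apply/funext => j; rewrite -[LHS]/((w k x - w (s (N + j)%N) x) ord0 i) !mxE.
        apply: cvgB; first exact: cvg_cst.
        have := hx i; rewrite -(cvg_shiftn N); under eq_fun do rewrite addnC.
        by rewrite mxE.
      exact: cvgM.
    by have [-> _] := cvg_limn_einf_sup h.
  apply: le_trans (fatou leb measurableT mF (fun j x _ => F0 j x)) _.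
  apply: limn_einf_le => j; rewrite /F nrmE; last exact: L2fB.
  rewrite lee_fin; apply: sqr_mono; first exact: nrm_ge0.
  by apply: hl; apply: leq_trans (s_ge _); rewrite leq_addr.
have mB k : mfunT (w k - wl).
  by have := mw k => ?; rewrite (_ : w k - wl = fun x : V => w k x - wl x)//; mfun.
have hwl : L2f wl.
  have [N hN] := cau 1 ltr01.
  have hB : L2f (w N - wl).
    split; first exact: mB.
    by apply: le_lt_trans (fat 1 N N ler01 (fun l Nl => hN N l (leqnn _) Nl)) _; rewrite ltry.
  by have := L2fB (hw N) hB; rewrite opprB addrC subrK.
exists wl; split => // e k N hl.
have e0 : 0 <= e by apply: le_trans (nrm_ge0 _) (hl N (leqnn N)).
have := fat e k N e0 hl; rewrite nrmE; last exact: L2fB.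
by rewrite lee_fin ler_pXn2r// nnegrE// nrm_ge0.
Qed.

End completeness.

(** * Projected nonlocal averages *)

Lemma inverse_power_near1 (R : realType) (n : nat) (e : R) : 0 < e ->
  exists2 d : R, 0 < d & forall l : R, `|l - 1| <= d -> 0 < l /\ `|1 - (`|l| ^+ n)^-1| <= e.
Proof.
move=> e0.
have c : (fun l : R => (l ^+ n)^-1) @ (1 : R) --> ((1 : R) ^+ n)^-1.
  by apply: cvgV; [rewrite expr1n oner_neq0|exact: exprn_continuous].
rewrite expr1n invr1 in c.
have /cvgrPdist_le/(_ _ e0)/nbhs_ballP[m /= m0 hm] := c.
exists (Num.min (m / 2) 2^-1); first by rewrite lt_min divr_gt0//= invr_gt0.
move=> l; rewrite le_min => /andP[l1 l2].
have l0 : 0 < l by move: l2; rewrite ler_norml => /andP[? ?]; lra.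
split=> //; rewrite (gtr0_norm l0).
have hb : ball (1 : R) m l.
  rewrite /ball/= distrC; apply: le_lt_trans l1 _; rewrite ltr_pdivrMr//; lra.
exact: (hm l hb).
Qed.

Section kernel_operator.
Context (R : realType) (n : nat).
Local Notation V := 'rV[R]_n.
Local Notation leb := (lebesgue_rV R n).
Local Notation omega := (unit_ball_volume R n).
Variables (f f1 : R -> R) (fp0 finf : R) (Jn : V -> R) (MJ : R).
Implicit Types (u v : V -> V) (e q D : R) (p : V * V) (z x : V).

Hypothesis n2 : (2 <= n)%N.
Hypothesis hp : pot_ok f f1 fp0 finf.
Hypothesis hk : ker_ok Jn MJ.
Hypothesis hJ : (\int[leb]_z (Jn z)%:E != 0)%E.

Let w0 : 0 < omega. Proof. exact: unit_ball_volume_gt0. Qed.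
Let J0 z : 0 <= Jn z. Proof. exact: (kok_ge0 hk z). Qed.
Let MJ0 : 0 <= MJ. Proof. exact: le_trans (J0 0) (kok_le hk 0). Qed.
Let mJ : mfunT Jn. Proof. exact: kok_m hk. Qed.

Lemma ball_integrable (F : V -> R) (c : R) : mfunT F ->
  (forall z, `|F z| <= c * \1_(eball 0 1) z) -> leb.-integrable setT (EFin \o F).
Proof.
move=> mF hF; apply/integrableP; split; first exact/measurable_EFinP.
have c0 : 0 <= c.
  have := hF 0; rewrite indicE mem_eball0 enorm0 ltr01 mulr1; exact: le_trans.
apply: (@le_lt_trans _ _ (c * omega)%:E); last exact: ltry.
apply: (@le_trans _ _ (\int[leb]_z (c * \1_(eball 0 1) z)%:E)%E).
  by apply: ge0_le_integralT => z; rewrite ?abse_ge0//= lee_fin.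
rewrite rintZl; [by rewrite rint_ball EFinM|sidec..].
Qed.

Lemma Rint_abs_le (F : V -> R) (c : R) : leb.-integrable setT (EFin \o F) ->
  (\int[leb]_z (`|F z|)%:E <= c%:E)%E -> `|\int[leb]_z F z| <= c.
Proof.
move=> iF h; rewrite -lee_fin; apply: le_trans h.
rewrite -[X in (X <= _)%E]/(`|(\int[leb]_z F z)%:E|)%E /Rintegral fineK; last exact: integrable_fin_num iF.
exact: le_abse_integral (measurable_int _ iF).
Qed.

Lemma Rint_ball_le (F : V -> R) (c : R) : mfunT F ->
  (forall z, `|F z| <= c * \1_(eball 0 1) z) -> `|\int[leb]_z F z| <= c * omega.
Proof.
move=> mF hF; apply: Rint_abs_le; first exact: ball_integrable hF.
have c0 : 0 <= c.
  have := hF 0; rewrite indicE mem_eball0 enorm0 ltr01 mulr1; exact: le_trans.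
apply: (@le_trans _ _ (\int[leb]_z (c * \1_(eball 0 1) z)%:E)%E); first exact: le_rint.
rewrite rintZl; [by rewrite rint_ball EFinM|sidec..].
Qed.

Definition Kker (i j : 'I_n) z : R := Jn z * (z ord0 i * z ord0 j / enorm z ^+ 2).

Lemma measurable_Kker i j : mfunT (Kker i j).
Proof.
have := @measurable_rV_coord R n i => ?; have := @measurable_rV_coord R n j => ?.
by rewrite /Kker; mfun.
Qed.

Lemma coord_ratio_le (a b : R) z : `|a| <= enorm z -> `|b| <= enorm z -> `|a * b / enorm z ^+ 2| <= 1.
Proof.
move=> ha hb; have [z0|z0] := eqVneq (enorm z) 0.
  by rewrite z0 expr0n/= invr0 mulr0 normr0.
have z1 : 0 < enorm z by rewrite lt_neqAle eq_sym z0 enorm_ge0.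
rewrite !normrM normfV normrX (gtr0_norm z1) ler_pdivrMr ?exprn_gt0// mul1r expr2.
exact: ler_pM.
Qed.

Lemma Kker_le i j z : `|Kker i j z| <= MJ * \1_(eball 0 1) z.
Proof.
rewrite /Kker normrM ger0_norm//; apply: le_trans (Jn_le hk z).
rewrite -[leRHS]mulr1; apply: ler_wpM2l => //.
by apply: coord_ratio_le; exact: ler_coord_enorm.
Qed.

(** The integral of J(z) (z . u(x + e z)) z / |z|^2. Projecting on z keeps exactly the component
    whose increments the energy controls, so up to such increments this is the matrix of [quad]
    applied to u x. *)
Definition Kop e u x (i : 'I_n) : R := \int[leb]_z (\sum_(j < n) Kker i j z * u (x + e *: z) ord0 j).

Lemma Kop_integrand_measurable e u x i : mfunT u ->
  mfunT (fun z : V => \sum_(j < n) Kker i j z * u (x + e *: z) ord0 j).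
Proof.
move=> mu; apply: measurable_sum => j; apply: measurable_funM; first exact: measurable_Kker.
apply: (measurableT_comp (measurable_rV_coord j)); mfun.
Qed.

Lemma Kop_integrand_dot e u x i z : \sum_(j < n) Kker i j z * u (x + e *: z) ord0 j =
  Jn z * (z ord0 i * dot z (u (x + e *: z)) / enorm z ^+ 2).
Proof.
rewrite /Kker /dot [z ord0 i * _]mulr_sumr mulr_suml mulr_sumr.
by apply: eq_bigr => j _; ring.
Qed.

Lemma Kop_integrand_le e u x i (M : R) z : 0 <= M -> (forall y, enorm (u y) <= M) ->
  `|\sum_(j < n) Kker i j z * u (x + e *: z) ord0 j| <= MJ * M * \1_(eball 0 1) z.
Proof.
move=> M0 uM; rewrite Kop_integrand_dot normrM ger0_norm//.
apply: (@le_trans _ _ (Jn z * M)); last first.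
  by rewrite mulrAC; apply: ler_wpM2r => //; exact: Jn_le hk z.
apply: ler_wpM2l => //; have [z0|z0] := eqVneq (enorm z) 0.
  by rewrite z0 expr0n/= invr0 mulr0 normr0.
have z1 : 0 < enorm z by rewrite lt_neqAle eq_sym z0 enorm_ge0.
rewrite !normrM normfV normrX (gtr0_norm z1) ler_pdivrMr ?exprn_gt0//.
apply: (@le_trans _ _ (enorm z * (enorm z * M))); last by apply: le_of_eq; ring.
apply: ler_pM => //; first exact: ler_coord_enorm.
by apply: le_trans (ler_dot_enorm _ _) _; rewrite ler_wpM2l ?enorm_ge0.
Qed.

Lemma Kop_bound e u x i (M : R) : 0 <= M -> mfunT u -> (forall y, enorm (u y) <= M) ->
  `|Kop e u x i| <= MJ * M * omega.
Proof.
move=> M0 mu uM; apply: Rint_ball_le; first exact: Kop_integrand_measurable.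
by move=> z; exact: Kop_integrand_le.
Qed.

Lemma Kop_integrable e u x i (M : R) : 0 <= M -> mfunT u -> (forall y, enorm (u y) <= M) ->
  leb.-integrable setT (EFin \o (fun z => \sum_(j < n) Kker i j z * u (x + e *: z) ord0 j)).
Proof.
move=> M0 mu uM; apply: (ball_integrable (c := MJ * M)); first exact: Kop_integrand_measurable.
by move=> z; exact: Kop_integrand_le.
Qed.

(** An affine substitution in z moves the change of x and of the scale from u to the kernel, which
    varies continuously in L^1 under such maps. The modulus therefore depends on u only through M.
    The scale has to be included because the multiples of a given horizon only come close to eta. *)
Lemma Kop_modulus (M eta dl0 : R) : 0 < M -> 0 < eta -> 0 < dl0 ->
  exists2 dl : R, 0 < dl & forall u e x (p : V) i, mfunT u -> (forall y, enorm (u y) <= M) ->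
    0 < e -> `|e - eta| <= dl -> (forall j, `|x ord0 j - p ord0 j| <= dl) ->
    `|Kop e u x i - Kop eta u p i| <= dl0.
Proof.
move=> M0 eta0 dl00.
pose C : R := MJ * M * omega.
have C0 : 0 <= C by rewrite /C; pos.
have nr : 0 <= n%:R :> R by rewrite ler0n.
pose e1 : R := dl0 / (2 * (M * n%:R + 1)).
have D1 : 0 < 2 * (M * n%:R + 1) by rewrite mulr_gt0// ltr_wpDl// mulr_ge0// ltW.
have e10 : 0 < e1 by rewrite divr_gt0.
pose e2 : R := dl0 / (2 * (C + 1)).
have D2 : 0 < 2 * (C + 1) by rewrite mulr_gt0// ltr_wpDl.
have e20 : 0 < e2 by rewrite divr_gt0.
have aff (ij : 'I_n * 'I_n) : exists dl : R, 0 < dl /\ forall (l : R) (h : V), `|l - 1| <= dl ->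
   (forall i, `|h ord0 i| <= dl) ->
    (\int[leb]_x (`|Kker ij.1 ij.2 (l *: x + h) - Kker ij.1 ij.2 x|)%:E <= e1%:E)%E.
  have [|x xo|//||dl d0 hd] := @affine_continuity R n (Kker ij.1 ij.2) MJ 1 e1 (measurable_Kker ij.1 ij.2).
  - move=> z; apply: le_trans (Kker_le _ _ z) _; rewrite -[leRHS]mulr1; apply: ler_wpM2l => //.
  - apply/eqP; rewrite -normr_le0; apply: le_trans (Kker_le _ _ x) _.
    rewrite indicE mem_eball0 ltNge (_ : 1 <= enorm x) ?mulr0//.
    rewrite leNgt; apply/negP => x1; apply: xo => i; rewrite mxE subr0.
    by apply: le_trans (ler_coord_enorm x i) (ltW x1).
  - exact: e10.
  by exists dl.
have [da hda] := choice aff.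
have [d2 d20 hd2] := inverse_power_near1 n e20.
pose dm : R := \big[Num.min/d2]_ij da ij.
have dm0 : 0 < dm by apply/bigmin_gtP; split => // ij _; have [] := hda ij.
have dmle ij : dm <= da ij by exact: bigmin_le_cond.
have dm2 : dm <= d2 by exact: bigmin_le_id.
exists (eta * dm); first exact: mulr_gt0.
move=> u e x p i mu uM e0 hel hxp.
pose l : R := e / eta; pose h : V := eta^-1 *: (x - p).
have hl : `|l - 1| <= dm.
  have -> : l - 1 = (e - eta) / eta by rewrite /l; field; rewrite gt_eqF.
  by rewrite normrM normfV (gtr0_norm eta0) ler_pdivrMr// mulrC.
have hh j : `|h ord0 j| <= dm.
  rewrite !mxE normrM normfV (gtr0_norm eta0) mulrC ler_pdivrMr// mulrC; exact: hxp.
have [l0 hl2] := hd2 l (le_trans hl dm2).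
pose F z : R := \sum_(j < n) Kker i j z * u (p + eta *: z) ord0 j.
have iF : leb.-integrable setT (EFin \o F) by exact: Kop_integrable (ltW M0) mu uM.
have shift z : p + eta *: (l *: z + h) = x + e *: z.
  rewrite scalerDr !scalerA (_ : eta * l = e); last by rewrite /l; field; rewrite gt_eqF.
  by rewrite mulfV ?gt_eqF// scale1r addrCA [p + _]addrC subrK addrC.
have KE := Rint_dilate h (lt0r_neq0 l0) iF.
have FE z : F (l *: z + h) = \sum_(j < n) Kker i j (l *: z + h) * u (x + e *: z) ord0 j.
  by rewrite /F shift.
have mF2 : mfunT (fun z => F (l *: z + h)).
  have mF : mfunT F by exact: Kop_integrand_measurable.
  by mfun.
have ln0 : 0 < (`|l| ^+ n)^-1 by rewrite invr_gt0 exprn_gt0// normr_gt0 gt_eqF.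
have iF2 : leb.-integrable setT (EFin \o (fun z => F (l *: z + h))).
  have mF : mfunT F by exact: Kop_integrand_measurable.
  apply/integrableP; split; first exact/measurable_EFinP.
  have hr := rint_dilate h (lt0r_neq0 l0) (f := fun z => `|F z|).
  rewrite /= hr; [|by mfun|by []].
  by apply: lte_mul_pinfty => //; have /integrableP[_] := iF.
have i1 := Kop_integrable e x i (ltW M0) mu uM.
pose G z : R := \sum_(j < n) Kker i j z * u (x + e *: z) ord0 j.
have iB : leb.-integrable setT (EFin \o (fun z => G z - F (l *: z + h))) by exact: (integrableB measurableT i1 iF2).
have dB : `|\int[leb]_z (G z - F (l *: z + h))| <= M * n%:R * e1.
  apply: Rint_abs_le => //.
  have mK j := measurable_Kker i j.
  apply: (@le_trans _ _ (\int[leb]_z (M * \sum_(j < n) `|Kker i j (l *: z + h) - Kker i j z|)%:E)%E).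
    apply: le_rint => // z; rewrite FE /G -sumrB mulr_sumr.
    apply: le_trans (ler_norm_sum _ _ _) _; apply: ler_sum => j _.
    rewrite -mulrBl normrM mulrC distrC; apply: ler_wpM2r => //.
    by apply: le_trans (ler_coord_enorm _ j) (uM _).
  have md j : mfunT (fun z => `|Kker i j (l *: z + h) - Kker i j z|).
    by have := mK j => ?; mfun.
  rewrite rintZl; [|exact: ltW|exact: measurable_sum|by move=> z; exact: sumr_ge0].
  rewrite rint_sum//.
  rewrite -mulrA EFinM; apply: lee_wpmul2l; first by rewrite lee_fin ltW.
  apply: (@le_trans _ _ (\sum_(j < n) e1%:E)%E).
    by apply: lee_sum => j _; apply: (hda (i, j)).2 => [|k]; exact: le_trans (dmle (i, j)).
  by rewrite sumEFin sumr_const card_ord mulr_natl.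
have E1 : Kop e u x i - (`|l| ^+ n)^-1 * Kop eta u p i = \int[leb]_z (G z - F (l *: z + h)).
  have E := RintegralB measurableT i1 iF2; rewrite /= in E.
  by rewrite -KE /Kop -E.
have -> : Kop e u x i - Kop eta u p i = (Kop e u x i - (`|l| ^+ n)^-1 * Kop eta u p i) -
    (1 - (`|l| ^+ n)^-1) * Kop eta u p i by ring.
rewrite E1; apply: le_trans (ler_normB _ _) _.
have b2 : `|(1 - (`|l| ^+ n)^-1) * Kop eta u p i| <= e2 * C.
  by rewrite normrM; apply: ler_pM => //; exact: Kop_bound (ltW M0) mu uM.
apply: le_trans (lerD dB b2) _.
have k1 : M * n%:R * e1 <= dl0 / 2.
  rewrite /e1 mulrA ler_pdivrMr//; apply: half_bound; exact: ltW.
have k2 : e2 * C <= dl0 / 2.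
  rewrite mulrC /e2 mulrA ler_pdivrMr//; apply: half_bound; exact: ltW.
lra.
Qed.

(** For w = u x - v x, the form [quad] evaluated at w is the pairing of w with the projected
    averages of the constants u x and v x. Replacing these constants by the values at the far ends
    of the bonds gives the two [Kop] terms, and the cost is the projected increments in
    [strain1]. *)
Lemma Kop_compare u v (M e1 e2 kap al : R) x : 0 < al ->
  (forall w : V, ((al * dot w w)%:E <= \int[leb]_z (quad Jn w z)%:E)%E) ->
  0 < M -> mfunT u -> mfunT v ->
  (forall y, enorm (u y) <= M) -> (forall y, enorm (v y) <= M) ->
  (forall i, `|Kop e1 u x i - Kop e2 v x i| <= kap) ->
  ((al * dot (u x - v x) (u x - v x))%:E <= (2 * M * n%:R * kap)%:E +
     (2 * M)%:E * (\int[leb]_z (strain1 Jn u e1 (z, x))%:E + \int[leb]_z (strain1 Jn v e2 (z, x))%:E))%E.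
Proof.
move=> al0 hal M0 mu mv uM vM hkap.
pose w : V := u x - v x.
have wM : enorm w <= 2 * M.
  apply: le_trans (ler_enormD _ _) _; rewrite enormN; have := uM x; have := vM x; lra.
pose a z : R := \sum_(i < n) w ord0 i * (Jn z * (z ord0 i * (dot z (u (x + e1 *: z)) - dot z (v (x + e2 *: z))) / enorm z ^+ 2)).
pose su z : R := strain1 Jn u e1 (z, x); pose sv z : R := strain1 Jn v e2 (z, x).
have su0 z : 0 <= su z by exact: (strain1_ge0 hk).
have sv0 z : 0 <= sv z by exact: (strain1_ge0 hk).
have msu : mfunT su.
  by apply: (measurableT_comp (measurable_strain1 hk e1 mu)); exact: pair2_measurable.
have msv : mfunT sv.
  by apply: (measurableT_comp (measurable_strain1 hk e2 mv)); exact: pair2_measurable.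
have sb (u' : V -> V) e z : (forall y, enorm (u' y) <= M) -> `|strain1 Jn u' e (z, x)| <= 2 * M * MJ * \1_(eball 0 1) z.
  move=> u'M; rewrite ger0_norm; last exact: (strain1_ge0 hk).
  rewrite /strain1 /= mulrC -mulrA; apply: ler_pM => //.
  - by apply: divr_ge0 => //; exact: enorm_ge0.
  - have [z0|z0] := eqVneq (enorm z) 0; first by rewrite z0 invr0 mulr0; lra.
    have z1 : 0 < enorm z by rewrite lt_neqAle eq_sym z0 enorm_ge0.
    rewrite ler_pdivrMr//; apply: le_trans (dlt_le u' e (z, x)) _; rewrite ler_wpM2r ?enorm_ge0//.
    apply: le_trans (ler_enormD _ _) _; rewrite enormN.
    by have := u'M ((z, x).2 + e *: (z, x).1); have := u'M (z, x).2; lra.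
  - exact: Jn_le hk z.
have isu : leb.-integrable setT (EFin \o su) by apply: ball_integrable msu _ => z; exact: sb.
have isv : leb.-integrable setT (EFin \o sv) by apply: ball_integrable msv _ => z; exact: sb.
have aE z : a z = \sum_(i < n) w ord0 i * ((\sum_(j < n) Kker i j z * u (x + e1 *: z) ord0 j) -
    (\sum_(j < n) Kker i j z * v (x + e2 *: z) ord0 j)).
  apply: eq_bigr => i _; rewrite !Kop_integrand_dot; ring.
have iK i : leb.-integrable setT (fun z => (w ord0 i * ((\sum_(j < n) Kker i j z * u (x + e1 *: z) ord0 j) -
    (\sum_(j < n) Kker i j z * v (x + e2 *: z) ord0 j)))%:E).
  apply: (@integrableZl _ _ _ leb _ measurableT (w ord0 i) (EFin \o (fun z => (\sum_(j < n) Kker i j z * u (x + e1 *: z) ord0 j) -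
    (\sum_(j < n) Kker i j z * v (x + e2 *: z) ord0 j)))).
  exact: (integrableB measurableT (Kop_integrable e1 x i (ltW M0) mu uM) (Kop_integrable e2 x i (ltW M0) mv vM)).
have ia : leb.-integrable setT (EFin \o a).
  rewrite (_ : EFin \o a = fun z => (\sum_(i < n) (w ord0 i * ((\sum_(j < n) Kker i j z * u (x + e1 *: z) ord0 j) -
    (\sum_(j < n) Kker i j z * v (x + e2 *: z) ord0 j)))%:E)%E); last first.
    by apply/funext => z; rewrite sumEFin /= aE.
  by apply: integrable_sum => // i _; exact: iK.
have Ia : \int[leb]_z a z = \sum_(i < n) w ord0 i * (Kop e1 u x i - Kop e2 v x i).
  apply: EFin_inj; rewrite {1}/Rintegral fineK; last exact: integrable_fin_num ia.
  transitivity (\int[leb]_z (\sum_(i < n) (w ord0 i * ((\sum_(j < n) Kker i j z * u (x + e1 *: z) ord0 j) -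
    (\sum_(j < n) Kker i j z * v (x + e2 *: z) ord0 j)))%:E))%E.
    by apply: eq_integral => z _; rewrite sumEFin aE.
  rewrite integral_sum// -sumEFin; apply: eq_bigr => i _.
  have iKu := Kop_integrable e1 x i (ltW M0) mu uM; have iKv := Kop_integrable e2 x i (ltW M0) mv vM.
  have E := RintegralB measurableT iKu iKv; rewrite /= in E; rewrite /Kop -E.
  have iB := integrableB measurableT iKu iKv.
  have E2 := RintegralZl (w ord0 i) measurableT iB; rewrite /= in E2; rewrite -E2.
  by rewrite /Rintegral fineK//; exact: integrable_fin_num (iK i).
have Iab : `|\int[leb]_z a z| <= 2 * M * n%:R * kap.
  rewrite Ia; apply: le_trans (ler_norm_sum _ _ _) _.
  apply: (@le_trans _ _ (\sum_(i < n) (2 * M * kap))); last first.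
    by rewrite sumr_const card_ord -mulr_natr le_eqVlt; apply/orP; left; apply/eqP; ring.
  apply: ler_sum => i _; rewrite normrM; apply: ler_pM => //.
  exact: le_trans (ler_coord_enorm _ i) wM.
have pw z : quad Jn w z <= a z + 2 * M * (su z + sv z).
  rewrite /quad.
  have [z0|z0] := eqVneq z 0.
    have az : a z = 0.
      rewrite /a big1// => i _; have zi : z ord0 i = 0 by rewrite z0 mxE.
      by rewrite zi !mul0r !mulr0.
    rewrite az add0r z0 dot0l expr0n/= mul0r mulr0.
    by have := su0 0; have := sv0 0 => h1 h2; rewrite !mulr_ge0 ?addr_ge0// ltW.
  have z1 : 0 < enorm z by rewrite enorm_gt0.
  have az : a z = Jn z * (dot z w * (dot z (u (x + e1 *: z)) - dot z (v (x + e2 *: z))) / enorm z ^+ 2).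
    rewrite /a; move: (dot z (u _) - dot z (v _)) => dd; clearbody w.
    rewrite /dot mulr_suml mulr_suml mulr_sumr; apply: eq_bigr => i _; ring.
  have qu : dot z (u (x + e1 *: z)) = dot z (u x) + dlt u e1 (z, x).
    by rewrite /dlt /= dotBl [dot (u x) z]dotC [dot (u (x + _)) z]dotC; ring.
  have qv : dot z (v (x + e2 *: z)) = dot z (v x) + dlt v e2 (z, x).
    by rewrite /dlt /= dotBl [dot (v x) z]dotC [dot (v (x + _)) z]dotC; ring.
  have dw : dot z w = dot z (u x) - dot z (v x) by rewrite /w dotBr.
  have zw : `|dot z w| <= 2 * M * enorm z.
    by apply: le_trans (ler_dot_enorm _ _) _; rewrite mulrC ler_wpM2r ?enorm_ge0.
  have -> : Jn z * (dot z w ^+ 2 / enorm z ^+ 2) =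
     a z + Jn z * (dot z w * (dlt v e2 (z, x) - dlt u e1 (z, x)) / enorm z ^+ 2).
    by rewrite az qu qv expr2 {2}dw; ring.
  rewrite lerD2l /su /sv /strain1 /=.
  have -> : 2 * M * (Jn z * (`|dlt u e1 (z, x)| / enorm z) + Jn z * (`|dlt v e2 (z, x)| / enorm z)) =
     Jn z * (2 * M * enorm z * (`|dlt v e2 (z, x)| + `|dlt u e1 (z, x)|) / enorm z ^+ 2).
    by field; rewrite gt_eqF.
  apply: ler_wpM2l => //; apply: ler_wpM2r; first by rewrite invr_ge0 exprn_ge0// ltW.
  apply: le_trans (ler_norm _) _; rewrite normrM; apply: ler_pM => //.
  exact: ler_normB.
have iq : leb.-integrable setT (EFin \o quad Jn w).
  apply: (ball_integrable (c := MJ * enorm w ^+ 2)); first exact: (measurable_quad hk).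
  by move=> z; rewrite ger0_norm; [exact: (quad_le hk)|exact: (quad_ge0 hk)].
have is_ : leb.-integrable setT (EFin \o (fun z => 2 * M * (su z + sv z))).
  rewrite (_ : EFin \o _ = fun z => ((2 * M)%:E * (EFin \o (fun z => (su z + sv z)%R)) z)%E); last by [].
  by apply: integrableZl => //; exact: (integrableD measurableT isu isv).
have ir : leb.-integrable setT (EFin \o (fun z => a z + 2 * M * (su z + sv z))) by exact: (integrableD measurableT ia is_).
have R1 : \int[leb]_z quad Jn w z <= \int[leb]_z (a z + 2 * M * (su z + sv z)).
  by apply: le_Rintegral => // z _; exact: pw.
have E1 := RintegralD measurableT ia is_; rewrite /= in E1; rewrite E1 in R1.
have iss : leb.-integrable setT (EFin \o (fun z => su z + sv z)) by exact: (integrableD measurableT isu isv).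
have E2 := RintegralZl (2 * M) measurableT iss; rewrite /= in E2; rewrite E2 in R1.
have E3 := RintegralD measurableT isu isv; rewrite /= in E3; rewrite E3 in R1.
have qE : (\int[leb]_z (quad Jn w z)%:E = (\int[leb]_z quad Jn w z)%:E)%E.
  by rewrite /Rintegral fineK//; exact: integrable_fin_num iq.
have uE : (\int[leb]_z (su z)%:E = (\int[leb]_z su z)%:E)%E.
  by rewrite /Rintegral fineK//; exact: integrable_fin_num isu.
have vE : (\int[leb]_z (sv z)%:E = (\int[leb]_z sv z)%:E)%E.
  by rewrite /Rintegral fineK//; exact: integrable_fin_num isv.
apply: le_trans (hal w) _; rewrite qE uE vE.
apply: (@le_trans _ _ (2 * M * n%:R * kap + 2 * M * (\int[leb]_z su z + \int[leb]_z sv z))%:E); last exact: lexx.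
rewrite lee_fin; apply: le_trans R1 _; rewrite lerD2r; exact: le_trans (ler_norm _) Iab.
Qed.

End kernel_operator.

(** * Compactness in L^2, uniform in time *)

Lemma fin_combo (R : realType) (a b c : R) : (a%:E + b%:E * (c%:E + c%:E) = (a + b * (c + c))%:E)%E.
Proof. by []. Qed.

Section compactness.
Context (R : realType) (n : nat).
Local Notation V := 'rV[R]_n.
Local Notation leb := (lebesgue_rV R n).
Local Notation omega := (unit_ball_volume R n).
Variables (f f1 : R -> R) (fp0 finf : R) (Jn : V -> R) (MJ : R).
Implicit Types (u v : V -> V) (e q D : R) (p : V * V) (z x : V).

Hypothesis n2 : (2 <= n)%N.
Hypothesis hp : pot_ok f f1 fp0 finf.
Hypothesis hk : ker_ok Jn MJ.
Hypothesis hJ : (\int[leb]_z (Jn z)%:E != 0)%E.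

Let w0 : 0 < omega. Proof. exact: unit_ball_volume_gt0. Qed.
Let MJ0 : 0 <= MJ. Proof. exact: le_trans (kok_ge0 hk 0) (kok_le hk 0). Qed.

Definition coer (M : R) : R := 4 * M ^+ 2 / f (4 * M ^+ 2).

Lemma coer_gt0 (M : R) : 0 < M -> 0 < coer M.
Proof.
move=> M0; have M2 : 0 < 4 * M ^+ 2 by rewrite mulr_gt0// exprn_gt0.
by apply: divr_gt0 => //; exact: pok_pos hp _ M2.
Qed.

Lemma strain1_box_le e u (M r la P eta : R) : 0 < e -> e <= eta -> e <= 1 -> 0 < M -> L2f u ->
  (forall x, enorm (u x) <= M) -> 0 <= r -> 0 < la -> PDr f Jn e u <= P -> 0 <= P ->
  mfunT (fun x => (\int[leb]_z (\1_(rV_box 0 r) x * strain1 Jn u e (z, x))%:E)%E) /\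
  (\int[leb]_x \int[leb]_z (\1_(rV_box 0 r) x * strain1 Jn u e (z, x))%:E <=
    (2^-1 * (la * MJ * omega * (2 * r) ^+ n + la^-1 * coer M * (eta * omega * P)))%:E)%E.
Proof.
move=> e0 eeta e1 M0 hu uM r0 la0 hP P0; have [mu _] := hu.
have mB2 : mfunT (\1_(rV_box (0 : V) r) : V -> R) by mfun.
have ms := measurable_strain1 hk e mu.
have mF : mfunT (fun p : V * V => (\1_(rV_box 0 r) p.2 * strain1 Jn u e p : R)) by mfun.
have F0 p : 0 <= (\1_(rV_box 0 r) p.2 * strain1 Jn u e p : R).
  by have := strain1_ge0 hk u e p => ?; pos.
split.
  apply: (measurable_fun_fubini_tonelli_G (fun p : V * V => (\1_(rV_box 0 r) p.2 * strain1 Jn u e p)%:E)).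
    exact/measurable_EFinP.
  by move=> p; rewrite lee_fin.
rewrite -(II_swap mF F0); apply: le_trans (strain1_le n2 hp hk e0 e1 M0 hu uM r0 la0) _.
rewrite lee_fin; apply: ler_wpM2l => //; rewrite lerD2l; apply: ler_wpM2l.
  by have := coer_gt0 M0 => ?; rewrite mulr_ge0// ?invr_ge0 ltW.
apply: ler_pM => //; [by pos|exact: (PDr_ge0 hp hk)|].
by apply: ler_wpM2r => //; exact: ltW.
Qed.

(** [Kop_compare] integrated over the common support, with the increments estimated by the energies.
    The two scales may differ, and eta bounds both. *)
Lemma L2_compare u v (M r e1 e2 kap al la P eta : R) : 0 < al ->
  (forall w : V, ((al * dot w w)%:E <= \int[leb]_z (quad Jn w z)%:E)%E) ->
  0 < M -> L2f u -> L2f v -> (forall y, enorm (u y) <= M) -> (forall y, enorm (v y) <= M) ->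
  0 <= r -> (forall x, ~ rV_box 0 r x -> u x = 0) -> (forall x, ~ rV_box 0 r x -> v x = 0) ->
  0 < e1 -> e1 <= eta -> 0 < e2 -> e2 <= eta -> eta <= 1 -> 0 < la -> 0 <= P -> 0 <= kap ->
  PDr f Jn e1 u <= P -> PDr f Jn e2 v <= P ->
  (forall x i, rV_box 0 r x -> `|Kop Jn e1 u x i - Kop Jn e2 v x i| <= kap) ->
  al * nrm (u - v) ^+ 2 <= 2 * M * n%:R * kap * (2 * r) ^+ n +
    2 * M * (la * MJ * omega * (2 * r) ^+ n + la^-1 * coer M * (eta * omega * P)).
Proof.
move=> al0 hal M0 hu hv uM vM r0 ur vr e10 e1e e20 e2e eta1 la0 P0 kap0 hPu hPv hK.
have [mu _] := hu; have [mv _] := hv.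
have [m1 b1] := strain1_box_le e10 e1e (le_trans e1e eta1) M0 hu uM r0 la0 hPu P0.
have [m2 b2] := strain1_box_le e20 e2e (le_trans e2e eta1) M0 hv vM r0 la0 hPv P0.
set X1 := (fun x => _) in m1; set X2 := (fun x => _) in m2.
set Bd : R := 2^-1 * _ in b1 b2.
have b1' : (\int[leb]_x X1 x <= Bd%:E)%E by exact: b1.
have b2' : (\int[leb]_x X2 x <= Bd%:E)%E by exact: b2.
clear b1 b2.
have X10 x : (0 <= X1 x)%E by apply: rint_ge0 => z; have := strain1_ge0 hk u e1 (z, x) => ?; pos.
have X20 x : (0 <= X2 x)%E by apply: rint_ge0 => z; have := strain1_ge0 hk v e2 (z, x) => ?; pos.
pose c : R := 2 * M * n%:R * kap.
have c0 : 0 <= c by rewrite /c; have := ler0n R n => ?; pos.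
have mb : mfunT (\1_(rV_box (0 : V) r) : V -> R) by mfun.
have h2f := L2fB hu hv.
have pw x : ((al * dot (u x - v x) (u x - v x))%:E <= (c * \1_(rV_box 0 r) x)%:E + (2 * M)%:E * (X1 x + X2 x))%E.
  have [xb|xb] := boolP (x \in rV_box 0 r); last first.
    have xo : ~ rV_box 0 r x by move=> h; move/negP: xb; apply; exact/mem_set.
    rewrite ur// vr// subrr dot0l mulr0; apply: adde_ge0; first by rewrite lee_fin; pos.
    by apply: mule_ge0; [rewrite lee_fin; pos|exact: adde_ge0].
  have := Kop_compare hk al0 hal M0 mu mv uM vM (fun i => hK x i (set_mem xb)).
  have -> : X1 x = (\int[leb]_z (strain1 Jn u e1 (z, x))%:E)%E.
    by apply: eq_integral => z _; rewrite indicE xb mul1r.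
  have -> : X2 x = (\int[leb]_z (strain1 Jn v e2 (z, x))%:E)%E.
    by apply: eq_integral => z _; rewrite indicE xb mul1r.
  by rewrite indicE xb mulr1.
have md : mfunT (fun x => dot (u x - v x) (u x - v x)) by mfun.
have I1 : (\int[leb]_x (al * dot (u x - v x) (u x - v x))%:E = (al * nrm (u - v) ^+ 2)%:E)%E.
  rewrite rintZl; [|exact: ltW|by mfun|by move=> x; exact: dot_ge0].
  by rewrite EFinM -nrmE.
have I2 : (\int[leb]_x ((c * \1_(rV_box 0 r) x)%:E + (2 * M)%:E * (X1 x + X2 x)) <=
   (c * (2 * r) ^+ n + 2 * M * (Bd + Bd))%:E)%E.
  have hA x : (0 <= (c * \1_(rV_box 0 r) x)%:E)%E by rewrite lee_fin; pos.
  have mA : mfunT (fun x : V => (c * \1_(rV_box 0 r) x)%:E) by mfun.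
  have hX x : (0 <= X1 x + X2 x)%E by exact: adde_ge0.
  have mX : mfunT (fun x => X1 x + X2 x)%E by exact: emeasurable_funD.
  have hB x : (0 <= (2 * M)%:E * (X1 x + X2 x))%E by apply: mule_ge0 => //; rewrite lee_fin; pos.
  have mB : mfunT (fun x => (2 * M)%:E * (X1 x + X2 x))%E by exact: measurable_funeM.
  have M20 : (0 <= (2 * M)%:E)%E by rewrite lee_fin; pos.
  rewrite (ge0_integralD leb measurableT (fun x _ => hA x) mA (fun x _ => hB x) mB).
  rewrite (ge0_integralZl_EFin leb measurableT (fun x _ => hX x) mX M20).
  rewrite (ge0_integralD leb measurableT (fun x _ => X10 x) m1 (fun x _ => X20 x) m2).
  rewrite rintZl; [|sidec..].
  rewrite rint_box//; apply: (@le_trans _ _ ((c * (2 * r) ^+ n)%:E + (2 * M)%:E * (Bd%:E + Bd%:E))%E); last by rewrite fin_combo.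
  exact: (leeD2l _ (lee_wpmul2l M20 (leeD b1' b2'))).
have I3 : (\int[leb]_x (al * dot (u x - v x) (u x - v x))%:E <=
    \int[leb]_x ((c * \1_(rV_box 0 r) x)%:E + (2 * M)%:E * (X1 x + X2 x)))%E.
  apply: ge0_le_integralT => [x|x]; last exact: pw.
  by rewrite lee_fin mulr_ge0 ?dot_ge0// ltW.
have := le_trans I3 I2; rewrite I1 lee_fin => /le_trans; apply.
have h2 (y : R) : 2^-1 * y + 2^-1 * y = y by field.
by rewrite /Bd h2.
Qed.

(** Each coordinate is rounded down to a multiple of 1/(N+1). The shift by Z + 1 makes the index of
    a possibly negative coordinate a natural number. *)
Lemma box_grid (r : R) (N Z : nat) x : rV_box 0 r x -> r * N.+1%:R <= Z%:R ->
  exists z : {ffun 'I_n -> 'I_((Z.+1).*2)}, forall i,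
    `|x ord0 i - ((z i : nat)%:R - Z.+1%:R) / N.+1%:R| <= N.+1%:R^-1.
Proof.
move=> xr rZ; have N0 : 0 < N.+1%:R :> R by rewrite ltr0n.
have key i : exists k : 'I_((Z.+1).*2), `|x ord0 i - ((k : nat)%:R - Z.+1%:R) / N.+1%:R| <= N.+1%:R^-1.
  pose y : R := x ord0 i * N.+1%:R + Z.+1%:R.
  have /ler_normlP[x1 x2] : `|x ord0 i * N.+1%:R| <= Z%:R.
    rewrite normrM (gtr0_norm N0); apply: le_trans rZ; apply: ler_wpM2r; first exact: ltW.
    by have := xr i; rewrite mxE subr0.
  have Z1 : Z.+1%:R = Z%:R + 1 :> R by rewrite -natr1.
  have y0 : 0 <= y by rewrite /y; lra.
  have /andP[t1 t2] := truncn_itv y0.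
  have tl : (Num.trunc y < (Z.+1).*2)%N.
    rewrite -(ltr_nat R); apply: le_lt_trans t1 _; rewrite -addnn natrD /y; lra.
  exists (Ordinal tl) => /=; rewrite -(ler_pM2r N0) mulVf ?gt_eqF// -[X in _ * X]gtr0_norm// -normrM.
  rewrite mulrBl divfK ?gt_eqF// ler_norml -natr1 in t2 *; rewrite /y in t1 t2; lra.
have [z hz] := choice key.
by exists [ffun i => z i] => i; rewrite ffunE.
Qed.

Lemma compactness (T L P M r : R) (eps : nat -> R) (u : nat -> R -> V -> V) :
  0 < T -> 0 <= L -> 0 <= P -> 0 < M -> 0 <= r ->
  (forall k, 0 < eps k) -> (forall e : R, 0 < e -> \forall k \near \oo, eps k <= e) ->
  (forall k t, 0 <= t <= T -> L2f (u k t)) ->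
  (forall k t x, 0 <= t <= T -> enorm (u k t x) <= M) ->
  (forall k t x, 0 <= t <= T -> ~ rV_box 0 r x -> u k t x = 0) ->
  (forall k t, 0 <= t <= T -> PDr f Jn (eps k) (u k t) <= P) ->
  (forall k s t, 0 <= s <= T -> 0 <= t <= T -> nrm (u k s - u k t) <= L * `|s - t|) ->
  exists phi : nat -> nat, {homo phi : m k / (m < k)%N} /\
  exists ul : R -> V -> V, (forall t, 0 <= t <= T -> L2f (ul t)) /\
    forall e : R, 0 < e -> \forall k \near \oo, forall t, 0 <= t <= T -> nrm (u (phi k) t - ul t) <= e.
Proof.
move=> T0 L0 P0 M0 r0 eps0 epsc hu uM ur hP hL.
have [al al0 hal] := quad_lower n2 hk hJ.
(* An index (m, N, i, (N', z, j)) encodes the scale 1/(m+1), the time T i/(N+1), the point z/(N'+1)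
   and the component j. Times beyond T receive the value 0, so that the sequence is bounded for
   every index. *)
pose C : countType := (nat * nat * nat * (nat * {ffun 'I_n -> int} * 'I_n))%type.
pose tm (N i : nat) : R := T * i%:R / N.+1%:R.
pose pt (N : nat) (z : {ffun 'I_n -> int}) : V := \row_i ((z i)%:~R / N.+1%:R).
pose F (c : C) (k : nat) : R := let: (m, N, i, (N', z, j)) := c in
  if (i <= N.+1)%N then Kop Jn (m.+1%:R^-1) (u k (tm N i)) (pt N' z) j else 0.
have tmT N i : (i <= N.+1)%N -> 0 <= tm N i <= T.
  move=> iN; have N0 : 0 < N.+1%:R :> R by rewrite ltr0n.
  apply/andP; split; first by rewrite /tm divr_ge0 ?mulr_ge0 ?ler0n// ltW.
  by rewrite /tm ler_pdivrMr// ler_pM2l// ler_nat.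
have FB c k : `|F c k| <= MJ * M * omega.
  case: c => [[[m N] i] [[N' z] j]] /=; case: ifP => iN; last by rewrite normr0; pos.
  apply: (Kop_bound hk) => //; first exact: ltW.
    by have [] := hu k _ (tmT N i iN).
  by move=> y; apply: uM; exact: tmT.
have [phi [phi_inc [pl hpl]]] := diagonal_subsequence FB.
have epsphi (e : R) : 0 < e -> \forall k \near \oo, eps (phi k) <= e.
  move=> e0; have [N _ hN] := epsc e e0; exists N => // k /= Nk; apply: hN => /=.
  by apply: leq_trans Nk _; exact: increasing_seq_le.
have cau (dl : R) : 0 < dl -> exists N0 : nat, forall k l, (N0 <= k)%N -> (N0 <= l)%N ->
    forall t, 0 <= t <= T -> nrm (u (phi k) t - u (phi l) t) <= 3 * dl.
  (* [L2_compare] produces three terms. In turn [la] makes the volume term, [eta0], depending on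
     [la], the energy term, and [kap] the term of the averages at most s; their sum is then below 4
     s = al dl^2. The accuracies of the grids follow from [kap], and that of the times from the
     Lipschitz bound. *)
  move=> dl0; pose s : R := al * dl ^+ 2 / 4.
  have s0 : 0 < s by rewrite divr_gt0// mulr_gt0// exprn_gt0.
  have V0 : 0 <= (2 * r) ^+ n by pos.
  have M2 : 0 < 2 * M by rewrite mulr_gt0.
  have om0 := w0.
  pose la : R := s / (2 * M * (MJ * omega * (2 * r) ^+ n) + 1).
  have D1 : 0 < 2 * M * (MJ * omega * (2 * r) ^+ n) + 1 by rewrite ltr_wpDl//; pos.
  have la0 : 0 < la by rewrite divr_gt0.
  have cM := coer_gt0 M0.
  pose eta0 : R := Num.min 1 (s / (2 * M * (la^-1 * coer M * (omega * P)) + 1)).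
  have D2 : 0 < 2 * M * (la^-1 * coer M * (omega * P)) + 1 by rewrite ltr_wpDl//; pos.
  have eta00 : 0 < eta0 by rewrite lt_min ltr01 divr_gt0.
  have [m /ltW hm] : exists m : nat, m.+1%:R^-1 < eta0 / 2.
    have [N _ hN] := near_infty_natSinv_lt (PosNum (divr_gt0 eta00 (ltr0n R 2))).
    by exists N; apply: hN => /=.
  pose eta : R := m.+1%:R^-1.
  have eta_gt0 : 0 < eta by rewrite invr_gt0 ltr0n.
  pose kap : R := s / (2 * M * n%:R * (2 * r) ^+ n + 1).
  have D3 : 0 < 2 * M * n%:R * (2 * r) ^+ n + 1 by rewrite ltr_wpDl//; have := ler0n R n => ?; pos.
  have kap0 : 0 < kap by rewrite divr_gt0.
  have k30 : 0 < kap / 4 by rewrite divr_gt0.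
  have [dd dd0 hdd] := Kop_modulus hk M0 eta_gt0 k30.
  pose ddm : R := Num.min dd eta.
  have ddm0 : 0 < ddm by rewrite lt_min dd0.
  have [N' /ltW hN'] : exists N' : nat, N'.+1%:R^-1 < dd.
    have [N _ hN] := near_infty_natSinv_lt (PosNum dd0).
    by exists N; apply: hN => /=.
  have LT0 : 0 < L * T + 1 by rewrite ltr_wpDl// mulr_ge0// ltW.
  have [N /ltW hN] : exists N : nat, N.+1%:R^-1 < dl / (L * T + 1).
    have [N _ hN] := near_infty_natSinv_lt (PosNum (divr_gt0 dl0 LT0)).
    by exists N; apply: hN => /=.
  pose Z := (Num.trunc (r * N'.+1%:R)).+1.
  have rZ : r * N'.+1%:R <= Z%:R.
    by apply: ltW; have /andP[_] := truncn_itv (mulr_ge0 r0 (ler0n R N'.+1)).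
  pose zi (z : {ffun 'I_n -> 'I_((Z.+1).*2)}) : {ffun 'I_n -> int} := [ffun i => (z i : nat)%:Z - (Z.+1)%:Z].
  have near1 : \forall k \near \oo, forall x : 'I_N.+2 * ({ffun 'I_n -> 'I_((Z.+1).*2)} * 'I_n),
     `|F (m, N, x.1 : nat, (N', zi x.2.1, x.2.2)) (phi k) - pl (m, N, x.1 : nat, (N', zi x.2.1, x.2.2))| <= kap / 4.
    by apply: filter_forall => x; exact: hpl.
  have [N0 _ hN0] := near1; have [N1 _ hN1] := epsphi _ ddm0.
  exists (maxn N0 N1) => k l; rewrite !geq_max => /andP[k0 k1] /andP[l0 l1].
  (* The largest multiple of the horizon not exceeding eta is within one horizon of eta, and
     [PDe_multiple] bounds the energy at this scale by P. *)
  have scale j : (N1 <= j)%N -> exists e : R, [/\ 0 < e, `|e - eta| <= dd, e <= eta0 &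
      forall t, 0 <= t <= T -> PDr f Jn e (u (phi j) t) <= P].
    move=> Nj; have := hN1 j Nj; rewrite /= le_min => /andP[j1 j2].
    have ej := eps0 (phi j); set ep := eps (phi j) in j1 j2 ej.
    have q1 : 1 <= eta / ep by rewrite ler_pdivlMr// mul1r.
    have /andP[t1 t2] := truncn_itv (le_trans ler01 q1).
    set q := Num.trunc (eta / ep) in t1 t2.
    have q0 : (0 < q)%N by rewrite -ltnS -(ltr_nat R); exact: le_lt_trans q1 t2.
    exists (q%:R * ep); rewrite ler_pdivlMr// in t1; rewrite ltr_pdivrMr// -natr1 mulrDl mul1r in t2.
    split.
    - by rewrite mulr_gt0// ltr0n.
    - by rewrite ler_norml; clear - t1 t2 j1 j2 ej; apply/andP; split; lra.
    - by apply: le_trans t1 (le_trans hm _); rewrite ler_pdivrMr// mulr_natr mulr2n lerDl ltW.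
    move=> t tT; apply: le_trans (hP (phi j) t tT).
    have hut := hu (phi j) t tT; have [mut _] := hut.
    rewrite -lee_fin -!(PDeE n2 hp hk)//; last by rewrite mulr_gt0// ltr0n.
    exact: (PDe_multiple hp hk q0 ej mut).
  have grid i : (i <= N.+1)%N -> nrm (u (phi k) (tm N i) - u (phi l) (tm N i)) <= dl.
    move=> iN; have tT := tmT N i iN.
    have [ek [ek0 ek1 ek2 ek3]] := scale k k1; have [el [el0 el1 el2 el3]] := scale l l1.
    have hK x j : rV_box 0 r x -> `|Kop Jn ek (u (phi k) (tm N i)) x j - Kop Jn el (u (phi l) (tm N i)) x j| <= kap.
      move=> xb; have [z hz] := box_grid xb rZ.
      have ptE j' : pt N' (zi z) ord0 j' = ((z j' : nat)%:R - Z.+1%:R) / N'.+1%:R.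
        by rewrite mxE ffunE rmorphB.
      have hxp j' : `|x ord0 j' - pt N' (zi z) ord0 j'| <= dd by rewrite ptE; exact: le_trans (hz j') hN'.
      have mk : mfunT (u (phi k) (tm N i)) by have [] := hu (phi k) _ tT.
      have ml : mfunT (u (phi l) (tm N i)) by have [] := hu (phi l) _ tT.
      have a1 := hdd _ ek x (pt N' (zi z)) j mk (fun y => uM (phi k) _ y tT) ek0 ek1 hxp.
      have a2 := hdd _ el x (pt N' (zi z)) j ml (fun y => uM (phi l) _ y tT) el0 el1 hxp.
      have iN2 : (i < N.+2)%N by [].
      have a3 := hN0 k k0 (Ordinal iN2, (z, j)); have a4 := hN0 l l0 (Ordinal iN2, (z, j)).
      rewrite /F /= iN -/eta in a3 a4.
      move: a1 a2 a3 a4; move: (Kop _ _ _ _ _) (Kop _ _ _ _ _) (Kop _ _ _ _ _) (Kop _ _ _ _ _) (pl _).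
      clear; move=> A B C1 D E; rewrite !ler_norml => /andP[? ?] /andP[? ?] /andP[? ?] /andP[? ?]; apply/andP; split; lra.
    have eta01 : eta0 <= 1 by rewrite ge_min lexx.
    have := L2_compare al0 hal M0 (hu _ _ tT) (hu _ _ tT) (fun y => uM (phi k) _ y tT) (fun y => uM (phi l) _ y tT)
       r0 (fun x => ur _ _ x tT) (fun x => ur _ _ x tT) ek0 ek2 el0 el2 eta01 la0 P0 (ltW kap0) (ek3 _ tT) (el3 _ tT) hK.
    set nn := nrm _ => hn.
    have b1 : 2 * M * n%:R * kap * (2 * r) ^+ n <= s.
      rewrite /kap (_ : _ * _ * _ * _ = s * (2 * M * n%:R * (2 * r) ^+ n) / (2 * M * n%:R * (2 * r) ^+ n + 1)); last by ring.
      by rewrite ler_pdivrMr// ler_pM2l// lerDl.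
    have b2 : 2 * M * (la * MJ * omega * (2 * r) ^+ n) <= s.
      rewrite {1}/la (_ : _ * _ = s * (2 * M * (MJ * omega * (2 * r) ^+ n)) / (2 * M * (MJ * omega * (2 * r) ^+ n) + 1)); last by ring.
      by rewrite ler_pdivrMr// ler_pM2l// lerDl.
    have b3 : 2 * M * (la^-1 * coer M * (eta0 * omega * P)) <= s.
      have h : eta0 <= s / (2 * M * (la^-1 * coer M * (omega * P)) + 1) by rewrite ge_min lexx orbT.
      rewrite (_ : _ * _ = (2 * M * (la^-1 * coer M * (omega * P))) * eta0); last by ring.
      apply: le_trans (ler_wpM2l _ h) _; first by pos.
      by rewrite mulrA ler_pdivrMr// mulrC ler_pM2l// lerDl.
    have hs : al * nn ^+ 2 <= al * dl ^+ 2.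
      rewrite mulrDr in hn; have : 4 * s = al * dl ^+ 2 by rewrite /s; field.
      by move: hn b1 b2 b3 s0; set y1 := 2 * M * _ * _ * _; set y2 := 2 * M * _; set y3 := 2 * M * _; lra.
    by rewrite ler_pM2l// ler_pXn2r// ?nnegrE ?nrm_ge0// ?ltW in hs.
  (* Between grid times each of the two fields moves by at most dl; with the estimate at the grid
     time this makes 3 dl. *)
  move=> t /andP[t0 tT].
  pose i := Num.trunc (t * N.+1%:R / T).
  have N10 : 0 < N.+1%:R :> R by rewrite ltr0n.
  have y0 : 0 <= t * N.+1%:R / T by rewrite divr_ge0 ?mulr_ge0// ltW.
  have /andP[i1 i2] := truncn_itv y0.
  have iN : (i <= N.+1)%N.
    rewrite -(ler_nat R); apply: le_trans i1 _; rewrite ler_pdivrMr// mulrC ler_pM2l//.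
  have ht : `|t - tm N i| <= T / N.+1%:R.
    have e2 : t * N.+1%:R / T < i%:R + 1 by rewrite natr1.
    rewrite /tm ler_norml; rewrite ler_pdivlMr// in i1; rewrite ltr_pdivrMr// mulrDl mul1r in e2.
    have -> : t = (t * N.+1%:R) / N.+1%:R by field; rewrite gt_eqF.
    rewrite -/i in i1; move: i1 e2; move: (t * N.+1%:R) => y e1 e2.
    rewrite -mulrBl -mulNr; apply/andP; split; rewrite ler_pM2r ?invr_gt0//; lra.
  have hLd j : nrm (u (phi j) t - u (phi j) (tm N i)) <= dl.
    apply: le_trans (hL (phi j) t (tm N i) _ (tmT N i iN)) _; first by rewrite t0.
    apply: le_trans (ler_wpM2l L0 ht) _; rewrite mulrA.
    apply: (@le_trans _ _ (L * T * (dl / (L * T + 1)))).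
      by apply: ler_wpM2l => //; rewrite mulr_ge0// ltW.
    rewrite mulrA ler_pdivrMr// mulrC ler_pM2l// lerDl//.
  have tT' : 0 <= t <= T by rewrite t0.
  have hk1 := L2fB (hu (phi k) t tT') (hu (phi k) _ (tmT N i iN)).
  have hk2 := L2fB (hu (phi k) _ (tmT N i iN)) (hu (phi l) _ (tmT N i iN)).
  have hk3 := L2fB (hu (phi l) _ (tmT N i iN)) (hu (phi l) t tT').
  have -> : u (phi k) t - u (phi l) t = (u (phi k) t - u (phi k) (tm N i)) +
    ((u (phi k) (tm N i) - u (phi l) (tm N i)) + (u (phi l) (tm N i) - u (phi l) t)) by rewrite !subrKA.
  apply: le_trans (ler_nrmD hk1 (L2fD hk2 hk3)) _.
  have q1 := ler_nrmD hk2 hk3; have q2 := hLd k; have q3 := hLd l; have q4 := grid i iN.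
  rewrite nrmBC in q3; move: q1 q2 q3 q4.
  move: (nrm _) (nrm _) (nrm _) (nrm _) => A B C1 D; lra.
exists phi; split => //.
have lim t : exists wl : V -> V, 0 <= t <= T -> L2f wl /\
   forall (e : R) (k N : nat), (forall l : nat, (N <= l)%N -> nrm (u (phi k) t - u (phi l) t) <= e) ->
     nrm (u (phi k) t - wl) <= e.
  have [tT|tT] := boolP (0 <= t <= T); last by exists 0.
  have [] := @L2_complete R n (fun k => u (phi k) t) r r0 (fun k => hu _ _ tT) (fun k x => ur _ _ x tT).
    move=> e e0; have [N0 hN0] := cau (e / 3) (divr_gt0 e0 (ltr0n R 3)).
    exists N0 => k l Nk Nl; have := hN0 k l Nk Nl t tT; lra.
  by move=> wl hwl; exists wl.
have [ul hul] := choice lim.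
exists ul; split; first by move=> t tT; have [] := hul t tT.
move=> e e0; have [N0 hN0] := cau (e / 3) (divr_gt0 e0 (ltr0n R 3)).
exists N0 => // k /= Nk t tT; have [_ h] := hul t tT.
apply: (h e k N0) => l Nl; have := hN0 k l Nk Nl t tT; lra.
Qed.

End compactness.

(** * A compactly supported bump of class C^1 *)

Section bump.
Context (R : realType) (n : nat).
Local Notation V := 'rV[R]_n.
Local Notation leb := (lebesgue_rV R n).
Implicit Types (z k p x y v : V).

(** The positive part of 1 - s. The absolute value lets continuity and measurability be read off the
    formula. *)
Definition ppart (s : R) : R := (`|1 - s| + (1 - s)) / 2.
(** Of class C^1 with a Lipschitz gradient: this suffices for the test functions of the strain and
    for a quadratic Taylor remainder. Its derivative at z along k is [dbump z k]. *)
Definition bump z : R := ppart (dot z z) ^+ 2.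
Definition dbump z k : R := - (4 * ppart (dot z z) * dot z k).

Lemma ppart_ge0 s : 0 <= ppart s.
Proof. by rewrite /ppart; have := ler_norm (- (1 - s)); rewrite normrN; lra. Qed.

Lemma ppart_lt s : s <= 1 -> ppart s = 1 - s.
Proof. by move=> s1; rewrite /ppart ger0_norm; lra. Qed.

Lemma ppart_ge s : 1 <= s -> ppart s = 0.
Proof. by move=> s1; rewrite /ppart ler0_norm; lra. Qed.

Lemma ppart_taylor r s : `|ppart s ^+ 2 - ppart r ^+ 2 + 2 * ppart r * (s - r)| <= (s - r) ^+ 2.
Proof.
have [r1|r1] := leP r 1; have [s1|s1] := leP s 1.
- rewrite !ppart_lt// (_ : _ + _ = (s - r) ^+ 2); last by ring.
  by rewrite ger0_norm ?sqr_ge0.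
- rewrite (ppart_lt r1) (ppart_ge (ltW s1)) ler_norml; apply/andP; split; nra.
- rewrite (ppart_lt s1) (ppart_ge (ltW r1)) ler_norml; apply/andP; split; nra.
- by rewrite (ppart_ge (ltW r1)) (ppart_ge (ltW s1)) expr0n/= subrr mulr0 mul0r addr0 normr0 sqr_ge0.
Qed.

Lemma bump_ge0 z : 0 <= bump z. Proof. exact: sqr_ge0. Qed.

Lemma bump_le1 z : bump z <= 1.
Proof.
rewrite /bump -[leRHS](expr1n _ 2) lerXn2r ?nnegrE ?ppart_ge0//.
have := dot_ge0 z; have [h|h] := leP (dot z z) 1; first by rewrite ppart_lt//; lra.
by rewrite (ppart_ge (ltW h)).
Qed.

Lemma bump_out z : 1 <= enorm z -> bump z = 0.
Proof.
move=> z1; rewrite /bump ppart_ge ?expr0n// -sqr_enorm -[leLHS](expr1n _ 2).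
by rewrite lerXn2r ?nnegrE ?enorm_ge0.
Qed.

Lemma bump_opp z : bump (- z) = bump z.
Proof. by rewrite /bump dotNl dotNr opprK. Qed.

Lemma dbump_le z k : `|dbump z k| <= 4 * enorm k.
Proof.
have [z1|z1] := leP 1 (enorm z).
  have d1 : 1 <= dot z z by rewrite -sqr_enorm -[leLHS](expr1n _ 2) lerXn2r ?nnegrE ?enorm_ge0.
  by rewrite /dbump (ppart_ge d1) mulr0 mul0r oppr0 normr0 mulr_ge0 ?enorm_ge0.
have d1 : dot z z <= 1.
  by rewrite -sqr_enorm -[leRHS](expr1n _ 2) lerXn2r ?nnegrE ?enorm_ge0// ltW.
have -> : `|dbump z k| = 4 * ppart (dot z z) * `|dot z k|.
  by rewrite /dbump normrN normrM ger0_norm// mulr_ge0// ppart_ge0.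
rewrite ppart_lt//.
have h := ler_dot_enorm z k; have d0 := dot_ge0 z.
have h2 : `|dot z k| <= enorm k.
  by apply: le_trans h _; rewrite -[leRHS]mul1r; apply: ler_wpM2r; [exact: enorm_ge0|exact: ltW].
rewrite -mulrA; apply: ler_wpM2l => //.
by rewrite -[leRHS]mul1r; apply: ler_pM => //; lra.
Qed.

(** For |z| >= 2 all terms vanish. Otherwise the squared norm changes by at most 5 |k|, whose square
    gives 25, and the part |k|^2 of that change, absent from the linear term, adds 2. *)
Lemma bump_taylor z k : enorm k <= 1 -> `|bump (z + k) - bump z - dbump z k| <= 27 * enorm k ^+ 2.
Proof.
move=> k1; have k0 := enorm_ge0 k.
have [z2|z2] := leP 2 (enorm z).
  have zk : 1 <= enorm (z + k).
    have := ler_enormD (z + k) (- k); rewrite enormN addrK; lra.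
  have d1 : 1 <= dot z z.
    by rewrite -sqr_enorm -[leLHS](expr1n _ 2) lerXn2r ?nnegrE ?enorm_ge0//; lra.
  rewrite (bump_out zk) bump_out; last lra.
  have dz : dbump z k = 0 by rewrite /dbump (ppart_ge d1) mulr0 mul0r oppr0.
  rewrite dz !subr0 normr0.
  by rewrite mulr_ge0 ?sqr_ge0.
have z0 := enorm_ge0 z.
have E : dot (z + k) (z + k) - dot z z = 2 * dot z k + enorm k ^+ 2.
  by rewrite sqr_enorm dotDl !dotDr (dotC k z); ring.
have h := ppart_taylor (dot z z) (dot (z + k) (z + k)).
rewrite E in h.
have hz : `|dot z k| <= 2 * enorm k.
  by apply: le_trans (ler_dot_enorm _ _) _; apply: ler_wpM2r; lra.
have h1 : `|2 * dot z k + enorm k ^+ 2| <= 5 * enorm k.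
  apply: le_trans (ler_normD _ _) _; rewrite normrM (ger0_norm (sqr_ge0 _)) ger0_norm//.
  have : enorm k ^+ 2 <= enorm k by rewrite expr2 -[leRHS]mul1r ler_wpM2r.
  lra.
have h2 : (2 * dot z k + enorm k ^+ 2) ^+ 2 <= 25 * enorm k ^+ 2.
  rewrite -real_normK ?num_real//.
  have -> : 25 * enorm k ^+ 2 = (5 * enorm k) ^+ 2 by ring.
  by rewrite lerXn2r ?nnegrE// mulr_ge0.
have p1 : ppart (dot z z) <= 1.
  have := dot_ge0 z; have [q|q] := leP (dot z z) 1; first by rewrite ppart_lt//; lra.
  by rewrite (ppart_ge (ltW q)).
have p0 := ppart_ge0 (dot z z).
have -> : bump (z + k) - bump z - dbump z k =
  (ppart (dot (z + k) (z + k)) ^+ 2 - ppart (dot z z) ^+ 2 + 2 * ppart (dot z z) * (2 * dot z k + enorm k ^+ 2))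
   - 2 * ppart (dot z z) * enorm k ^+ 2 by rewrite /bump /dbump; ring.
apply: le_trans (ler_normB _ _) _.
have h3 : `|2 * ppart (dot z z) * enorm k ^+ 2| <= 2 * enorm k ^+ 2.
  rewrite ger0_norm; last by rewrite mulr_ge0 ?sqr_ge0// mulr_ge0.
  by apply: ler_wpM2r; [exact: sqr_ge0|lra].
have := le_trans h h2; lra.
Qed.

Lemma dot_cont (f g : V -> V) : continuous f -> continuous g -> continuous (fun y => dot (f y) (g y)).
Proof.
move=> cf cg y; rewrite /dot /continuous_at.
have Fy : Filter (nbhs y) by exact: nbhs_filter.
elim: (index_enum _) => [|i s IH].
  by rewrite (_ : (fun y => _) = cst 0) ?big_nil; [exact: cvg_cst|apply/funext => ?; rewrite big_nil].
rewrite (_ : (fun y => _) = (fun y => f y ord0 i * g y ord0 i + \sum_(j <- s) f y ord0 j * g y ord0 j)); last first.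
  by apply/funext => ?; rewrite big_cons.
rewrite big_cons; apply: cvgD; last exact: IH.
have ci (g' : V -> V) : continuous g' -> (fun x => g' x ord0 i) @ y --> g' y ord0 i.
  by move=> c'; exact: (continuous_comp (c' y) (@coord_continuous _ _ _ ord0 i (g' y))).
by apply: cvgM; exact: ci.
Qed.

Lemma affine_cont (c : R) (p : V) : continuous (fun y : V => c *: (y - p)).
Proof.
move=> y; have Fy : Filter (nbhs y) by exact: nbhs_filter.
by apply: cvgZr; apply: cvgB; [exact: cvg_id|exact: cvg_cst].
Qed.

Lemma ppart_cont (g : V -> R) : continuous g -> continuous (fun y => ppart (g y)).
Proof.
move=> cg y; have Fy : Filter (nbhs y) by exact: nbhs_filter.
rewrite /ppart; apply: cvgM; last exact: cvg_cst.
apply: cvgD; first apply: cvg_norm; apply: cvgB; [exact: cvg_cst|exact: cg|exact: cvg_cst|exact: cg].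
Qed.

Lemma quadratic_derive (phi : V -> R) y v (df C m : R) : 0 < m ->
  (forall h : R, `|h| < m -> `|phi (h *: v + y) - phi y - h * df| <= C * h ^+ 2) ->
  derivable phi y v /\ 'D_v phi y = df.
Proof.
move=> m0 hC.
suff H : (fun h : R => h^-1 *: (phi (h *: v + y) - phi y)) @ 0^' --> df.
  by split; [apply/cvg_ex; exists df|exact: cvg_lim H].
have F0 : Filter (0 : R)^' by exact: dnbhs_filter.
apply/cvgrPdist_le => e e0.
pose b : R := Num.min m (e / (`|C| + 1)).
have b0 : 0 < b by rewrite lt_min m0 divr_gt0// ltr_wpDl.
apply/nbhs_ballP; exists b => // h; rewrite /ball/= sub0r normrN lt_min => /andP[h1 h2] hn0.
have hp : 0 < `|h| by rewrite normr_gt0.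
have := hC h h1 => hh.
rewrite -normrN opprB -[_ *: _]/(h^-1 * _).
have -> : h^-1 * (phi (h *: v + y) - phi y) - df = h^-1 * (phi (h *: v + y) - phi y - h * df) by field.
rewrite normrM normfV ler_pdivrMl//; apply: le_trans hh _.
apply: (@le_trans _ _ ((`|C| + 1) * h ^+ 2)).
  by apply: ler_wpM2r; [exact: sqr_ge0|have := ler_norm C; lra].
rewrite -real_normK ?num_real// expr2 mulrA mulrC; apply: ler_wpM2l => //.
by rewrite mulrC -ler_pdivlMr ?ltr_wpDl// ltW.
Qed.

(** Not normalised: its integral is dl^n times the mass c of the bump, and the factor 1/(dl^n c)
    appears explicitly where an average is meant. *)
Definition moll (dl : R) p y : R := bump (dl^-1 *: (y - p)).

Lemma moll_derive (dl : R) p y v : 0 < dl ->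
  derivable (moll dl p) y v /\ 'D_v (moll dl p) y = dl^-1 * dbump (dl^-1 *: (y - p)) v.
Proof.
move=> dl0; pose m : R := dl / (enorm v + 1).
have v0 := enorm_ge0 v; have v1 : 0 < enorm v + 1 by lra.
apply: (@quadratic_derive _ _ _ _ (27 * (enorm v / dl) ^+ 2) m); first exact: divr_gt0.
move=> h hm.
have E : dl^-1 *: (h *: v + y - p) = dl^-1 *: (y - p) + (h / dl) *: v.
  by apply/rowP => i; rewrite !mxE; ring.
have k1 : enorm ((h / dl) *: v) <= 1.
  rewrite enormZ normrM normfV (gtr0_norm dl0) mulrAC ler_pdivrMr// mul1r.
  apply: (@le_trans _ _ (m * enorm v)); first by apply: ler_wpM2r => //; exact: ltW.
  by rewrite /m mulrAC ler_pdivrMr// ler_wpM2l ?ltW//; lra.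
have := bump_taylor (dl^-1 *: (y - p)) k1.
rewrite /moll E enormZ normrM normfV (gtr0_norm dl0).
have -> : dbump (dl^-1 *: (y - p)) ((h / dl) *: v) = h * (dl^-1 * dbump (dl^-1 *: (y - p)) v).
  by rewrite /dbump dotZr; ring.
move/le_trans; apply; apply: le_of_eq.
by rewrite -[h ^+ 2]real_normK ?num_real//; ring.
Qed.

Lemma moll_out (dl : R) p y : 0 < dl -> dl <= enorm (y - p) -> moll dl p y = 0.
Proof.
move=> dl0 h; apply: bump_out; rewrite enormZ gtr0_norm ?invr_gt0//.
by rewrite ler_pdivlMl// mulr1.
Qed.

Lemma moll_cont (dl : R) p : continuous (moll dl p).
Proof.
have ca := @affine_cont dl^-1 p; have := ppart_cont (dot_cont ca ca) => c y.
by have Fy : Filter (nbhs y) by [exact: nbhs_filter]; apply: cvgM; exact: c.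
Qed.

Lemma moll_C1c (D : set V) (dl : R) p : 0 < dl -> (forall y, enorm (y - p) <= dl -> D y) -> C1c D (moll dl p).
Proof.
move=> dl0 hD; have ca := @affine_cont dl^-1 p.
split.
- by move=> y i; have [] := moll_derive p y (delta_mx ord0 i) dl0.
- move=> i; rewrite (_ : (fun x => _) = fun y => dl^-1 * dbump (dl^-1 *: (y - p)) (delta_mx ord0 i)); last first.
    by apply/funext => y; have [] := moll_derive p y (delta_mx ord0 i) dl0.
  move=> y; have Fy : Filter (nbhs y) by exact: nbhs_filter.
  apply: cvgM; first exact: cvg_cst.
  apply: cvgN; apply: cvgM.
    by apply: cvgM; [exact: cvg_cst|exact: (ppart_cont (dot_cont ca ca))].
  by apply: (dot_cont ca) => z; have Fz : Filter (nbhs z) by [exact: nbhs_filter]; exact: cvg_cst.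
- exact: moll_cont.
exists [set y | enorm (y - p) <= dl]; split.
- have cl : closed [set y : V | enorm (y - p) <= dl].
    have ce : continuous (fun y : V => enorm (y - p)).
      apply: (@lipschitz_continuous_rV _ _ _ 1) => x y; rewrite mul1r.
      by apply: le_trans (enorm_lipschitz _ _) _; rewrite opprB addrA subrK.
    have := closed_comp (f := fun y : V => enorm (y - p)) (D := [set t : R | t <= dl]).
    by apply => //; exact: closed_le.
  apply: bounded_closed_compact => //.
  exists (enorm p + dl); split; first exact: num_real.
  move=> M hM y /= hy; apply: le_trans (ltW hM); apply: le_trans (ler_norm_enorm y) _.
  by have := ler_enormD (y - p) p; rewrite subrK; lra.
- by move=> y; exact: hD.
- move=> y /negP; rewrite -ltNge => hy; apply: moll_out => //; exact: ltW.
Qed.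

Lemma measurable_ppart : mfunT ppart.
Proof.
rewrite /ppart; apply: measurable_funM; last exact: measurable_cst.
apply: measurable_funD; last by apply: measurable_funB; [exact: measurable_cst|exact: measurable_id].
by apply: measurableT_comp => //; apply: measurable_funB; [exact: measurable_cst|exact: measurable_id].
Qed.

Lemma measurable_bump : mfunT bump.
Proof.
have := measurable_ppart => h; rewrite /bump.
by apply: measurable_funX; apply: (measurableT_comp h); mfun.
Qed.

Lemma bump_le_indic z : bump z <= \1_(eball 0 1) z.
Proof.
rewrite indicE mem_eball0; have [z1|z1] := ltP (enorm z) 1; first exact: bump_le1.
by rewrite bump_out.
Qed.

Lemma bump_mass : exists2 c : R, 0 < c & (\int[leb]_z (bump z)%:E = c%:E)%E.
Proof.
have F : (\int[leb]_z (bump z)%:E)%E \is a fin_num.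
  rewrite ge0_fin_numE; last by apply: rint_ge0; exact: bump_ge0.
  apply: le_lt_trans (le_rint _ bump_ge0 bump_le_indic) _.
  by rewrite rint_indic; [exact: lebesgue_eball_fin|exact: measurable_eball].
exists (fine (\int[leb]_z (bump z)%:E)%E); last by rewrite fineK.
rewrite -lte_fin fineK//.
have mB1 : mfunT (\1_(eball (0 : V) 1) : V -> R) by mfun.
have h : (\int[leb]_z (4^-1 * \1_(eball 0 1) (2 *: z + 0))%:E <= \int[leb]_z (bump z)%:E)%E.
  apply: le_rint => z; first by pos.
  rewrite addr0 indicE mem_eball0; case: ltP => z1 /=; last by rewrite mulr0 bump_ge0.
  have z2 : enorm z < 2^-1 by move: z1; rewrite enormZ ger0_norm//; lra.
  have zz : dot z z <= 2^-1.
    rewrite -sqr_enorm expr2; have z0 := enorm_ge0 z.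
    have : enorm z * enorm z <= 2^-1 * 1 by apply: ler_pM => //; lra.
    lra.
  rewrite mulr1 /bump ppart_lt; last lra.
  have p1 : 2^-1 <= 1 - dot z z by lra.
  apply: (@le_trans _ _ (2^-1 ^+ 2)); first lra.
  by rewrite lerXn2r ?nnegrE//; lra.
apply: lt_le_trans h; rewrite rintZl; [|by pos|by mfun|by move=> z; pos].
have B0 (z : V) : 0 <= \1_(eball 0 1) z :> R by exact: indic_ge0.
have two0 : (2 : R) != 0 by rewrite pnatr_eq0.
have hB : (\int[leb]_z (\1_(eball (0 : V) 1) z)%:E = (unit_ball_volume R n)%:E)%E.
  by rewrite rint_indic; [exact: unit_ball_volumeE|exact: measurable_eball].
apply: mule_gt0; first by rewrite lte_fin invr_gt0.
rewrite (rint_dilate 0 two0 mB1 B0) hB.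
by apply: mule_gt0; rewrite lte_fin ?unit_ball_volume_gt0// invr_gt0 exprn_gt0// normr_gt0.
Qed.

End bump.

(** * From values on sets to integrals *)

Lemma indic_norm_le1 (R : realType) (T : Type) (A : set T) x : `|\1_A x : R| <= 1.
Proof. by rewrite indicE; case: (_ \in _); rewrite ?normr1 ?normr0 ?ler01. Qed.

Lemma cancel_scale (R : realFieldType) (a b c : R) : a != 0 -> a^-1 * (a * b * c) = b * c.
Proof. by move=> a0; field. Qed.

Section transfer.
Context (R : realType) (d : measure_display) (T : measurableType d).
Implicit Types (mu : {measure set T -> \bar R}) (A B : set T).

Lemma Rint_sum mu A (I : Type) (s : seq I) (F : I -> T -> R) : measurable A ->
  (forall i, mu.-integrable A (EFin \o F i)) ->
  mu.-integrable A (EFin \o (fun x => \sum_(i <- s) F i x)) /\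
  \int[mu]_(x in A) (\sum_(i <- s) F i x) = \sum_(i <- s) \int[mu]_(x in A) F i x.
Proof.
move=> mA iF; elim: s => [|i s [IH1 IH2]].
  have E : (fun x => \sum_(i <- [::]) F i x) = cst 0 by apply/funext => x; rewrite big_nil.
  by rewrite E big_nil; split; [exact: integrable0|rewrite /Rintegral integral0].
have E : (fun x => \sum_(j <- i :: s) F j x) = (fun x => F i x + \sum_(j <- s) F j x).
  by apply/funext => x; rewrite big_cons.
rewrite E big_cons; split; first exact: (integrableD mA (iF i) IH1).
by have := RintegralD mA (iF i) IH1; rewrite /= => ->; rewrite IH2.
Qed.

Lemma finite_integrable mu A (F : T -> R) (K : R) : 0 <= K -> measurable A -> (mu A < +oo)%E ->
  mfunT F -> (forall x, `|F x| <= K) -> mu.-integrable A (EFin \o F).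
Proof.
move=> K0 mA Afin mF FK; apply/integrableP; split.
  by apply/measurable_EFinP; exact: measurable_funTS.
apply: (@le_lt_trans _ _ (\int[mu]_(x in A) K%:E)%E).
  apply: ge0_le_integral => //.
  - by apply/measurable_EFinP; apply: measurableT_comp => //; exact: measurable_funTS.
  - by move=> x _; rewrite /= lee_fin.
by rewrite integral_cst// lte_mul_pinfty.
Qed.

Definition steps (s : R) (N : nat) (phi : T -> R) (x : T) : R :=
  \sum_(j <- enum 'I_N) s * \1_[set y | j.+1%:R * s <= phi y] x.

Lemma steps_approx (s : R) (N : nat) (phi : T -> R) x : 0 < s -> 0 <= phi x -> phi x <= N%:R * s ->
  steps s N phi x <= phi x /\ phi x <= steps s N phi x + s.
Proof.
move=> s0 p0 pN; have y0 : 0 <= phi x / s by rewrite divr_ge0// ltW.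
have [h1 h2] := staircase N y0.
have E : steps s N phi x = s * \sum_(j < N) ((j.+1%:R <= phi x / s)%R)%:R.
  rewrite /steps big_enum/= mulr_sumr; apply: eq_bigr => j _; congr (_ * _).
  rewrite indicE; congr (nat_of_bool _)%:R; rewrite ler_pdivlMr//.
  by apply/idP/idP => [/set_mem|h]; [|apply/mem_set].
have hN : phi x / s <= N%:R by rewrite ler_pdivrMr.
have h3 := h2 hN; rewrite E; split.
  by rewrite mulrC -ler_pdivlMr.
by rewrite -[X in _ + X]mulr1 -mulrDr [leRHS]mulrC -ler_pdivrMr.
Qed.

Lemma measurable_level (phi : T -> R) (c : R) : mfunT phi -> measurable [set y | c <= phi y].
Proof.
move=> mphi; have := mphi measurableT _ (measurable_itv `[c, +oo[).
by rewrite setTI; congr measurable; apply/seteqP; split => y /=; rewrite in_itv/= andbT.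
Qed.

Lemma steps_int mu A (s : R) (N : nat) (phi : T -> R) : measurable A -> (mu A < +oo)%E ->
  mfunT phi -> 0 < s -> (forall x, 0 <= phi x) -> (forall x, phi x <= N%:R * s) ->
  `|\int[mu]_(x in A) phi x - \sum_(j <- enum 'I_N) s * fine (mu (A `&` [set y | j.+1%:R * s <= phi y]))|
    <= s * fine (mu A).
Proof.
move=> mA Afin mphi s0 p0 pN.
have mL (j : 'I_N) : measurable [set y | j.+1%:R * s <= phi y] by exact: measurable_level.
have i1 : mu.-integrable A (EFin \o phi).
  apply: (@finite_integrable mu A phi (N%:R * s)) => //; first by rewrite mulr_ge0 ?ler0n// ltW.
  by move=> x; rewrite ger0_norm.
have iI (j : 'I_N) : mu.-integrable A (EFin \o (fun x => s * \1_[set y | j.+1%:R * s <= phi y] x)).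
  apply: (@finite_integrable mu A _ s) => //; first exact: ltW.
    by apply: measurable_funM; [exact: measurable_cst|exact: measurable_indic].
  move=> x; rewrite normrM gtr0_norm// -[leRHS]mulr1.
  by apply: ler_wpM2l; [exact: ltW|exact: indic_norm_le1].
have [i2 E] := Rint_sum (enum 'I_N) mA iI.
have -> : \sum_(j <- enum 'I_N) s * fine (mu (A `&` [set y | j.+1%:R * s <= phi y])) =
    \int[mu]_(x in A) steps s N phi x.
  rewrite /steps E; apply: eq_bigr => j _.
  rewrite RintegralZl//; last first.
    by apply: (@finite_integrable mu A _ 1) => // x; exact: indic_norm_le1.
  by rewrite /Rintegral integral_indic// setIC.
have E2 := RintegralB mA i1 i2; rewrite /= in E2; rewrite /steps -E2 -/(steps s N phi).
have ic : mu.-integrable A (EFin \o cst s).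
  apply: (@finite_integrable mu A _ s) => //; first exact: ltW.
  by move=> x; rewrite /= gtr0_norm.
have sE : s * fine (mu A) = \int[mu]_(x in A) cst s x.
  have e : (\int[mu]_(x in A) (cst s x)%:E = s%:E * mu A)%E by rewrite -integral_cst.
  by rewrite /Rintegral e fineM// ge0_fin_numE.
have iB := integrableB mA i1 i2.
have pos x : 0 <= phi x - \sum_(j <- enum 'I_N) s * \1_[set y | j.+1%:R * s <= phi y] x <= s.
  have [h1 h2] := steps_approx s0 (p0 x) (pN x); rewrite /steps in h1 h2; apply/andP; split; lra.
rewrite ger0_norm; last by apply: Rintegral_ge0 => x _; have /andP[] := pos x.
by rewrite sE; apply: le_Rintegral => // x _; have /andP[] := pos x.
Qed.

(** phi is within s of a combination of indicators of its superlevel sets, for which the identity is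
    the hypothesis on sets. The three integrals change by at most s times the total masses of Ep, Em
    and |g|, and s is arbitrarily small. The signed measure enters only through the pair Ep, Em. *)
Lemma transfer (Ep Em : {finite_measure set T -> \bar R}) (leb : {measure set T -> \bar R}) A (g phi : T -> R) (K : R) :
  measurable A -> leb.-integrable A (EFin \o g) -> mfunT phi ->
  (forall x, 0 <= phi x) -> (forall x, phi x <= K) ->
  (forall B, measurable B -> B `<=` A -> fine (Ep B) - fine (Em B) = \int[leb]_(x in B) g x) ->
  \int[Ep]_(x in A) phi x - \int[Em]_(x in A) phi x = \int[leb]_(x in A) (phi x * g x).
Proof.
move=> mA ig mphi p0 pK hE.
have fin (m : {finite_measure set T -> \bar R}) B : measurable B -> (m B < +oo)%E.
  by move=> mB; rewrite ltey_eq fin_num_measure.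
pose G : R := \int[leb]_(x in A) `|g x|.
pose C : R := fine (Ep A) + fine (Em A) + G.
have ign : leb.-integrable A (EFin \o (fun x => `|g x|)) by exact: (integrable_norm ig).
have C0 : 0 <= C.
  have G0 : 0 <= G by apply: Rintegral_ge0.
  by rewrite /C addr_ge0// addr_ge0// fine_ge0.
pose K1 : R := `|K| + 1; have K10 : 0 < K1 by rewrite ltr_wpDl.
have key N : `|\int[Ep]_(x in A) phi x - \int[Em]_(x in A) phi x - \int[leb]_(x in A) (phi x * g x)| <= K1 * C * N.+1%:R^-1.
  pose s : R := K1 / N.+1%:R; have s0 : 0 < s by rewrite divr_gt0// ltr0n.
  have pN x : phi x <= N.+1%:R * s.
    rewrite /s mulrC divfK ?pnatr_eq0//; apply: le_trans (pK x) _; rewrite /K1.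
    by apply: le_trans (ler_norm K) _; rewrite lerDl.
  have h1 := steps_int (mu := Ep) mA (fin Ep A mA) mphi s0 p0 pN.
  have h2 := steps_int (mu := Em) mA (fin Em A mA) mphi s0 p0 pN.
  have mL (j : 'I_N.+1) : measurable [set y | j.+1%:R * s <= phi y] by exact: measurable_level.
  have iI (j : 'I_N.+1) : leb.-integrable A (EFin \o (fun x => s * \1_[set y | j.+1%:R * s <= phi y] x * g x)).
    apply: le_integrable (integrableZl mA s ig) => //.
    - apply/measurable_EFinP; apply: measurable_funM; last by apply/measurable_EFinP; exact: measurable_int ig.
      by apply: measurable_funTS; apply: measurable_funM; [exact: measurable_cst|exact: measurable_indic].
    - move=> x _; rewrite /= lee_fin !normrM ler_wpM2r// -[leRHS]mulr1.
      by apply: ler_wpM2l => //; exact: indic_norm_le1.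
  have [i2 E] := Rint_sum (enum 'I_N.+1) mA iI.
  have ip : leb.-integrable A (EFin \o (fun x => phi x * g x)).
    apply: le_integrable (integrableZl mA K1 ig) => //.
    - apply/measurable_EFinP; apply: measurable_funM; last by apply/measurable_EFinP; exact: measurable_int ig.
      exact: measurable_funTS.
    - move=> x _; rewrite /= lee_fin !normrM ler_wpM2r// (ger0_norm (p0 x)) ger0_norm ?(ltW K10)//.
      apply: le_trans (pK x) _; rewrite /K1; apply: le_trans (ler_norm K) _; by rewrite lerDl.
  have h3 : `|\int[leb]_(x in A) (phi x * g x) - \sum_(j <- enum 'I_N.+1) s * \int[leb]_(x in A `&` [set y | j.+1%:R * s <= phi y]) g x| <= s * G.
    have -> : \sum_(j <- enum 'I_N.+1) s * \int[leb]_(x in A `&` [set y | j.+1%:R * s <= phi y]) g x =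
       \int[leb]_(x in A) (\sum_(j <- enum 'I_N.+1) s * \1_[set y | j.+1%:R * s <= phi y] x * g x).
      rewrite E; apply: eq_bigr => j _.
      have igj : leb.-integrable A (EFin \o (fun x => \1_[set y | j.+1%:R * s <= phi y] x * g x)).
        have := integrableZl mA s^-1 (iI j); congr (_.-integrable _ _).
        by apply/funext => x; rewrite /= -EFinM (@cancel_scale _ s _ _ (lt0r_neq0 s0)).
      have -> : \int[leb]_(x in A) (s * \1_[set y | j.+1%:R * s <= phi y] x * g x) =
          \int[leb]_(x in A) (s * (\1_[set y | j.+1%:R * s <= phi y] x * g x)).
        by apply: eq_Rintegral => x _ /=; ring.
      rewrite RintegralZl//; congr (_ * _); rewrite /Rintegral; congr fine.
      rewrite integral_mkcondr; apply: eq_integral => x _; rewrite patchE indicE /=.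
      by case: ifP => _ /=; rewrite ?mul1r ?mul0r.
    have E2 := RintegralB mA ip i2; rewrite /= in E2; rewrite -E2.
    have iB := integrableB mA ip i2.
    apply: le_trans (le_normr_Rintegral mA iB) _.
    rewrite /G -RintegralZl//; apply: le_Rintegral => //.
    - exact: (integrable_norm iB).
    - exact: (integrableZl mA s ign).
    move=> x _; rewrite -mulr_suml -mulrBl normrM; apply: ler_wpM2r => //.
    have [q1 q2] := steps_approx s0 (p0 x) (pN x); rewrite /steps in q1 q2.
    by rewrite ger0_norm; lra.
  have Esum : \sum_(j <- enum 'I_N.+1) s * fine (Ep (A `&` [set y | j.+1%:R * s <= phi y])) -
    \sum_(j <- enum 'I_N.+1) s * fine (Em (A `&` [set y | j.+1%:R * s <= phi y])) =
    \sum_(j <- enum 'I_N.+1) s * \int[leb]_(x in A `&` [set y | j.+1%:R * s <= phi y]) g x.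
    rewrite -sumrB; apply: eq_bigr => j _; rewrite -mulrBr hE//.
    exact: measurableI.
  rewrite (_ : K1 * C * _ = s * C); last by rewrite /s; ring.
  rewrite /C !mulrDr; move: h1 h2 h3 Esum.
  move: (\sum_(j <- _) _) (\sum_(j <- _) _) (\sum_(j <- _) _) => S1 S2 S3.
  rewrite !ler_norml => /andP[? ?] /andP[? ?] /andP[? ?] ?; apply/andP; split; lra.
apply/eqP; rewrite -subr_eq0 -normr_le0; apply/ler_addgt0Pr => e e0; rewrite add0r.
have KC : 0 < K1 * C + 1 by rewrite ltr_wpDl// mulr_ge0// ltW.
have [N _ hN] := near_infty_natSinv_lt (PosNum (divr_gt0 e0 KC)).
apply: le_trans (key N) _; have /= := ltW (hN N (leqnn N)).
rewrite ler_pdivlMr// mulrC => h; apply: le_trans h; apply: ler_wpM2r; first by rewrite invr_ge0 ler0n.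
by rewrite lerDl.
Qed.

End transfer.

(** * Volume swept by a neighbourhood of the jump set *)

Section bad_set.
Context (R : realType) (n : nat).
Local Notation V := 'rV[R]_n.
Local Notation leb := (lebesgue_rV R n).
Hypothesis n2 : (2 <= n)%N.

Lemma ediam_ge (A : set V) x y : A x -> A y -> ((enorm (x - y))%:E <= ediam A)%E.
Proof. by move=> Ax Ay; apply: ereal_sup_ubound; right; exists (x, y). Qed.

Lemma ediam_ge0 (A : set V) : (0 <= ediam A)%E.
Proof. by apply: ereal_sup_ubound; left. Qed.

(* The slabs swept by a box of radius r under a translation by h, |h| <= L, r <= 2L. *)
Lemma swept_box (c h : V) (r L : R) : 0 < r -> r <= 2 * L -> enorm h <= L ->
  exists B : set V, [/\ measurable B, (leb B <= (5 * 4 ^+ n * L * r ^+ n.-1)%:E)%E &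
    forall (x : V) (s : R), 0 <= s <= 1 -> rV_box c r (x + s *: h) -> B x].
Proof.
move=> r0 rL hL; have L0 : 0 < L by lra.
pose M := (Num.trunc (L / r)).+1.
have y0 : 0 <= L / r by rewrite divr_ge0// ltW.
have /andP[t1 t2] := truncn_itv y0.
have M0 : 0 < M%:R :> R by rewrite ltr0n.
have LM : L <= M%:R * r by rewrite -ler_pdivrMr// ltW.
(* Consecutive centres are at most r apart, so the double radius catches every intermediate
   translate. There are M + 1 boxes and (M + 1) r <= L + 2 r <= 5 L, which is the origin of the
   5. *)
pose b (j : nat) : set V := rV_box (c - (j%:R / M%:R) *: h) (2 * r).
exists (\big[setU/set0]_(j < M.+1) b j); split.
- by apply: bigsetU_measurable => j _; exact: measurable_rV_box.
- apply: le_trans (le_mu_bigsetU _ _) _; first by move=> j _; exact: measurable_rV_box.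
  rewrite (eq_bigr (fun=> ((4 * r) ^+ n)%:E)); last first.
    move=> j _; apply: (etrans (@lebesgue_rV_box R n (c - (j%:R / M%:R) *: h) (2 * r) _)); first lra.
    by congr ((_ ^+ n)%:E); ring.
  rewrite sumEFin lee_fin sumr_const card_ord -[X in X <= _]mulr_natl exprMn.
  have -> : r ^+ n = r * r ^+ n.-1 by rewrite -exprS prednK// (leq_trans _ n2).
  rewrite (_ : M.+1%:R * _ = (M.+1%:R * r) * (4 ^+ n * r ^+ n.-1)); last by ring.
  rewrite (_ : 5 * _ * _ * _ = 5 * L * (4 ^+ n * r ^+ n.-1)); last by ring.
  apply: ler_wpM2r; first by rewrite mulr_ge0 ?exprn_ge0// ltW.
  rewrite ler_pdivlMr// in t1.
  have -> : M.+1%:R * r = (Num.trunc (L / r))%:R * r + 2 * r :> R.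
    by rewrite /M -!natr1; ring.
  lra.
move=> x s /andP[s0 s1] hx.
have z0 : 0 <= s * M%:R by rewrite mulr_ge0// ltW.
have /andP[u1 u2] := truncn_itv z0.
set j := Num.trunc (s * M%:R) in u1 u2.
have jM : (j < M.+1)%N.
  by rewrite ltnS -(ler_nat R); apply: le_trans u1 _; rewrite -[leRHS]mul1r ler_wpM2r// ltW.
rewrite -bigcup_mkord; exists j => //= i.
have hi := hx i; rewrite !mxE in hi *.
have hh : `|(s - j%:R / M%:R) * h ord0 i| <= r.
  rewrite normrM.
  have sj : `|s - j%:R / M%:R| <= M%:R^-1.
    have -> : s - j%:R / M%:R = (s * M%:R - j%:R) / M%:R by field; rewrite gt_eqF.
    rewrite normrM normfV (gtr0_norm M0) -[leRHS]mul1r ler_wpM2r ?invr_ge0 ?(ltW M0)//.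
    by rewrite ger0_norm ?subr_ge0//; rewrite -natr1 in u2; lra.
  apply: (@le_trans _ _ (M%:R^-1 * L)).
    by apply: ler_pM => //; apply: le_trans (ler_coord_enorm _ i) hL.
  by rewrite mulrC ler_pdivrMr// mulrC.
have := ler_normB (x ord0 i + s * h ord0 i - c ord0 i) ((s - j%:R / M%:R) * h ord0 i).
have -> : x ord0 i + s * h ord0 i - c ord0 i - (s - j%:R / M%:R) * h ord0 i =
  x ord0 i - (c ord0 i - j%:R / M%:R * h ord0 i) by ring.
lra.
Qed.

Lemma expr_add_le (a b : R) (m : nat) : 0 <= a -> 0 <= b -> (a + b) ^+ m <= 2 ^+ m * (a ^+ m + b ^+ m).
Proof.
wlog ab : a b / a <= b => [hw a0 b0|a0 b0].
  have [h|/ltW h] := leP a b; first exact: hw.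
  by rewrite addrC [a ^+ m + _]addrC; exact: hw.
apply: (@le_trans _ _ ((2 * b) ^+ m)); first by rewrite lerXn2r ?nnegrE ?addr_ge0 ?mulr_ge0//; lra.
by rewrite exprMn ler_wpM2l ?exprn_ge0// lerDr exprn_ge0.
Qed.

(* A set of finite (n-1)-dimensional Hausdorff measure has an open neighbourhood whose
   shadow in a direction h has volume O(|h|). *)
Lemma hausdorff_shadow (J : set V) : (hausdorff_measure n.-1 J < +oo)%E ->
  exists2 C : R, 0 <= C & forall (h : V), 0 < enorm h ->
  exists U B : set V, [/\ open U, J `<=` U, measurable B, (leb B <= (C * enorm h)%:E)%E &
    forall (x : V) (s : R), 0 <= s <= 1 -> U (x + s *: h) -> B x].
Proof.
move=> hJ; pose H : R := fine (hausdorff_measure n.-1 J).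
have H0 : (0 <= hausdorff_measure n.-1 J)%E.
  apply: ereal_sup_ge => /=; exists (hausdorff_content n.-1 1 J); first by exists 1.
  apply: le_ereal_inf_tmp => _ [U [_ _] <-]; apply: nneseries_ge0 => i _ _.
  apply: mule_ge0; first by rewrite lee_fin ltW// unit_ball_volume_gt0.
  by apply: expe_ge0; apply: mule_ge0 => //; exact: ediam_ge0.
have HE : hausdorff_measure n.-1 J = H%:E by rewrite fineK// ge0_fin_numE.
have om := @unit_ball_volume_gt0 R n.-1; set w := unit_ball_volume R n.-1 in om.
have n1 : n = n.-1.+1 by rewrite prednK// (leq_trans _ n2).
(* The first term bounds the sum of the (n-1)-th powers of the diameters of a nearly optimal
   covering, the 2 the sum of the enlargements of its members. *)
pose D : R := (2 ^+ n.-1 * (H + 1) / w) + 2.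
have HH : 0 <= H by rewrite /H fine_ge0.
have D0 : 0 <= D by rewrite /D addr_ge0// divr_ge0 ?(ltW om)// mulr_ge0 ?exprn_ge0// addr_ge0.
exists (5 * 4 ^+ n * (2 ^+ n.-1 * D)) => [|h h0]; first by rewrite !mulr_ge0 ?exprn_ge0.
set L := enorm h in h0 *.
(* The content is taken at scale |h|: the members of the covering are then no wider than the
   displacement, and sweeping one of radius r costs a volume of order |h| r^(n-1). *)
have : (hausdorff_content n.-1 L J < (H + 1)%:E)%E.
  apply: (@le_lt_trans _ _ (hausdorff_measure n.-1 J)).
    by apply: ereal_sup_ubound; exists L.
  by rewrite HE lte_fin ltrDl.
move=> /ereal_inf_lt[_ [W [JW WL] <-] hW].
pose a i : R := fine (ediam (W i)).
have aE i : ediam (W i) = (a i)%:E.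
  by rewrite fineK// ge0_fin_numE ?ediam_ge0//; apply: le_lt_trans (WL i) _; rewrite ltry.
have a0 i : 0 <= a i by rewrite fine_ge0// ediam_ge0.
have aL i : a i <= L by rewrite -lee_fin -aE.
pose m1 : R := Num.min 1 L.
have m10 : 0 < m1 by rewrite lt_min ltr01.
have [m11 m1L] : m1 <= 1 /\ m1 <= L by rewrite !ge_min !lexx orbT.
(* Enlargement that makes each member a nondegenerate open box even when it is a single point. It is
   at most |h|, and its (n-1)-th powers are summable. *)
pose tau i : R := m1 * 2^-1 ^+ i.
have hp i : 0 < 2^-1 ^+ i :> R by rewrite exprn_gt0.
have h1 i : 2^-1 ^+ i <= 1 :> R by rewrite exprn_ile1//; lra.
have tau0 i : 0 < tau i by rewrite mulr_gt0.
pose rho i : R := a i + tau i.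
have rho0 i : 0 < rho i by rewrite ltr_wpDl.
have rhoL i : rho i <= 2 * L.
  have : tau i <= L by apply: le_trans m1L; rewrite -[leRHS]mulr1 ler_wpM2l// ltW.
  by have := aL i; rewrite /rho; lra.
pose c i : V := xget 0 (W i).
have cW i x : W i x -> rV_box (c i) (a i) x.
  move=> Wx j; have Wc : W i (c i) by exact: (xgetI 0 Wx).
  have := ediam_ge Wx Wc; rewrite aE lee_fin; apply: le_trans.
  by have := ler_coord_enorm (x - c i) j; rewrite !mxE.
have swp i := swept_box (c i) (rho0 i) (rhoL i) (lexx L).
have [B hB] := choice swp.
pose O i : set V := ball (c i) (rho i).
exists (\bigcup_i O i), (\bigcup_i B i); split.
- by apply: bigcup_open => i _; exact: ball_open.
- move=> x Jx; have [i _ Wx] := JW _ Jx; exists i => //.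
  split; first exact: rho0.
  move=> j k; rewrite [j]ord1 -ball_normE/= distrC.
  by apply: le_lt_trans (cW i x Wx k) _; rewrite /rho ltrDl.
- by apply: bigcup_measurable => i _; have [] := hB i.
- have hsum : (\sum_(0 <= i <oo) leb (B i) <= (5 * 4 ^+ n * (2 ^+ n.-1 * D) * L)%:E)%E.
    apply: lime_le; first exact: is_cvg_nneseries.
    apply: nearW => k.
    apply: (@le_trans _ _ (\sum_(0 <= i < k) (5 * 4 ^+ n * L * (2 ^+ n.-1 * (a i ^+ n.-1 + 2^-1 ^+ i)))%:E)%E).
      apply: lee_sum => i _; have [_ hBi _] := hB i; apply: le_trans hBi _; rewrite lee_fin.
      apply: ler_wpM2l; first by rewrite !mulr_ge0 ?exprn_ge0// ltW.
      apply: le_trans (expr_add_le n.-1 (a0 i) (ltW (tau0 i))) _.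
      apply: ler_wpM2l; first exact: exprn_ge0.
      rewrite lerD2l; case: (n.-1) n1 n2 => [-> //|m _ _].
      rewrite exprS; apply: (@le_trans _ _ (tau i * 1)).
        apply: ler_wpM2l; first exact: ltW.
        by apply: exprn_ile1; [exact: ltW|rewrite /tau -[leRHS]mul1r; apply: ler_pM => //; exact: ltW].
      by rewrite mulr1 /tau -[leRHS]mul1r ler_wpM2r// ltW.
    rewrite sumEFin lee_fin -mulr_sumr -mulr_sumr big_split/=.
    rewrite (_ : 5 * 4 ^+ n * (2 ^+ n.-1 * D) * L = 5 * 4 ^+ n * L * (2 ^+ n.-1 * D)); last by ring.
    apply: ler_wpM2l; first by rewrite !mulr_ge0 ?exprn_ge0// ltW.
    apply: ler_wpM2l; first exact: exprn_ge0.
    rewrite /D; apply: lerD; last exact: half_series.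
    rewrite ler_pdivlMr//.
    have : (\sum_(0 <= i < k) (w * (2^-1 * a i) ^+ n.-1)%:E <= (H + 1)%:E)%E.
      apply: le_trans (ltW hW); apply: le_trans (nneseries_lim_ge k _); last first.
        move=> i _ _; apply: mule_ge0; first by rewrite lee_fin ltW.
        by apply: expe_ge0; apply: mule_ge0 => //; exact: ediam_ge0.
      by apply: lee_sum => i _; rewrite aE -EFinM -EFin_expe -EFinM.
    rewrite sumEFin lee_fin -mulr_sumr.
    rewrite (eq_bigr (fun i => 2^-1 ^+ n.-1 * a i ^+ n.-1)); last by move=> i _; rewrite exprMn.
    rewrite -mulr_sumr => hs.
    have p2 : 0 < 2 ^+ n.-1 :> R by rewrite exprn_gt0.
    have := ler_wpM2l (ltW p2) hs; apply: le_trans.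
    apply: le_of_eq.
    by rewrite exprVn; field; rewrite gt_eqF.
  by apply: le_trans (measure_sigma_subadditive _ _ _ _) hsum => //; [move=> i; have [] := hB i|
    by apply: bigcup_measurable => i _; have [] := hB i].
- move=> x s s01 [i _ Oi]; exists i => //; have [_ _ hBx] := hB i; apply: (hBx x s s01) => k.
  have := Oi.2 ord0 k; rewrite -ball_normE/= distrC; exact: ltW.
Qed.

End bad_set.

(** * Mollification and its increments along a segment *)

Section mollification.
Context (R : realType) (n : nat).
Local Notation V := 'rV[R]_n.
Local Notation leb := (lebesgue_rV R n).
Lemma moll_ge0 (dl : R) (p y : V) : 0 <= moll dl p y :> R.
Proof. exact: bump_ge0. Qed.

Lemma moll_le1 (dl : R) (p y : V) : moll dl p y <= 1 :> R.
Proof. exact: bump_le1. Qed.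

Lemma moll_sym (dl : R) (p y : V) : moll dl p y = moll dl y p.
Proof. by rewrite /moll -(opprB y p) scalerN bump_opp. Qed.

Lemma measurable_moll2 d (T : measurableType d) (dl : R) (p y : T -> V) :
  mfunT p -> mfunT y -> mfunT (fun x : T => moll dl (p x) (y x)).
Proof.
move=> mp my; rewrite /moll; apply: (measurableT_comp (@measurable_bump R n)).
by apply: measurable_rVZ => //; apply: measurable_rVD => //; exact: measurable_rVN.
Qed.

Lemma measurable_moll (dl : R) (p : V) : mfunT (moll dl p).
Proof. exact: (measurable_moll2 dl (measurable_cst p) (@measurable_id _ _ _)). Qed.

Variable c : R.
Hypothesis hc : (\int[leb]_z (bump z : R)%:E = c%:E)%E.

Lemma moll_mass (dl : R) (p : V) : 0 < dl -> (\int[leb]_y (moll dl p y)%:E = (dl ^+ n * c)%:E)%E.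
Proof.
move=> dl0; have d0 : dl^-1 != 0 by rewrite invr_eq0 gt_eqF.
have mb := @measurable_bump R n.
have := rint_dilate (- (dl^-1 *: p)) d0 mb (@bump_ge0 R n).
rewrite hc normfV gtr0_norm// exprVn invrK -EFinM => <-.
by apply: eq_integral => y _; rewrite /moll scalerBr.
Qed.

Section tonelli.
Variables (mu : {sigma_finite_measure set V -> \bar R}) (G : V -> R) (dl : R).
Hypotheses (mG : mfunT G) (G0 : forall y, 0 <= G y) (dl0 : 0 < dl).

End tonelli.

(* The L1 modulus of continuity of w controls its mollification error *)
Lemma moll_error (w : V -> R) (M r e : R) : mfunT w ->
  (forall x, `|w x| <= M) -> (forall x, ~ rV_box 0 r x -> w x = 0) -> 0 <= r -> 0 < e ->
  exists2 dl0 : R, 0 < dl0 & forall dl : R, 0 < dl -> dl <= dl0 -> forall v : V,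
    mfunT (fun x : V => \int[leb]_y (`|w y - w (x + v)| * moll dl (x + v) y)%:E)%E /\
    (\int[leb]_x \int[leb]_y (`|w y - w (x + v)| * moll dl (x + v) y)%:E <= (dl ^+ n * c * e)%:E)%E.
Proof.
move=> mw wM wS r0 e0; have [d d0 hd] := affine_continuity mw wM wS r0 e0.
exists d => // dl dl0 dld v.
have mF (k : V) : mfunT (fun p : V * V => (`|w p.2 - w (p.1 + k)| * moll dl (p.1 + k) p.2)%:E).
  apply/measurable_EFinP; apply: measurable_funM; last by apply: measurable_moll2; mfun.
  by apply: (measurableT_comp (@normr_measurable _ setT)); apply: measurable_funD; mfun.
have F0 (k : V) (p : V * V) : (0 <= (`|w p.2 - w (p.1 + k)| * moll dl (p.1 + k) p.2)%:E)%E.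
  by rewrite lee_fin mulr_ge0// moll_ge0.
split.
  exact: (measurable_fun_fubini_tonelli_F (m2 := leb) (fun p : V * V => (`|w p.2 - w (p.1 + v)| * moll dl (p.1 + v) p.2)%:E)).
have mB := @measurable_bump R n.
have dn0 : dl != 0 by rewrite gt_eqF.
have E (x : V) : (\int[leb]_y (`|w y - w (x + v)| * moll dl (x + v) y)%:E =
  \int[leb]_z (dl ^+ n * (`|w (dl *: z + (x + v)) - w (x + v)| * bump z))%:E)%E.
  have m1 : mfunT (fun y => `|w y - w (x + v)| * moll dl (x + v) y).
    apply: measurable_funM; last by apply: measurable_moll2; mfun.
    by apply: (measurableT_comp (@normr_measurable _ setT)); apply: measurable_funD; mfun.
  have := rint_dilate (x + v) dn0 m1 (fun y => mulr_ge0 (normr_ge0 _) (moll_ge0 _ _ _)).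
  rewrite gtr0_norm// => h.
  rewrite rintZl; [|by rewrite exprn_ge0// ltW| |by move=> z; rewrite mulr_ge0 ?bump_ge0]; last first.
    apply: measurable_funM => //.
    by apply: (measurableT_comp (@normr_measurable _ setT)); apply: measurable_funD; mfun.
  under [X in (_ = _ * X)%E]eq_integral => z _.
    have -> : bump z = moll dl (x + v) (dl *: z + (x + v)) by rewrite /moll addrK scalerA mulVf// scale1r.
    over.
  rewrite h muleA -EFinM mulfV ?mul1e//; by rewrite expf_neq0.
under eq_integral do rewrite E.
have mH : mfunT (fun p : V * V => dl ^+ n * (`|w (dl *: p.2 + (p.1 + v)) - w (p.1 + v)| * bump p.2)).
  apply: measurable_funM; first by mfun.
  apply: measurable_funM; last by mfun.
  by apply: (measurableT_comp (@normr_measurable _ setT)); apply: measurable_funD; mfun.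
rewrite (fubini_tonelli (m1 := leb) (m2 := leb) (fun p : V * V => (dl ^+ n * (`|w (dl *: p.2 + (p.1 + v)) - w (p.1 + v)| * bump p.2))%:E)); first last.
- by move=> p; rewrite lee_fin; apply: mulr_ge0; [apply: exprn_ge0; exact: ltW|apply: mulr_ge0 => //; exact: bump_ge0].
- by apply/measurable_EFinP.
have key (z : V) : (\int[leb]_x (dl ^+ n * (`|w (dl *: z + (x + v)) - w (x + v)| * bump z))%:E <=
    (dl ^+ n * e * bump z)%:E)%E.
  have [z1|z1] := leP 1 (enorm z).
    by rewrite bump_out// integral0_eq ?mulr0// => x _; rewrite !mulr0.
  have mw2 : mfunT (fun x : V => `|w (x + dl *: z) - w x|).
    by apply: (measurableT_comp (@normr_measurable _ setT)); apply: measurable_funD; mfun.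
  rewrite (_ : \int[leb]_x _ = \int[leb]_x (dl ^+ n * bump z * `|w ((x + v) + dl *: z) - w (x + v)|)%:E)%E; last first.
    by apply: eq_integral => x _; congr (_%:E); rewrite [dl *: z + _]addrC; ring.
  have b0 := bump_ge0 z.
  have k0 : 0 <= dl ^+ n * bump z by rewrite mulr_ge0// exprn_ge0// ltW.
  rewrite rintZl//; last first.
    by apply: (measurableT_comp (@normr_measurable _ setT)); apply: measurable_funD; mfun.
  rewrite (rint_translate v mw2)//.
  rewrite (_ : dl ^+ n * e * bump z = (dl ^+ n * bump z) * e); last by ring.
  rewrite [leRHS]EFinM; apply: lee_wpmul2l; first by rewrite lee_fin.
  have := hd 1 (dl *: z); under eq_integral do rewrite scale1r.
  apply; first by rewrite subrr normr0 ltW.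
  move=> i; apply: le_trans (ler_coord_enorm _ _) _; rewrite enormZ gtr0_norm//.
  by apply: le_trans dld; rewrite -[leRHS]mulr1 ler_wpM2l// ltW.
apply: (@le_trans _ _ (\int[leb]_z (dl ^+ n * e * bump z)%:E)%E).
  apply: ge0_le_integralT => z; last exact: key.
  by apply: integral_ge0 => x _; rewrite lee_fin; apply: mulr_ge0; [apply: exprn_ge0; exact: ltW|apply: mulr_ge0 => //; exact: bump_ge0].
rewrite rintZl//; [|by rewrite mulr_ge0 ?exprn_ge0// ltW|exact: bump_ge0].
by rewrite hc -EFinM lee_fin mulrAC.
Qed.

End mollification.

Lemma tel_arith1 (R : realFieldType) (a d X N : R) : N != 0 -> d != 0 ->
  27 * (a / N / d) ^+ 2 * X = 27 * (a / d) ^+ 2 * X / N ^+ 2.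
Proof. by move=> N0 d0; field; rewrite N0 d0. Qed.

Lemma tel_arith2 (R : realFieldType) (X N : R) : N != 0 -> N * (X / N ^+ 2) = X / N.
Proof. by move=> N0; field. Qed.

Section telescope.
Context (R : realType) (n : nat).
Local Notation V := 'rV[R]_n.
Local Notation leb := (lebesgue_rV R n).
Variables (D : set V) (w : V -> R) (W l : R) (dl : R).
Hypotheses (mD : measurable D) (hl : leb D = l%:E) (mw : mfunT w) (wW : forall y, `|w y| <= W)
  (dl0 : 0 < dl).

(** Unnormalised mollification over D. Moving the centre p differentiates the bump with the opposite
    sign, so the derivative of [smear] at p along k is - [dl^-1 * dsmear p k]. *)
Definition smear (p : V) : R := \int[leb]_(y in D) (w y * moll dl p y).
Definition dsmear (p k : V) : R := \int[leb]_(y in D) (w y * dbump (dl^-1 *: (y - p)) k).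

Lemma W_ge0 : 0 <= W. Proof. exact: le_trans (normr_ge0 _) (wW 0). Qed.

Lemma dom_fin : (leb D < +oo)%E. Proof. by rewrite hl ltry. Qed.

Lemma dbumpZ (z k : V) (a : R) : dbump z (a *: k) = a * dbump z k.
Proof. by rewrite /dbump dotZr; ring. Qed.

Lemma dbumpN (z k : V) : dbump z (- k) = - dbump z k :> R.
Proof. by rewrite /dbump dotNr; ring. Qed.

Lemma measurable_dbump (k : V) : mfunT (fun z : V => dbump z k : R).
Proof.
rewrite /dbump; apply: measurable_funN; apply: measurable_funM; last by mfun.
apply: measurable_funM; first by mfun.
by apply: (measurableT_comp (@measurable_ppart R)); mfun.
Qed.

Lemma smear_int (p : V) : leb.-integrable D (EFin \o (fun y => w y * moll dl p y)).
Proof.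
have W0 := W_ge0; apply: (@finite_integrable _ _ _ _ _ _ W) => //; first exact: dom_fin.
- apply: measurable_funM => //; exact: measurable_moll.
- move=> y; rewrite normrM -[leRHS]mulr1 ler_pM// (ger0_norm (moll_ge0 _ _ _)); exact: moll_le1.
Qed.

Lemma dsmear_int (p k : V) : leb.-integrable D (EFin \o (fun y => w y * dbump (dl^-1 *: (y - p)) k)).
Proof.
have W0 := W_ge0; apply: (@finite_integrable _ _ _ _ _ _ (W * (4 * enorm k))) => //; first by pos.
- exact: dom_fin.
- by apply: measurable_funM => //; apply: (measurableT_comp (measurable_dbump k)); mfun.
- by move=> y; rewrite normrM ler_pM//; exact: dbump_le.
Qed.

Lemma smear_step (p k : V) : enorm k <= dl ->
  `|smear (p + k) - smear p + dl^-1 * dsmear p k| <= 27 * (enorm k / dl) ^+ 2 * (W * l).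
Proof.
move=> kd; have W0 := W_ge0.
have E : smear (p + k) - smear p + dl^-1 * dsmear p k =
    \int[leb]_(y in D) (w y * moll dl (p + k) y - w y * moll dl p y + dl^-1 * (w y * dbump (dl^-1 *: (y - p)) k)).
  have i1 := smear_int (p + k); have i2 := smear_int p; have i3 := dsmear_int p k.
  have i4 := integrableB mD i1 i2; have i5 := integrableZl mD dl^-1 i3.
  have e1 := RintegralD mD i4 i5; rewrite /= in e1; rewrite e1.
  have e2 := RintegralB mD i1 i2; rewrite /= in e2; rewrite e2.
  by congr (_ + _); rewrite RintegralZl.
rewrite E.
have pt y : `|w y * moll dl (p + k) y - w y * moll dl p y + dl^-1 * (w y * dbump (dl^-1 *: (y - p)) k)| <=
    27 * (enorm k / dl) ^+ 2 * W.
  have k1 : enorm (- (dl^-1 *: k)) <= 1.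
    by rewrite enormN enormZ normfV gtr0_norm// mulrC ler_pdivrMr// mul1r.
  have := bump_taylor (dl^-1 *: (y - p)) k1.
  have -> : dl^-1 *: (y - p) + - (dl^-1 *: k) = dl^-1 *: (y - (p + k)).
    by rewrite -scalerBr opprD addrA.
  have -> : dbump (dl^-1 *: (y - p)) (- (dl^-1 *: k)) = - dl^-1 * dbump (dl^-1 *: (y - p)) k.
    by rewrite dbumpN dbumpZ mulNr.
  rewrite enormN enormZ normfV (gtr0_norm dl0) [dl^-1 * enorm k]mulrC => h.
  rewrite (_ : w y * _ - _ + _ = w y * (bump (dl^-1 *: (y - (p + k))) - bump (dl^-1 *: (y - p)) -
    - dl^-1 * dbump (dl^-1 *: (y - p)) k)); last by rewrite /moll; ring.
  by rewrite normrM mulrC; apply: ler_pM.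
have lD : fine (leb D) = l by rewrite hl.
have c0 : 0 <= 27 * (enorm k / dl) ^+ 2 * W by apply: mulr_ge0 => //; apply: mulr_ge0 => //; exact: sqr_ge0.
have iF : leb.-integrable D (EFin \o (fun y => w y * moll dl (p + k) y - w y * moll dl p y + dl^-1 * (w y * dbump (dl^-1 *: (y - p)) k))).
  apply: (@finite_integrable _ _ _ _ _ _ (27 * (enorm k / dl) ^+ 2 * W)) => //; first exact: dom_fin.
  have md := measurable_dbump k.
  have m1 q := measurable_moll dl q.
  apply: measurable_funD; first by apply: measurable_funB; apply: measurable_funM => //; exact: m1.
  by apply: measurable_funM => //; apply: measurable_funM => //; apply: (measurableT_comp md); mfun.
apply: le_trans (le_normr_Rintegral mD iF) _.
have ic : leb.-integrable D (EFin \o cst (27 * (enorm k / dl) ^+ 2 * W)).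
  by apply: (@finite_integrable _ _ _ _ _ _ (27 * (enorm k / dl) ^+ 2 * W)) => //; [exact: dom_fin|move=> y; rewrite /cst ger0_norm].
apply: (@le_trans _ _ (\int[leb]_(y in D) cst (27 * (enorm k / dl) ^+ 2 * W) y)).
  by apply: le_Rintegral => //; exact: integrable_norm iF.
by rewrite Rintegral_cst// (_ : fine _ = l)// mulrA.
Qed.

(* The increment of the mollified function over h, as the average of N infinitesimal ones *)
Lemma smear_telescope (x h : V) (N : nat) : enorm h <= N.+1%:R * dl ->
  `|smear (x + h) - smear x + dl^-1 * N.+1%:R^-1 * \sum_(m < N.+1) dsmear (x + (m%:R / N.+1%:R) *: h) h|
    <= 27 * (enorm h / dl) ^+ 2 * (W * l) / N.+1%:R.
Proof.
move=> hN; have N0 : 0 < N.+1%:R :> R by rewrite ltr0n.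
have Nn : N.+1%:R != 0 :> R by rewrite gt_eqF.
pose q (m : nat) : V := x + (m%:R / N.+1%:R) *: h.
have q0 : q 0%N = x by rewrite /q mul0r scale0r addr0.
have qN : q N.+1 = x + h by rewrite /q mulfV// scale1r.
have qS m : q m.+1 = q m + N.+1%:R^-1 *: h.
  by rewrite /q -addrA -scalerDl; congr (_ + _ *: _); rewrite -natr1; field.
have E1 : smear (x + h) - smear x = \sum_(m < N.+1) (smear (q m.+1) - smear (q m)).
  by rewrite -(big_mkord xpredT (fun m => smear (q m.+1) - smear (q m))) telescope_sumr; [by rewrite qN q0|exact: leq0n].
have dZ p : dsmear p (N.+1%:R^-1 *: h) = N.+1%:R^-1 * dsmear p h.
  rewrite /dsmear -RintegralZl//; last exact: dsmear_int.
  by apply: eq_Rintegral => y _; rewrite dbumpZ; ring.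
rewrite E1 mulr_sumr -big_split/=.
apply: le_trans (ler_norm_sum _ _ _) _.
apply: (@le_trans _ _ (\sum_(m < N.+1) 27 * (enorm h / dl) ^+ 2 * (W * l) / N.+1%:R ^+ 2)).
  apply: ler_sum => m _; have := @smear_step (q m) (N.+1%:R^-1 *: h).
  have eh : enorm (N.+1%:R^-1 *: h) = enorm h / N.+1%:R by rewrite enormZ normfV (gtr0_norm N0) mulrC.
  rewrite -qS dZ eh mulrA => H; apply: le_trans (H _) _; first by rewrite ler_pdivrMr// mulrC.
  by rewrite (tel_arith1 (enorm h) (W * l) Nn (lt0r_neq0 dl0)).
by rewrite sumr_const card_ord -[X in X <= _]mulr_natl (tel_arith2 _ Nn).
Qed.

End telescope.

(** * A probability kernel along a segment *)

Lemma young_kernel (R : realFieldType) (I b k f : R) : `|b| <= 1 -> 0 <= k ->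
  `|2 * I * (b * (k * f))| <= I ^+ 2 * k + f ^+ 2 * k.
Proof.
move=> b1 k0; rewrite !normrM (ger0_norm k0) (@ger0_norm _ 2)//.
have b0 : 0 <= `|b| by [].
have t0 : 0 <= k * (`|I| * `|f|) by rewrite !mulr_ge0.
have t1 : 2 * (`|I| * `|f|) <= I ^+ 2 + f ^+ 2.
  have := sqr_ge0 (`|I| - `|f|); rewrite sqrrB !real_normK ?num_real//; lra.
apply: (@le_trans _ _ (k * (2 * (`|I| * `|f|)))).
  rewrite (_ : 2 * `|I| * _ = `|b| * (2 * (k * (`|I| * `|f|)))); last by ring.
  rewrite [leRHS](_ : _ = 1 * (2 * (k * (`|I| * `|f|)))); last by ring.
  by apply: ler_wpM2r => //; rewrite mulr_ge0.
by rewrite -mulrDl mulrC; apply: ler_wpM2r.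
Qed.

Section kernel.
Context (R : realType) (n : nat).
Local Notation V := 'rV[R]_n.
Local Notation leb := (lebesgue_rV R n).
Variables (c dl : R) (N : nat) (h : V).
Hypothesis hc : (\int[leb]_z (bump z : R)%:E = c%:E)%E.
Hypotheses (c0 : 0 < c) (dl0 : 0 < dl).

Definition node (x : V) (m : nat) : V := x + (m%:R / N.+1%:R) *: h.
Definition kern0 : R := (dl ^+ n * c * N.+1%:R)^-1.
(** The mean of normalised bumps at N + 1 nodes of the segment from x to x + h, omitting the end x +
    h. It has mass 1 in y, which gives a Jensen inequality, and also mass 1 in x, so that
    integrating over x loses nothing. *)
Definition kern (x y : V) : R := kern0 * \sum_(m < N.+1) moll dl (node x m) y.

Lemma kern0_gt0 : 0 < kern0.
Proof. by rewrite /kern0 invr_gt0 !mulr_gt0 ?exprn_gt0// ltr0n. Qed.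

Lemma kern_ge0 x y : 0 <= kern x y.
Proof. by rewrite /kern mulr_ge0 ?(ltW kern0_gt0)// sumr_ge0// => m _; exact: moll_ge0. Qed.

Lemma kern_le x y : kern x y <= kern0 * N.+1%:R.
Proof.
rewrite /kern ler_wpM2l ?(ltW kern0_gt0)//.
apply: (@le_trans _ _ (\sum_(m < N.+1) 1)); first by apply: ler_sum => m _; exact: moll_le1.
by rewrite sumr_const card_ord.
Qed.

Lemma kern_norm x y : `|kern x y| <= kern0 * N.+1%:R.
Proof. by rewrite (ger0_norm (kern_ge0 x y)) kern_le. Qed.

Lemma measurable_kern2 : mfunT (fun p : V * V => kern p.1 p.2).
Proof.
apply: measurable_funM => //; apply: measurable_sum => m; apply: measurable_moll2; rewrite /node; by mfun.
Qed.

Lemma measurable_kern x : mfunT (kern x).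
Proof.
by apply: measurable_funM => //; apply: measurable_sum => m; exact: measurable_moll.
Qed.

Lemma measurable_kern1 y : mfunT (fun x : V => kern x y).
Proof.
apply: measurable_funM => //; apply: measurable_sum => m; apply: measurable_moll2; rewrite /node; by mfun.
Qed.

Lemma sum_mass : (kern0%:E * \sum_(m < N.+1) (dl ^+ n * c)%:E = 1)%E.
Proof.
rewrite sumEFin -EFinM sumr_const card_ord -mulr_natl; congr (_%:E); rewrite /kern0.
have N0 : N.+1%:R != 0 :> R by rewrite pnatr_eq0.
rewrite [N.+1%:R * _]mulrC mulVf// !mulf_neq0// ?gt_eqF// ?exprn_gt0//.
Qed.

Lemma kern_mass x : (\int[leb]_y (kern x y)%:E = 1)%E.
Proof.
rewrite rintZl; first last.
- by move=> y; apply: sumr_ge0 => m _; exact: moll_ge0.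
- by apply: measurable_sum => m; exact: measurable_moll.
- exact: ltW kern0_gt0.
rewrite rint_sum; first last.
- by move=> m y; exact: moll_ge0.
- by move=> m; exact: measurable_moll.
rewrite -[RHS]sum_mass; congr (_ * _)%E; apply: eq_bigr => m _.
exact: (moll_mass hc).
Qed.

Lemma kern_mass1 y : (\int[leb]_x (kern x y)%:E = 1)%E.
Proof.
have mm (m : nat) : mfunT (fun x : V => moll dl (node x m) y).
  by apply: measurable_moll2; rewrite /node; mfun.
rewrite rintZl; first last.
- by move=> x; apply: sumr_ge0 => m _; exact: moll_ge0.
- by apply: measurable_sum => m.
- exact: ltW kern0_gt0.
rewrite rint_sum; first last.
- by move=> m x; exact: moll_ge0.
- by move=> m; exact: mm.
rewrite -[RHS]sum_mass; congr (_ * _)%E; apply: eq_bigr => m _.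
under eq_integral do rewrite moll_sym.
rewrite /node (rint_translate _ (measurable_moll dl y)); first exact: (moll_mass hc).
by move=> x; exact: moll_ge0.
Qed.

Lemma measurable_kern_int (mu : {sigma_finite_measure set V -> \bar R}) (G : V -> R) :
  mfunT G -> (forall y, 0 <= G y) ->
  mfunT (fun x : V => \int[mu]_y (G y * kern x y)%:E)%E.
Proof.
move=> mG G0; have mK := measurable_kern2.
apply: (measurable_fun_fubini_tonelli_F (m2 := mu) (fun p : V * V => (G p.2 * kern p.1 p.2)%:E)).
  by apply/measurable_EFinP; apply: measurable_funM => //; by mfun.
by move=> p; rewrite lee_fin mulr_ge0// kern_ge0.
Qed.

Lemma kern_tonelli (mu : {sigma_finite_measure set V -> \bar R}) (G : V -> R) :
  mfunT G -> (forall y, 0 <= G y) ->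
  (\int[leb]_x \int[mu]_y (G y * kern x y)%:E = \int[mu]_y (G y)%:E)%E.
Proof.
move=> mG G0; have mK := measurable_kern2.
rewrite (fubini_tonelli (m1 := leb) (m2 := mu) (fun p : V * V => (G p.2 * kern p.1 p.2)%:E)); first last.
- by move=> p; rewrite lee_fin mulr_ge0// kern_ge0.
- by apply/measurable_EFinP; apply: measurable_funM => //; by mfun.
apply: eq_integral => y _ /=.
rewrite rintZl//; [|exact: measurable_kern1|by move=> x; exact: kern_ge0].
by rewrite kern_mass1 mule1.
Qed.

(* Young's inequality 2AE <= A^2 + E^2 in place of Jensen's *)
Lemma kern_jensen (A : set V) (F : V -> R) x : measurable A -> mfunT F ->
  leb.-integrable A (EFin \o (fun y => kern x y * F y)) ->
  (((\int[leb]_(y in A) (kern x y * F y)) ^+ 2)%:E <= \int[leb]_y (F y ^+ 2 * kern x y)%:E)%E.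
Proof.
move=> mA mF iF; set I := \int[leb]_(y in A) _.
have mK := measurable_kern x.
have mB : mfunT (\1_A : V -> R) by exact: measurable_indic.
have h1 : ((2 * I ^+ 2)%:E <= \int[leb]_y (I ^+ 2 * kern x y + F y ^+ 2 * kern x y)%:E)%E.
  have E1 : (I%:E = \int[leb]_y (\1_A y * (kern x y * F y))%:E)%E.
    rewrite /I /Rintegral fineK; last exact: integrable_fin_num iF.
    rewrite integral_mkcond; apply: eq_integral => y _; rewrite patchE indicE /=.
    by case: ifP => _ /=; rewrite ?mul1r ?mul0r.
  have iF' : leb.-integrable setT (EFin \o (fun y => \1_A y * (kern x y * F y))).
    have /(integrable_mkcond _ mA) := iF; congr (_.-integrable _ _).
    apply/funext => y; rewrite patchE /= indicE.
    by case: ifP => _ /=; rewrite ?mul1r ?mul0r.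
  have -> : ((2 * I ^+ 2)%:E = (2 * I)%:E * \int[leb]_y (\1_A y * (kern x y * F y))%:E)%E.
    by rewrite -E1 -EFinM; congr (_%:E); ring.
  rewrite -integralZl//; apply: le_trans (lee_abs _) _.
  have mm : mfunT (fun y : V => (2 * I)%:E * (\1_A y * (kern x y * F y))%:E)%E.
    have := integrableZl measurableT (2 * I) iF'; exact: measurable_int.
  apply: le_trans (le_abse_integral _ measurableT mm) _.
  apply: ge0_le_integralT => y; first exact: abse_ge0.
  rewrite -EFinM abse_EFin lee_fin.
  by apply: young_kernel; [exact: indic_norm_le1|exact: kern_ge0].
have m2 : mfunT (fun y => F y ^+ 2 * kern x y) by apply: measurable_funM => //; exact: measurable_funX.
have p2 y : 0 <= F y ^+ 2 * kern x y by rewrite mulr_ge0 ?sqr_ge0// kern_ge0.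
rewrite rintD// in h1; [|by apply: measurable_funM|by move=> y; rewrite mulr_ge0 ?sqr_ge0// kern_ge0].
rewrite rintZl ?sqr_ge0// in h1; last by move=> y; exact: kern_ge0.
rewrite kern_mass mule1 in h1.
have z0 : (0 <= \int[leb]_y (F y ^+ 2 * kern x y)%:E)%E by apply: rint_ge0 => y; exact: p2.
move: h1 z0; case: (\int[leb]_y (F y ^+ 2 * kern x y)%:E)%E => [q| |].
- by rewrite -EFinD !lee_fin => h1 _; lra.
- by move=> _ _; rewrite leey.
- by [].
Qed.

Lemma kern_out (x y : V) : (forall m : nat, (m <= N)%N -> dl <= enorm (y - node x m)) -> kern x y = 0.
Proof.
move=> H; rewrite /kern big1 ?mulr0// => m _; apply: moll_out => //; apply: H.
by rewrite -ltnS.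
Qed.

End kernel.

(** * Increments of fields of bounded deformation *)

Lemma dot_delta (R : realType) n (z : 'rV[R]_n) j : dot z (delta_mx ord0 j) = z ord0 j.
Proof.
rewrite /dot (bigD1 j)//= mxE !eqxx mulr1 big1 ?addr0// => i ij.
by rewrite mxE eqxx/= (negbTE ij) mulr0.
Qed.

Lemma strain_form_sqr (R : realType) n (h : 'rV[R]_n) (e : 'I_n -> 'I_n -> R) :
  (\sum_(q : 'I_n * 'I_n) h ord0 q.1 * h ord0 q.2 * e q.1 q.2) ^+ 2 <=
  enorm h ^+ 4 * \sum_(q : 'I_n * 'I_n) e q.1 q.2 ^+ 2.
Proof.
pose r i : 'rV[R]_n := \row_j e i j; pose g : 'rV[R]_n := \row_i dot h (r i).
have -> : \sum_(q : 'I_n * 'I_n) h ord0 q.1 * h ord0 q.2 * e q.1 q.2 = dot h g.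
  rewrite -(pair_bigA _ (fun i j => h ord0 i * h ord0 j * e i j))/= /dot; apply: eq_bigr => i _.
  by rewrite mxE /dot mulr_sumr; apply: eq_bigr => j _; rewrite mxE mulrA.
rewrite -(pair_bigA _ (fun i j => e i j ^+ 2))/=.
have cs (x y : 'rV[R]_n) : dot x y ^+ 2 <= dot x x * dot y y.
  rewrite -!sqr_enorm -exprMn -[dot x y ^+ 2]real_normK ?num_real//.
  by rewrite lerXn2r ?nnegrE ?mulr_ge0 ?enorm_ge0// ler_dot_enorm.
apply: le_trans (cs h g) _.
rewrite (_ : enorm h ^+ 4 = dot h h * dot h h); last by rewrite -!sqr_enorm -exprD.
rewrite -mulrA; apply: ler_wpM2l; first exact: dot_ge0.
rewrite {1}/dot mulr_sumr; apply: ler_sum => i _; rewrite !mxE -expr2.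
apply: le_trans (cs _ _) _; apply: le_of_eq.
by congr (_ * _); apply: eq_bigr => j _; rewrite mxE expr2.
Qed.

Section sbd_increments.
Context (R : realType) (n : nat).
Local Notation V := 'rV[R]_n.
Local Notation leb := (lebesgue_rV R n).
Variables (c : R) (D U : set V) (u : V -> V) (M l : R)
  (Ep Em : 'I_n -> 'I_n -> {finite_measure set V -> \bar R}) (e : 'I_n -> 'I_n -> V -> R).
Hypotheses (hc : (\int[leb]_z (bump z : R)%:E = c%:E)%E) (c0 : 0 < c).
Hypotheses (mD : measurable D) (hl : leb D = l%:E) (mU : measurable U).
Hypotheses (mu : mfunT u) (uM : forall x, enorm (u x) <= M).
Hypothesis hst : forall i j phi, C1c D phi ->
    \int[Ep i j]_(x in D) phi x - \int[Em i j]_(x in D) phi x =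
    - 2^-1 * \int[leb]_(x in D)
      (u x ord0 i * 'D_(delta_mx ord0 j) phi x + u x ord0 j * 'D_(delta_mx ord0 i) phi x).
Hypothesis me : forall i j, mfunT (e i j).
Hypothesis ie : forall i j, leb.-integrable D (EFin \o e i j).
Hypothesis hsing : forall i j A, measurable A -> A `<=` D `\` U ->
  fine (Ep i j A) - fine (Em i j A) = \int[leb]_(x in A) e i j x.

Definition strain_sqr (y : V) : R := \sum_(q : 'I_n * 'I_n) e q.1 q.2 y ^+ 2.

Lemma strain_sqr_ge0 y : 0 <= strain_sqr y.
Proof. by apply: sumr_ge0 => q _; exact: sqr_ge0. Qed.

Lemma measurable_strain_sqr : mfunT strain_sqr.
Proof. by apply: measurable_sum => q; exact: measurable_funX. Qed.

Section direction.
Variables (h : V) (dl : R) (N : nat).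
Hypotheses (h0 : 0 < enorm h) (dl0 : 0 < dl) (hN : enorm h <= N.+1%:R * dl).
Local Notation L := (enorm h).
Local Notation K := (kern c dl N h).

Definition wh (y : V) : R := dot (u y) h.
Definition hh (q : 'I_n * 'I_n) : R := h ord0 q.1 * h ord0 q.2.

Lemma hh_le q : `|hh q| <= L ^+ 2.
Proof. by rewrite /hh normrM expr2; apply: ler_pM => //; exact: ler_coord_enorm. Qed.

Lemma measurable_wh : mfunT wh.
Proof. by rewrite /wh; mfun. Qed.

Lemma wh_le y : `|wh y| <= M * L.
Proof.
apply: le_trans (ler_dot_enorm _ _) _; apply: ler_wpM2r => //; exact: ltW.
Qed.

(** Contracting the symmetrised gradient with h_i h_j leaves the derivative of the scalar function u
    . h in the direction h; the strain is all that is known of the gradient, and this contraction is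
    all that the energy sees. *)
Lemma strain_test p : (forall y, enorm (y - p) <= dl -> D y) ->
  \sum_q hh q * (\int[Ep q.1 q.2]_(y in D) moll dl p y - \int[Em q.1 q.2]_(y in D) moll dl p y) =
  - (dl^-1 * dsmear D wh dl p h).
Proof.
move=> hpD; have C := moll_C1c dl0 hpD.
have M0 : 0 <= M by exact: le_trans (enorm_ge0 _) (uM 0).
have di0 : 0 <= dl^-1 by rewrite invr_ge0 ltW.
pose F (q : 'I_n * 'I_n) (y : V) : R := u y ord0 q.1 * (dl^-1 * dbump (dl^-1 *: (y - p)) (delta_mx ord0 q.2)) +
  u y ord0 q.2 * (dl^-1 * dbump (dl^-1 *: (y - p)) (delta_mx ord0 q.1)).
have E q : \int[Ep q.1 q.2]_(y in D) moll dl p y - \int[Em q.1 q.2]_(y in D) moll dl p y =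
    - 2^-1 * \int[leb]_(y in D) F q y.
  rewrite hst//; congr (_ * _); apply: eq_Rintegral => y _.
  by rewrite !(moll_derive p y _ dl0).2.
have mc i : mfunT (fun y => u y ord0 i) by exact: measurable_coord.
have mdb (k : V) : mfunT (fun y : V => dl^-1 * dbump (dl^-1 *: (y - p)) k).
  have md := @measurable_dbump R n k.
  by apply: measurable_funM => //; apply: (measurableT_comp md); mfun.
have cK (i : 'I_n) (k : V) y : `|u y ord0 i * (dl^-1 * dbump (dl^-1 *: (y - p)) k)| <= M * (dl^-1 * (4 * enorm k)).
  rewrite !normrM (ger0_norm di0); apply: ler_pM => //; first by rewrite mulr_ge0.
    by apply: le_trans (ler_coord_enorm _ _) _.
  by apply: ler_wpM2l => //; exact: dbump_le.
have iF q : leb.-integrable D (EFin \o F q).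
  apply: (@finite_integrable _ _ _ _ _ _ (M * (dl^-1 * (4 * enorm (delta_mx ord0 q.2 : V))) +
    M * (dl^-1 * (4 * enorm (delta_mx ord0 q.1 : V))))) => //.
  - by apply: addr_ge0; rewrite mulr_ge0// mulr_ge0// mulr_ge0// enorm_ge0.
  - exact: (dom_fin hl).
  - by apply: measurable_funD; apply: measurable_funM.
  - by move=> y; apply: le_trans (ler_normD _ _) _; apply: lerD; exact: cK.
rewrite (eq_bigr (fun q => \int[leb]_(y in D) (- (hh q / 2) * F q y))); last first.
  by move=> q _; rewrite E RintegralZl//; ring.
have iF2 q : leb.-integrable D (EFin \o (fun y => - (hh q / 2) * F q y)) by exact: (integrableZl mD _ (iF q)).
rewrite -(Rint_sum _ mD iF2).2 /dsmear -mulNr -RintegralZl//; last first.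
  have H := @dsmear_int _ _ _ _ _ _ dl mD hl measurable_wh wh_le p h.
  exact: H.
apply: eq_Rintegral => y _.
set z := dl^-1 *: (y - p); pose be : R := 4 * ppart (dot z z).
have dE (k : V) : dbump z k = - (be * dot z k) by [].
rewrite dE (eq_bigr (fun q => (be * dl^-1 / 2) * ((u y ord0 q.1 * h ord0 q.1) * (z ord0 q.2 * h ord0 q.2)) +
  (be * dl^-1 / 2) * ((z ord0 q.1 * h ord0 q.1) * (u y ord0 q.2 * h ord0 q.2)))); last first.
  by move=> q _; rewrite /F -/z !dE !dot_delta /hh; ring.
rewrite big_split/= -!mulr_sumr.
have dd (a b : V) : \sum_(q : 'I_n * 'I_n) (a ord0 q.1 * h ord0 q.1) * (b ord0 q.2 * h ord0 q.2) = dot a h * dot b h.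
  by rewrite /dot big_distrlr/= pair_bigA.
by rewrite !dd /wh; field; rewrite gt_eqF.
Qed.

Lemma finite_moll (nu : {finite_measure set V -> \bar R}) p A : measurable A ->
  nu.-integrable A (EFin \o moll dl p).
Proof.
move=> mA; apply: (@finite_integrable _ _ _ _ _ _ 1) => //.
- by rewrite -ge0_fin_numE// fin_num_measure.
- exact: measurable_moll.
- by move=> y; rewrite (ger0_norm (moll_ge0 _ _ _)); exact: moll_le1.
Qed.

Lemma finite_kern (nu : {finite_measure set V -> \bar R}) x A : measurable A ->
  nu.-integrable A (EFin \o K x).
Proof.
move=> mA; have k0 := kern0_gt0 n N c0 dl0.
apply: (@finite_integrable _ _ _ _ _ _ (kern0 n c dl N * N.+1%:R)) => //.
- by rewrite mulr_ge0// ltW.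
- by rewrite -ge0_fin_numE// fin_num_measure.
- exact: measurable_kern.
- by move=> y; exact: kern_norm.
Qed.

Definition strain_pairing (x : V) : R :=
  \sum_q hh q * (\int[Ep q.1 q.2]_(y in D) K x y - \int[Em q.1 q.2]_(y in D) K x y).

(** [strain_test] at every node turns the sum in [smear_telescope] into the strain measure
    integrated against the kernel. The bumps at the nodes must lie in D to be admissible tests. *)
Lemma smear_strain x : (forall m : nat, (m <= N)%N -> forall y, enorm (y - node N h x m) <= dl -> D y) ->
  `|(dl ^+ n * c)^-1 * (smear D wh dl (x + h) - smear D wh dl x) - strain_pairing x| <=
  (dl ^+ n * c)^-1 * (27 * (L / dl) ^+ 2 * (M * L * l) / N.+1%:R).
Proof.
move=> hx; pose k1 : R := (dl ^+ n * c)^-1.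
have k10 : 0 <= k1 by rewrite invr_ge0 mulr_ge0 ?exprn_ge0// ltW.
have I (nu : {finite_measure set V -> \bar R}) :
    \int[nu]_(y in D) K x y = kern0 n c dl N * \sum_(m < N.+1) \int[nu]_(y in D) moll dl (node N h x m) y.
  have im (m : 'I_N.+1) := finite_moll nu (node N h x m) mD.
  have [i1 i2] := Rint_sum (index_enum 'I_N.+1) mD im.
  by rewrite /kern RintegralZl// i2.
have E : strain_pairing x = \sum_(m < N.+1) kern0 n c dl N * - (dl^-1 * dsmear D wh dl (node N h x m) h).
  rewrite /strain_pairing (eq_bigr (fun q => \sum_(m < N.+1) kern0 n c dl N * (hh q *
    (\int[Ep q.1 q.2]_(y in D) moll dl (node N h x m) y - \int[Em q.1 q.2]_(y in D) moll dl (node N h x m) y)))); last first.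
    by move=> q _; rewrite !I -mulrBr -sumrB mulrCA !mulr_sumr.
  rewrite exchange_big/=; apply: eq_bigr => m _; rewrite -mulr_sumr strain_test//.
  by apply: hx; rewrite -ltnS.
have N0 : N.+1%:R != 0 :> R by rewrite pnatr_eq0.
have -> : k1 * (smear D wh dl (x + h) - smear D wh dl x) - strain_pairing x =
    k1 * (smear D wh dl (x + h) - smear D wh dl x + dl^-1 * N.+1%:R^-1 * \sum_(m < N.+1) dsmear D wh dl (node N h x m) h).
  have k0E : kern0 n c dl N = k1 * N.+1%:R^-1 by rewrite /kern0 invfM.
  rewrite E -mulr_sumr k0E sumrN -mulr_sumr.
  move: (\sum_(_ < _) _) (smear D wh dl (x + h)) (smear D wh dl x) => p1 p2 p3; clear; ring.
rewrite normrM (ger0_norm k10); apply: ler_wpM2l => //.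
exact: (smear_telescope mD hl measurable_wh wh_le dl0).
Qed.

Definition absolute_part (x : V) : R := \sum_q hh q * \int[leb]_(y in D `\` U) (K x y * e q.1 q.2 y).
Definition shadow_part (x : V) : R :=
  \sum_q hh q * (\int[Ep q.1 q.2]_(y in D `&` U) K x y - \int[Em q.1 q.2]_(y in D `&` U) K x y).

(** Off U the strain has density e on every measurable set, and [transfer] extends this to integrals
    of the kernel. The rest of the strain measure is carried by U. *)
Lemma strain_pairing_split x : strain_pairing x = absolute_part x + shadow_part x.
Proof.
have mA : measurable (D `\` U) by exact: measurableD.
have mB : measurable (D `&` U) by exact: measurableI.
have DE : D = (D `\` U) `|` (D `&` U) by rewrite setUC setUIDK.
have dis : [disjoint D `\` U & D `&` U].
  by apply/disj_set2P; rewrite setIC; apply/seteqP; split => // y [[_ Uy] [_ nU]].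
rewrite /absolute_part /shadow_part -big_split/=; apply: eq_bigr => q _; rewrite -mulrDr; congr (_ * _).
have sp (nu : {finite_measure set V -> \bar R}) :
    \int[nu]_(y in D) K x y = \int[nu]_(y in D `\` U) K x y + \int[nu]_(y in D `&` U) K x y.
  by rewrite {1}DE Rintegral_setU// -DE; exact: finite_kern.
have k0 := kern0_gt0 n N c0 dl0.
have tr := @transfer _ _ _ (Ep q.1 q.2) (Em q.1 q.2) leb (D `\` U) (e q.1 q.2) (K x) (kern0 n c dl N * N.+1%:R) mA
  (integrableS mD mA (@subDsetl _ _ _) (ie q.1 q.2)) (measurable_kern _ _ _ _ _) (kern_ge0 N h c0 dl0 x) (kern_le N h c0 dl0 x) (@hsing q.1 q.2).
by rewrite -tr !sp; ring.
Qed.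

Lemma absolute_part_le x :
  ((absolute_part x ^+ 2)%:E <= (L ^+ 4)%:E * \int[leb]_y (strain_sqr y * K x y)%:E)%E.
Proof.
have mA : measurable (D `\` U) by exact: measurableD.
pose F (y : V) : R := \sum_q hh q * e q.1 q.2 y.
have k0 := kern0_gt0 n N c0 dl0.
have mK := measurable_kern c dl N h x.
have K0 : 0 <= kern0 n c dl N * N.+1%:R by rewrite mulr_ge0// ltW.
have KS (y : V) (t : R) : `|K x y * t| <= `|kern0 n c dl N * N.+1%:R * t|.
  rewrite normrM [leRHS]normrM (ger0_norm K0); apply: ler_wpM2r => //; exact: kern_norm.
have iK q : leb.-integrable (D `\` U) (EFin \o (fun y => hh q * (K x y * e q.1 q.2 y))).
  have i0 := integrableS mD mA (@subDsetl _ _ _) (ie q.1 q.2).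
  apply: (integrableZl mA (hh q) (f := EFin \o (fun y => K x y * e q.1 q.2 y))).
  apply: le_integrable (integrableZl mA (kern0 n c dl N * N.+1%:R) i0) => //.
  - by apply/measurable_EFinP; apply: measurable_funTS; apply: measurable_funM.
  - move=> y _; rewrite /= lee_fin; exact: KS.
have E : absolute_part x = \int[leb]_(y in D `\` U) (K x y * F y).
  transitivity (\sum_q \int[leb]_(y in D `\` U) (hh q * (K x y * e q.1 q.2 y))).
    apply: eq_bigr => q _; rewrite RintegralZl//.
    have i0 := integrableS mD mA (@subDsetl _ _ _) (ie q.1 q.2).
    apply: le_integrable (integrableZl mA (kern0 n c dl N * N.+1%:R) i0) => //.
    - by apply/measurable_EFinP; apply: measurable_funTS; apply: measurable_funM.
    - move=> y _; rewrite /= lee_fin; exact: KS.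
  rewrite -(Rint_sum _ mA iK).2; apply: eq_Rintegral => y _.
  by rewrite /F mulr_sumr; apply: eq_bigr => q _; ring.
have mF : mfunT F by apply: measurable_sum => q; apply: measurable_funM.
have iF : leb.-integrable (D `\` U) (EFin \o (fun y => K x y * F y)).
  have [i1 _] := Rint_sum (index_enum ('I_n * 'I_n)%type) mA iK; move: i1; congr (_.-integrable _ _).
  by apply/funext => y /=; congr (_%:E); rewrite /F mulr_sumr; apply: eq_bigr => q _; ring.
rewrite E; apply: le_trans (kern_jensen hc c0 dl0 mA mF iF) _.
have mS := measurable_strain_sqr.
rewrite -rintZl; first last.
- by move=> y; rewrite mulr_ge0 ?strain_sqr_ge0// kern_ge0.
- exact: measurable_funM.
- exact: exprn_ge0 (enorm_ge0 _).
apply: le_rint => y; first by rewrite mulr_ge0 ?sqr_ge0// kern_ge0.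
by rewrite [leRHS]mulrA; apply: ler_wpM2r; [exact: kern_ge0|exact: (strain_form_sqr h (fun i j => e i j y))].
Qed.

(** Meant for x outside the shadow of U, where Z is the rim of U: all nodes are then outside U, and
    the kernel sees only points of U close to its complement. No bound on the singular strain is
    used beyond the smallness of the measure of the rim. *)
Lemma shadow_part_le (Z : set V) x : measurable Z -> Z `<=` D `&` U ->
  (forall y, D y -> U y -> ~ Z y -> K x y = 0) ->
  ((`|shadow_part x|)%:E <= (L ^+ 2)%:E * \sum_(q : 'I_n * 'I_n)
    (\int[Ep q.1 q.2]_y (\1_Z y * K x y)%:E + \int[Em q.1 q.2]_y (\1_Z y * K x y)%:E))%E.
Proof.
move=> mZ ZDU hZ; have mB : measurable (D `&` U) by exact: measurableI.
have E (nu : {finite_measure set V -> \bar R}) :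
    (\int[nu]_y (\1_Z y * K x y)%:E = (\int[nu]_(y in D `&` U) K x y)%:E)%E.
  rewrite /Rintegral fineK; last exact: integrable_fin_num (finite_kern nu x mB).
  rewrite [RHS]integral_mkcond; apply: eq_integral => y _; rewrite patchE indicE /=.
  case: ifPn => [/set_mem[Dy Uy]|/negP nDU].
    have [Zy|nZ] := pselect (Z y); first by rewrite mem_set// mul1r.
    by rewrite (hZ y)// mulr0.
  by rewrite memNset ?mul0r// => /ZDU DUy; apply: nDU; exact: mem_set.
have P0 (nu : {finite_measure set V -> \bar R}) : 0 <= \int[nu]_(y in D `&` U) K x y.
  by apply: Rintegral_ge0 => y _; exact: kern_ge0.
rewrite (eq_bigr (fun q : 'I_n * 'I_n => (\int[Ep q.1 q.2]_(y in D `&` U) K x y + \int[Em q.1 q.2]_(y in D `&` U) K x y)%:E)); last first.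
  by move=> q _; rewrite !E.
rewrite sumEFin -EFinM lee_fin; apply: le_trans (ler_norm_sum _ _ _) _.
rewrite mulr_sumr; apply: ler_sum => q _; rewrite normrM; apply: ler_pM => //; first exact: hh_le.
by apply: le_trans (ler_normB _ _) _; rewrite !ger0_norm.
Qed.

End direction.
End sbd_increments.

Lemma eball_open (R : realType) n (z : 'rV[R]_n) r : open (eball z r).
Proof.
have cf : continuous (fun y : 'rV[R]_n => enorm (y - z)).
  apply: (@lipschitz_continuous_rV _ _ _ 1) => x y; rewrite mul1r.
  by apply: le_trans (enorm_lipschitz _ _) _; rewrite opprB addrA subrK.
have -> : eball z r = (fun y : 'rV[R]_n => enorm (y - z)) @^-1` `]-oo, r[%classic.
  by apply/seteqP; split => y; rewrite /eball /= in_itv.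
by apply: open_comp => [y _|]; [exact: cf|exact: interval_open].
Qed.

(* The part of U within distance 1/(k+1) of its complement is eventually negligible. *)
Definition rim (R : realType) n (U : set 'rV[R]_n) (k : nat) : set 'rV[R]_n :=
  \bigcup_(z in ~` U) eball z k.+1%:R^-1.

Lemma measurable_rim (R : realType) n (U : set 'rV[R]_n) k : measurable (rim U k).
Proof. by apply: open_measurable_rV; apply: bigcup_open => z _; exact: eball_open. Qed.

Lemma rim_shrink (R : realType) n (U D : set 'rV[R]_n) (s : R) (Q : finType)
    (nu : Q -> {finite_measure set 'rV[R]_n -> \bar R}) : open U -> measurable D -> 0 < s ->
  exists k0, forall k, (k0 <= k)%N -> forall i, (nu i (D `&` U `&` rim U k) <= s%:E)%E.
Proof.
move=> oU mD s0; have mQ : measurable (D `&` U) by apply: measurableI => //; exact: open_measurable_rV.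
have mono k k' : (k <= k')%N -> rim U k' `<=` rim U k.
  move=> kk y [z Uz]; rewrite /eball/= => yz; exists z => //; rewrite /eball/=.
  by apply: lt_le_trans yz _; rewrite lef_pV2 ?posrE ?ltr0n// ler_nat ltnS.
have H i : exists k, (nu i (D `&` U `&` rim U k) <= s%:E)%E.
  have hE : \bigcap_k (U `&` rim U k) = set0.
    rewrite -subset0 => y hy; have [Uy _] := hy 0%N I.
    have /nbhs_ballP[m /= m0 hm] : nbhs y U by exact: open_nbhs_nbhs.
    have p0 : 0 <= m^-1 by rewrite invr_ge0 ltW.
    have /andP[_ t2] := truncn_itv p0; set k := Num.trunc m^-1 in t2.
    have [_ [z nU]] := hy k I; rewrite /eball/= => yz; apply: nU; apply: hm.
    rewrite -ball_normE/=; apply: le_lt_trans (ler_norm_enorm _) _; apply: lt_le_trans yz _.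
    by rewrite invf_ple ?posrE ?ltr0n//; exact: ltW.
  have [k hk] := @measure_shrink _ _ _ (nu i) (D `&` U) (fun k => U `&` rim U k) s mQ
    ltac:(by rewrite -ge0_fin_numE// fin_num_measure)
    ltac:(by move=> k; apply: measurableI; [exact: open_measurable_rV|exact: measurable_rim])
    ltac:(by move=> k y [Uy ry]; split => //; exact: mono ry) hE s0.
  by exists k; rewrite setIA -(setIA D U U) setIid in hk.
have [k hk] := choice H.
exists (\sum_i k i)%N => k' kk' i; apply: le_trans (hk i); apply: le_measure; rewrite ?inE.
- by apply: measurableI => //; exact: measurable_rim.
- by apply: measurableI => //; exact: measurable_rim.
apply: setIS; apply: mono; apply: leq_trans kk'; by rewrite (bigD1 i)//= leq_addr.
Qed.

Section bounded_integral.
Context (d : measure_display) (T : measurableType d) (R : realType) (mu : {measure set T -> \bar R}).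
Implicit Types (F G : T -> \bar R) (p q : R).

(** Keeps measurability, sign and bound together, so that a sum of many error terms can be
    integrated at once. *)
Definition bdd F p := [/\ mfunT F, forall x, (0 <= F x)%E & (\int[mu]_x F x <= p%:E)%E].

Lemma bddD F G p q : bdd F p -> bdd G q -> bdd (fun x => F x + G x)%E (p + q).
Proof.
move=> [mF F0 Fp] [mG G0 Gq]; split; first exact: emeasurable_funD.
  by move=> x; exact: adde_ge0.
by rewrite ge0_integralD// EFinD leeD.
Qed.

Lemma bddZ (k : R) F p : 0 <= k -> bdd F p -> bdd (fun x => k%:E * F x)%E (k * p).
Proof.
move=> k0 [mF F0 Fp]; split; first exact: measurable_funeM.
  by move=> x; apply: mule_ge0.
by rewrite ge0_integralZl// EFinM lee_wpmul2l.
Qed.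

Lemma bdd_sum (I : Type) (s : seq I) (F : I -> T -> \bar R) (p : I -> R) :
  (forall i, bdd (F i) (p i)) -> bdd (fun x => \sum_(i <- s) F i x)%E (\sum_(i <- s) p i).
Proof.
move=> h; elim: s => [|i s IH].
  rewrite big_nil (_ : (fun x => _) = cst 0%E); last by apply/funext => x; rewrite big_nil.
  by split => //; rewrite integral0.
rewrite big_cons (_ : (fun x => _) = (fun x => F i x + \sum_(j <- s) F j x)%E); last first.
  by apply/funext => x; rewrite big_cons.
exact: bddD.
Qed.

Lemma bdd_indic (A : set T) (k p : R) : 0 <= k -> measurable A -> (mu A <= p%:E)%E ->
  bdd (fun x => (k * \1_A x)%:E) (k * p).
Proof.
move=> k0 mA Ap; have mI : mfunT (\1_A : T -> R) by exact: measurable_indic.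
split; first by apply/measurable_EFinP; apply: measurable_funM.
  by move=> x; rewrite lee_fin mulr_ge0// indic_ge0.
rewrite rintZl//.
by rewrite rint_indic// EFinM lee_wpmul2l.
Qed.

Lemma Rint_abs_leE (F : T -> R) : mu.-integrable setT (EFin \o F) ->
  ((`|\int[mu]_x F x|)%:E <= \int[mu]_x (`|F x|)%:E)%E.
Proof.
move=> iF; rewrite -[X in (X <= _)%E]/(`|(\int[mu]_x F x)%:E|)%E /Rintegral fineK; last exact: integrable_fin_num iF.
exact: le_abse_integral (measurable_int _ iF).
Qed.

End bounded_integral.

(** The main part A is known in L^2, the error b only in L^1, hence a bound quadratic in A and
    linear in b. The slope f'(0) serves when |b| <= |A|, and when |A| < |b| < 1 because then b^2 <=
    |b|; the bound f_oo serves when |b| >= 1. *)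
Lemma pot_split (R : realType) (f f1 : R -> R) (fp0 finf : R) (A b L3 : R) : pot_ok f f1 fp0 finf -> 0 < L3 ->
  f ((A + b) ^+ 2 / L3) <= 4 * fp0 / L3 * A ^+ 2 + (finf + 4 * fp0 / L3) * `|b|.
Proof.
move=> hp l0; have p0 := pok_fp0 hp; have q0 := pok_finf hp.
have li : 0 <= L3^-1 by rewrite invr_ge0 ltW.
have k0 : 0 <= 4 * fp0 / L3 by rewrite !mulr_ge0// ltW.
have a0 : 0 <= (A + b) ^+ 2 / L3 by rewrite mulr_ge0 ?sqr_ge0.
have f0 := pok_lin hp a0; have /andP[_ f2] := pok_f hp a0.
have bb : 0 <= `|b| by []. have A2 : 0 <= A ^+ 2 by exact: sqr_ge0.
have t1 : 0 <= finf * `|b| by rewrite mulr_ge0// ltW.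
have t2 : 0 <= 4 * fp0 / L3 * `|b| by rewrite mulr_ge0.
have t3 : 0 <= 4 * fp0 / L3 * A ^+ 2 by rewrite mulr_ge0.
rewrite mulrDl.
have [ba|ab] := leP `|b| `|A|.
  have : (A + b) ^+ 2 <= 4 * A ^+ 2.
    rewrite -[(A + b) ^+ 2]real_normK ?num_real// -[A ^+ 2]real_normK ?num_real//.
    have -> : 4 * `|A| ^+ 2 = (2 * `|A|) ^+ 2 by ring.
    rewrite lerXn2r ?nnegrE ?mulr_ge0//.
    apply: le_trans (ler_normD _ _) _; lra.
  move=> /(ler_wpM2l k0) h.
  have e1 : 4 * (fp0 * ((A + b) ^+ 2 / L3)) = 4 * fp0 / L3 * (A + b) ^+ 2 by ring.
  have e2 : 4 * fp0 / L3 * (4 * A ^+ 2) = 4 * (4 * fp0 / L3 * A ^+ 2) by ring.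
  lra.
have [b1|b1] := leP 1 `|b|.
  have : finf * 1 <= finf * `|b| by rewrite ler_wpM2l// ltW.
  lra.
have : (A + b) ^+ 2 <= 4 * `|b|.
  rewrite -[(A + b) ^+ 2]real_normK ?num_real//.
  apply: (@le_trans _ _ ((2 * `|b|) ^+ 2)).
    rewrite lerXn2r ?nnegrE ?mulr_ge0//.
    by apply: le_trans (ler_normD _ _) _; lra.
  have : `|b| * `|b| <= `|b| * 1 by apply: ler_wpM2l => //; exact: ltW.
  have -> : (2 * `|b|) ^+ 2 = 4 * (`|b| * `|b|) by ring.
  lra.
move=> /(ler_wpM2l k0) h.
have e1 : 4 * (fp0 * ((A + b) ^+ 2 / L3)) = 4 * fp0 / L3 * (A + b) ^+ 2 by ring.
have e2 : 4 * fp0 / L3 * (4 * `|b|) = 4 * (4 * fp0 / L3 * `|b|) by ring.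
lra.
Qed.

Lemma smear_error (R : realType) n (c dl W : R) (D : set 'rV[R]_n) (w : 'rV[R]_n -> R) (p : 'rV[R]_n) :
  (\int[lebesgue_rV R n]_z (bump z : R)%:E = c%:E)%E -> 0 < c -> 0 < dl -> measurable D ->
  mfunT w -> (forall y, `|w y| <= W) -> (forall y, ~ D y -> w y = 0) ->
  ((`|w p - (dl ^+ n * c)^-1 * smear D w dl p|)%:E <=
   ((dl ^+ n * c)^-1)%:E * \int[lebesgue_rV R n]_y (`|w y - w p| * moll dl p y)%:E)%E.
Proof.
move=> hc c0 dl0 mD mw wW wD; set leb := lebesgue_rV R n; set k := (dl ^+ n * c)^-1.
have dc : 0 < dl ^+ n * c by rewrite mulr_gt0 ?exprn_gt0.
have k0 : 0 <= k by rewrite invr_ge0 ltW.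
have mm := measurable_moll dl p.
have mass := moll_mass hc p dl0.
have im : leb.-integrable setT (EFin \o moll dl p).
  apply/integrableP; split; first exact/measurable_EFinP.
  under eq_integral do rewrite /= ger0_norm ?moll_ge0//.
  by rewrite mass ltry.
have W0 : 0 <= W by exact: le_trans (normr_ge0 _) (wW 0).
have iw : leb.-integrable setT (EFin \o (fun y => w y * moll dl p y)).
  apply: le_integrable (integrableZl measurableT W im) => //.
    by apply/measurable_EFinP; apply: measurable_funM.
  move=> y _; rewrite /= lee_fin normrM [leRHS]normrM (ger0_norm W0); apply: ler_wpM2r => //.
have sE : smear D w dl p = \int[leb]_y (w y * moll dl p y).
  rewrite /smear /Rintegral integral_mkcond; congr fine; apply: eq_integral => y _.
  rewrite patchE; case: ifPn => // /negP nD; rewrite wD ?mul0r// => Dy; apply: nD; exact: mem_set.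
have wE : w p * (dl ^+ n * c) = \int[leb]_y (w p * moll dl p y).
  by rewrite RintegralZl//; congr (_ * _); rewrite /Rintegral mass.
have ip : leb.-integrable setT (EFin \o (fun y => w p * moll dl p y)) by exact: (integrableZl measurableT (w p) im).
have -> : w p - k * smear D w dl p = k * \int[leb]_y (w p * moll dl p y - w y * moll dl p y).
  have e1 := RintegralB measurableT ip iw; rewrite /= in e1; rewrite e1 -wE -sE mulrBr; congr (_ - _).
  by rewrite mulrCA /k mulVf ?mulr1// gt_eqF.
rewrite normrM (ger0_norm k0) EFinM; apply: lee_wpmul2l; first by rewrite lee_fin.
have iB := integrableB measurableT ip iw.
apply: le_trans (Rint_abs_leE iB) _; apply: le_rint => y //.
by rewrite /= -mulrBl normrM distrC (ger0_norm (moll_ge0 _ _ _)).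
Qed.

Section increments_integral.
Context (R : realType) (n : nat).
Local Notation V := 'rV[R]_n.
Local Notation leb := (lebesgue_rV R n).
Variables (c : R) (D Ds U B : set V) (u : V -> V) (M l r a CB Eb : R)
  (Ep Em : 'I_n -> 'I_n -> {finite_measure set V -> \bar R}) (e : 'I_n -> 'I_n -> V -> R).
Variables (f f1 : R -> R) (fp0 finf : R) (h : V).
Hypothesis hp : pot_ok f f1 fp0 finf.
Hypotheses (hc : (\int[leb]_z (bump z : R)%:E = c%:E)%E) (c0 : 0 < c).
Hypotheses (mD : measurable D) (hl : leb D = l%:E) (oU : open U).
Hypotheses (mu : mfunT u) (uM : forall x, enorm (u x) <= M).
Hypotheses (uDs : forall x, ~ Ds x -> u x = 0) (DsD : forall x y, Ds x -> enorm (y - x) <= a -> D y).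
Hypotheses (r0 : 0 <= r) (Dr : D `<=` rV_box 0 r).
Hypothesis hst : forall i j phi, C1c D phi ->
    \int[Ep i j]_(x in D) phi x - \int[Em i j]_(x in D) phi x =
    - 2^-1 * \int[leb]_(x in D)
      (u x ord0 i * 'D_(delta_mx ord0 j) phi x + u x ord0 j * 'D_(delta_mx ord0 i) phi x).
Hypothesis me : forall i j, mfunT (e i j).
Hypothesis ie : forall i j, leb.-integrable D (EFin \o e i j).
Hypothesis hsing : forall i j A, measurable A -> A `<=` D `\` U ->
  fine (Ep i j A) - fine (Em i j A) = \int[leb]_(x in A) e i j x.
Hypothesis hE : (\int[leb]_y (strain_sqr e y)%:E <= Eb%:E)%E.
Hypotheses (mB : measurable B).
Hypothesis hUB : forall (x : V) (s : R), 0 <= s <= 1 -> U (x + s *: h) -> B x.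

(** On B the potential is at most f_oo, which gives [T1]. Off B the increment is A + b with A the
    average of the density e, giving [T2], and b the sum of the mollification errors at x + h and x
    ([T3], [T4]), the Taylor error of the telescoping ([T5]) and the strain of the rim of U ([T6]).
    The last four contribute at most |h|/4 each: this is the 1 in the constant. *)
Lemma increments_bound : (leb B <= (CB * enorm h)%:E)%E -> 0 < enorm h -> enorm h < a ->
  (\int[leb]_x (f (dot (u (x + h) - u x) h ^+ 2 / enorm h ^+ 3))%:E <=
   ((finf * CB + 4 * fp0 * Eb + 1) * enorm h)%:E)%E.
Proof.
set L := enorm h => hB h0 ha.
have p0 := pok_fp0 hp; have q0 := pok_finf hp.
have a0 : 0 < a by exact: lt_trans ha.
have M0 : 0 <= M by exact: le_trans (enorm_ge0 _) (uM 0).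
have l0 : 0 <= l by rewrite -lee_fin -hl.
have hl' : (leb D <= l%:E)%E by rewrite hl.
pose w := wh u h.
have mw : mfunT w by exact: measurable_wh.
have wW y : `|w y| <= M * L by exact: wh_le.
have DsD0 x : Ds x -> D x by move=> /DsD; apply; rewrite subrr enorm0 ltW.
have wD y : ~ D y -> w y = 0 by move=> nD; rewrite /w /wh uDs ?dot0l// => /DsD0.
have wr y : ~ rV_box 0 r y -> w y = 0 by move=> nr; apply: wD => /Dr.
have L3 : 0 < L ^+ 3 by rewrite exprn_gt0.
pose al : R := 4 * fp0 / L ^+ 3; pose be : R := finf + al.
have al0 : 0 < al by rewrite !mulr_gt0// invr_gt0.
have be0 : 0 < be by rewrite addr_gt0.
(* Each error integral is multiplied by [be] in [pot_split], so the target for each of them is L /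
   (4 be). *)
pose ga : R := L / (4 * be).
have ga0 : 0 < ga by rewrite divr_gt0// mulr_gt0.
have [d1 d10 hd1] := moll_error hc mw wW wr r0 ga0.
pose nq : R := #|{: 'I_n * 'I_n}|%:R.
have nq0 : 0 <= nq by exact: ler0n.
pose s : R := ga / (L ^+ 2 * (2 * nq + 1)).
have L2 : 0 < L ^+ 2 by rewrite exprn_gt0.
have s0 : 0 < s by rewrite divr_gt0// mulr_gt0// ltr_wpDl// mulr_ge0.
have [k1 hk1] := rim_shrink (fun q : 'I_n * 'I_n => Ep q.1 q.2) oU mD s0.
have [k2 hk2] := rim_shrink (fun q : 'I_n * 'I_n => Em q.1 q.2) oU mD s0.
pose k := maxn k1 k2.
have kk1 : (k1 <= k)%N by exact: leq_maxl.
have kk2 : (k2 <= k)%N by exact: leq_maxr.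
(* Three constraints on the radius of the bumps: below d1 the mollification error is small, below a
   - |h| the bumps along the segment stay in D, and below 1/(k+1) a bump centred outside U meets U
   only in its rim. *)
pose dl : R := Num.min (Num.min d1 (a - L)) (k.+1%:R^-1).
have dl0 : 0 < dl by rewrite !lt_min d10 subr_gt0 ha invr_gt0 ltr0n.
have [[dld1 dla] dlk] : (dl <= d1 /\ dl <= a - L) /\ dl <= k.+1%:R^-1.
  by rewrite /dl !ge_min !lexx !orbT.
pose kap : R := (dl ^+ n * c)^-1.
have dc0 : 0 < dl ^+ n * c by rewrite mulr_gt0 ?exprn_gt0.
have kap0 : 0 <= kap by rewrite invr_ge0 ltW.
pose X : R := kap * (27 * (L / dl) ^+ 2 * (M * L * l)).
have X0 : 0 <= X.
  by apply: mulr_ge0 => //; rewrite !mulr_ge0// ?exprn_ge0// ?invr_ge0 ?ltW.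
(* The first term makes the spacing of the nodes at most dl, the second makes the Taylor error,
   integrated over D, at most [ga]. *)
pose Y : R := L / dl + X * l / ga.
have y1 : 0 <= L / dl by rewrite divr_ge0// ltW.
have y2 : 0 <= X * l / ga by exact: (divr_ge0 (mulr_ge0 X0 l0) (ltW ga0)).
have Y0 : 0 <= Y by exact: (addr_ge0 y1 y2).
have /andP[_ YN] := truncn_itv Y0; set N := Num.trunc Y in YN.
have N0 : 0 < N.+1%:R :> R by rewrite ltr0n.
have hN : L <= N.+1%:R * dl.
  by rewrite -ler_pdivrMr//; apply: le_trans (ltW YN); rewrite lerDl.
pose err : R := kap * (27 * (L / dl) ^+ 2 * (M * L * l) / N.+1%:R).
have errE : err = X / N.+1%:R by rewrite /err /X mulrA.
have err0 : 0 <= err by rewrite errE; exact: (divr_ge0 X0 (ltW N0)).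
have errl : err * l <= ga.
  rewrite errE mulrAC ler_pdivrMr// [ga * _]mulrC -ler_pdivrMr//.
  by apply: le_trans (ltW YN); rewrite lerDr.
pose Z := D `&` U `&` rim U k.
have mZ : measurable Z.
  by apply: measurableI; [apply: measurableI => //; exact: open_measurable_rV|exact: measurable_rim].
pose K := kern c dl N h.
pose Q (v x : V) : \bar R := (\int[leb]_y (`|w y - w (x + v)| * moll dl (x + v) y)%:E)%E.
pose T1 (x : V) : \bar R := (finf * \1_B x)%:E.
pose T2 (x : V) : \bar R := ((al * L ^+ 4)%:E * \int[leb]_y (strain_sqr e y * K x y)%:E)%E.
pose T3 (x : V) : \bar R := ((be * kap)%:E * Q h x)%E.
pose T4 (x : V) : \bar R := ((be * kap)%:E * Q (0 : V)%R x)%E.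
pose T5 (x : V) : \bar R := (be * err * \1_D x)%:E.
pose G (q : 'I_n * 'I_n) (x : V) : \bar R :=
  (\int[Ep q.1 q.2]_y (\1_Z y * K x y)%:E + \int[Em q.1 q.2]_y (\1_Z y * K x y)%:E)%E.
pose T6 (x : V) : \bar R := ((be * L ^+ 2)%:E * \sum_(q : 'I_n * 'I_n) G q x)%E.
have b1 : bdd leb T1 (finf * (CB * L)) by apply: bdd_indic => //; exact: ltW.
have b2 : bdd leb T2 (al * L ^+ 4 * Eb).
  apply: bddZ; first exact: (mulr_ge0 (ltW al0) (exprn_ge0 4 (ltW h0))).
  have mS := measurable_strain_sqr me.
  have S0 := strain_sqr_ge0 e.
  split; first by apply: measurable_kern_int.
    by move=> x; apply: rint_ge0 => y; rewrite mulr_ge0 ?strain_sqr_ge0// (kern_ge0 N h c0 dl0).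
  have -> : (\int[leb]_x \int[leb]_y (strain_sqr e y * K x y)%:E = \int[leb]_y (strain_sqr e y)%:E)%E.
    by apply: kern_tonelli.
  exact: hE.
have bQ v : bdd leb (Q v) (dl ^+ n * c * ga).
  have [m1 m2] := hd1 dl dl0 dld1 v; split => // x.
  by apply: rint_ge0 => y; rewrite mulr_ge0// moll_ge0.
have bk0 : 0 <= be * kap by exact: (mulr_ge0 (ltW be0) kap0).
have b3 : bdd leb T3 (be * kap * (dl ^+ n * c * ga)) by exact: bddZ.
have b4 : bdd leb T4 (be * kap * (dl ^+ n * c * ga)) by exact: bddZ.
have b5 : bdd leb T5 (be * err * l) by apply: bdd_indic; [exact: (mulr_ge0 (ltW be0) err0)|exact: mD|exact: hl'].
have bnu (nu : {finite_measure set V -> \bar R}) : (nu Z <= s%:E)%E -> bdd leb (fun x : V => \int[nu]_y (\1_Z y * K x y)%:E)%E s.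
  move=> nuZ; have mI : mfunT (\1_Z : V -> R) by exact: measurable_indic.
  have I0 (y : V) : 0 <= \1_Z y :> R by exact: indic_ge0.
  split; first by apply: measurable_kern_int.
    by move=> x; apply: integral_ge0 => y _; rewrite lee_fin mulr_ge0// (kern_ge0 N h c0 dl0).
  have -> : (\int[leb]_x \int[nu]_y (\1_Z y * K x y)%:E = \int[nu]_y (\1_Z y)%:E)%E by apply: kern_tonelli.
  by rewrite rint_indic.
have b6 : bdd leb T6 (be * L ^+ 2 * \sum_(q : 'I_n * 'I_n) (s + s)).
  apply: bddZ; first exact: (mulr_ge0 (ltW be0) (ltW L2)).
  by apply: bdd_sum => q; apply: bddD; apply: bnu; [exact: hk1|exact: hk2].
have [_ _ tot] := bddD b1 (bddD b2 (bddD b3 (bddD b4 (bddD b5 b6)))).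
have [[_ T10 _] [_ T20 _]] := (b1, b2); have [[_ T30 _] [_ T40 _]] := (b3, b4).
have [[_ T50 _] [_ T60 _]] := (b5, b6).
have rest0 x : (0 <= T2 x + (T3 x + (T4 x + (T5 x + T6 x))))%E by exact: adde_ge0 (T20 x) (adde_ge0 (T30 x) (adde_ge0 (T40 x) (adde_ge0 (T50 x) (T60 x)))).
have arg0 (x : V) : 0 <= dot (u (x + h) - u x) h ^+ 2 / L ^+ 3 by rewrite mulr_ge0 ?sqr_ge0// invr_ge0 ltW.
apply: (@le_trans _ _ (\int[leb]_x (T1 x + (T2 x + (T3 x + (T4 x + (T5 x + T6 x))))))%E); last first.
  apply: le_trans tot _; rewrite lee_fin.
  have e2 : al * L ^+ 4 * Eb = 4 * fp0 * Eb * L by rewrite /al; field; rewrite gt_eqF.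
  have e3 : be * kap * (dl ^+ n * c * ga) = L / 4.
    rewrite (_ : _ * _ = be * ga * (kap * (dl ^+ n * c))); last by ring.
    by rewrite /kap mulVf ?gt_eqF// mulr1 /ga; field; rewrite gt_eqF.
  have bg : be * ga = L / 4 by rewrite /ga; field; rewrite gt_eqF.
  have e5 : be * err * l <= L / 4 by rewrite -mulrA -bg; apply: ler_wpM2l => //; exact: ltW.
  have e6 : be * L ^+ 2 * \sum_(q : 'I_n * 'I_n) (s + s) <= L / 4.
    rewrite -bg -mulrA; apply: ler_wpM2l; first exact: ltW.
    rewrite sumr_const -mulr_natl -/nq.
    have g1 : s * (L ^+ 2 * (2 * nq + 1)) = ga.
      by rewrite /s mulfVK// gt_eqF// mulr_gt0// ltr_wpDl// mulr_ge0.
    have g2 : L ^+ 2 * (nq * (s + s)) = ga - s * L ^+ 2 by rewrite -g1; ring.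
    have g3 : 0 <= s * L ^+ 2 by rewrite mulr_ge0// ltW.
    by rewrite g2; lra.
  rewrite e2 e3; have -> : (finf * CB + 4 * fp0 * Eb + 1) * L = finf * (CB * L) + 4 * fp0 * Eb * L + L by ring.
  lra.
apply: ge0_le_integralT => x.
  by rewrite lee_fin; have /andP[] := pok_f hp (arg0 x).
have [Bx|nB] := pselect (B x).
  apply: (@le_trans _ _ (T1 x)); last exact: leeDl.
  rewrite /T1 indicE mem_set// mulr1 lee_fin.
  by have /andP[] := pok_f hp (arg0 x).
apply: (@le_trans _ _ (T2 x + (T3 x + (T4 x + (T5 x + T6 x))))%E); last by apply: leeDr; exact: T10.
(* If neither end lies in Ds the increment is 0. Otherwise the segment, thickened by dl, is within
   distance a of that end and hence in D. *)
have [Dsx|nDs] := pselect (Ds x \/ Ds (x + h)); last first.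
  rewrite uDs; last by move=> H; apply: nDs; right.
  rewrite uDs; last by move=> H; apply: nDs; left.
  by rewrite subr0 dot0l expr0n/= mul0r (pok_f0 hp).
have hD m : (m <= N)%N -> forall y, enorm (y - node N h x m) <= dl -> D y.
  move=> mN y hy.
  have m1 : 0 <= (m%:R / N.+1%:R : R) <= 1.
    by rewrite divr_ge0//= ler_pdivrMr// mul1r ler_nat leqW.
  move/andP: m1 => [m10 m11].
  case: Dsx => Dsx; apply: (DsD Dsx).
    have -> : y - x = (y - node N h x m) + (m%:R / N.+1%:R) *: h.
      by rewrite /node opprD addrA addrNK.
    apply: le_trans (ler_enormD _ _) _; rewrite enormZ (ger0_norm m10).
    have : m%:R / N.+1%:R * L <= 1 * L by apply: ler_wpM2r => //; exact: ltW.
    by rewrite mul1r => hm; apply: le_trans (lerD hy hm) _; rewrite -lerBrDr.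
  have -> : y - (x + h) = (y - node N h x m) + (m%:R / N.+1%:R - 1) *: h.
    by rewrite /node scalerBl scale1r !opprD !addrA addrNK.
  apply: le_trans (ler_enormD _ _) _; rewrite enormZ ler0_norm ?subr_le0//.
  have : - (m%:R / N.+1%:R - 1) * L <= 1 * L by apply: ler_wpM2r; [exact: ltW|by rewrite opprB lerBlDr lerDl].
  by rewrite mul1r => hm; apply: le_trans (lerD hy hm) _; rewrite -lerBrDr.
have Dx : D x.
  by apply: (hD 0%N) => //; rewrite /node mul0r scale0r addr0 subrr enorm0 ltW.
have mU := open_measurable_rV oU.
have := smear_strain c0 mD hl mu uM hst h0 dl0 hN hD.
rewrite (strain_pairing_split c0 mD mU ie hsing h N dl0) -/err -/kap -/w.
set A := absolute_part _ _ _ _ _ _ _ _; set S := shadow_part _ _ _ _ _ _ _ _ _ => hS.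
have hA : ((A ^+ 2)%:E <= (L ^+ 4)%:E * \int[leb]_y (strain_sqr e y * K x y)%:E)%E.
  by apply: absolute_part_le.
have hSh : ((`|S|)%:E <= (L ^+ 2)%:E * \sum_(q : 'I_n * 'I_n) G q x)%E.
  apply: shadow_part_le => //; first by move=> y [].
  move=> y Dy Uy nZ; apply: (kern_out _ dl0) => m mN.
  rewrite leNgt; apply/negP => lt; apply: nZ; split; first by split.
  exists (node N h x m); last by rewrite /eball/=; exact: lt_le_trans lt dlk.
  move=> Un; apply: nB; apply: (hUB (s := m%:R / N.+1%:R)) => //.
  by rewrite divr_ge0//= ler_pdivrMr// mul1r ler_nat leqW.
have s1 := smear_error (x + h) hc c0 dl0 mD mw wW wD.
have s2 := smear_error (x + 0) hc c0 dl0 mD mw wW wD.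
rewrite -/kap in s1; rewrite -/kap in s2.
rewrite {1 2}addr0 in s2.
set a1 := `|w (x + h) - _| in s1; set a2 := `|w x - _| in s2.
pose b := dot (u (x + h) - u x) h - A.
have bE : `|b| <= a1 + (a2 + (err + `|S|)).
  have -> : b = (w (x + h) - kap * smear D w dl (x + h)) - (w x - kap * smear D w dl x) +
     ((kap * (smear D w dl (x + h) - smear D w dl x) - (A + S)) + S).
    have -> : b = w (x + h) - w x - A by rewrite /b dotBl.
    move: (w (x + h)) (w x) (smear D w dl (x + h)) (smear D w dl x) => p1 p2 p3 p4; clear; ring.
  apply: le_trans (ler_normD _ _) _; rewrite addrA; apply: lerD; first exact: ler_normB.
  by apply: le_trans (ler_normD _ _) _; apply: lerD.
have gE : dot (u (x + h) - u x) h = A + b by rewrite /b [RHS]addrCA subrr addr0.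
apply: (@le_trans _ _ ((al * A ^+ 2 + (be * a1 + (be * a2 + (be * err + be * `|S|))))%:E)).
  rewrite lee_fin gE; apply: le_trans (pot_split A b hp L3) _; rewrite -/al -/be lerD2l.
  by have := ler_wpM2l (ltW be0) bE; rewrite (mulrDr be a1) (mulrDr be a2) (mulrDr be err).
have be00 := ltW be0; have al00 := ltW al0.
rewrite !EFinD; apply: leeD.
  by rewrite /T2 (EFinM al (A ^+ 2)) (EFinM al (L ^+ 4)) -muleA; apply: lee_wpmul2l; [rewrite lee_fin|exact: hA].
apply: leeD; first by rewrite /T3 (EFinM be a1) (EFinM be kap) -muleA; apply: lee_wpmul2l; [rewrite lee_fin|exact: s1].
apply: leeD; first by rewrite /T4 (EFinM be a2) (EFinM be kap) -muleA; apply: lee_wpmul2l; [rewrite lee_fin|exact: s2].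
apply: leeD; first by rewrite /T5 indicE mem_set// mulr1.
by rewrite /T6 (EFinM be `|S|) (EFinM be (L ^+ 2)) -muleA; apply: lee_wpmul2l; [rewrite lee_fin|exact: hSh].
Qed.

End increments_integral.

Section energy_increments.
Context (R : realType) (n : nat).
Local Notation V := 'rV[R]_n.
Local Notation leb := (lebesgue_rV R n).
Variables (f f1 : R -> R) (fp0 finf : R) (Jn : V -> R) (MJ : R).
Hypothesis n2 : (2 <= n)%N.
Hypothesis hp : pot_ok f f1 fp0 finf.
Hypothesis hk : ker_ok Jn MJ.

(** Integration over z of the bounds for h = eps z. The right-hand sides are at most C eps on the
    unit ball, and the normalisation 1/(eps omega) leaves a constant independent of eps. *)
Lemma PDr_increments (u : V -> V) (C eps : R) : 0 < eps -> 0 <= C -> L2f u ->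
  (forall h : V, 0 < enorm h -> enorm h < eps ->
    (\int[leb]_x (f (dot (u (x + h) - u x) h ^+ 2 / enorm h ^+ 3))%:E <= (C * enorm h)%:E)%E) ->
  PDr f Jn eps u <= MJ * C.
Proof.
move=> e0 C0 [mu u2] hC; have w0 := unit_ball_volume_gt0 R n.
have MJ0 : 0 <= MJ by exact: le_trans (kok_ge0 hk 0) (kok_le hk 0).
have mB : mfunT (\1_(eball (0 : V) 1) : V -> R) by exact: measurable_indic (measurable_eball _ _).
have mf := pok_mf hp; have mJ := kok_m hk.
have hII : (II (PDd f Jn eps (dlt u eps)) <= (MJ * C * eps * unit_ball_volume R n)%:E)%E.
  apply: (@le_trans _ _ (\int[leb]_z (MJ * C * eps * \1_(eball (0 : V) 1) z)%:E)%E); last first.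
    rewrite rintZl//; last by rewrite !mulr_ge0// ltW.
    have hB : (\int[leb]_z (\1_(eball (0 : V) 1) z)%:E = (unit_ball_volume R n)%:E)%E.
      by rewrite rint_indic; [exact: unit_ball_volumeE|exact: measurable_eball].
    by rewrite hB.
  have parg0 (z x : V) : 0 <= parg eps (dlt u eps (z, x)) z.
    by rewrite /parg mulr_ge0 ?sqr_ge0// invr_ge0 mulr_ge0 ?exprn_ge0 ?enorm_ge0// ltW.
  apply: ge0_le_integralT => z.
    by apply: rint_ge0 => x; rewrite /PDd mulr_ge0 ?(kok_ge0 hk)//; have /andP[] := pok_f hp (parg0 z x).
  rewrite indicE mem_eball0; case: ltP => z1 /=; last first.
    by rewrite integral0_eq ?mulr0// => x _; rewrite /PDd/= (kok_supp hk z1) mul0r.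
  rewrite mulr1; have [->|zn] := eqVneq z 0.
    rewrite integral0_eq; first by rewrite lee_fin !mulr_ge0// ltW.
    by move=> x _; rewrite /PDd/= /parg /dlt/= dot0r expr0n/= mul0r (pok_f0 hp) mulr0.
  have z0 : 0 < enorm z by rewrite enorm_gt0.
  have eh : enorm (eps *: z) = eps * enorm z by rewrite enormZ gtr0_norm.
  have := hC (eps *: z); rewrite eh mulr_gt0// => /(_ isT).
  rewrite -[X in _ < X]mulr1 ltr_pM2l// => /(_ z1) hz.
  have E x : PDd f Jn eps (dlt u eps) (z, x) = Jn z * f (dot (u (x + eps *: z) - u x) (eps *: z) ^+ 2 / (eps * enorm z) ^+ 3).
    rewrite /PDd /parg /dlt/= dotZr; congr (_ * f _).
    by field; rewrite !gt_eqF.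
  under eq_integral do rewrite E.
  have arg0 (x : V) : 0 <= dot (u (x + eps *: z) - u x) (eps *: z) ^+ 2 / (eps * enorm z) ^+ 3.
    by rewrite mulr_ge0 ?sqr_ge0// invr_ge0 exprn_ge0// mulr_ge0// ltW.
  rewrite rintZl; first last.
  - by move=> x; have /andP[] := pok_f hp (arg0 x).
  - by apply: (measurableT_comp mf); apply: measurable_funM => //; apply: measurable_funX; mfun.
  - exact: (kok_ge0 hk).
  apply: (@le_trans _ _ (MJ%:E * (C * (eps * enorm z))%:E)%E).
    apply: lee_pmul => //; first by rewrite lee_fin (kok_ge0 hk).
      by apply: rint_ge0 => x; have /andP[] := pok_f hp (arg0 x).
    by rewrite lee_fin (kok_le hk).
  rewrite -EFinM lee_fin -!mulrA; do 2 (apply: ler_wpM2l => //).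
  by rewrite -[leRHS]mulr1; apply: ler_wpM2l; exact: ltW.
have L2u : L2f u by split.
rewrite (II_PDd n2 hp hk e0 L2u) lee_fin in hII.
have ew : 0 < eps * unit_ball_volume R n by rewrite mulr_gt0.
rewrite -(ler_pM2l ew); apply: le_trans hII _.
by apply: le_of_eq; ring.
Qed.

End energy_increments.

(** * Translations and density of Lipschitz fields with prescribed support *)

Lemma fin_min (R : realFieldType) (I : finType) (d : I -> R) : (forall i, 0 < d i) ->
  exists2 m : R, 0 < m & forall i, m <= d i.
Proof.
move=> d0; have s0 : 0 < 1 + \sum_i (d i)^-1.
  by rewrite ltr_wpDr// sumr_ge0// => i _; rewrite invr_ge0 ltW.
exists (1 + \sum_i (d i)^-1)^-1; first by rewrite invr_gt0.
move=> i; rewrite -[leRHS]invrK lef_pV2 ?posrE ?invr_gt0//.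
rewrite (bigD1 i)//= addrCA lerDl addr_ge0// sumr_ge0// => j _; by rewrite invr_ge0 ltW.
Qed.

Section translation.
Context (R : realType) (n : nat).
Local Notation V := 'rV[R]_n.
Local Notation leb := (lebesgue_rV R n).

Lemma translation_continuity (u : V -> V) (M r e : R) : mfunT u ->
  (forall x, enorm (u x) <= M) -> (forall x, ~ rV_box 0 r x -> u x = 0) -> 0 <= r -> 0 < e ->
  exists2 d : R, 0 < d & forall k l : V, enorm (k - l) <= d ->
    (\int[leb]_x (enorm (u (x + k) - u (x + l)))%:E <= e%:E)%E.
Proof.
move=> mu uM ur r0 e0; have n0 : 0 < n%:R + 1 :> R by rewrite ltr_wpDl.
have en : 0 < e / (n%:R + 1) by rewrite divr_gt0.
have mi (i : 'I_n) : mfunT (fun x => u x ord0 i) by exact: measurable_coord.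
have H' (i : 'I_n) : exists d : R, 0 < d /\ forall h : V, (forall j, `|h ord0 j| <= d) ->
    (\int[leb]_x (`|u (x + h) ord0 i - u x ord0 i|)%:E <= (e / (n%:R + 1))%:E)%E.
  have cM x : `|u x ord0 i| <= M by apply: le_trans (ler_coord_enorm _ _) (uM x).
  have cr x : ~ rV_box 0 r x -> u x ord0 i = 0 by move=> hx; rewrite ur// mxE.
  have [d d0 hd] := affine_continuity (mi i) cM cr r0 en.
  exists d; split => // h hh; have := hd 1 h; under eq_integral do rewrite scale1r.
  by apply=> //; rewrite subrr normr0 ltW.
have [d hd] := choice H'.
have [m m0 hm] := fin_min (fun i => (hd i).1).
exists m => // k l kl.
have mu2 (h : V) : mfunT (fun x : V => u (x + h)) by mfun.
have mE : mfunT (fun x : V => enorm (u (x + (k - l)) - u x)).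
  by apply: measurable_enorm; apply: measurable_rVB.
have -> : (\int[leb]_x (enorm (u (x + k) - u (x + l)))%:E = \int[leb]_x (enorm (u (x + (k - l)) - u x))%:E)%E.
  rewrite -(rint_translate l mE); last by move=> x; exact: enorm_ge0.
  by apply: eq_integral => x _; rewrite -addrA [l + _]addrC subrK.
have mc (i : 'I_n) : mfunT (fun x : V => `|u (x + (k - l)) ord0 i - u x ord0 i|).
  apply: (measurableT_comp (@normr_measurable _ setT)); apply: measurable_funB => //.
  exact: ((measurable_fun_rVP _).1 (mu2 (k - l)) i).
apply: (@le_trans _ _ (\int[leb]_x (\sum_i `|u (x + (k - l)) ord0 i - u x ord0 i|)%:E)%E).
  apply: le_rint => x; first exact: enorm_ge0.
  apply: le_trans (ler_enorm_sum _) _; apply: ler_sum => i _; by rewrite !mxE.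
rewrite rint_sum//; apply: (@le_trans _ _ (\sum_(i < n) (e / (n%:R + 1))%:E)%E).
  apply: lee_sum => i _; apply: (hd i).2 => j.
  by apply: le_trans (ler_coord_enorm _ _) (le_trans kl (hm i)).
rewrite sumEFin lee_fin sumr_const card_ord -[X in X <= _]mulr_natl mulrA ler_pdivrMr// mulrC.
by apply: ler_wpM2l; [exact: ltW|rewrite lerDl].
Qed.

(** Young's inequality with weight s on a bounded support. The bound stays linear in s, the size of
    a time step. *)
Lemma L1_le_nrm (w : V -> V) (r s N : R) : L2f w -> (forall x, ~ rV_box 0 r x -> w x = 0) -> 0 <= r -> 0 < s ->
  nrm w <= N * s -> (\int[leb]_x (enorm (w x))%:E <= (s * (((2 * r) ^+ n + N ^+ 2) / 2))%:E)%E.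
Proof.
move=> hw wr r0 s0 wN; have mw := L2f_measurable hw.
have mB : mfunT (\1_(rV_box (0 : V) r) : V -> R) by exact: measurable_indic (measurable_rV_box _ _).
have s20 : 0 <= s / 2 by rewrite divr_ge0// ltW.
have i0 : 0 <= (2 * s)^-1 by rewrite invr_ge0 mulr_ge0// ltW.
have md : mfunT (fun x => dot (w x) (w x)) by mfun.
apply: (@le_trans _ _ (\int[leb]_x (s / 2 * \1_(rV_box 0 r) x + (2 * s)^-1 * dot (w x) (w x))%:E)%E).
  apply: le_rint => x; first exact: enorm_ge0.
  rewrite indicE; have [xr|xr] := pselect (rV_box 0 r x); last first.
    by rewrite memNset// wr// enorm0 dot0l !mulr0 addr0.
  rewrite mem_set// mulr1 -sqr_enorm.
  have := sqr_ge0 (enorm (w x) - s) => h.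
  rewrite -(ler_pM2l (_ : 0 < 2 * s)) ?mulr_gt0//.
  have -> : 2 * s * (s / 2 + (2 * s)^-1 * enorm (w x) ^+ 2) = s ^+ 2 + enorm (w x) ^+ 2.
    by field; rewrite gt_eqF.
  have -> : 2 * s * enorm (w x) = s ^+ 2 + enorm (w x) ^+ 2 - (enorm (w x) - s) ^+ 2 by ring.
  lra.
rewrite rintD; first last.
- by move=> x; rewrite mulr_ge0 ?dot_ge0.
- by apply: measurable_funM.
- by move=> x; rewrite mulr_ge0 ?indic_ge0.
- by apply: measurable_funM.
rewrite rintZl//; rewrite rint_box// rintZl//; last by move=> x; exact: dot_ge0.
rewrite ipE// -sqr_nrm -!EFinM -EFinD lee_fin.
have : nrm w ^+ 2 <= (N * s) ^+ 2 by rewrite lerXn2r ?nnegrE ?nrm_ge0// (le_trans (nrm_ge0 w)).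
move=> /(ler_wpM2l i0) h.
have e1 : (2 * s)^-1 * (N * s) ^+ 2 = s * (N ^+ 2 / 2) by field; rewrite gt_eqF.
have e2 : s / 2 * (2 * r) ^+ n = s * ((2 * r) ^+ n / 2) by ring.
rewrite [leRHS](_ : _ = s * ((2 * r) ^+ n / 2) + s * (N ^+ 2 / 2)); last by ring.
lra.
Qed.

End translation.

Section cutoff.
Context (R : realType) (n : nat).
Local Notation V := 'rV[R]_n.
Local Notation leb := (lebesgue_rV R n).
Variable S : set V.

Definition depth (x : V) : R := inf [set enorm (x - y) | y in ~` S].

Lemma depth_lbound x : has_lbound [set enorm (x - y) | y in ~` S].
Proof. by exists 0 => _ [y _ <-]; exact: enorm_ge0. Qed.

Lemma depth_le x y : ~ S y -> depth x <= enorm (x - y).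
Proof. by move=> Sy; apply: ge_inf; [exact: depth_lbound|exists y]. Qed.

Hypothesis Sc : ~` S !=set0.

Lemma depth_ge0 x : 0 <= depth x.
Proof.
have [y Sy] := Sc; apply: lb_le_inf; first by exists (enorm (x - y)), y.
by move=> _ [z _ <-]; exact: enorm_ge0.
Qed.

Lemma depth_out x : ~ S x -> depth x = 0.
Proof.
move=> Sx; apply/eqP; rewrite eq_le depth_ge0 andbT.
by have := depth_le x Sx; rewrite subrr enorm0.
Qed.

Lemma depth_lipschitz : elipschitz depth.
Proof.
exists 1; split => // x y; rewrite mul1r.
have H a b : depth a <= depth b + enorm (a - b).
  rewrite -lerBlDr; have [y0 Sy0] := Sc; apply: lb_le_inf; first by exists (enorm (b - y0)), y0.
  move=> _ [z Sz <-]; rewrite lerBlDr; apply: le_trans (depth_le a Sz) _.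
  have -> : a - z = (b - z) + (a - b) by rewrite [RHS]addrC subrKA.
  exact: ler_enormD.
have h1 := H x y; have := H y x; rewrite (enormB y x) ler_norml => h2; lra.
Qed.

Lemma depth_gt0 x : open S -> S x -> 0 < depth x.
Proof.
move=> oS Sx; have /nbhs_ballP[m /= m0 hm] : nbhs x S by exact: open_nbhs_nbhs.
apply: (@lt_le_trans _ _ m) => //; have [y0 Sy0] := Sc.
apply: lb_le_inf; first by exists (enorm (x - y0)), y0.
move=> _ [z Sz <-]; rewrite leNgt; apply/negP => xz; apply: Sz; apply: hm.
by rewrite -ball_normE/=; apply: le_lt_trans (ler_norm_enorm _) xz.
Qed.

End cutoff.

Section lipschitz_density.
Context (R : realType) (n : nat).
Local Notation V := 'rV[R]_n.
Local Notation leb := (lebesgue_rV R n).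

(** Each component is approximated in L^1 and multiplied by a Lipschitz cutoff of the distance to
    the complement of S. The region where the cutoff is below 1 shrinks to a null part of S, and the
    common bound M turns L^1 errors into L^2 errors. *)
Lemma lipschitz_fields_dense (S : set V) (v : V -> V) (M r e : R) : open S -> S `<=` rV_box 0 r -> 0 <= r ->
  ~` S !=set0 -> L2f v -> 0 < M -> (forall x, enorm (v x) <= M) -> (forall x, ~ S x -> v x = 0) -> 0 < e ->
  exists psi : V -> V, exists2 L : R, 0 <= L &
   [/\ forall x y, enorm (psi x - psi y) <= L * enorm (x - y), forall x, ~ S x -> psi x = 0, L2f psi & nrm (v - psi) <= e].
Proof.
move=> oS Sr r0 Sc hv M0 vM vS e0; have mv := L2f_measurable hv.
have mS : measurable S by exact: open_measurable_rV.
have Sfin : (leb S < +oo)%E.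
  apply: (@le_lt_trans _ _ (leb (rV_box 0 r))); first by apply: le_measure; rewrite ?inE//; exact: measurable_rV_box.
  by rewrite lebesgue_rV_box// ltry.
have n1 : 0 < n%:R + 1 :> R by rewrite ltr_wpDl.
pose t : R := e ^+ 2 / (2 * M * (n%:R + 1) * (1 + M)).
have t0 : 0 < t by rewrite divr_gt0 ?exprn_gt0// !mulr_gt0// addr_gt0.
have mi (i : 'I_n) : mfunT (fun x => v x ord0 i) by exact: measurable_coord.
have H (i : 'I_n) := @lip_dense R n S (fun x => v x ord0 i) M t mS Sfin (mi i) M0
  (fun x => le_trans (ler_coord_enorm (v x) i) (vM x)) t0.
have [p hp] := choice H.
have md := elipschitz_measurable (depth_lipschitz Sc).
have [N hN] := @measure_shrink _ _ _ leb S (fun k => S `&` [set x | k.+1%:R * depth S x < 1]) t mS Sfin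
  ltac:(by move=> k; apply: measurableI => //; have mk : mfunT (fun x => k.+1%:R * depth S x);
    [by apply: measurable_funM|have := mk measurableT _ (measurable_itv `]-oo, 1[); rewrite setTI; congr measurable;
     apply/seteqP; split => x; rewrite /= in_itv])
  ltac:(by move=> k x [Sx hx]; split => //; apply: le_lt_trans hx; rewrite ler_wpM2r ?depth_ge0// ler_nat)
  ltac:(by rewrite -subset0 => x hx; have [Sx _] := hx 0%N I; have d0 := depth_gt0 Sc oS Sx;
     have p0 : 0 <= (depth S x)^-1; [by rewrite invr_ge0 ltW|have /andP[_ t2] := truncn_itv p0;
     have [_ /=] := hx (Num.trunc (depth S x)^-1) I; rewrite ltNge => /negP; apply;
     rewrite -ler_pdivrMr// mul1r; exact: ltW]) t0.
pose chi (x : V) : R := clamp (N.+1%:R * depth S x).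
have chi01 x : 0 <= chi x <= 1 by exact: clamp_itv.
have Lchi : elipschitz chi by apply: elipschitz_clamp; apply: elipschitzZ; exact: depth_lipschitz.
have chi1 x : 1 <= N.+1%:R * depth S x -> chi x = 1.
  by rewrite /chi /clamp => h; rewrite ?max_r ?min_l ?min_r//; lra.
have chi0 x : ~ S x -> chi x = 0.
  by move=> Sx; rewrite /chi depth_out// mulr0 /clamp ?max_l ?min_r ?min_l//; lra.
have Lq (i : 'I_n) : elipschitz (fun x => chi x * p i x).
  have [l1 l2 _] := hp i; apply: elipschitzM => //; [|by exists M].
  by exists 1 => x; have /andP[c0 c1] := chi01 x; rewrite ger0_norm.
have [Li hLi] := choice Lq.
pose psi (x : V) : V := \row_i (chi x * p i x).
have mpsi : mfunT psi.
  apply/measurable_fun_rVP => i; rewrite (_ : (fun x => _) = (fun x => chi x * p i x)).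
    exact: elipschitz_measurable (Lq i).
  by apply/funext => x; rewrite mxE.
have psiS x : ~ S x -> psi x = 0 by move=> Sx; apply/rowP => i; rewrite !mxE chi0// mul0r.
have mde (i : 'I_n) : mfunT (fun x => `|v x ord0 i - p i x|).
  have [l1 _ _] := hp i; have mp := elipschitz_measurable l1.
  by apply: (measurableT_comp (@normr_measurable _ setT)); apply: measurable_funB.
pose E : set V := S `&` (S `&` [set x | N.+1%:R * depth S x < 1]).
have mk : mfunT (fun x => N.+1%:R * depth S x) by apply: measurable_funM.
have mE : measurable E.
  apply: measurableI => //; apply: measurableI => //.
  have := mk measurableT _ (measurable_itv `]-oo, 1[); rewrite setTI; congr measurable.
have mIE : mfunT (\1_E : V -> R) by exact: measurable_indic.
have mIS : mfunT (\1_S : V -> R) by exact: measurable_indic.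
have mw : mfunT (v - psi) by apply: measurable_rVB.
have key : (\int[leb]_x sqL2 (v - psi)%R x <= (e ^+ 2)%:E)%E.
  apply: (@le_trans _ _ (\int[leb]_x (\sum_(i < n) 2 * M * (\1_S x * `|v x ord0 i - p i x| + M * \1_E x))%:E)%E).
    apply: ge0_le_integralT => x; first exact: sqL2_ge0.
    rewrite /sqL2 lee_fin /dot; apply: ler_sum => i _; rewrite !mxE.
    have [Sx|Sx] := pselect (S x); last first.
      by rewrite vS// chi0// mxE mul0r subrr mulr0 mulr_ge0 ?mulr_ge0 ?addr_ge0 ?mulr_ge0 ?indic_ge0 ?(ltW M0).
    have [_ pM _] := hp i; have /andP[c0 c1] := chi01 x.
    have vi : `|v x ord0 i| <= M by apply: le_trans (ler_coord_enorm _ _) (vM x).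
    have cp : `|chi x * p i x| <= M.
      rewrite normrM (ger0_norm c0) -[leRHS]mul1r; apply: ler_pM => //.
    rewrite -expr2 -[X in X <= _]real_normK ?num_real// expr2.
    apply: ler_pM => //; first by apply: le_trans (ler_normB _ _) _; rewrite (_ : 2 * M = M + M) ?lerD//; ring.
    rewrite indicE mem_set// mul1r.
    have -> : v x ord0 i - chi x * p i x = (v x ord0 i - p i x) + (1 - chi x) * p i x by ring.
    apply: le_trans (ler_normD _ _) _; rewrite lerD2l.
    have [h1|h1] := leP 1 (N.+1%:R * depth S x).
      by rewrite chi1// subrr mul0r normr0 mulr_ge0 ?indic_ge0 ?(ltW M0).
    rewrite indicE mem_set// mulr1 normrM -[leRHS]mul1r; apply: ler_pM => //.
    by rewrite ger0_norm; lra.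
  have M20 : 0 <= 2 * M by rewrite mulr_ge0// ltW.
  have m1 (i : 'I_n) : mfunT (fun x => \1_S x * `|v x ord0 i - p i x|) by apply: measurable_funM.
  have m2 : mfunT (fun x : V => M * \1_E x) by apply: measurable_funM.
  have q1 (i : 'I_n) x : 0 <= \1_S x * `|v x ord0 i - p i x| by rewrite mulr_ge0// indic_ge0.
  have q2 (x : V) : 0 <= M * \1_E x by rewrite mulr_ge0 ?indic_ge0// ltW.
  rewrite rint_sum; first last.
  - by move=> i x; rewrite mulr_ge0// addr_ge0.
  - by move=> i; apply: measurable_funM => //; apply: measurable_funD.
  apply: (@le_trans _ _ (\sum_(i < n) (2 * M * (t + M * t))%:E)%E).
    apply: lee_sum => i _; rewrite rintZl//; [|by apply: measurable_funD|by move=> x; rewrite addr_ge0].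
    rewrite [leRHS]EFinM; apply: lee_wpmul2l; first by rewrite lee_fin.
    rewrite rintD// [leRHS]EFinD; apply: leeD; first by have [] := hp i.
    rewrite rintZl//; last exact: ltW.
    by rewrite rint_indic// [leRHS]EFinM; apply: lee_wpmul2l; [rewrite lee_fin ltW|exact: hN].
  rewrite sumEFin lee_fin sumr_const card_ord -[X in X <= _]mulr_natl.
  have -> : n%:R * (2 * M * (t + M * t)) = n%:R * (2 * M * (1 + M) * t) by ring.
  apply: (@le_trans _ _ ((n%:R + 1) * (2 * M * (1 + M) * t))).
    apply: ler_wpM2r; last by rewrite lerDl.
    by apply: mulr_ge0; [apply: mulr_ge0 => //; rewrite addr_ge0// ltW|exact: ltW].
  apply: le_of_eq; rewrite /t; field.
  by rewrite !gt_eqF// addr_gt0.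
have [hw he] := nrm_le (ltW e0) mw key.
have hpsi : L2f psi.
  have -> : psi = v - (v - psi) by rewrite opprB addrC subrK.
  exact: L2fB.
exists psi, (\sum_i Li i); first by apply: sumr_ge0 => i _; have [] := hLi i.
split => // x y; apply: le_trans (ler_enorm_sum _) _; rewrite mulr_suml; apply: ler_sum => i _.
by rewrite !mxE; have [_] := hLi i; apply.
Qed.

End lipschitz_density.

(** * The limit evolution and its initial velocity *)

Lemma velocity_arith (R : realFieldType) (y1 y2 y3 y4 y5 y6 : R) : y1 <= y3 + y4 ->
  y3 - (y4 / 2 - y6) - y5 <= y2 -> y5 <= y4 / 2 -> 0 <= y6 -> 0 <= y4 -> y1 - 2 * y2 + y3 <= 4 * y4.
Proof. lra. Qed.

Lemma kinetic_arith (R : realFieldType) (d q1 q2 q3 q4 q5 q6 q7 q8 q9 : R) : q1 + q3 <= q2 + q4 + q8 ->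
  q4 <= q5 + d -> q5 <= q6 + (q7 + q9) -> q6 <= q3 -> q7 <= d -> q8 + q9 <= 2 * d -> q1 <= q2 + 4 * d.
Proof. lra. Qed.

Lemma kinetic_time (R : realFieldType) (bv cc t dd d D : R) : D = bv + cc + 1 -> 0 <= bv -> 0 <= cc -> 0 <= t ->
  0 <= dd -> t * D <= d -> dd * D = d -> bv * t + cc * (t + dd) <= 2 * d.
Proof.
move=> -> b0 c0 t0 d0 td ed; have p1 : 0 <= dd * bv by exact: mulr_ge0.
rewrite -[2 * d]/((1 + 1) * d) mulrDl mul1r -{2}ed.
have -> : bv * t + cc * (t + dd) = (t * (bv + cc + 1) - t) + (dd * (bv + cc + 1) - dd * bv - dd) by ring.
apply: lerD; first by rewrite lerBlDr (le_trans td)// lerDl.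
by rewrite -addrA -opprD gerBl addr_ge0.
Qed.

Section limit_evolution.
Context (R : realType) (n : nat).
Local Notation V := 'rV[R]_n.
Local Notation leb := (lebesgue_rV R n).
Variables (f f1 : R -> R) (fp0 finf : R) (Jn : V -> R) (MJ : R).
Hypothesis n2 : (2 <= n)%N.
Hypothesis hp : pot_ok f f1 fp0 finf.
Hypothesis hk : ker_ok Jn MJ.
Hypothesis hJ : (\int[leb]_z (Jn z)%:E != 0)%E.
Local Notation PDr := (PDr f Jn).
Variables (rho T B : R) (S : set V) (r M P e1 : R) (eps : nat -> R) (u ut utt : nat -> R -> V -> V)
  (b : R -> V -> V) (u0 v0 : V -> V).
Hypothesis he : forall k, evo f1 Jn (eps k) rho T B S (u k) (ut k) (utt k) b.
Hypotheses (T0 : 0 < T) (M0 : 0 < M) (r0 : 0 <= r) (e10 : 0 < e1).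
Hypotheses (oS : open S) (Sr : S `<=` rV_box 0 r) (Sc : ~` S !=set0).
Hypothesis epsc : forall e : R, 0 < e -> \forall k \near \oo, eps k <= e.
Hypothesis uM : forall k t x, 0 <= t <= T -> enorm (u k t x) <= M.
Hypothesis uS : forall k t x, 0 <= t <= T -> ~ S x -> u k t x = 0.
Hypotheses (hv0 : L2f v0) (v0M : forall x, enorm (v0 x) <= M) (v0S : forall x, ~ S x -> v0 x = 0).
Hypotheses (u00 : forall k, u k 0 = u0) (ut0 : forall k, ut k 0 = v0).
Hypothesis hP : forall e, 0 < e -> e <= e1 -> PDr e u0 <= P.
Hypothesis eps1 : forall k, eps k <= e1.

Let eps0 k : 0 < eps k. Proof. exact: (evo_e (he k)). Qed.
Let rho0 : 0 < rho. Proof. exact: (evo_rho (he 0%N)). Qed.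
Let B0 : 0 <= B. Proof. exact: (evo_B0 (he 0%N)). Qed.
Let T00 : 0 <= (0 : R) <= T. Proof. by rewrite lexx ltW. Qed.
Let hu0 : L2f u0. Proof. by rewrite -(u00 0%N); exact: (evo_u (he 0%N) T00). Qed.
Let u0M x : enorm (u0 x) <= M. Proof. by rewrite -(u00 0%N); exact: uM. Qed.
Let u0r x : ~ rV_box 0 r x -> u0 x = 0.
Proof. by move=> nr; rewrite -(u00 0%N); apply: uS => // /Sr. Qed.

Definition Emax : R := Ebound rho T B (rho / 2 * nrm v0 ^+ 2 + P).
Definition vmax : R := Num.sqrt (2 / rho * Emax).

Lemma Emax_ge0 : 0 <= Emax. Proof. exact: sqr_ge0. Qed.
Lemma vmax_ge0 : 0 <= vmax. Proof. exact: sqrtr_ge0. Qed.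

Lemma Etot0_le k : Etot f Jn (eps k) rho (u k) (ut k) 0 <= rho / 2 * nrm v0 ^+ 2 + P.
Proof. by rewrite /Etot u00 ut0 lerD2l; exact: hP. Qed.

Lemma Ebound_le k : Ebound rho T B (Etot f Jn (eps k) rho (u k) (ut k) 0) <= Emax.
Proof.
have h0 := Etot_ge0 hp hk (he k) 0; have h1 := Etot0_le k.
have c0 : 0 <= B / Num.sqrt (2 * rho) * T.
  by rewrite mulr_ge0 ?(ltW T0)// divr_ge0// sqrtr_ge0.
rewrite /Emax /Ebound lerXn2r ?nnegrE ?addr_ge0 ?sqrtr_ge0// lerD2r ler_wsqrtr// lerD2r//.
Qed.

Lemma ut_le k t : 0 <= t <= T -> nrm (ut k t) <= vmax.
Proof. by move=> tT; exact: (evo_ut_bound n2 hp hk (he k) tT (Ebound_le k)). Qed.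

Lemma u_lip k s t : 0 <= s <= T -> 0 <= t <= T -> nrm (u k s - u k t) <= vmax * `|s - t|.
Proof.
have H a c : 0 <= a -> a <= c -> c <= T -> nrm (u k c - u k a) <= vmax * (c - a).
  move=> a0 ac cT; apply: (ndiff_bound (evo_u (he k)) (evo_ut (he k)) (evo_d (he k)) a0 ac cT vmax_ge0).
  by move=> x /andP[ax xc]; apply: ut_le; rewrite (le_trans a0 ax) (le_trans xc cT).
move=> /andP[s0 sT] /andP[t0 tT]; have [st|ts] := leP s t.
  by rewrite nrmBC distrC ger0_norm ?subr_ge0//; exact: H.
by rewrite ger0_norm ?subr_ge0 ?(ltW ts)//; apply: H => //; exact: ltW.
Qed.

Lemma PDr_u_le k t : 0 <= t <= T -> PDr (eps k) (u k t) <= Emax.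
Proof.
move=> tT; apply: le_trans (Ebound_le k).
apply: le_trans (Etot_bound n2 hp hk (he k) tT).
by rewrite /Etot lerDr mulr_ge0 ?sqr_ge0// divr_ge0// ltW.
Qed.

Lemma PDr_multiple (m : nat) e w : (0 < m)%N -> 0 < e -> L2f w -> PDr (m%:R * e) w <= PDr e w.
Proof.
move=> m0 e0 hw; have me0 : 0 < m%:R * e by rewrite mulr_gt0// ltr0n.
by rewrite -lee_fin -(PDeE n2 hp hk me0 hw) -(PDeE n2 hp hk e0 hw); apply: (PDe_multiple hp hk m0 e0 (L2f_measurable hw)).
Qed.

(* Lower semicontinuity of the energies along eps_k -> 0 turns energy conservation into this bound. *)
Lemma kinetic_le (ka : R) : 0 < ka -> exists2 m : R, 0 < m & \forall k \near \oo,
  forall t, 0 <= t <= T -> t < m -> nrm (ut k t) ^+ 2 <= nrm v0 ^+ 2 + ka.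
Proof.
move=> ka0; pose d : R := rho / 2 * (ka / 4).
have d0 : 0 < d by rewrite !mulr_gt0// ?invr_gt0.
(* A horizon at which the energy of u0 is within d of its supremum over horizons up to e1. Since eps
   k is such a horizon, the initial energy at eps k exceeds the one at [es] by at most d. *)
have [es [es0 es1 hes]] : exists es : R, [/\ 0 < es, es <= e1 & forall e, 0 < e -> e <= e1 -> PDr e u0 <= PDr es u0 + d].
  pose A : set R := [set PDr e u0 | e in [set e | 0 < e <= e1]].
  have A0 : has_sup A.
    split; first by exists (PDr e1 u0), e1 => //=; rewrite e10 lexx.
    by exists P => _ [e /andP[? ?] <-]; exact: hP.
  have [_ [es /andP[es0 es1] <-] hes] := sup_adherent d0 A0.
  exists es; split => // e ep ep1; have : PDr e u0 <= sup A.
    by apply: sup_upper_bound => //; exists e => //=; rewrite ep ep1.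
  by move/le_trans; apply; rewrite -lerBlDr ltW.
have w0 := unit_ball_volume_gt0 R n.
have MJ0 : 0 <= MJ by exact: le_trans (kok_ge0 hk 0) (kok_le hk 0).
pose C : R := (es * unit_ball_volume R n)^-1 * (MJ * (finf + fp0 / es * (1 + 4 * M)) * 2 ^+ n.+2).
have C0 : 0 <= C.
  have p0 := pok_fp0 hp; have q0 := pok_finf hp.
  have t1 : 0 <= fp0 / es * (1 + 4 * M).
    by apply: mulr_ge0; [rewrite divr_ge0// ltW|rewrite addr_ge0// mulr_ge0// ltW].
  have v1 : 0 <= (es * unit_ball_volume R n)^-1 by rewrite invr_ge0; exact: (mulr_ge0 (ltW es0) (ltW w0)).
  have v2 := addr_ge0 (ltW q0) t1.
  have v3 : 0 <= 2 ^+ n.+2 :> R by exact: exprn_ge0.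
  exact: (mulr_ge0 v1 (mulr_ge0 (mulr_ge0 MJ0 v2) v3)).
pose c1 : R := ((2 * r) ^+ n + vmax ^+ 2) / 2.
have c10 : 0 <= c1 by rewrite divr_ge0// addr_ge0 ?sqr_ge0// exprn_ge0// mulr_ge0.
pose t1 : R := d / (C + 1).
have C1 : 0 < C + 1 by lra.
have t10 : 0 < t1 by rewrite divr_gt0.
have Ct1 : C * t1 <= d.
  by rewrite /t1 mulrCA ler_piMr ?(ltW d0)// ler_pdivrMr// mul1r lerDl.
have [dd dd0 hdd] := translation_continuity (L2f_measurable hu0) u0M u0r r0 t10.
pose D : R := B * vmax + 2 * C * c1 + 1.
have vm := vmax_ge0.
have x1 : 0 <= B * vmax by rewrite mulr_ge0.
have x2 : 0 <= 2 * C * c1 by apply: mulr_ge0 => //; apply: mulr_ge0.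
have D0 : 0 < D by rewrite /D; lra.
exists (d / D); first by rewrite divr_gt0.
have mind : 0 < Num.min dd es by rewrite lt_min dd0.
near=> k => t tT tm; have /andP[t0 _] := tT.
have : eps k <= Num.min dd es by near: k; exact: epsc.
rewrite le_min => /andP[kd kes].
(* m eps k is the multiple of eps k just below [es]. [PDr_lsc] compares the energy of u0 at [es]
   with that of u k t at this multiple, and [PDr_multiple] passes to the horizon eps k. The
   potential energy thus drops by little, and the energy inequality leaves little for the kinetic
   energy to gain. *)
pose m := Num.trunc (es / eps k).
have y0 : 0 <= es / eps k by rewrite divr_ge0// ltW.
have /andP[m1 m2] := truncn_itv y0; rewrite -/m in m1 m2.
have mp : (0 < m)%N.
  rewrite -ltnS -(ltr_nat R); apply: le_lt_trans m2; by rewrite ler_pdivlMr// mul1r.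
have m1' : m%:R * eps k <= es by rewrite -ler_pdivlMr.
have m2' : es - m%:R * eps k <= eps k.
  by rewrite ltr_pdivrMr// -natr1 mulrDl mul1r in m2; rewrite lerBlDl ltW.
have hut := evo_u (he k) tT.
have eta0 : 0 < m%:R * eps k by rewrite mulr_gt0// ltr0n.
have tr (z : V) : enorm z < 1 -> (\int[leb]_x (enorm (u0 (x + es *: z)%R - u0 (x + (m%:R * eps k) *: z)%R)%R)%:E <= t1%:E)%E.
  move=> z1; apply: hdd; rewrite -scalerBl enormZ ger0_norm ?subr_ge0//.
  apply: le_trans kd; apply: le_trans m2'; rewrite -[leRHS]mulr1.
  by apply: ler_wpM2l; [rewrite subr_ge0|exact: ltW].
have L1 : (\int[leb]_x (enorm (u0 x - u k t x)%R)%:E <= ((t + d / D) * c1)%:E)%E.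
  have s0 : 0 < t + d / D by rewrite ltr_wpDl// divr_gt0.
  have hw := L2fB hu0 hut.
  have wr x : ~ rV_box 0 r x -> (u0 - u k t) x = 0.
    move=> nr; rewrite -[LHS]/(u0 x - u k t x) u0r// uS// ?subrr// => /Sr//.
  apply: (L1_le_nrm hw wr r0 s0).
  rewrite -{1}(u00 k); apply: le_trans (u_lip _ T00 tT) _.
  rewrite sub0r normrN ger0_norm//; apply: ler_wpM2l => //; rewrite lerDl; exact: ltW (divr_gt0 d0 D0).
have tk x : enorm (u k t x) <= M by exact: uM.
have lsc := PDr_lsc n2 hp hk eta0 m1' hu0 hut u0M tk tr L1.
rewrite -/C in lsc.
have mono := PDr_multiple mp (eps0 k) hut.
have en := Etot_le n2 hp hk (he k) tT vmax_ge0 (ut_le k).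
rewrite /Etot u00 ut0 in en.
have h3 := hes _ (eps0 k) (eps1 k).
have tD : t * D <= d by rewrite -ler_pdivlMr// ltW.
have dD : d / D * D = d by rewrite divfK// gt_eqF.
have tE : B * vmax * t + 2 * C * c1 * (t + d / D) <= 2 * d.
  exact: (kinetic_time (erefl D) x1 x2 t0 (ltW (divr_gt0 d0 D0)) tD dD).
have fin : rho / 2 * nrm (ut k t) ^+ 2 <= rho / 2 * (nrm v0 ^+ 2 + ka).
  have e4 : C * (t1 + 2 * ((t + d / D) * c1)) = C * t1 + 2 * C * c1 * (t + d / D) by ring.
  have e5 : rho / 2 * (nrm v0 ^+ 2 + ka) = rho / 2 * nrm v0 ^+ 2 + 4 * d by rewrite /d; field.
  rewrite e4 in lsc; rewrite e5.
  move: en h3 lsc mono Ct1 tE; set q1 := rho / 2 * nrm (ut k t) ^+ 2; set q2 := rho / 2 * nrm v0 ^+ 2.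
  set q3 := PDr (eps k) (u k t); set q4 := PDr (eps k) u0; set q5 := PDr es u0; set q6 := PDr (m%:R * eps k) (u k t).
  set q7 := C * t1; set q8 := B * vmax * t; set q9 := 2 * C * c1 * (t + d / D).
  exact: kinetic_arith.
by rewrite ler_pM2l in fin; rewrite ?divr_gt0.
Unshelve. all: by end_near.
Qed.

(** v0 itself is no admissible test, so it is replaced by a Lipschitz psi fixed before k. The error
    is charged to the uniform velocity bound, and the Lipschitz constant of psi enters only a term
    of order s^2 in the pairing with psi, absorbed by taking s small. *)
Lemma velocity_bound (e : R) : 0 < e -> exists2 m : R, 0 < m & \forall k \near \oo,
  forall s, 0 <= s <= T -> s < m -> nrm (u k s - u0 - s *: v0) <= e * s.
Proof.
move=> e0; pose N0 := nrm v0; have N00 : 0 <= N0 by exact: nrm_ge0.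
have vm := vmax_ge0.
pose g : R := vmax + N0 + 1; have g0 : 0 < g by rewrite /g; lra.
pose q : R := e ^+ 2 / 4.
have q0 : 0 < q by rewrite divr_gt0// exprn_gt0.
(* The distance from psi to v0 is multiplied by the velocity bound plus the norm of v0, both
   contained in g. *)
pose k' : R := q / (2 * g); have k'0 : 0 < k' by rewrite divr_gt0// mulr_gt0.
have [psi [Lp Lp0 [pl pS hpsi pk]]] := lipschitz_fields_dense oS Sr r0 Sc hv0 M0 v0M v0S k'0.
have pr x : ~ rV_box 0 r x -> psi x = 0 by move=> nr; apply: pS => /Sr.
pose Cp : R := (B * nrm psi + Lp * Emax + Lp * (fp0 * MJ * (2 * (r + 1)) ^+ n)) / rho.
have Cp0 : 0 <= Cp.
  have MJ0 : 0 <= MJ by exact: le_trans (kok_ge0 hk 0) (kok_le hk 0).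
  have f0 := ltW (pok_fp0 hp); have n0 := nrm_ge0 psi; have E0 := Emax_ge0.
  have v1 : 0 <= (2 * (r + 1)) ^+ n by apply: exprn_ge0; rewrite mulr_ge0// addr_ge0.
  exact: (divr_ge0 (addr_ge0 (addr_ge0 (mulr_ge0 B0 n0) (mulr_ge0 Lp0 E0)) (mulr_ge0 Lp0 (mulr_ge0 (mulr_ge0 f0 MJ0) v1))) (ltW rho0)).
have [m m0 hm] := kinetic_le q0.
exists (Num.min m (q / (2 * Cp + 1))).
  by rewrite lt_min m0 divr_gt0//; lra.
near=> k => s sT; rewrite lt_min => /andP[sm sq]; have /andP[s0 s1] := sT.
have kin : forall t, 0 <= t <= T -> t < m -> nrm (ut k t) ^+ 2 <= N0 ^+ 2 + q by near: k.
have ek1 : eps k <= 1 by near: k; exact: epsc.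
have weak := evo_weak n2 hp hk (he k) ek1 sT Lp0 pl r0 pr pS hpsi (Ebound_le k).
rewrite u00 ut0 -/Cp in weak.
have hus := evo_u (he k) sT.
have hw := L2fB hus hu0.
pose w := u k s - u0.
have w1 : nrm w ^+ 2 <= s ^+ 2 * (N0 ^+ 2 + q).
  have : nrm w <= Num.sqrt (N0 ^+ 2 + q) * s.
    rewrite /w -{1}(u00 k) -[X in _ * X]subr0.
    apply: (ndiff_bound (evo_u (he k)) (evo_ut (he k)) (evo_d (he k)) (lexx 0) s0 s1 (sqrtr_ge0 _)).
    move=> t /andP[t0 ts]; rewrite -[nrm _]ger0_norm ?nrm_ge0// -sqrtr_sqr; apply: ler_wsqrtr; apply: kin.
      by rewrite t0 (le_trans ts).
    exact: le_lt_trans ts sm.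
  move=> h; apply: (@le_trans _ _ ((Num.sqrt (N0 ^+ 2 + q) * s) ^+ 2)).
    by rewrite lerXn2r ?nnegrE ?nrm_ge0// (le_trans (nrm_ge0 w)).
  by rewrite exprMn sqr_sqrtr ?addr_ge0 ?sqr_ge0 ?(ltW q0)// mulrC.
have wn : nrm w <= vmax * s.
  rewrite /w -{1}(u00 k); apply: le_trans (u_lip k sT T00) _; by rewrite subr0 ger0_norm.
have hvp := L2fB hv0 hpsi.
have hsv := L2fZ s hv0.
have hws := L2fB hw hsv.
have E1 : ip w v0 = ip w (v0 - psi) + ip (w - s *: v0) psi + s * (N0 ^+ 2 - ip v0 (v0 - psi)).
  rewrite (ipBl hw hsv hpsi) (ipZl s hv0 hpsi) (ipBr hv0 hpsi hw) (ipBr hv0 hpsi hv0) /N0 sqr_nrm; ring.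
have i1 : - (vmax * s * k') <= ip w (v0 - psi).
  rewrite lerNl; apply: le_trans (ler_norm _) _; rewrite normrN.
  by apply: le_trans (CauchySchwarz hw hvp) _; apply: ler_pM => //; exact: nrm_ge0.
have i2 : - (Cp * s ^+ 2) <= ip (w - s *: v0) psi.
  by rewrite lerNl; apply: le_trans (ler_norm _) _; rewrite normrN.
have i3 : ip v0 (v0 - psi) <= N0 * k'.
  by apply: le_trans (ip_le hv0 hvp) _; apply: ler_wpM2l.
have i3s := ler_wpM2l s0 i3.
have E2 : nrm (w - s *: v0) ^+ 2 = nrm w ^+ 2 - 2 * (s * ip w v0) + s ^+ 2 * N0 ^+ 2.
  have := sqr_nrmD hw (L2fN hsv); rewrite -/w => ->.
  rewrite nrmN (nrmZ s hv0) -(ipC (- (s *: v0))) (ipNl hsv hw) (ipZl s hv0 hw) (ipC v0 w) exprMn real_normK ?num_real//.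
  by rewrite /N0; ring.
have fin : nrm (w - s *: v0) ^+ 2 <= s ^+ 2 * e ^+ 2.
  have gk : g * k' = q / 2 by rewrite /k'; field; rewrite gt_eqF.
  have j1 : s * (s * (g * k')) = s ^+ 2 * (q / 2) by rewrite gk; ring.
  have lb : s * (N0 ^+ 2) - vmax * s * k' - Cp * s ^+ 2 - s * (N0 * k') <= ip w v0.
    rewrite E1; lra.
  have lbs := ler_wpM2l s0 lb.
  have Cs : Cp * s <= q / 2.
    have c2 : 0 < 2 * Cp + 1 by lra.
    have : s * (2 * Cp + 1) <= q by rewrite -ler_pdivlMr// ltW.
    rewrite mulrDr mulr1 => h; have e9 : s * (2 * Cp) = 2 * (Cp * s) by ring.
    lra.
  have Css : s ^+ 2 * (Cp * s) <= s ^+ 2 * (q / 2) by apply: ler_wpM2l => //; exact: sqr_ge0.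
  have k's : 0 <= s ^+ 2 * k' by rewrite mulr_ge0 ?sqr_ge0// ltW.
  rewrite E2.
  have x1 : s * (s * N0 ^+ 2 - vmax * s * k' - Cp * s ^+ 2 - s * (N0 * k')) =
    s ^+ 2 * N0 ^+ 2 - (s * (s * (g * k')) - s ^+ 2 * k') - s ^+ 2 * (Cp * s) by rewrite /g; ring.
  rewrite x1 j1 in lbs.
  have x2 : s ^+ 2 * e ^+ 2 = 4 * (s ^+ 2 * q) by rewrite /q; field.
  have x3 : s ^+ 2 * (N0 ^+ 2 + q) = s ^+ 2 * N0 ^+ 2 + s ^+ 2 * q by ring.
  have x4 : s ^+ 2 * (q / 2) = s ^+ 2 * q / 2 by ring.
  have x5 : 0 <= s ^+ 2 * q by rewrite mulr_ge0 ?sqr_ge0// ltW.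
  rewrite x2; rewrite x3 in w1; rewrite x4 in lbs Css.
  move: w1 lbs Css k's x5; set y1 := nrm w ^+ 2; set y2 := s * ip w v0; set y3 := s ^+ 2 * N0 ^+ 2.
  set y4 := s ^+ 2 * q; set y5 := s ^+ 2 * (Cp * s); set y6 := s ^+ 2 * k'.
  exact: velocity_arith.
rewrite -(@ler_pXn2r _ 2)// ?nnegrE ?nrm_ge0// ?mulr_ge0 ?(ltW e0)//.
by rewrite exprMn mulrC.
Unshelve. all: by end_near.
Qed.

Theorem limit_exists : exists phi : nat -> nat, {homo phi : m k / (m < k)%N} /\
  exists ul : R -> V -> V,
  [/\ forall t, 0 <= t <= T -> L2f (ul t) /\ forall x, ~ S x -> ul t x = 0,
      forall e : R, 0 < e -> \forall k \near \oo, forall t, 0 <= t <= T -> nrm (u (phi k) t - ul t) <= e,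
      {ae leb, forall x, ul 0 x = u0 x} &
      forall e : R, 0 < e -> exists2 m : R, 0 < m & forall s, 0 <= s <= T -> s < m ->
        nrm (ul s - ul 0 - s *: v0) <= e * s].
Proof.
have uL k t : 0 <= t <= T -> L2f (u k t) by move=> tT; exact: (evo_u (he k) tT).
have ur k t x : 0 <= t <= T -> ~ rV_box 0 r x -> u k t x = 0.
  by move=> tT nr; apply: uS => // /Sr.
have [phi [hphi [ul [hul conv]]]] := compactness n2 hp hk hJ T0 vmax_ge0 Emax_ge0 M0 r0 eps0 epsc uL uM ur PDr_u_le u_lip.
exists phi; split => //.
have mS : measurable S by exact: open_measurable_rV.
have mI : mfunT (\1_S : V -> R) by exact: measurable_indic.
(* Multiplication by the indicator of S makes the limit vanish at every point outside S. It does not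
   increase the distance to the fields u k t, which vanish there. *)
pose mk (w : V -> V) (x : V) : V := \1_S x *: w x.
have hmk w : L2f w -> L2f (mk w) /\ nrm (mk w) <= nrm w.
  move=> hw; apply: nrm_le; [exact: nrm_ge0|by apply: measurable_rVZ => //; exact: L2f_measurable|].
  rewrite -(nrmE hw); apply: ge0_le_integralT => x; first exact: sqL2_ge0.
  rewrite /sqL2 lee_fin /mk indicE; case: (x \in S); first by rewrite scale1r.
  by rewrite scale0r dot0l dot_ge0.
have {hul} {conv} [hul conv ulS] : [/\ forall t, 0 <= t <= T -> L2f (mk (ul t)),
    forall e : R, 0 < e -> \forall k \near \oo, forall t, 0 <= t <= T -> nrm (u (phi k) t - mk (ul t)) <= e &
    forall t x, ~ S x -> mk (ul t) x = 0].
  split; first by move=> t tT; have [] := hmk _ (hul t tT).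
    move=> e e0; have [K _ hK] := conv e e0; exists K => // k Kk t tT; apply: le_trans (hK k Kk t tT).
    have hw := L2fB (uL (phi k) t tT) (hul t tT); have [_] := hmk _ hw; congr (nrm _ <= _).
    apply/funext => x; rewrite -[RHS]/(u (phi k) t x - mk (ul t) x) /mk -[LHS]/(\1_S x *: (u (phi k) t x - ul t x)).
    rewrite scalerBr; congr (_ - _); rewrite indicE; have [Sx|Sx] := pselect (S x).
      by rewrite mem_set// scale1r.
    by rewrite memNset// scale0r uS.
  by move=> t x Sx; rewrite /mk indicE memNset// scale0r.
pose ul2 t := mk (ul t).
have {}hul t : 0 <= t <= T -> L2f (ul2 t) by exact: hul.
have {}ulS t x : ~ S x -> ul2 t x = 0 by exact: ulS.
have {}conv e : 0 < e -> \forall k \near \oo, forall t, 0 <= t <= T -> nrm (u (phi k) t - ul2 t) <= e by exact: conv.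
exists ul2; clearbody ul2; clear ul; rename ul2 into ul.
have phik k : (k <= phi k)%N by elim: k => // k IH; apply: leq_ltn_trans IH (hphi _ _ (ltnSn k)).
have z0 : nrm (u0 - ul 0) = 0.
  apply/eqP; rewrite eq_le nrm_ge0 andbT; apply/ler_addgt0Pr => e e0; rewrite add0r.
  have [K _ hK] := conv e e0; have := hK K (leqnn K) 0 T00.
  by rewrite u00.
have hul0 := hul 0 T00.
have L0 := L2fB hu0 hul0.
split => //.
    by move=> t tT; split; [exact: hul|exact: ulS].
  have := nrm_eq0 L0 z0; apply: filterS => x.
  by rewrite -[LHS]/(u0 x - ul 0 x) => /subr0_eq.
move=> e e0; have [m m0 hm] := velocity_bound e0.
exists m => // s sT sm; apply/ler_addgt0Pr => d d0.
near \oo => k.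
have c1 : forall t, 0 <= t <= T -> nrm (u (phi k) t - ul t) <= d by near: k; exact: conv.
have c2 : nrm (u (phi k) s - u0 - s *: v0) <= e * s.
  have : forall s, 0 <= s <= T -> s < m -> nrm (u (phi k) s - u0 - s *: v0) <= e * s.
    near: k; move: hm => [K _ hK]; exists K => // k Kk; apply: hK => /=; exact: leq_trans (phik k).
  by apply.
have hus := uL (phi k) s sT; have huls := hul s sT.
have hsv := L2fZ s hv0.
have hA := L2fB (L2fB hus hu0) hsv.
have hB := L2fB huls hus.
have E : ul s - ul 0 - s *: v0 = (ul s - u (phi k) s) + ((u (phi k) s - u0 - s *: v0) + (u0 - ul 0)).
  apply/funext => x; rewrite -[LHS]/(ul s x - ul 0 x - s *: v0 x).
  rewrite -[RHS]/((ul s x - u (phi k) s x) + ((u (phi k) s x - u0 x - s *: v0 x) + (u0 x - ul 0 x))).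
  by apply/rowP => i; rewrite !mxE; ring.
rewrite E; apply: le_trans (ler_nrmD hB (L2fD hA L0)) _.
have h1 := ler_nrmD hA L0; rewrite z0 addr0 in h1.
have h2 := c1 s sT; rewrite nrmBC in h2.
by rewrite addrC; apply: lerD => //; exact: le_trans h1 c2.
Unshelve. all: by end_near.
Qed.

End limit_evolution.

(** * Geometry of the boundary layer *)

Section geometry.
Context (R : realType) (n : nat).
Local Notation V := 'rV[R]_n.

(** Otherwise the segment from x to y has a first point outside D. It belongs to closure D [\] D and
    is at distance at most a from x, which puts x in the boundary layer. *)
Lemma interior_ball (D : set V) (a : R) x y : open D -> interior_part D a x -> enorm (y - x) <= a -> D y.
Proof.
move=> oD [Dx nb] ya; apply: contrapT => nDy.
pose g (s : R) : V := x + s *: (y - x); pose L := enorm (y - x) + 1.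
have L0 : 0 < L by rewrite ltr_wpDl// enorm_ge0.
have gL s t : enorm (g s - g t) = `|s - t| * enorm (y - x).
  by rewrite /g opprD addrACA subrr add0r -scalerBl enormZ.
pose A : set R := [set s | 0 <= s <= 1 /\ ~ D (g s)].
have A1 : A 1 by split; [rewrite ler01 lexx|rewrite /g scale1r addrC subrK].
have Al : lbound A 0 by move=> s [/andP[]].
have hA : has_inf A by split; [exists 1|exists 0].
set s0 := inf A.
have s00 : 0 <= s0 by apply: lb_le_inf; [exists 1|].
have s01 : s0 <= 1 by apply: ge_inf; [exists 0|].
have opn z : D z -> exists2 m : R, 0 < m & forall z' : V, enorm (z' - z) < m -> D z'.
  move=> Dz; have /nbhs_ballP[m /= m0 hm] : nbhs z D by exact: open_nbhs_nbhs.
  exists m => // z' h; apply: hm; rewrite -ball_normE/= distrC.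
  exact: le_lt_trans (ler_norm_enorm _) h.
have nDs : ~ D (g s0).
  move=> /opn[m m0 hm].
  have mL : 0 < m / L by rewrite divr_gt0.
  have [s [/andP[sa sb] nDg] slt] := inf_adherent mL hA.
  have ss : s0 <= s by apply: ge_inf; [exists 0|split => //; rewrite sa sb].
  apply: nDg; apply: hm; rewrite gL ger0_norm ?subr_ge0//.
  have d0 : s - s0 < m / L by rewrite ltrBlDl.
  apply: (@le_lt_trans _ _ ((s - s0) * L)).
    by apply: ler_wpM2l; [rewrite subr_ge0|rewrite lerDl].
  by rewrite -ltr_pdivlMr.
have s0p : 0 < s0.
  by rewrite lt_neqAle s00 andbT; apply/eqP => s0E; apply: nDs; rewrite -s0E /g scale0r addr0.
apply: nb; split => //; exists (g s0); split; last first.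
  have -> : g s0 - x = g s0 - g 0 by rewrite /g scale0r addr0.
  rewrite gL subr0 ger0_norm//; apply: le_trans ya; rewrite -[leRHS]mul1r.
  by apply: ler_wpM2r => //; exact: enorm_ge0.
split => // B /nbhs_ballP[m /= m0 hm].
pose t : R := Num.min s0 (m / (2 * L)).
have mL : 0 < m / (2 * L) by rewrite divr_gt0// mulr_gt0.
have t0 : 0 < t by rewrite lt_min s0p.
have [ts tm] : t <= s0 /\ t <= m / (2 * L) by rewrite !ge_min !lexx orbT.
exists (g (s0 - t)); split.
  apply: contrapT => nD; have : s0 <= s0 - t.
    apply: ge_inf; [by exists 0|split => //]; apply/andP; split; first by rewrite subr_ge0.
    by apply: le_trans s01; rewrite gerBl ltW.
  by rewrite lerBrDr gerDl leNgt t0.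
apply: hm; rewrite -ball_normE/=; apply: le_lt_trans (ler_norm_enorm _) _.
rewrite gL opprB addrC subrK ger0_norm ?ltW//.
apply: (@le_lt_trans _ _ (m / (2 * L) * L)).
  by apply: ler_pM; [exact: ltW|exact: enorm_ge0|exact: tm|rewrite lerDl].
have -> : m / (2 * L) * L = m / 2 by field; rewrite gt_eqF.
by rewrite ltr_pdivrMr// ltr_pMr// ltr1n.
Qed.

Lemma bounded_box (D : set V) : bounded_set D -> exists2 r : R, 0 <= r & D `<=` rV_box 0 r.
Proof.
move=> [M [Mr hM]]; exists (`|M| + 1); first by rewrite addr_ge0.
move=> x Dx i; rewrite mxE subr0; apply: le_trans (ler_coord_norm _ _) _.
by apply: (hM (`|M| + 1)) => //; apply: le_lt_trans (ler_norm _) _; rewrite ltrDl.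
Qed.

Lemma compact_box (r : R) : compact (rV_box (0 : V) r).
Proof.
have -> : rV_box (0 : V) r = [set v : V | forall i, (`[- r, r]%classic : set R) (v ord0 i)].
  by apply/seteqP; split => v h i; have := h i; rewrite /= in_itv/= mxE subr0 ler_norml.
by apply: (@rV_compact R n (fun=> `[- r, r]%classic)) => i; exact: segment_compact.
Qed.

(** The set closure D [\] D is compact, so its distance to a point of the interior part is attained
    and strictly larger than a. The inequality survives small displacements. *)
Lemma interior_open (D : set V) (a : R) : open D -> bounded_set D -> open (interior_part D a).
Proof.
move=> oD bD; have [r r0 Dr] := bounded_box bD.
have hV : hausdorff_space V by exact: norm_hausdorff.
have cb : closed (rV_box (0 : V) r) by apply: (compact_closed hV); exact: compact_box.
pose F : set V := closure D `\` D.
have Fb : F `<=` rV_box 0 r.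
  move=> x [cx _]; rewrite ((closure_id _).1 cb); exact: (closure_subset Dr).
have cF : compact F.
  apply: (@subclosed_compact _ F (rV_box 0 r)) => //; last exact: compact_box.
  by apply: closedI; [exact: closed_closure|exact: open_closedC].
have cf x : continuous (fun y : V => enorm (y - x)).
  apply: (@lipschitz_continuous_rV _ _ _ 1) => y z; rewrite mul1r.
  by apply: le_trans (enorm_lipschitz _ _) _; rewrite opprB addrA subrK.
rewrite openE => x [Dx nb]; rewrite /interior.
have [m m0 hm] : exists2 m : R, 0 < m & forall y, F y -> a + m <= enorm (y - x).
  have [[y0 Fy0]|F0] := pselect (exists y, F y); last first.
    by exists 1 => // y Fy; exfalso; apply: F0; exists y.
  have [c Fc hc] := @compact_EVT_min _ _ (fun y : V => enorm (y - x)) F (ex_intro _ y0 Fy0) cF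
    (continuous_subspaceT (cf x)).
  have ac : a < enorm (c - x).
    rewrite ltNge; apply/negP => h; apply: nb; split => //; exists c; split => //.
    by have := Fc; rewrite inE.
  exists (enorm (c - x) - a); first by rewrite subr_gt0.
  by move=> y Fy; rewrite addrC subrK; apply: hc; rewrite inE.
have /nbhs_ballP[m' /= m'0 hm'] : nbhs x D by exact: open_nbhs_nbhs.
pose q : R := Num.min m' (m / (2 * (n%:R + 1))).
have n1 : 0 < n%:R + 1 :> R by rewrite ltr_wpDl.
have q0 : 0 < q by rewrite lt_min m'0 divr_gt0// mulr_gt0.
apply/nbhs_ballP; exists q => //= y xy.
have [qm qn] : q <= m' /\ q <= m / (2 * (n%:R + 1)) by rewrite !ge_min !lexx orbT.
split; first by apply: hm'; exact: le_ball xy.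
move=> [_ [z [Fz za]]]; have := hm z Fz.
have xy' : enorm (y - x) <= m / 2.
  apply: le_trans (ler_enorm_norm _) _.
  move: xy; rewrite -ball_normE/= distrC => xy.
  apply: (@le_trans _ _ ((n%:R + 1) * (m / (2 * (n%:R + 1))))).
    by apply: ler_pM => //; [rewrite lerDl|exact: le_trans (ltW xy) qn].
  by apply: le_of_eq; field; rewrite gt_eqF.
have := ler_enormD (z - y) (y - x); rewrite subrKA => h1 h2.
lra.
Qed.

End geometry.

(** * Almost everywhere equality and conversion of the hypotheses *)

Section lin_ae.
Context (R : realType) (n : nat).
Local Notation V := 'rV[R]_n.
Local Notation leb := (lebesgue_rV R n).

Lemma SI_ae (F1 F2 : V * V -> R) : mfunT F1 -> mfunT F2 ->
  (forall z, {ae leb, forall x, F1 (z, x) = F2 (z, x)}) -> SI F1 = SI F2.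
Proof.
move=> m1 m2 h; have md : mfunT (fun p => `|F1 p - F2 p|).
  by apply: (measurableT_comp (@normr_measurable _ setT)); apply: measurable_funB.
have I0 : (\int[@leb2 R n]_p (`|F1 p - F2 p|)%:E = 0)%E.
  rewrite II_prod// /II integral0_eq// => z _.
  have mz : mfunT (fun x => `|F1 (z, x) - F2 (z, x)|).
    exact: (measurableT_comp md (measurable_pair1 z)).
  have -> : (\int[leb]_x (`|F1 (z, x) - F2 (z, x)|)%:E = \int[leb]_x ((fun=> 0 : R) x)%:E)%E; last by rewrite integral0.
  apply: rint_ae_eq => //.
  by apply: filterS (h z) => x ->; rewrite subrr normr0.
have md' : mfunT (fun p => (F1 p - F2 p)%:E).
  by apply/measurable_EFinP; apply: measurable_funB.
have /(ae_eq_integral_abs _ measurableT md') hz : (\int[@leb2 R n]_p `|(F1 p - F2 p)%:E| = 0)%E by exact: I0.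
rewrite /SI /Rintegral; congr fine; apply: ae_eq_integral => //; [exact/measurable_EFinP|exact/measurable_EFinP|].
apply: filterS hz => p hp _; have := hp Logic.I => /= /eqP; rewrite eqe subr_eq0 => /eqP ->//.
Qed.

Variables (f f1 : R -> R) (fp0 finf : R) (Jn : V -> R) (MJ : R).
Hypothesis n2 : (2 <= n)%N.
Hypothesis hp : pot_ok f f1 fp0 finf.
Hypothesis hk : ker_ok Jn MJ.

Lemma ae_translate (P : V -> Prop) (h : V) : {ae leb, forall x, P x} -> {ae leb, forall x, P (x + h)}.
Proof.
move=> [A [mA A0 hA]]; exists [set x | A (x + h)].
have mh : mfunT (fun x : V => x + h) by mfun.
have mA' : measurable [set x | A (x + h)].
  by have := mh measurableT _ mA; rewrite setTI.
split => //; last by move=> x hx; apply: hA.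
rewrite -(@rint_indic _ _ _ leb _ mA').
have mI : mfunT (\1_A : V -> R) by exact: measurable_indic.
have I0 (x : V) : 0 <= \1_A x :> R by exact: indic_ge0.
have := rint_translate h mI I0.
have -> : (\int[leb]_v (\1_A v : R)%:E = 0)%E by rewrite rint_indic.
by move=> <-; apply: eq_integral => x _; rewrite !indicE.
Qed.

Lemma Lin_ae e u v psi : mfunT u -> mfunT v -> mfunT psi ->
  {ae leb, forall x, u x = v x} -> Lin f1 Jn e u psi = Lin f1 Jn e v psi.
Proof.
move=> mu mv mp uv; rewrite /Lin; congr (_ * _); apply: SI_ae.
- by apply: measurable_funM; [exact: (measurable_PDk hp hk)|exact: measurable_dlt].
- by apply: measurable_funM; [exact: (measurable_PDk hp hk)|exact: measurable_dlt].
move=> z; apply: filterS2 uv (ae_translate (e *: z) uv) => x h1 h2.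
by rewrite /PDk /dlt/= h1 h2.
Qed.

End lin_ae.

Section conversions.
Context (R : realType) (n : nat).
Local Notation V := 'rV[R]_n.
Local Notation leb := (lebesgue_rV R n).
Variables (D : set V) (a T : R).
Hypothesis mD : measurable D.

Lemma interior_sub : interior_part D a `<=` D. Proof. by move=> x []. Qed.

Lemma L20_L2f w : L20 D a w -> L2f w /\ {ae leb, forall x, ~ interior_part D a x -> w x = 0}.
Proof.
move=> [mw w2 wS]; split => //; split => //.
have wD : {ae leb, forall x, ~ D x -> w x = 0} by apply: filterS wS => x h nD; apply: h => /interior_sub.
by rewrite -(L2norm_nrm mD mw wD).1.
Qed.

Lemma L2norm_eq w : L2f w -> {ae leb, forall x, ~ interior_part D a x -> w x = 0} -> L2norm D w = (nrm w)%:E.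
Proof.
move=> hw wS; apply: (L2norm_nrm mD (L2f_measurable hw) _).2 => //.
by apply: filterS wS => x h nD; apply: h => /interior_sub.
Qed.

Lemma L2f_L20 w : L2f w -> {ae leb, forall x, ~ interior_part D a x -> w x = 0} -> L20 D a w.
Proof.
by move=> hw wS; split => //; [exact: L2f_measurable|rewrite (L2norm_eq hw wS) ltry].
Qed.

Lemma near_itv_lt (F : R -> \bar R) (t e : R) : F s @[s --> within `[0, T] (nbhs t)] --> 0%E -> 0 < e ->
  exists2 m : R, 0 < m & forall s, 0 <= s <= T -> `|s - t| < m -> (F s < e%:E)%E.
Proof.
move=> h e0; have : within `[0, T] (nbhs t) (fun s => F s < e%:E)%E.
  by apply: (cvge0_lt h e0); exact: within_filter.
move=> /nbhs_ballP[m /= m0 hm]; exists m => // s sT st.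
by apply: hm; rewrite /= ?in_itv//= -ball_normE/= distrC.
Qed.

Lemma near_itv_lt' (F : R -> \bar R) (t e : R) : F s @[s --> within `[0, T] t^'] --> 0%E -> 0 < e ->
  exists2 m : R, 0 < m & forall s, 0 <= s <= T -> s != t -> `|s - t| < m -> (F s < e%:E)%E.
Proof.
move=> h e0; have : within `[0, T] t^' (fun s => F s < e%:E)%E.
  by apply: (cvge0_lt h e0); exact: within_filter.
move=> /nbhs_ballP[m /= m0 hm]; exists m => // s sT sn st.
by apply: hm; rewrite /= ?in_itv//= -ball_normE/= distrC.
Qed.

Lemma C1_L20_ndiff w w1 : C1_L20 D a T w w1 -> [/\ forall t : R, 0 <= t <= T -> L20 D a (w t),
  forall t : R, 0 <= t <= T -> L20 D a (w1 t), ndiff T w w1 &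
  forall t dl : R, 0 <= t <= T -> 0 < dl -> exists2 m : R, 0 < m &
    forall s : R, 0 <= s <= T -> `|s - t| < m -> nrm (w1 s - w1 t) <= dl].
Proof.
move=> [h c]; have h0 t : 0 <= t <= T -> [/\ L20 D a (w t), L20 D a (w1 t) & L2_derivative_at D T w t (w1 t)].
  by move=> tT; apply: h; rewrite in_itv.
split; [by move=> t /h0[]|by move=> t /h0[]| |].
  move=> t dl tT dl0; have [Lt L1t hd] := h0 t tT.
  have [m m0 hm] := near_itv_lt' hd dl0; exists m => // s sT st.
  have [->|sn] := eqVneq s t.
    rewrite !subrr scale0r subr0 normr0 mulr0 /nrm /ip.
    by rewrite (_ : (fun x => _) = cst 0) ?Rintegral_cst// ?mul0r ?sqrtr0//; apply/funext => x; rewrite /= dot0l.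
  have [Ls _ _] := h0 s sT.
  have [L2s as_] := L20_L2f Ls; have [L2t at_] := L20_L2f Lt; have [L21 a1] := L20_L2f L1t.
  have hq := L2fB (L2fZ (s - t)^-1 (L2fB L2s L2t)) L21.
  have := hm s sT sn st.
  rewrite -[X in L2norm D X]/((s - t)^-1 *: (w s - w t) - w1 t) (L2norm_eq hq); last first.
    apply: filterS3 as_ at_ a1 => x e1 e2 e3 nS.
    by rewrite -[LHS]/((s - t)^-1 *: (w s x - w t x) - w1 t x) e1// e2// e3// subrr scaler0 subr0.
  rewrite lte_fin => hlt; have st0 : s - t != 0 by rewrite subr_eq0.
  have -> : w s - w t - (s - t) *: w1 t = (s - t) *: ((s - t)^-1 *: (w s - w t) - w1 t).
    by rewrite scalerBr scalerA mulfV// scale1r.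
  by rewrite nrmZ// mulrC; apply: ler_wpM2r => //; exact: ltW.
move=> t dl tT dl0; have tT' : t \in `[0, T] by rewrite in_itv.
have [m m0 hm] := near_itv_lt (c t tT') dl0; exists m => // s sT st.
have [_ L1t _] := h0 t tT; have [_ L1s _] := h0 s sT.
have [L2s as_] := L20_L2f L1s; have [L2t at_] := L20_L2f L1t.
have := hm s sT st; rewrite -[X in L2norm D X]/(w1 s - w1 t) (L2norm_eq (L2fB L2s L2t)).
  by rewrite lte_fin => /ltW.
by apply: filterS2 as_ at_ => x e1 e2 nS; rewrite -[LHS]/(w1 s x - w1 t x) e1// e2// subrr.
Qed.

Lemma nrm_bounded (w : R -> V -> V) : 0 < T -> (forall t : R, 0 <= t <= T -> L2f (w t)) ->
  (forall t dl : R, 0 <= t <= T -> 0 < dl -> exists2 m : R, 0 < m &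
    forall s : R, 0 <= s <= T -> `|s - t| < m -> nrm (w s - w t) <= dl) ->
  exists2 B : R, 0 <= B & forall t : R, 0 <= t <= T -> nrm (w t) <= B.
Proof.
(* Time is clamped to [0, T], so that the norm becomes a continuous function on the whole line and
   attains its maximum on the interval. *)
move=> T0 hw hc; pose cl (t : R) : R := Num.max 0 (Num.min t T).
have clT t : 0 <= cl t <= T.
  by rewrite /cl le_max lexx/= ge_max (ltW T0)/= ge_min lexx orbT.
have clE t : 0 <= t <= T -> cl t = t.
  by move=> /andP[t0 tT]; rewrite /cl min_l// max_r.
have cl1 s t : `|cl s - cl t| <= `|s - t|.
  rewrite /cl; apply: (@le_trans _ _ `|Num.min s T - Num.min t T|).
    set p := Num.min s T; set q := Num.min t T; clearbody p q.
    by rewrite /Num.max; case: ifPn => ?; case: ifPn => ?; rewrite ?ler_norml ?real_ltNge ?num_real//;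
      have := ler_norm (p - q); have := ler_norm (q - p); rewrite distrC => ? ?; lra.
  rewrite /Num.min; case: ifPn => ?; case: ifPn => ?; rewrite ?ler_norml;
      have := ler_norm (s - t); have := ler_norm (t - s); rewrite distrC => ? ?; lra.
have cg : continuous (fun t => nrm (w (cl t))).
  move=> t; apply/cvgrPdist_le => e e0; have [m m0 hm] := hc _ _ (clT t) e0.
  apply/nbhs_ballP; exists m => //= s st0; have st : `|s - t| < m by rewrite distrC.
  rewrite distrC; apply: le_trans (ler_nrm_dist (hw _ (clT s)) (hw _ (clT t))) _.
  by apply: hm => //; exact: le_lt_trans (cl1 _ _) st.
have [c _ hmax] := EVT_max (ltW T0) (continuous_subspaceT cg).
exists (nrm (w (cl c))); first exact: nrm_ge0.
by move=> t tT; have := hmax t; rewrite in_itv/= tT clE// => /(_ isT).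
Qed.

End conversions.

Lemma cvge0_of_le (R : realType) T (F : set_system T) {FF : Filter F} (X : T -> \bar R) :
  (forall x, (0 <= X x)%E) -> (forall e : R, 0 < e -> \forall x \near F, (X x <= e%:E)%E) -> X x @[x --> F] --> 0%E.
Proof.
move=> X0 h; apply/fine_cvgP; split.
  by apply: filterS (h 1 ltr01) => x hx; rewrite ge0_fin_numE//; apply: le_lt_trans hx _; rewrite ltry.
apply/cvgr0Pnorm_le => e e0; apply: filterS (h e e0) => x hx /=.
rewrite ger0_norm ?fine_ge0//; rewrite -lee_fin fineK// ge0_fin_numE//; apply: le_lt_trans hx _; by rewrite ltry.
Qed.

Lemma lty_bound (R : realType) (x : \bar R) : (x < +oo)%E -> exists2 M : R, 0 <= M & (x <= M%:E)%E.
Proof.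
case: x => [r| |] //; first by move=> _; exists `|r| => //; rewrite lee_fin ler_norm.
by move=> _; exists 0 => //; rewrite leNye.
Qed.

(** * Admissible representatives and the energy of the initial data *)

Section influence_moment.
Context (R : realType).

Lemma influence_moment_gt0 (J : R -> R) (m : nat) : influence_function J ->
  0 < \int[lebesgue_measure]_(r in `[0, 1]) (r ^+ m * J r).
Proof.
move=> [mJ J0 [K JK] J1 Jae]; set mu := @lebesgue_measure R.
have mA : measurable (`[0, 1]%classic : set R) by exact: measurable_itv.
have A0 (r : R) : `[0, 1]%classic r -> 0 <= r <= 1 by rewrite /= in_itv.
have mJA : measurable_fun (`[0, 1]%classic : set R) J.
  apply: measurable_funS mJ; first exact: measurable_itv.
  by move=> r /A0 /andP[r0 _]; rewrite /= in_itv/= r0.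
have mg : measurable_fun (`[0, 1]%classic : set R) (fun r => r ^+ m * J r).
  by apply: measurable_funM => //; apply: measurable_funTS; apply: measurable_funX; exact: measurable_id.
have g0 r : `[0, 1]%classic r -> 0 <= r ^+ m * J r.
  by move=> /A0 /andP[r0 _]; rewrite mulr_ge0 ?exprn_ge0 ?J0.
have ig : mu.-integrable `[0, 1] (EFin \o (fun r => r ^+ m * J r)).
  apply: measurable_bounded_integrable => //.
    suff : (lebesgue_measure (`[0%R, 1%R]%classic : set R) < +oo)%E by [].
    by rewrite lebesgue_measure_itv/= lte_fin ltr01 -EFinD ltry.
  exists K; split; first exact: num_real.
  move=> M KM r rA /=; rewrite ger0_norm ?g0//.
  have /andP[r0 r1] := A0 r rA; apply: le_trans (ltW KM); apply: le_trans (JK r r0).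
  by rewrite -[leRHS]mul1r ler_wpM2r ?J0// exprn_ile1.
rewrite lt_neqAle Rintegral_ge0 ?andbT//; apply/eqP => E.
apply: Jae; have I0 : (\int[mu]_(r in `[0%R, 1%R]) (r ^+ m * J r)%:E = 0)%E.
  by rewrite -[LHS]fineK; [rewrite -[fine _]E|exact: integrable_fin_num ig].
pose Jp := J \_ `[0, +oo[%classic.
have mJp : mfunT Jp.
  by apply/(measurable_restrictT _ _).1 => //; exact: measurable_itv.
have JpE (r : R) : 0 <= r -> Jp r = J r.
  by move=> r0; rewrite /Jp patchE mem_set//= in_itv/= andbT.
have mI : mfunT (\1_(`[0, 1]%classic) : R -> R) by exact: measurable_indic.
have : ae_eq (@lebesgue_measure R) setT
    (fun r => (\1_(`[0, 1]%classic) r * (r ^+ m * Jp r))%:E) (cst 0%E).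
  apply/ae_eq_integral_abs => //.
    apply/measurable_EFinP; apply: measurable_funM => //; apply: measurable_funM => //.
  transitivity (\int[@lebesgue_measure R]_(r in `[0%R, 1%R]) (r ^+ m * J r)%:E)%E; last exact: I0.
  rewrite [RHS]integral_mkcond; apply: eq_integral => r _; rewrite patchE indicE.
  case: ifPn => [/set_mem rA|_] /=; last by rewrite mul0r normr0.
  have /andP[r0 _] := A0 r rA.
  by rewrite mul1r JpE// ger0_norm// g0.
have hz : {ae @lebesgue_measure R, forall r, r != 0}.
  exists [set 0]; split => //; first exact: lebesgue_measure_set1.
  by move=> r /= /negP; rewrite negbK => /eqP.
have aeF : Filter (almost_everywhere (@lebesgue_measure R)).
  exact: (ae_filter_ringOfSetsType [the {measure set (measurableTypeR R) -> \bar R} of @lebesgue_measure R]).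
apply: (@filterS2 _ _ aeF _ _ _ _ hz) => r rn0 /(_ Logic.I) hr r0.
have [r1|r1] := leP 1 r; first exact: J1.
have rA : `[0, 1]%classic r by rewrite /= in_itv/= r0 ltW.
move: hr => -[] /eqP; rewrite indicE mem_set// mul1r JpE// mulf_eq0 expf_eq0 (negbTE rn0) andbF/= => /eqP.
by [].
Qed.

End influence_moment.

Section data.
Context (R : realType) (n : nat).
Local Notation V := 'rV[R]_n.
Local Notation leb := (lebesgue_rV R n).

Lemma hausdorff_measure_ge0 s (A : set V) : (0 <= hausdorff_measure s A)%E.
Proof.
apply: ereal_sup_ge => /=; exists (hausdorff_content s 1 A); first by exists 1.
apply: le_ereal_inf_tmp => _ [U [_ _] <-]; apply: nneseries_ge0 => i _ _.
apply: mule_ge0; first by rewrite lee_fin ltW// unit_ball_volume_gt0.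
by apply: expe_ge0; apply: mule_ge0 => //; exact: ediam_ge0.
Qed.

(** The moment of J is positive, hence so are the Lame constant and the toughness. Finiteness of a
    sum of two nonnegative terms then bounds both the measure of the jump set and the square of the
    density of the strain. *)
Lemma LEFM_energy_bounds (J : R -> R) (fp0 finf : R) (D : set V) (u : V -> V) (e : V -> 'M[R]_n) :
  (forall i j, mfunT ((fun x => e x i j) \_ D)) ->
  influence_function J -> 0 < fp0 -> 0 < finf -> (LEFM_energy J fp0 finf D u e < +oo)%E ->
  (hausdorff_measure n.-1 (jump_set D u) < +oo)%E /\
  exists2 E : R, 0 <= E & (\int[leb]_y (strain_sqr (fun i j => (fun x => e x i j) \_ D) y)%:E <= E%:E)%E.
Proof.
move=> me hJ f0 q0; rewrite /LEFM_energy.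
have m0 := influence_moment_gt0 n hJ.
have la0 : 0 < lame_constant n J fp0 by rewrite /lame_constant !mulr_gt0// invr_gt0.
have w0 := unit_ball_volume_gt0 R.
have g0 : 0 < fracture_toughness n J finf.
  by rewrite /fracture_toughness !mulr_gt0// invr_gt0.
set la := lame_constant n J fp0 in la0 *; set g := fracture_toughness n J finf in g0 *.
set A1 := (\int[leb]_(x in D) _)%E; set H := hausdorff_measure _ _.
have H0 : (0 <= H)%E by exact: hausdorff_measure_ge0.
have i0 x : 0 <= 2 * la * (\sum_i \sum_j (e x i j) ^+ 2) + la * (\tr (e x)) ^+ 2.
  apply: addr_ge0; last by rewrite mulr_ge0 ?sqr_ge0// ltW.
  apply: mulr_ge0; first by rewrite mulr_ge0// ltW.
  by apply: sumr_ge0 => i _; apply: sumr_ge0 => j _; exact: sqr_ge0.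
have A10 : (0 <= A1)%E by apply: integral_ge0 => x _; rewrite lee_fin.
have gH0 : (0 <= g%:E * H)%E by rewrite mule_ge0// lee_fin ltW.
move=> hlt; split.
  have : (g%:E * H < +oo)%E by apply: le_lt_trans hlt; exact: leeDr.
  rewrite !ltey; apply: contra => /eqP ->; by rewrite gt0_muley// lte_fin.
have A1f : (A1 < +oo)%E by apply: le_lt_trans hlt; exact: leeDl.
have [E E0 hE] := lty_bound A1f.
exists (E / (2 * la)); first by rewrite divr_ge0// mulr_ge0// ltW.
have l2 : 0 < 2 * la by rewrite mulr_gt0.
apply: (@le_trans _ _ (((2 * la)^-1)%:E * A1)%E); last first.
  by rewrite [E / _]mulrC (EFinM (2 * la)^-1 E); apply: lee_wpmul2l => //; rewrite lee_fin invr_ge0 ltW.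
set I0 := (\int[leb]_y _)%E; suff hI : ((2 * la)%:E * I0 <= A1)%E.
  have E1 : I0 = (((2 * la)^-1)%:E * ((2 * la)%:E * I0))%E by rewrite muleA -EFinM mulVf ?mul1e// gt_eqF.
  by rewrite E1; apply: lee_wpmul2l => //; rewrite lee_fin invr_ge0 ltW.
rewrite /I0 /A1 [X in (_ <= X)%E]integral_mkcond -rintZl; first last.
- by move=> y; exact: strain_sqr_ge0.
- exact: measurable_strain_sqr.
- exact: ltW.
apply: ge0_le_integralT => y; first by rewrite lee_fin mulr_ge0 ?strain_sqr_ge0// ltW.
rewrite patchE; case: ifPn => yD; last first.
  by rewrite lee_fin /strain_sqr big1 ?mulr0// => q _; rewrite patchE (negbTE yD) expr0n.
rewrite lee_fin; apply: le_trans (_ : 2 * la * (\sum_i \sum_j (e y i j) ^+ 2) <= _); last first.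
  by rewrite lerDl mulr_ge0 ?sqr_ge0// ltW.
rewrite /strain_sqr pair_bigA/=; apply: ler_wpM2l; first exact: ltW.
by apply: ler_sum => q _; rewrite patchE yD.
Qed.

(** A representative that is bounded by M and zero outside S at every point. It equals w almost
    everywhere when w has these properties almost everywhere. *)
Definition cut (S : set V) (M : R) (w : V -> V) (x : V) : V :=
  \1_(S `&` [set x | enorm (w x) <= M]) x *: w x.

Lemma cut_out S M w x : ~ S x -> cut S M w x = 0.
Proof. by move=> Sx; rewrite /cut indicE memNset ?scale0r// => -[]. Qed.

Lemma cut_le S M w x : 0 <= M -> enorm (cut S M w x) <= M.
Proof.
move=> M0; rewrite /cut indicE; case: (boolP (x \in _)) => [/set_mem[_ h]|_].
  by rewrite scale1r.
by rewrite scale0r enorm0.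
Qed.

Lemma measurable_cut S M w : measurable S -> mfunT w -> mfunT (cut S M w).
Proof.
move=> mS mw; have me : mfunT (fun x => enorm (w x)) by exact: measurable_enorm.
have mA : measurable (S `&` [set x | enorm (w x) <= M]).
  apply: measurableI => //; have := me measurableT _ (measurable_itv `]-oo, M]).
  by rewrite setTI; congr measurable; apply/seteqP; split => x; rewrite /= in_itv.
by apply: measurable_rVZ => //; exact: measurable_indic.
Qed.

Lemma cut_ae (S D : set V) M w : S `<=` D -> {ae leb, forall x, ~ S x -> w x = 0} ->
  {ae leb, forall x, D x -> enorm (w x) <= M} -> {ae leb, forall x, w x = cut S M w x}.
Proof.
move=> SD; apply: filterS2 => x h1 h2; rewrite /cut indicE.
have [Sx|Sx] := pselect (S x); last by rewrite h1// scaler0.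
by rewrite mem_set ?scale1r//; split => //; apply: h2; exact: SD.
Qed.

Lemma Linfnorm_ae (D : set V) w (M : R) : (Linfnorm D w <= M%:E)%E ->
  {ae leb, forall x, D x -> enorm (w x) <= M}.
Proof.
rewrite /Linfnorm unlock /=; case: ifPn => [_|]; last first.
  (* The case in which the whole space is null, excluded by the positive volume of the unit ball. *)
  rewrite -leNgt => h; exfalso; have := unit_ball_volume_gt0 R n.
  rewrite -lte_fin -unit_ball_volumeE ltNge => /negP; apply; apply: le_trans h.
  by apply: le_measure; rewrite ?inE//; exact: measurable_eball.
move=> /ess_supP; apply: filterS => x /= + Dx; rewrite patchE mem_set//.
by rewrite abse_EFin lee_fin ger0_norm ?enorm_ge0.
Qed.

Lemma ndiff_ae (T : R) (w w' w1 w1' : R -> V -> V) :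
  (forall t : R, 0 <= t <= T -> [/\ mfunT (w t), mfunT (w' t) & {ae leb, forall x, w t x = w' t x}]) ->
  (forall t : R, 0 <= t <= T -> [/\ mfunT (w1 t), mfunT (w1' t) & {ae leb, forall x, w1 t x = w1' t x}]) ->
  ndiff T w w1 -> ndiff T w' w1'.
Proof.
move=> h h1 hd t dl tT dl0; have [m m0 hm] := hd t dl tT dl0; exists m; first exact: m0.
move=> s sT st; have [m1 m2 a1] := h t tT; have [m3 m4 a2] := h s sT; have [m5 m6 a3] := h1 t tT.
have E : nrm (w s - w t - (s - t) *: w1 t) = nrm (w' s - w' t - (s - t) *: w1' t).
  apply: nrm_ae.
  - apply: measurable_rVB; first exact: measurable_rVB.
    by apply: measurable_rVZ => //; exact: measurable_cst.
  - apply: measurable_rVB; first exact: measurable_rVB.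
    by apply: measurable_rVZ => //; exact: measurable_cst.
  apply: filterS3 a1 a2 a3 => x e1 e2 e3.
  by rewrite -[LHS]/(w s x - w t x - (s - t) *: w1 t x) e1 e2 e3.
by rewrite -E; exact: (hm s sT st).
Qed.

End data.

(** The SBD hypotheses concern u0, whereas the increments are estimated for a representative v
    bounded at every point. The jump set is kept from u0, and only the volume integral in the
    definition of the strain is transferred, where a null set is invisible. The restriction eps <=
    a/2 keeps every bond shorter than a. *)
Lemma initial_energy_bound (R : realType) (n : nat) (D : set 'rV[R]_n) (a M : R) (f f1 J : R -> R) (fp0 finf MJ : R)
    (Jn : 'rV[R]_n -> R) (u0 v : 'rV[R]_n -> 'rV[R]_n) (e : 'rV[R]_n -> 'M[R]_n) :
  (2 <= n)%N -> pot_ok f f1 fp0 finf -> ker_ok Jn MJ -> influence_function J -> open D -> bounded_set D -> 0 < a ->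
  mfunT u0 -> L2f v -> (forall x, enorm (v x) <= M) -> (forall x, ~ interior_part D a x -> v x = 0) ->
  {ae lebesgue_rV R n, forall x, u0 x = v x} ->
  SBD_with_density D u0 e -> (LEFM_energy J fp0 finf D u0 e < +oo)%E ->
  exists2 P : R, 0 <= P & forall eps, 0 < eps -> eps <= a / 2 -> PDr f Jn eps v <= P.
Proof.
move=> n2 hp hk hJ oD bD a0 mu0 hv vM vS uv [mD _ ie [Ep [Em [hd _ hs]]]] hE.
have mv := L2f_measurable hv.
set leb := lebesgue_rV R n in ie *.
have p0 := pok_fp0 hp; have q0 := pok_finf hp.
pose e' (i j : 'I_n) : 'rV[R]_n -> R := (fun x => e x i j) \_ D.
have me i j : mfunT (e' i j).
  have h : measurable_fun D (fun x => e x i j) by apply/measurable_EFinP; exact: measurable_int (ie i j).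
  exact: ((measurable_restrictT _ mD).1 h).
have [hH [Eb Eb0 hEb]] := LEFM_energy_bounds me hJ p0 q0 hE.
have [C C0 hsh] := hausdorff_shadow n2 hH.
have [r r0 Dr] := bounded_box bD.
have Dfin : (leb D < +oo)%E.
  apply: (@le_lt_trans _ _ (leb (rV_box 0 r))); first by apply: le_measure; rewrite ?inE//; exact: measurable_rV_box.
  by rewrite lebesgue_rV_box// ltry.
have hl : leb D = (fine (leb D))%:E by rewrite fineK// ge0_fin_numE.
have [c c0 hc] := bump_mass R n.
have MJ0 : 0 <= MJ by exact: le_trans (kok_ge0 hk 0) (kok_le hk 0).
have Q0 : 0 <= finf * C + 4 * fp0 * Eb + 1.
  by rewrite !addr_ge0 ?mulr_ge0 ?(ltW q0) ?(ltW p0).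
exists (MJ * (finf * C + 4 * fp0 * Eb + 1)); first exact: mulr_ge0.
move=> eps eps0 epsa; apply: (PDr_increments n2 hp hk) => // h h0 he.
have ha : enorm h < a.
  apply: lt_trans he _; apply: le_lt_trans epsa _; by rewrite ltr_pdivrMr// ltr_pMr// ltr1n.
have [U [B [oU JU mB hB hUB]]] := hsh h h0.
have DsD (x y : 'rV[R]_n) : interior_part D a x -> enorm (y - x) <= a -> D y by exact: interior_ball.
have ie' i j : leb.-integrable D (EFin \o e' i j).
  apply: eq_integrable (ie i j) => // x xD; by rewrite /= /e' patchE xD.
have hsing i j A : measurable A -> A `<=` D `\` U -> fine (Ep i j A) - fine (Em i j A) = \int[leb]_(x in A) e' i j x.
  move=> mA AD; have := hs i j A mA (fun x Ax => conj (AD x Ax).1 (fun Jx => (AD x Ax).2 (JU x Jx))).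
  rewrite /singular_strain => /subr0_eq ->; apply: eq_Rintegral => x /set_mem Ax.
  by rewrite /e' patchE mem_set//; have [] := AD x Ax.
have hst i j phi : C1c D phi ->
    \int[Ep i j]_(x in D) phi x - \int[Em i j]_(x in D) phi x =
    - 2^-1 * \int[leb]_(x in D)
      (v x ord0 i * 'D_(delta_mx ord0 j) phi x + v x ord0 j * 'D_(delta_mx ord0 i) phi x).
  move=> hphi; rewrite hd//; congr (_ * _); rewrite /Rintegral; congr fine.
  have [_ cD _ _] := hphi.
  have mDp k : mfunT (fun x => 'D_(delta_mx ord0 k) phi x) by exact: continuous_measurable_rV.
  have mc (w : 'rV[R]_n -> 'rV[R]_n) k : mfunT w -> mfunT (fun x => w x ord0 k).
    by move=> mw; exact: ((measurable_fun_rVP _).1 mw k).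
  apply: ae_eq_integral => //.
  - by apply/measurable_EFinP; apply: measurable_funTS; apply: measurable_funD; apply: measurable_funM => //; exact: mc.
  - by apply/measurable_EFinP; apply: measurable_funTS; apply: measurable_funD; apply: measurable_funM => //; exact: mc.
  by apply: filterS uv => x -> _.
exact: (increments_bound hp hc c0 mD hl oU mv vM vS DsD r0 Dr hst me ie' hsing hEb mB hUB hB h0 ha).
Qed.

Theorem theorem1 (R : realType) (d : nat) (hd : d = 2%N \/ d = 3%N)
  (D : set 'rV[R]_d) (hD : bounded_domain D)
  (a : R) (ha : 0 < a)
  (f : R -> R) (fp0 finf rbar : R) (hf : cohesive_potential f fp0 finf rbar)
  (J : R -> R) (hJ : influence_function J)
  (rho T : R) (hrho : 0 < rho) (hT : 0 < T)
  (eps : nat -> R) (heps0 : forall k, 0 < eps k)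
  (hepsa : forall k, 2 * eps k < a) (heps : eps k @[k --> \oo] --> 0)
  (u0 v0 : 'rV[R]_d -> 'rV[R]_d)
  (hu0v0 : LEFM_initial_data J fp0 finf D a u0 v0)
  (b : R -> 'rV[R]_d -> 'rV[R]_d) (hb : exists bt, C1_L20 D a T b bt)
  (u : nat -> R -> 'rV[R]_d -> 'rV[R]_d)
  (hu : forall k, cohesive_evolution f J D a T rho (eps k) u0 v0 b (u k))
  (hsup : (ereal_sup (range (fun k =>
     ereal_sup [set Linfnorm D (u k t) | t in `[0%R, T]%classic])) < +oo)%E) :
  exists phi : nat -> nat, {homo phi : m n / (m < n)%N} /\
  exists ulim : R -> 'rV[R]_d -> 'rV[R]_d,
    [/\ forall t, t \in `[0, T] -> L20 D a (ulim t),
        ereal_sup [set L2norm D (u (phi k) t \- ulim t) | t in `[0, T]%classic]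
          @[k --> \oo] --> 0%E,
        {ae lebesgue_rV R d, forall x, ulim 0 x = u0 x} &
        L2_derivative_at D T ulim 0 v0].
Proof.
have n2 : (2 <= d)%N by case: hd => ->.
have n0 : (0 < d)%N by exact: ltnW.
have [_ oD _ bD] := hD; have mD := open_measurable_rV oD.
pose S := interior_part D a.
have oS : open S by exact: interior_open.
have mS := open_measurable_rV oS.
have SD : S `<=` D by exact: interior_sub.
have [r r0 Dr] := bounded_box bD.
have Sr : S `<=` rV_box 0 r by move=> x /SD /Dr.
have Sc : ~` S !=set0.
  exists (const_mx (r + 1)) => /Sr /(_ (Ordinal n0)); rewrite !mxE subr0 ger0_norm ?addr_ge0//.
  by rewrite gerDl ler10.
have [F [f1 [hp FE FD]]] := cohesive_pot_ok hf.
have [MJ hk] := influence_ker_ok d hJ.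
pose Jn (z : 'rV[R]_d) : R := J (enorm z).
have hJ0 : (\int[lebesgue_rV R d]_z (Jn z)%:E != 0)%E by exact: influence_rint_gt0.
have [Lu0 Lv0 Iu0 Iv0 [e [hS he]]] := hu0v0.
have [M1 M10 hM1] := lty_bound hsup.
have [M2 M20 hM2] := lty_bound Iu0; have [M3 M30 hM3] := lty_bound Iv0.
pose M := M1 + M2 + M3 + 1.
have [M0 [M1M [M2M M3M]]] : 0 < M /\ M1 <= M /\ M2 <= M /\ M3 <= M by rewrite /M; lra.
have M00 := ltW M0.
have [bt hbt] := hb; have [b1 b2 b3 _] := C1_L20_ndiff mD hbt.
have hbL t (tT : 0 <= t <= T) := (L20_L2f mD (b1 t tT)).1.
have hbtL t (tT : 0 <= t <= T) := (L20_L2f mD (b2 t tT)).1.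
have [B B0 hB] := nrm_bounded hT hbL (ndiff_cont hbL hbtL b3).
have [ut hut] := choice hu; have [utt hevo] := choice hut.
have T00 : 0 <= (0 : R) <= T by rewrite lexx ltW.
pose u0' := cut S M u0; pose v0' := cut S M v0.
have [Lu0' Su0] := L20_L2f mD Lu0; have [Lv0' Sv0] := L20_L2f mD Lv0.
have aeu0 : {ae lebesgue_rV R d, forall x, u0 x = u0' x}.
  by apply: (cut_ae SD Su0); apply: Linfnorm_ae; apply: le_trans hM2 _; rewrite lee_fin.
have aev0 : {ae lebesgue_rV R d, forall x, v0 x = v0' x}.
  by apply: (cut_ae SD Sv0); apply: Linfnorm_ae; apply: le_trans hM3 _; rewrite lee_fin.
have mu0' : mfunT u0' by apply: measurable_cut => //; exact: L2f_measurable.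
have mv0' : mfunT v0' by apply: measurable_cut => //; exact: L2f_measurable.
have Hu0 : L2f u0' by exact: L2f_ae mu0' Lu0' aeu0.
have Hv0 : L2f v0' by exact: L2f_ae mv0' Lv0' aev0.
(* At time 0 the representatives are the same two fields for every k, so that the initial conditions
   hold as equalities of functions. At other times the cut makes the displacements bounded by M and
   supported in S at every point. *)
pose uu k t := if t == 0 then u0' else cut S M (u k t).
pose uut k t := if t == 0 then v0' else ut k t.
have ev k := C1_L20_ndiff mD (let: And5 h _ _ _ _ := hevo k in h).
have ev1 k := C1_L20_ndiff mD (let: And5 _ h _ _ _ := hevo k in h).
have Lu k t : 0 <= t <= T -> L2f (u k t) /\ {ae lebesgue_rV R d, forall x, ~ S x -> u k t x = 0}.
  by move=> tT; have [h _ _ _] := ev k; exact: L20_L2f (h t tT).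
have Lut k t : 0 <= t <= T -> L2f (ut k t) /\ {ae lebesgue_rV R d, forall x, ~ S x -> ut k t x = 0}.
  by move=> tT; have [_ h _ _] := ev k; exact: L20_L2f (h t tT).
have Lutt k t : 0 <= t <= T -> L2f (utt k t).
  by move=> tT; have [_ h _ _] := ev1 k; exact: (L20_L2f mD (h t tT)).1.
have aeu k t : 0 <= t <= T -> [/\ mfunT (u k t), mfunT (uu k t) &
    {ae lebesgue_rV R d, forall x, u k t x = uu k t x}].
  move=> tT; have [h1 h2] := Lu k t tT; split; first exact: L2f_measurable.
    by rewrite /uu; case: ifP => // _; apply: measurable_cut => //; exact: L2f_measurable.
  rewrite /uu; case: eqP => [->|_].
    by have [_ _ _ h _] := hevo k; apply: filterS2 h aeu0 => x -> ->.
  apply: (cut_ae SD h2); apply: Linfnorm_ae; apply: (@le_trans _ _ M1%:E); last by rewrite lee_fin.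
  apply: le_trans hM1; apply: (@le_trans _ _ (ereal_sup [set Linfnorm D (u k s) | s in `[0%R, T]%classic])).
    by apply: ereal_sup_ubound; exists t => //=; rewrite in_itv.
  by apply: ereal_sup_ubound; exists k.
have aeut k t : 0 <= t <= T -> [/\ mfunT (ut k t), mfunT (uut k t) &
    {ae lebesgue_rV R d, forall x, ut k t x = uut k t x}].
  move=> tT; have [h1 h2] := Lut k t tT; split; first exact: L2f_measurable.
    by rewrite /uut; case: ifP => // _; exact: L2f_measurable.
  rewrite /uut; case: eqP => [->|_]; last by apply: filterE.
  by have [_ _ _ _ h] := hevo k; apply: filterS2 h aev0 => x -> ->.
have a2 : 0 < a / 2 by rewrite divr_gt0.
have [P P0 hP] := initial_energy_bound n2 hp hk hJ oD bD ha (L2f_measurable Lu0') Hu0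
  (fun x => cut_le S u0 x M00) (fun x Sx => cut_out M u0 Sx) aeu0 hS he.
have evok k : evo f1 Jn (eps k) rho T B S (uu k) (uut k) (utt k) b.
  have [_ _ d1 _] := ev k; have [_ _ d2 cc] := ev1 k.
  have Luu t : 0 <= t <= T -> L2f (uu k t).
    by move=> tT; have [_ m2 h] := aeu k t tT; exact: L2f_ae m2 (Lu k t tT).1 h.
  have Luut t : 0 <= t <= T -> L2f (uut k t).
    by move=> tT; have [_ m2 h] := aeut k t tT; exact: L2f_ae m2 (Lut k t tT).1 h.
  apply: Evo; [exact: heps0|exact: hrho|exact: B0|exact: Luu|exact: Luut|exact: Lutt|exact: hbL|exact: hB| | |exact: cc| | |].
  - exact: (ndiff_ae (aeu k) (aeut k) d1).
  - apply: (ndiff_ae (aeut k) _ d2) => t tT; have mt := L2f_measurable (Lutt k t tT).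
    by split => //; apply: filterE.
  - move=> t tT; have [_ _ h] := aeu k t tT; have [_ h2] := Lu k t tT.
    by apply: filterS2 h h2 => x <-.
  - move=> t tT; have [_ _ h] := aeut k t tT; have [_ h2] := Lut k t tT.
    by apply: filterS2 h h2 => x <-.
  move=> t psi tT hpsi psiS; have [m1 m2 h] := aeu k t tT.
  rewrite -(Lin_ae hp hk (eps k) m1 m2 (L2f_measurable hpsi) h).
  have hg := L2fB (hbL t tT) (L2fZ rho (Lutt k t tT)).
  apply: (Lin_ip n2 hp FE FD hk (heps0 k) (Lu k t tT).1 hpsi hg).
  have [_ _ heq _ _] := hevo k; have tT' : t \in `[0, T] by rewrite in_itv.
  apply: filterS2 psiS (heq t tT') => x h1 h2; have [Sx|Sx] := pselect (S x); last by left; exact: h1.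
  right; rewrite -[LHS]/(b t x - rho *: utt k t x) h2//.
  by rewrite opprD opprK addrC addrNK.
have epsc e1 : 0 < e1 -> \forall k \near \oo, eps k <= e1.
  move=> e10; have /cvgrPdist_le /(_ e1 e10) := heps.
  by apply: filterS => k; rewrite sub0r normrN; apply: le_trans; exact: ler_norm.
have uuM k t x : 0 <= t <= T -> enorm (uu k t x) <= M.
  by move=> _; rewrite /uu; case: ifP => _; exact: (cut_le S _ x M00).
have uuS k t x : 0 <= t <= T -> ~ S x -> uu k t x = 0.
  by move=> _ Sx; rewrite /uu; case: ifP => _; exact: (cut_out M _ Sx).
have eps1 k : eps k <= a / 2 by rewrite ler_pdivlMr// mulrC ltW.
have uu0 k : uu k 0 = u0' by rewrite /uu eqxx.
have uut0 k : uut k 0 = v0' by rewrite /uut eqxx.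
have [phi [hphi [ul [ulL conv ul0 vel]]]] := limit_exists n2 hp hk hJ0 evok hT M0 r0 a2 oS Sr Sc epsc uuM uuS Hv0
  (fun x => cut_le S v0 x M00) (fun x Sx => cut_out M v0 Sx) uu0 uut0 hP eps1.
exists phi; split => //; exists ul.
have aeS t : 0 <= t <= T -> {ae lebesgue_rV R d, forall x, ~ S x -> ul t x = 0}.
  by move=> tT; apply: filterE; exact: (ulL t tT).2.
have nE k t : 0 <= t <= T -> L2norm D (u (phi k) t \- ul t) = (nrm (uu (phi k) t - ul t))%:E.
  move=> tT; have [m1 m2 h] := aeu (phi k) t tT; have [h1 h2] := Lu (phi k) t tT; have [h3 h4] := ulL t tT.
  rewrite -[X in L2norm D X]/(u (phi k) t - ul t) (L2norm_eq (a := a) mD (L2fB h1 h3)).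
    congr (_%:E); apply: nrm_ae; [exact: measurable_rVB m1 (L2f_measurable h3)|exact: measurable_rVB m2 (L2f_measurable h3)|].
    apply: filterS h => x hx; rewrite -[LHS]/(u (phi k) t x - ul t x) hx//.
  apply: filterS h2 => x h2 Sx; by rewrite -[LHS]/(u (phi k) t x - ul t x) h2// h4// subrr.
split.
- by move=> t; rewrite in_itv/= => tT; apply: L2f_L20 => //; [exact: (ulL t tT).1|exact: aeS].
- apply: cvge0_of_le => [k|e1 e10].
    apply: (@le_trans _ _ (L2norm D (u (phi k) 0 \- ul 0))); first by rewrite nE// lee_fin nrm_ge0.
    by apply: ereal_sup_ubound; exists 0 => //=; rewrite in_itv.
  apply: filterS (conv e1 e10) => k hk1; apply: ge_ereal_sup => _ [t tT <-].
  by rewrite /= in_itv/= in tT; rewrite nE// lee_fin; exact: hk1.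
- by apply: filterS2 ul0 aeu0 => x -> ->.
apply: cvge0_of_le => [s|e1 e10]; first exact: Lnorm_ge0.
have [m m0 hm] := vel e1 e10.
apply/nbhs_ballP; exists m => // s; rewrite -ball_normE/= sub0r normrN => sm sn; rewrite in_itv/= => sT.
have s0 : 0 < s by rewrite lt_neqAle eq_sym sn; case/andP: sT.
have [hs1 hs2] := ulL s sT; have [h01 h02] := ulL 0 T00.
have hq := L2fB (L2fZ (s - 0)^-1 (L2fB hs1 h01)) Lv0'.
rewrite -[X in L2norm D X]/((s - 0)^-1 *: (ul s - ul 0) - v0) (L2norm_eq (a := a) mD hq); last first.
  apply: filterS Sv0 => x h3 Sx.
  by rewrite -[LHS]/((s - 0)^-1 *: (ul s x - ul 0 x) - v0 x) hs2// h02// h3// subrr scaler0 subrr.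
have hz := L2fB (L2fB hs1 h01) (L2fZ s Hv0).
have E : nrm ((s - 0)^-1 *: (ul s - ul 0) - v0) = nrm (s^-1 *: (ul s - ul 0 - s *: v0')).
  apply: nrm_ae; [exact: L2f_measurable hq|exact: L2f_measurable (L2fZ s^-1 hz)|].
  apply: filterS aev0 => x h.
  rewrite -[LHS]/((s - 0)^-1 *: (ul s x - ul 0 x) - v0 x) -[RHS]/(s^-1 *: (ul s x - ul 0 x - s *: v0' x)).
  by rewrite subr0 [in RHS]scalerBr scalerA mulVf ?gt_eqF// scale1r h.
rewrite E (nrmZ s^-1 hz) lee_fin ger0_norm ?invr_ge0 ?(ltW s0)// mulrC ler_pdivrMr//.
by apply: hm => //; apply: le_lt_trans sm; exact: ler_norm.
Qed.
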